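(* Let $(\mathcal K,\mathrm d)$ be a metric tame Kuranishi cobordism with nested cobordism reduction $\mathcal C\sqsubset\mathcal V$ and additive norms $\|\cdot\|$, and let $0<\delta<\min\{\varepsilon,\delta_{\mathcal V}\}$, where $\varepsilon$ is the collar width of $(\mathcal K,\mathrm d)$ and the reductions $\mathcal C,\mathcal V$. Then $\sigma_{\rm rel}(\mathcal V,\mathcal C,\|\cdot\|,\delta)>0$ and the following holds. (i) Given any $0<\sigma\le\sigma_{\rm rel}(\mathcal V,\mathcal C,\|\cdot\|,\delta)$, there exists an admissible, precompact, transverse cobordism perturbation $\nu$ of $\mathfrak s_{\mathcal K}|_{\mathcal V}$ with $\pi_{\mathcal K}\big((\mathfrak s_{\mathcal K}|_{\mathcal V}+\nu)^{-1}(0)\big)\subset\pi_{\mathcal K}(\mathcal C)$, whose restrictions $\nu|_{\partial^\alpha\mathcal V}$ for $\alpha=0,1$ are $(\partial^\alpha\mathcal V,\partial^\alpha\mathcal C,\partial^\alpha\|\cdot\|,\delta,\sigma)$-adapted perturbations of $\mathfrak s_{\partial^\alpha\mathcal K}|_{\partial^\alpha\mathcal V}$. (ii) Given perturbations $\nu^\alpha$ of $\mathfrak s_{\partial^\alpha\mathcal K}|_{\partial^\alpha\mathcal V}$ for $\alpha=0,1$ that are $(\partial^\alpha\mathcal V,\partial^\alpha\mathcal C,\partial^\alpha\|\cdot\|,\delta,\sigma)$-adapted with $\sigma\le\sigma_{\rm rel}(\mathcal V,\mathcal C,\|\cdot\|,\delta)$, the perturbation $\nu$ of $\mathfrak s_{\mathcal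 K}|_{\mathcal V}$ in (i) can be constructed to have boundary values $\nu|_{\partial^\alpha\mathcal V}=\nu^\alpha$ for $\alpha=0,1$. (iii) In the case of a product cobordism $[0,1]\times\mathcal K$ with product metric and product reductions $[0,1]\times\mathcal C\sqsubset[0,1]\times\mathcal V$, both (i) and (ii) hold without requiring $\delta$ to be bounded in terms of the collar width.
   Context: \textbf{Charts and atlases.} A Kuranishi chart (trivial isotropy) for a compact metrizable $X$ with footprint a nonempty open $F\subset X$ is $\mathbf K=(U,E,s,\psi)$ with $U$ a finite-dimensional smooth manifold (without boundary), $E$ a finite-dimensional real vector space, $s:U\to E$ smooth, $\psi:s^{-1}(0)\to X$ a homeomorphism onto $F$; $\dim\mathbf K=\dim U-\dim E$. A coordinate change $\widehat\Phi_{IJ}:\mathbf K_I\to\mathbf K_J$ ($F_I\cap F_J\neq\emptyset$) consists of an open $U_{IJ}\subset U_I$ with $U_{IJ}\cap s_I^{-1}(0)=\psi_I^{-1}(F_I\cap F_J)$, a smooth embedding $\phi_{IJ}:U_{IJ}\to U_J$ and a linear injection $\widehat\phi_{IJ}:E_I\to E_J$ with $s_J\circ\phi_{IJ}=\widehat\phi_{IJ}\circ s_I$, $\phi_{IJ}=\psi_J^{-1}\circ\psi_I$ on $U_{IJ}\cap s_I^{-1}(0)$, and the index condition: for all $u\in U_{IJ}$, $d_u\phi_{IJ}(\ker d_us_I)=\ker d_{\phi_{IJ}(u)}s_J$, and $E_I=\operatorname{im}d_us_I\oplus C$ implies $E_J=\operatorname{im}d_{\phi_{IJ}(u)}s_J\oplus\widehat\phi_{IJ}(C)$.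 A Kuranishi atlas $\mathcal K$ of dimension $d$ on $X$ consists of basic charts $\mathbf K_1,\dots,\mathbf K_N$ with footprints covering $X$; with $\mathcal I_{\mathcal K}=\{\emptyset\neq I\subset\{1,\dots,N\}:F_I:=\bigcap_{i\in I}F_i\neq\emptyset\}$, charts $\mathbf K_I$ with footprint $F_I$ for $I\in\mathcal I_{\mathcal K}$ ($\mathbf K_{\{i\}}=\mathbf K_i$), all of dimension $d$; and coordinate changes $\widehat\Phi_{IJ}$ for $I\subsetneq J$, such that for $I\subsetneq J\subsetneq L$: $\widehat\phi_{JL}\widehat\phi_{IJ}=\widehat\phi_{IL}$, $\phi_{IJ}^{-1}(U_{JL})\subset U_{IL}$, and $\phi_{JL}\phi_{IJ}=\phi_{IL}$ on $\phi_{IJ}^{-1}(U_{JL})$. Conventions: $U_{II}=U_I$, $\phi_{II}=\mathrm{id}$, $s_J^{-1}(E_I)=s_J^{-1}(\widehat\phi_{IJ}(E_I))$. It is tame if additive (each map $\prod_{i\in I}E_i\to E_I$, $(e_i)\mapsto\sum\widehat\phi_{iI}(e_i)$ is an isomorphism) and, for all indices (equalities allowed), $U_{IJ}\cap U_{IL}=U_{I(J\cup L)}$ for $I\subset J,L$ (with $U_{IH}=\emptyset$ for $H\notin\mathcal I_{\mathcal K}$) and $\phi_{IJ}(U_{IL})=U_{JL}\cap s_J^{-1}(E_I)$ for $I\subset J\subset L$. $|\mathcal K|=\bigsqcup_IU_I/\!\sim$, with $\sim$ generated by $(I,x)\sim(J,\phi_{IJ}(x))$ and quotient topology, has projection $\pi_{\mathcal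 K}$; $\iota_{\mathcal K}:X\to|\mathcal K|$, $p\mapsto[I,\psi_I^{-1}(p)]$. $A\sqsubset B$ means precompact inclusion. \textbf{Cobordisms.} Let $A^0_\delta=[0,\delta)$, $A^1_\delta=(1-\delta,1]$. A collared cobordism $(Y,\iota_Y^0,\iota_Y^1)$ is a separable, locally compact metrizable space with disjoint (possibly empty) closed subsets $\partial^0Y,\partial^1Y$ and maps $\iota^\alpha_Y:A^\alpha_\varepsilon\times\partial^\alpha Y\to Y$ with $\iota^\alpha_Y(\alpha,\cdot)$ the inclusion, which are homeomorphisms onto disjoint open neighbourhoods of $\partial^\alpha Y$. An open $F\subset Y$ is collared if with $\partial^\alpha F=F\cap\partial^\alpha Y$ one has $F\cap\iota_Y^\alpha(A^\alpha_\delta\times\partial^\alpha Y)=\iota_Y^\alpha(A^\alpha_\delta\times\partial^\alpha F)$ for some $\delta>0$, and $F\cap\operatorname{im}\iota^\alpha_Y=\emptyset$ if $\partial^\alpha F=\emptyset$. A chart with collared boundary for $Y$ is $(U,E,s,\psi)$ with $E$ a finite-dimensional real vector space, $s:U\to E$ smooth, $\psi:s^{-1}(0)\to Y$ a homeomorphism onto an open footprint $F\subset Y$, and $U$ a finite-dimensional smooth manifold with boundary $\partial^0U\sqcup\partial^1U$ with collar diffeomorphisms $\iota^\alpha_U:A^\alpha_\varepsilon\times\partial^\alpha U\to U$ onto neighbourhoods of $\partial^\alpha U$, footprint $F$ collared and meeting some $\partial^\alpha Y$, $\partial^\alpha U\ne\emptyset$ iff $\partial^\alpha F\neq\emptyset$,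 and charts $\partial^\alpha\mathbf K=(\partial^\alpha U,E,s^\alpha,\psi^\alpha)$ for $\partial^\alpha Y$ with footprint $\partial^\alpha F$ such that $s(\iota_U^\alpha(t,x))=s^\alpha(x)$, $\psi(\iota^\alpha_U(t,x))=\iota^\alpha_Y(t,\psi^\alpha(x))$ near the boundary. A coordinate change with collared boundary from such $\mathbf K_I$ to $\mathbf K_J$ (with or without boundary) has collared domain $U_{IJ}$; if $F_J\cap\partial^\alpha Y\neq\emptyset$ it equals, in collar coordinates near the boundary, the product of $\mathrm{id}_{A^\alpha_\varepsilon}$ with a coordinate change $\partial^\alpha\widehat\Phi_{IJ}:\partial^\alpha\mathbf K_I\to\partial^\alpha\mathbf K_J$ of domain $\partial^\alpha U_{IJ}$ (including equality of domains and images in the collars); if $F_J\cap\partial^\alpha Y=\emptyset$ its domain is disjoint from a collar of $\partial^\alpha U_I$. A Kuranishi cobordism on a compact collared cobordism $Y$ is defined as a Kuranishi atlas on $Y$, with charts that have collared boundary or are ordinary charts with footprints $\sqsubset Y\setminus(\partial^0Y\cup\partial^1Y)$, and coordinate changes of the corresponding type; tameness is defined as for atlases. $\partial^\alpha\mathcal K$ is the atlas on $\partial^\alpha Y$ of the restrictions, with index set $\mathcal I_{\partial^\alpha\mathcal K}=\{I:F_I\cap\partial^\alpha Y\neq\emptyset\}$. The collars induce $\iota^\alpha_{|\mathcal K|}:A^\alpha_\varepsilon\times|\partial^\alpha\mathcal K|\to|\mathcal K|$. For an atlas $\mathcal K$, $[0,1]\times\mathcal K$ is the product cobordism on $[0,1]\times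 X$, with product charts and coordinate changes. \textbf{Metrics.} An admissible metric on $|\mathcal K|$ is a bounded metric $\mathrm d$ on the set $|\mathcal K|$ whose pullback $\mathrm d_I$ to each $U_I$ is a metric inducing the topology of $U_I$. For a metric Kuranishi cobordism $\mathrm d$ is also collared: for some $\varepsilon>0$, $\mathrm d$ pulls back under $\iota^\alpha_{|\mathcal K|}$ to $|t-t'|+\mathrm d^\alpha$ on $A^\alpha_\varepsilon\times|\partial^\alpha\mathcal K|$, where $\mathrm d^\alpha=\iota^\alpha_{|\mathcal K|}(\alpha,\cdot)^*\mathrm d$, and $\mathrm d(y,\iota^\alpha_{|\mathcal K|}(\alpha+t,x))\ge\varepsilon-|t|$ for $y\notin\iota^\alpha_{|\mathcal K|}(A^\alpha_\varepsilon\times|\partial^\alpha\mathcal K|)$. $\partial^\alpha\mathcal K$ carries the metric $\mathrm d^\alpha$. The collar width $\varepsilon$ is one for which all collar properties (of $\mathcal K$, $\mathrm d$, $\mathcal C$, $\mathcal V$) hold (the smallest of their collar widths). $B^I_\delta,B_\delta$ are $\delta$-neighbourhoods in $(U_I,\mathrm d_I)$, $(|\mathcal K|,\mathrm d)$. \textbf{Reductions and perturbations.} A reduction of a tame atlas (cobordism) is $\mathcal V=\bigsqcup V_I$ with open $V_I\sqsubset U_I$, $V_I\cap s_I^{-1}(0)\neq\emptyset$ if $V_I\neq\emptyset$; $\pi_{\mathcal K}(\overline{V_I})\cap\pi_{\mathcal K}(\overline{V_J})\neq\emptyset$ only if $I\subset J$ or $J\subset I$; $\iota_{\mathcal K}(X)\subset\pi_{\mathcal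 K}(\mathcal V)$ ($X$ replaced by $Y$ for cobordisms). A cobordism reduction satisfies in addition, for $I\in\mathcal I_{\partial^\alpha\mathcal K}$: $(\iota^\alpha_{U_I})^{-1}(V_I)\cap(A^\alpha_\varepsilon\times\partial^\alpha U_I)=A^\alpha_\varepsilon\times\partial^\alpha V_I$ for some $\varepsilon>0$ and $\partial^\alpha V_I\subset\partial^\alpha U_I$, with $\partial^\alpha V_I\neq\emptyset$ iff $V_I\cap\psi_I^{-1}(\partial^\alpha F_I)\ne\emptyset$; $\partial^\alpha\mathcal V=\bigsqcup\partial^\alpha V_I$. A nested (cobordism) reduction $\mathcal C\sqsubset\mathcal V$ is a pair of such with precompact inclusion. A perturbation of $\mathfrak s_{\mathcal K}|_{\mathcal V}=(s_I|_{V_I})$ is a family of smooth $\nu_I:V_I\to E_I$ with $\nu_J\circ\phi_{IJ}=\widehat\phi_{IJ}\circ\nu_I$ on $V_I\cap\phi_{IJ}^{-1}(V_J)$. It is admissible if $d_y\nu_J(T_yV_J)\subset\operatorname{im}\widehat\phi_{IJ}$ for all $I\subsetneq J$, $y\in V_J\cap\phi_{IJ}(V_I\cap U_{IJ})$. A precompact, transverse cobordism perturbation satisfies $\nu_I(\iota^\alpha_{U_I}(t,x))=\nu_I^\alpha(x)$ near the boundary for maps $\nu^\alpha_I$ on $\partial^\alpha V_I$ (these form $\nu|_{\partial^\alpha\mathcal V}$), $s_I|_{V_I}+\nu_I\pitchfork0$ on the interior, and $\pi_{\mathcal K}((\mathfrak s_{\mathcal K}|_{\mathcal V}+\nu)^{-1}(0))\subset\pi_{\mathcal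 K}(\mathcal C')$ for some nested cobordism reduction $\mathcal C'\sqsubset\mathcal V$, where $(\mathfrak s_{\mathcal K}|_{\mathcal V}+\nu)^{-1}(0)=\bigsqcup_I(s_I|_{V_I}+\nu_I)^{-1}(0)$. \textbf{Adapted perturbations.} Additive norms: norms on the $E_i$, extended by $\|\sum_{i\in I}\widehat\phi_{iI}(e_i)\|=\max_i\|e_i\|$; $\partial^\alpha\|\cdot\|$ is the subfamily for $\partial^\alpha\mathcal K$. $\delta_{\mathcal V}\in(0,\frac14]$ is the maximal constant such that every $\delta<\delta_{\mathcal V}$ satisfies $B^I_{2\delta}(V_I)\sqsubset U_I$ and $B_{2\delta}(\pi_{\mathcal K}(V_I))\cap B_{2\delta}(\pi_{\mathcal K}(V_J))\neq\emptyset\Rightarrow I\subset J$ or $J\subset I$. Given $0<\delta<\delta_{\mathcal V}$ put $V^k_I=B^I_{2^{-k}\delta}(V_I)$ (real $k\ge0$), $N^k_{JI}=V_J^k\cap\phi_{IJ}(V_I^k\cap U_{IJ})$, $\eta_k=2^{-k}(1-2^{-1/4})\delta$, $\widetilde C_J=\bigcup_{L\supset J}\phi_{JL}^{-1}(C_L)$. Let $\sigma(\mathcal V,\mathcal C,\|\cdot\|,\delta)$ (for $j=0$) and $\sigma'(\mathcal V,\mathcal C,\|\cdot\|,\delta)$ (for $j=1$) be $$\min_{J\in\mathcal I_{\mathcal K}}\inf\Big\{\|s_J(x)\|:x\in\overline{V_J^{|J|+j}}\setminus\big(\widetilde C_J\cup\textstyle\bigcup_{I\subsetneq J}B^J_{\eta_{|J|+j-1/2}}(N_{JI}^{|J|+j-1/4})\big)\Big\},$$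 and $\sigma_{\rm rel}(\mathcal V,\mathcal C,\|\cdot\|,\delta)=\min\{\sigma(\partial^0\mathcal V,\partial^0\mathcal C,\partial^0\|\cdot\|,\delta),\sigma(\partial^1\mathcal V,\partial^1\mathcal C,\partial^1\|\cdot\|,\delta),\sigma'(\mathcal V,\mathcal C,\|\cdot\|,\delta)\}$. For an atlas with $0<\delta<\delta_{\mathcal V}$, $0<\sigma\le\sigma(\mathcal V,\mathcal C,\|\cdot\|,\delta)$, a perturbation $\nu$ is $(\mathcal V,\mathcal C,\|\cdot\|,\delta,\sigma)$-adapted if the $\nu_I$ extend smoothly to $V_I^{|I|}$ so that for every $k=1,\dots,\max|I|$ and all $|I|\le k$: (a) $\nu_I\circ\phi_{HI}=\widehat\phi_{HI}\circ\nu_H$ on $V_H^k\cap\phi_{HI}^{-1}(V_I^k)$ for $H\subsetneq I$; (b) $(s_I+\nu_I)|_{V_I^k}\pitchfork0$; (c) $\nu_I(B^I_{\eta_k}(N^k_{IH}))\subset\widehat\phi_{HI}(E_H)$ for $H\subsetneq I$ (at points in the domain of $\nu_I$); (d) $(s_I|_{V_I^k}+\nu_I)^{-1}(0)\subset\pi_{\mathcal K}^{-1}(\pi_{\mathcal K}(\mathcal C))$; (e) $\sup_{V_I^k}\|\nu_I\|<\sigma$. *)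

(* Defs.v *)
From HB Require Import structures.
From mathcomp Require Import all_boot all_order all_algebra.
From mathcomp Require Import all_classical all_reals all_analysis.
From Stdlib Require Relation_Operators.

Set Implicit Arguments.
Unset Strict Implicit.
Unset Printing Implicit Defensive.

Import Order.TTheory GRing.Theory Num.Theory.
Import numFieldNormedType.Exports VectorInternalTheory.

Local Open Scope classical_set_scope.
Local Open Scope ring_scope.

(** * Subspaces of a topological space

   Spaces (X, Y, the domains U of charts, their boundaries) are *subsets* of
   ambient topological types, with the subspace topology.  Maps are total
   functions on the ambient types whose values off the intended domain are
   never used. *)

Section Subspaces.
Context {T : topologicalType}.

Definition open_in (M A : set T) := exists2 O, open O & A = M `&` O.

Definition closed_in (M A : set T) := exists2 O, closed O & A = M `&` O.

Definition closure_in (M A : set T) := M `&` closure A.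

(* A ⊏ B : the closure of A relative to B is compact. *)
Definition precompact_in (A B : set T) :=
  A `<=` B /\ compact (closure_in B A).

Definition hausdorff_set (M : set T) :=
  forall x y, M x -> M y -> x <> y ->
  exists A B, [/\ open_in M A, open_in M B, A x, B y & A `&` B = set0].

Definition second_countable_set (M : set T) :=
  exists B : nat -> set T, (forall n, open_in M (B n)) /\
    forall A x, open_in M A -> A x -> exists n, B n x /\ B n `<=` A.

End Subspaces.

Definition homeomorphism {T T' : topologicalType} (A : set T) (B : set T')
    (f : T -> T') :=
  [/\ set_bij A B f, {within A, continuous f} &
      forall O, open_in A O -> open_in B (f @` O)].

Section MetricSets.
Context {R : realType}.

Definition metric_on {T : Type} (S : set T) (d : T -> T -> R) :=
  [/\ forall x y, S x -> S y -> 0 <= d x y,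
      forall x y, S x -> S y -> (d x y = 0 <-> x = y),
      forall x y, S x -> S y -> d x y = d y x &
      forall x y z, S x -> S y -> S z -> d x z <= d x y + d y z].

Definition induces_topology {T : topologicalType} (S : set T)
    (d : T -> T -> R) :=
  forall A, A `<=` S ->
    (open_in S A <->
     forall x, A x -> exists2 r : R, 0 < r & S `&` [set y | d x y < r] `<=` A).

Definition metrizable {T : topologicalType} (S : set T) :=
  exists d : T -> T -> R, metric_on S d /\ induces_topology S d.

End MetricSets.
Arguments metrizable R {T} S.

(** * Smooth maps on subsets of R^n *)

Section EuclideanSmooth.
Context {R : realType}.

Fixpoint Ck {n m : nat} (k : nat) (O : set 'rV[R]_n) (g : 'rV[R]_n -> 'rV[R]_m)
    : Prop :=
  (forall x, O x -> {for x, continuous g}) /\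
  if k is k'.+1 then
    forall i : 'I_n, (forall x, O x -> derivable g x (delta_mx 0 i)) /\
      Ck k' O (fun x => 'D_(delta_mx 0 i) g x)
  else True.

Definition Cinfty {n m : nat} (O : set 'rV[R]_n) (g : 'rV[R]_n -> 'rV[R]_m) :=
  forall k, Ck k O g.

(* Finite-dimensional real vector spaces [W] are read in the coordinates
   [v2r : W -> 'rV_(dim W)] that are part of their [vectType] structure. *)
Definition smooth_extension {n : nat} {W : vectType R} (D : set 'rV[R]_n)
    (f : 'rV[R]_n -> W) (x : 'rV[R]_n) (g : 'rV[R]_n -> 'rV[R]_(dim W)) :=
  exists O, [/\ open O, O x, Cinfty O g &
               forall y, D y -> O y -> g y = v2r (f y)].

Definition smooth_in {n : nat} {W : vectType R} (D : set 'rV[R]_n)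
    (f : 'rV[R]_n -> W) :=
  forall x, D x -> exists g, smooth_extension D f x g.

(* When D is open in R^n or in a half-space and x is in D, this does not depend
   on the chosen extension. *)
Definition deriv_in {n : nat} {W : vectType R} (D : set 'rV[R]_n)
    (f : 'rV[R]_n -> W) (x : 'rV[R]_n) : 'Hom('rV[R]_n, W) :=
  let g : 'rV[R]_n -> 'rV[R]_(dim W) :=
    xget (fun y => v2r (f y)) [set g | smooth_extension D f x g] in
  linfun (fun v => r2v ('d g x v)).

Definition halfspace (n : nat) : set 'rV[R]_n :=
  [set v | forall j : 'I_n, nat_of_ord j = 0%N -> 0 <= v 0 j].

End EuclideanSmooth.

(** * Smooth manifolds, possibly with boundary *)

Record chart (R : realType) (T : Type) (n : nat) := Chart {
  cdom : set T;
  cmap : T -> 'rV[R]_n;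
  cinv : 'rV[R]_n -> T }.

HB.instance Definition _ (R : realType) (T : Type) (n : nat) :=
  gen_eqMixin (chart R T n).
HB.instance Definition _ (R : realType) (T : Type) (n : nat) :=
  gen_choiceMixin (chart R T n).

Record manifold (R : realType) (T : topologicalType) := Manifold {
  carrier : set T;
  mdim : nat;
  charts : set (chart R T mdim) }.
Arguments charts {R T} m.

Definition unit_ivl (R : realType) : set R := `[0, 1].
Arguments unit_ivl R : clear implicits.

Section Manifolds.
Context {R : realType}.

Definition valid_chart {T : topologicalType} {n} (M : set T)
    (c : chart R T n) :=
  let V := cmap c @` cdom c in
  [/\ open_in M (cdom c),
      open V \/ open_in (@halfspace R n) V,
      {within cdom c, continuous (cmap c)},
      {within V, continuous (cinv c)} &
      forall x, cdom c x -> cinv c (cmap c x) = x].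

Definition is_manifold {T : topologicalType} (M : manifold R T) :=
  [/\ hausdorff_set (carrier M), second_countable_set (carrier M),
      forall x, carrier M x -> exists2 c, charts M c & cdom c x,
      forall c, charts M c -> valid_chart (carrier M) c &
      forall c c', charts M c -> charts M c' ->
        smooth_in (cmap c @` (cdom c `&` cdom c')) (cmap c' \o cinv c)].

Definition boundary {T : topologicalType} (M : manifold R T) : set T :=
  [set x | carrier M x /\
     forall c, charts M c -> cdom c x -> ~ interior (cmap c @` cdom c) (cmap c x)].

Definition smooth_fun {T : topologicalType} {W : vectType R}
    (M : manifold R T) (D : set T) (f : T -> W) :=
  forall c, charts M c -> smooth_in (cmap c @` (cdom c `&` D)) (f \o cinv c).

Definition smooth_map {T T' : topologicalType} (M : manifold R T)
    (N : manifold R T') (D : set T) (f : T -> T') :=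
  [/\ f @` D `<=` carrier N, {within D, continuous f} &
      forall c c', charts M c -> charts N c' ->
        smooth_in (cmap c @` (cdom c `&` D `&` f @^-1` cdom c'))
                  (cmap c' \o f \o cinv c)].

(* The tangent space of M at x is 'rV_(mdim M), by means of [chart_at M x]. *)
Definition chart_at {T : topologicalType} (M : manifold R T) (x : T)
    : chart R T (mdim M) :=
  xget (Chart set0 (fun=> 0) (fun=> x)) [set c | charts M c /\ cdom c x].

Definition dfun {T : topologicalType} {W : vectType R} (M : manifold R T)
    (D : set T) (f : T -> W) (x : T) : 'Hom('rV[R]_(mdim M), W) :=
  let c := chart_at M x in
  deriv_in (cmap c @` (cdom c `&` D)) (f \o cinv c) (cmap c x).

Definition dmap {T T' : topologicalType} (M : manifold R T)
    (N : manifold R T') (D : set T) (f : T -> T') (x : T)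
    : 'Hom('rV[R]_(mdim M), 'rV[R]_(mdim N)) :=
  let c := chart_at M x in let c' := chart_at N (f x) in
  deriv_in (cmap c @` (cdom c `&` D `&` f @^-1` cdom c'))
           (cmap c' \o f \o cinv c) (cmap c x).

Definition smooth_embedding {T T' : topologicalType} (M : manifold R T)
    (N : manifold R T') (D : set T) (f : T -> T') :=
  [/\ smooth_map M N D f,
      forall x, D x -> lker (dmap M N D f x) = 0%VS &
      homeomorphism D (f @` D) f].

Definition diffeo_onto {T T' : topologicalType} (M : manifold R T)
    (N : manifold R T') (W : set T') (f : T -> T') :=
  [/\ set_bij (carrier M) W f, smooth_map M N (carrier M) f &
      exists2 g, smooth_map N M W g &
        forall x, carrier M x -> g (f x) = x].

Definition transverse0 {T : topologicalType} {W : vectType R}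
    (M : manifold R T) (D : set T) (f : T -> W) (A : set T) :=
  forall x, A x -> f x = 0 -> limg (dfun M D f x) = fullv.

(** Collar intervals; [false] and [true] stand for α = 0 and α = 1. *)

Definition endpoint (a : bool) : R := (nat_of_bool a)%:R.

Definition collar_ivl (a : bool) (e : R) : set R :=
  [set t | if a then 1 - e < t <= 1 else 0 <= t < e].

(* Distance to the endpoint α; an involution of R. *)
Definition ivl_coord (a : bool) (t : R) : R := if a then 1 - t else t.

Definition cyl_chart {T : Type} {n} (a : bool) (e : R) (c : chart R T n)
    : chart R (R * T)%type (1 + n) :=
  Chart (collar_ivl a e `*` cdom c)
    (fun p => row_mx (const_mx (ivl_coord a p.1)) (cmap c p.2))
    (fun v => (ivl_coord a (lsubmx v 0 0), cinv c (rsubmx v))).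

(* A^α_e x M for M without boundary *)
Definition half_cylinder {T : topologicalType} (a : bool) (e : R)
    (M : manifold R T) : manifold R (R * T)%type :=
  @Manifold R (R * T)%type (collar_ivl a e `*` carrier M) (1 + mdim M)
    [set cyl_chart a e c | c in charts M].

(* [0,1] x M for M without boundary *)
Definition cylinder {T : topologicalType} (M : manifold R T)
    : manifold R (R * T)%type :=
  @Manifold R (R * T)%type (unit_ivl R `*` carrier M) (1 + mdim M)
    [set C | exists a c, charts M c /\ C = cyl_chart a 1 c].

(* {α} x M *)
Definition slice {T : topologicalType} (a : bool) (M : manifold R T)
    : manifold R (R * T)%type :=
  @Manifold R (R * T)%type ([set endpoint a] `*` carrier M) (mdim M)
    [set Chart ([set endpoint a] `*` cdom c) (fun p => cmap c p.2)
               (fun v => (endpoint a, cinv c v)) | c in charts M].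

End Manifolds.

(** * Kuranishi charts and atlases *)

Record kchart (R : realType) (TX : topologicalType) := KChart {
  kT : topologicalType;
  kU : manifold R kT;
  kE : vectType R;
  ks : kT -> kE;
  kpsi : kT -> TX }.
Arguments ks {R TX} k.
Arguments kpsi {R TX} k.

(* The data of an atlas on [aX].  The families are indexed by all subsets of
   {1..N}, but only entries with indices in [idx] below are relevant.  In the
   restriction to a boundary the labels are kept; those i whose restricted
   footprint is empty then do not occur in [idx]. *)
Record atlas (R : realType) (TX : topologicalType) := Atlas {
  aN : nat;
  aX : set TX;
  ach : {set 'I_aN} -> kchart R TX;
  aU : forall I J : {set 'I_aN}, set (kT (ach I));
  aphi : forall I J : {set 'I_aN}, kT (ach I) -> kT (ach J);
  ahat : forall I J : {set 'I_aN}, 'Hom(kE (ach I), kE (ach J)) }.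
Arguments ach {R TX} a I.
Arguments aU {R TX} a I J.
Arguments aphi {R TX} a {I} J.
Arguments ahat {R TX} a I J.

Section Atlases.
Context {R : realType} {TX : topologicalType}.
Implicit Types (K : atlas R TX) (c : kchart R TX).

Definition dom c : set (kT c) := carrier (kU c).

#[global] Arguments dom _ : clear implicits.

Definition zeros c : set (kT c) := [set x | dom c x /\ ks c x = 0].

#[global] Arguments zeros _ : clear implicits.

Definition footprint c : set TX := kpsi c @` zeros c.

(* A chart for X whose domain may have boundary. *)
Definition is_bkchart (X : set TX) c :=
  [/\ is_manifold (kU c), smooth_fun (kU c) (dom c) (ks c),
      footprint c !=set0, open_in X (footprint c) &
      homeomorphism (zeros c) (footprint c) (kpsi c)].

Definition is_kchart (X : set TX) c :=
  is_bkchart X c /\ boundary (kU c) = set0.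

Definition basic K (i : 'I_(aN K)) : kchart R TX := ach K (finset.set1 i).

Definition foot K (I : {set 'I_(aN K)}) : set TX :=
  [set p | forall i, i \in I -> footprint (basic i) p].

Definition idx K : set {set 'I_(aN K)} :=
  [set I | I != finset.set0 /\ foot I !=set0].

#[global] Arguments idx _ : clear implicits.

Definition index_condition K (I J : {set 'I_(aN K)}) :=
  let D := aU K I J in
  let phi := aphi K J in
  forall u, D u ->
    let dsI := dfun (kU (ach K I)) (dom (ach K I)) (ks (ach K I)) u in
    let dsJ := dfun (kU (ach K J)) (dom (ach K J)) (ks (ach K J)) (phi u) in
    (dmap (kU (ach K I)) (kU (ach K J)) D phi u @: lker dsI)%VS = lker dsJ /\
    forall C : {vspace kE (ach K I)},
      (limg dsI + C)%VS = fullv -> (limg dsI :&: C)%VS = 0%VS ->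
      (limg dsJ + ahat K I J @: C)%VS = fullv /\
      (limg dsJ :&: (ahat K I J @: C))%VS = 0%VS.

Definition is_coord_change K (I J : {set 'I_(aN K)}) :=
  let D := aU K I J in
  let phi := aphi K J in
  [/\ open_in (dom (ach K I)) D,
      D `&` zeros (ach K I) =
        zeros (ach K I) `&`
        kpsi (ach K I) @^-1` (footprint (ach K I) `&` footprint (ach K J)),
      smooth_embedding (kU (ach K I)) (kU (ach K J)) D phi &
      [/\ lker (ahat K I J) = 0%VS,
      forall x, D x -> ks (ach K J) (phi x) = ahat K I J (ks (ach K I) x),
      forall x, D x -> zeros (ach K I) x ->
        kpsi (ach K J) (phi x) = kpsi (ach K I) x &
      index_condition I J]].

(* What atlases and cobordisms (whose charts may have boundary) have in
   common, except for the requirements on the individual charts. *)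
Definition atlas_axioms K (D : int) :=
  [/\ compact (aX K), metrizable R (aX K),
      (forall i, footprint (@basic K i) !=set0) /\
        aX K `<=` \bigcup_i footprint (@basic K i),
      (forall I, idx K I -> footprint (ach K I) = foot I /\
        (mdim (kU (ach K I)))%:Z - (dim (kE (ach K I)))%:Z = D) &
      [/\ (forall I, idx K I ->
            [/\ aU K I I = dom (ach K I),
                forall x, dom (ach K I) x -> aphi K I x = x &
                forall e, ahat K I I e = e]),
          (forall I J, idx K I -> idx K J -> I \proper J ->
            is_coord_change I J) &
          (forall I J L, idx K I -> idx K J -> idx K L ->
            I \proper J -> J \proper L ->
            [/\ forall e, ahat K J L (ahat K I J e) = ahat K I L e,
                aU K I J `&` aphi K J @^-1` aU K J L `<=` aU K I L &
                forall x, aU K I J x -> aU K J L (aphi K J x) ->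
                  aphi K L (aphi K J x) = aphi K L x])]].

Definition is_atlas K (D : int) :=
  atlas_axioms K D /\ forall I, idx K I -> is_kchart (aX K) (ach K I).

Definition sum_hat K (I : {set 'I_(aN K)}) (e : forall i, kE (basic (K:=K) i))
    : kE (ach K I) :=
  \sum_(i in I) ahat K (finset.set1 i) I (e i).

Definition additive K :=
  forall I, idx K I ->
    (forall v : kE (ach K I), exists e, v = sum_hat I e) /\
    (forall e, sum_hat I e = 0 -> forall i, i \in I -> e i = 0).

Definition tame K :=
  [/\ additive K,
      (forall I J L, idx K I -> idx K J -> idx K L ->
        I \subset J -> I \subset L ->
        aU K I J `&` aU K I L =
          [set x | idx K (J :|: L)%SET /\ aU K I (J :|: L)%SET x]) &
      (forall I J L, idx K I -> idx K J -> idx K L ->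
        I \subset J -> J \subset L ->
        aphi K J @` aU K I L =
          aU K J L `&`
          [set y | dom (ach K J) y /\ ks (ach K J) y \in limg (ahat K I J)])].

(** The realization |K|: the set of equivalence classes.  (Its quotient
    topology plays no role below.) *)

Definition point K : Type := {I : {set 'I_(aN K)} & kT (ach K I)}.

Definition Point K I (x : kT (ach K I)) : point K :=
  existT (fun I => kT (ach K I)) I x.

Definition step K (p q : point K) : Prop :=
  exists I J (x : kT (ach K I)),
    [/\ idx K I, idx K J, I \subset J & aU K I J x] /\
    (p = Point x /\ q = Point (aphi K J x)).

Definition equiv K : point K -> point K -> Prop :=
  @Relation_Operators.clos_refl_sym_trans (point K) (@step K).

Definition cls K I (x : kT (ach K I)) : set (point K) :=
  [set q | equiv (Point x) q].

Definition realization K : set (set (point K)) :=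
  [set a | exists I (x : kT (ach K I)), [/\ idx K I, dom (ach K I) x & a = cls x]].

#[global] Arguments realization _ : clear implicits.

Definition iotaX K (p : TX) : set (point K) :=
  [set q | exists I (x : kT (ach K I)),
     [/\ idx K I, zeros (ach K I) x, kpsi (ach K I) x = p & cls x q]].

Definition dom_family K := forall I, set (kT (ach K I)).
Definition section_family K := forall I, kT (ach K I) -> kE (ach K I).
Definition norm_family K := forall I, kE (ach K I) -> R.
Definition metric_family K := set (point K) -> set (point K) -> R.

Definition projU K I (A : set (kT (ach K I))) : set (set (point K)) :=
  @cls K I @` A.

(* π_K of the disjoint union of the [V I] *)
Definition projK K (V : dom_family K) : set (set (point K)) :=
  \bigcup_(I in idx K) projU (V I).

(** ** Admissible metrics and neighbourhoods *)

Definition pull_metric K (d : metric_family K) I (x y : kT (ach K I)) : R :=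
  d (cls x) (cls y).

Definition admissible_metric K (d : metric_family K) :=
  [/\ metric_on (realization K) d,
      exists M : R, forall a b, realization K a -> realization K b -> d a b <= M &
      forall I, idx K I -> metric_on (dom (ach K I)) (@pull_metric K d I) /\
        induces_topology (dom (ach K I)) (@pull_metric K d I)].

Definition nbhdU K (d : metric_family K) (r : R) I (A : set (kT (ach K I)))
    : set (kT (ach K I)) :=
  [set x | dom (ach K I) x /\ exists2 y, A y & pull_metric d x y < r].

Definition nbhdK K (d : metric_family K) (r : R) (A : set (set (point K)))
    : set (set (point K)) :=
  [set a | realization K a /\ exists2 b, A b & d a b < r].

(** ** Reductions *)

Definition reduction K (V : dom_family K) :=
  [/\ (forall I, idx K I -> open_in (dom (ach K I)) (V I)),
      (forall I, idx K I -> precompact_in (V I) (dom (ach K I))),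
      (forall I, idx K I -> V I !=set0 -> V I `&` zeros (ach K I) !=set0),
      (forall I J, idx K I -> idx K J ->
        projU (closure_in (dom (ach K I)) (V I)) `&`
        projU (closure_in (dom (ach K J)) (V J)) !=set0 ->
        I \subset J \/ J \subset I) &
      @iotaX K @` aX K `<=` projK V].

Definition nested K (C V : dom_family K) :=
  forall I, idx K I -> precompact_in (C I) (V I).

(** ** Perturbations *)

Definition perturbation K (V : dom_family K) (nu : section_family K) :=
  (forall I, idx K I -> smooth_fun (kU (ach K I)) (V I) (nu I)) /\
  (forall I J, idx K I -> idx K J -> I \proper J ->
     forall x, V I x -> aU K I J x -> V J (aphi K J x) ->
       nu J (aphi K J x) = ahat K I J (nu I x)).

Definition admissible_pert K (V : dom_family K) (nu : section_family K) :=
  forall I J, idx K I -> idx K J -> I \proper J ->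
    forall y, V J y -> (aphi K J @` (V I `&` aU K I J)) y ->
      (limg (dfun (kU (ach K J)) (V J) (nu J) y) <= limg (ahat K I J))%VS.

Definition pert_section K (nu : section_family K) I (x : kT (ach K I))
    : kE (ach K I) := ks (ach K I) x + nu I x.

Definition pert_zeros K (V : dom_family K) (nu : section_family K)
    : dom_family K :=
  fun I => [set x | V I x /\ pert_section nu x = 0].

(** ** Additive norms *)

Definition is_norm (W : vectType R) (n : W -> R) :=
  [/\ forall v, 0 <= n v, forall v, n v = 0 -> v = 0,
      forall (a : R) v, n (a *: v) = `|a| * n v &
      forall v w, n (v + w) <= n v + n w].

Definition additive_norms K (n : norm_family K) :=
  (forall i, idx K (finset.set1 i) -> is_norm (n (finset.set1 i))) /\
  (forall I, idx K I -> forall e,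
     n I (sum_hat I e) = \big[Num.max/0]_(i in I) n (finset.set1 i) (e i)).

(** ** The constants δ_V and σ, and adapted perturbations *)

Definition separating K (d : metric_family K) (V : dom_family K) (delta : R) :=
  (forall I, idx K I ->
     precompact_in (nbhdU d (2 * delta) (V I)) (dom (ach K I))) /\
  (forall I J, idx K I -> idx K J ->
     nbhdK d (2 * delta) (projU (V I)) `&` nbhdK d (2 * delta) (projU (V J))
       !=set0 ->
     I \subset J \/ J \subset I).

(* The supremum is attained (if the set is nonempty), since the condition
   concerns δ < r only. *)
Definition delta_red K (d : metric_family K) (V : dom_family K) : R :=
  sup [set r : R | 0 < r <= 4^-1 /\
         forall delta, 0 < delta < r -> separating d V delta].

Definition pow2n (k : R) : R := (2 : R) `^ (- k).

Definition Vk K (d : metric_family K) (V : dom_family K) (delta k : R)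
    : dom_family K :=
  fun I => nbhdU d (pow2n k * delta) (V I).

#[global] Arguments Vk [K] _ _ _ _ _ _.

(* N^k_JI *)
Definition Nk K (d : metric_family K) (V : dom_family K) (delta k : R)
    (J I : {set 'I_(aN K)}) : set (kT (ach K J)) :=
  Vk d V delta k J `&` aphi K J @` (Vk d V delta k I `&` aU K I J).

#[global] Arguments Nk [K] _ _ _ _ _ _ _.

Definition eta (delta k : R) : R := pow2n k * (1 - pow2n 4^-1) * delta.

Definition Ctilde K (C : dom_family K) : dom_family K :=
  fun J => \bigcup_(L in [set L | idx K L /\ J \subset L])
    [set x | aU K J L x /\ C L (aphi K L x)].

(* σ(V,C,n,δ) for j = 0, σ'(V,C,n,δ) for j = 1; the infimum over the empty set
   is +oo. *)
Definition sigma K (d : metric_family K) (V C : dom_family K)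
    (n : norm_family K) (delta : R) (j : nat) : \bar R :=
  ereal_inf [set r | exists J (x : kT (ach K J)),
    let k : R := (#|J| + j)%:R in
    [/\ idx K J,
        closure_in (dom (ach K J)) (Vk d V delta k J) x,
        ~ Ctilde C x,
        (forall I, idx K I -> I \proper J ->
           ~ nbhdU d (eta delta (k - 2^-1)) (Nk d V delta (k - 4^-1) J I) x) &
        r = (n J (ks (ach K J) x))%:E]].

Definition adapted K (d : metric_family K) (V C : dom_family K)
    (n : norm_family K) (delta s : R) (nu : section_family K) :=
  [/\ 0 < delta < delta_red d V, 0 < s, (s%:E <= sigma d V C n delta 0)%E,
      perturbation V nu &
  exists nu' : section_family K,
    (forall I, idx K I ->
       smooth_fun (kU (ach K I)) (Vk d V delta #|I|%:R I) (nu' I) /\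
       forall x, V I x -> nu' I x = nu I x) /\
    forall k : nat, (1 <= k)%N -> (exists2 L, idx K L & (k <= #|L|)%N) ->
    forall I, idx K I -> (#|I| <= k)%N ->
    [/\ (forall H, idx K H -> H \proper I ->
           forall x, Vk d V delta k%:R H x -> aU K H I x ->
             Vk d V delta k%:R I (aphi K I x) ->
             nu' I (aphi K I x) = ahat K H I (nu' H x)),
        transverse0 (kU (ach K I)) (Vk d V delta k%:R I) (@pert_section K nu' I)
          (Vk d V delta k%:R I),
        (forall H, idx K H -> H \proper I ->
           forall x, nbhdU d (eta delta k%:R) (Nk d V delta k%:R I H) x ->
             Vk d V delta #|I|%:R I x -> nu' I x \in limg (ahat K H I)),
        (forall x, Vk d V delta k%:R I x -> pert_section nu' x = 0 ->
           projK C (cls x)) &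
        (ereal_sup [set (n I (nu' I x))%:E | x in Vk d V delta k%:R I] < s%:E)%E]].

End Atlases.

(** * Kuranishi cobordisms *)

(* The boundary [cbdU a I] of a chart domain is a manifold on a subset of the
   same ambient space; collars are total functions of t and x that matter only
   for t in A^α_e and x in the boundary. *)
Record cobordism (R : realType) (TY : topologicalType) := Cobordism {
  catlas :> atlas R TY;
  cbdY : bool -> set TY;
  ccolY : bool -> R -> TY -> TY;
  cbdU : bool -> forall I, manifold R (kT (ach catlas I));
  ccolU : bool -> forall I, R -> kT (ach catlas I) -> kT (ach catlas I) }.
Arguments cbdU {R TY} c a I : rename.
Arguments ccolU {R TY} c a {I} t x : rename.

Section Cobordisms.
Context {R : realType} {TY : topologicalType}.
Implicit Types (K : cobordism R TY) (a : bool) (e : R).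

Definition collar_im {T : Type} a e (col : R -> T -> T) (B : set T) : set T :=
  [set y | exists t x, [/\ collar_ivl a e t, B x & y = col t x]].

Definition collared_space (Y : set TY) (bd : bool -> set TY)
    (col : bool -> R -> TY -> TY) e :=
  [/\ forall a, closed_in Y (bd a), bd false `&` bd true = set0,
      forall a x, bd a x -> col a (endpoint a) x = x,
      (forall a, open_in Y (collar_im a e (col a) (bd a)) /\
         homeomorphism (collar_ivl a e `*` bd a) (collar_im a e (col a) (bd a))
           (fun p => col a p.1 p.2)) &
      collar_im false e (col false) (bd false) `&`
      collar_im true e (col true) (bd true) = set0].

(* ∂^α K; sections, footprint maps and coordinate changes are restricted, which
   is why the functions do not change. *)
Definition bd_chart a K (I : {set 'I_(aN K)}) : kchart R TY :=
  KChart (cbdU K a I) (ks (ach K I)) (kpsi (ach K I)).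

Definition bd_atlas a K : atlas R TY :=
  @Atlas R TY (aN K) (cbdY K a) (bd_chart a (K:=K))
    (fun I J => aU K I J `&` carrier (cbdU K a I))
    (fun I J => aphi K J)
    (fun I J => ahat K I J).

Definition bd_fam a K (V : dom_family K) : dom_family (bd_atlas a K) :=
  fun I => V I `&` carrier (cbdU K a I).

#[global] Arguments bd_fam _ [K] _ _ _.

Definition bd_foot a K (I : {set 'I_(aN K)}) : set TY :=
  footprint (ach K I) `&` cbdY K a.

Definition collared_set e K (F : set TY) :=
  forall a,
    F `&` collar_im a e (ccolY K a) (cbdY K a) =
      collar_im a e (ccolY K a) (F `&` cbdY K a) /\
    (F `&` cbdY K a = set0 ->
     F `&` collar_im a e (ccolY K a) (cbdY K a) = set0).

Definition collared_kchart e K (I : {set 'I_(aN K)}) :=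
  [/\ is_bkchart (aX K) (ach K I), collared_set e K (footprint (ach K I)),
      exists a, bd_foot a I !=set0,
      boundary (kU (ach K I)) =
        carrier (cbdU K false I) `|` carrier (cbdU K true I) /\
      carrier (cbdU K false I) `&` carrier (cbdU K true I) = set0 &
  forall a,
    (carrier (cbdU K a I) !=set0 <-> bd_foot a I !=set0) /\
    (bd_foot a I !=set0 ->
     [/\ is_kchart (cbdY K a) (bd_chart a I),
         footprint (bd_chart a I) = bd_foot a I,
         (forall x, carrier (cbdU K a I) x -> ccolU K a (endpoint a) x = x),
         (let W := collar_im a e (@ccolU _ _ K a I) (carrier (cbdU K a I)) in
          open_in (dom (ach K I)) W /\
          diffeo_onto (half_cylinder a e (cbdU K a I)) (kU (ach K I)) W
            (fun p => ccolU K a p.1 p.2)) &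
         forall t x, collar_ivl a e t -> carrier (cbdU K a I) x ->
           ks (ach K I) (ccolU K a t x) = ks (ach K I) x /\
           (ks (ach K I) x = 0 ->
            kpsi (ach K I) (ccolU K a t x) = ccolY K a t (kpsi (ach K I) x))])].

Definition interior_kchart K (I : {set 'I_(aN K)}) :=
  [/\ is_kchart (aX K) (ach K I),
      precompact_in (footprint (ach K I))
        (aX K `\` (cbdY K false `|` cbdY K true)) &
      forall a, carrier (cbdU K a I) = set0].

Definition collared_coord_change e K (I J : {set 'I_(aN K)}) :=
  forall a,
    let bI := carrier (cbdU K a I) in
    let bJ := carrier (cbdU K a J) in
    let D := aU K I J in
    let phi := aphi K J in
    D `&` collar_im a e (@ccolU _ _ K a I) bI =
      collar_im a e (@ccolU _ _ K a I) (D `&` bI) /\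
    (bd_foot a J !=set0 ->
       [/\ @is_coord_change R TY (bd_atlas a K) I J,
           (forall t x, collar_ivl a e t -> (D `&` bI) x ->
              phi (ccolU K a t x) = ccolU K a t (phi x)) &
           phi @` D `&` collar_im a e (@ccolU _ _ K a J) bJ =
             collar_im a e (@ccolU _ _ K a J) (phi @` (D `&` bI))]) /\
    (bd_foot a J = set0 ->
       D `&` collar_im a e (@ccolU _ _ K a I) bI = set0).

(* A Kuranishi cobordism of dimension D on a compact collared cobordism, all of
   whose collars have width e. *)
Definition is_cobordism K (D : int) e :=
  [/\ atlas_axioms K D, collared_space (aX K) (cbdY K) (ccolY K) e,
      (forall I, idx K I -> collared_kchart e I \/ interior_kchart I) &
      forall I J, idx K I -> idx K J -> I \proper J ->
        collared_coord_change e I J].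

(* ι^α_|K|(t, -) : |∂^α K| -> |K| *)
Definition iota_real a K (t : R) (b : set (point (bd_atlas a K)))
    : set (point K) :=
  [set q | exists I (x : kT (ach K I)),
     b (@Point R TY (bd_atlas a K) I x) /\ cls (ccolU K a t x) q].

Definition bd_metric a K (d : metric_family K) : metric_family (bd_atlas a K) :=
  fun b c => d (iota_real (endpoint a) b) (iota_real (endpoint a) c).

Definition collared_metric e K (d : metric_family K) :=
  forall a,
    (forall t t' b b', collar_ivl a e t -> collar_ivl a e t' ->
       realization (bd_atlas a K) b -> realization (bd_atlas a K) b' ->
       d (iota_real t b) (iota_real t' b') = `|t - t'| + bd_metric d b b') /\
    (forall y, realization K y ->
       ~ (exists t b, [/\ collar_ivl a e t, realization (bd_atlas a K) b &
                          y = iota_real t b]) ->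
       forall t b, collar_ivl a e t -> realization (bd_atlas a K) b ->
         e - `|t - endpoint a| <= d y (iota_real t b)).

Definition metric_tame_cobordism K (D : int) e (d : metric_family K) :=
  [/\ is_cobordism K D e, tame K, admissible_metric d & collared_metric e d].

Definition cobordism_reduction e K (V : dom_family K) :=
  reduction V /\
  forall a I, idx (bd_atlas a K) I ->
    (forall t x, collar_ivl a e t -> carrier (cbdU K a I) x ->
       (V I (ccolU K a t x) <-> V I x)) /\
    (bd_fam a V I !=set0 <->
     V I `&` [set x | zeros (ach K I) x /\ bd_foot a I (kpsi (ach K I) x)]
       !=set0).

Definition nested_cobordism_reduction e K (C V : dom_family K) :=
  [/\ cobordism_reduction e C, cobordism_reduction e V & nested C V].

(* The restriction of nu to ∂^α V is given by the same functions. *)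
Definition cobordism_perturbation K (V : dom_family K) (nu : section_family K) :=
  [/\ perturbation V nu,
      exists2 e : R, 0 < e & forall a I, idx (bd_atlas a K) I ->
        forall t x, collar_ivl a e t -> bd_fam a V I x ->
          nu I (ccolU K a t x) = nu I x,
      (forall I, idx K I ->
        transverse0 (kU (ach K I)) (V I) (@pert_section R TY K nu I)
          (V I `\` boundary (kU (ach K I)))) &
      exists C' e, [/\ 0 < e, nested_cobordism_reduction e C' V &
        projK (pert_zeros V nu) `<=` projK C']].

Definition sigma_rel K (d : metric_family K) (V C : dom_family K)
    (n : norm_family K) (delta : R) : \bar R :=
  mine (sigma (bd_metric (a:=false) d) (bd_fam false V) (bd_fam false C) n delta 0)
    (mine
      (sigma (bd_metric (a:=true) d) (bd_fam true V) (bd_fam true C) n delta 0)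
      (sigma d V C n delta 1)).

Definition bd_adapted a K (d : metric_family K) (V C : dom_family K)
    (n : norm_family K) (delta s : R) (nu : section_family (bd_atlas a K)) :=
  @adapted R TY (bd_atlas a K) (bd_metric (a:=a) d) (bd_fam a V) (bd_fam a C)
    n delta s nu.

Definition good_perturbation K (d : metric_family K) (V C : dom_family K)
    (n : norm_family K) (delta s : R) (nu : section_family K) :=
  [/\ admissible_pert V nu, cobordism_perturbation V nu,
      projK (pert_zeros V nu) `<=` projK C &
      forall a, @bd_adapted a K d V C n delta s nu].

Definition perturbations_exist K (d : metric_family K) (V C : dom_family K)
    (n : norm_family K) (delta : R) :=
  forall s : R, 0 < s -> (s%:E <= sigma_rel d V C n delta)%E ->
  exists nu, good_perturbation d V C n delta s nu.

Definition relative_perturbations_exist K (d : metric_family K)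
    (V C : dom_family K) (n : norm_family K) (delta : R) :=
  forall s : R, 0 < s -> (s%:E <= sigma_rel d V C n delta)%E ->
  forall nu' : (forall a, section_family (bd_atlas a K)),
  (forall a, bd_adapted d V C n delta s (nu' a)) ->
  exists nu, good_perturbation d V C n delta s nu /\
    forall a I x, idx (bd_atlas a K) I -> bd_fam a V I x -> nu I x = nu' a I x.

End Cobordisms.

(** * Product cobordisms *)

Section Products.
Context {R : realType} {TX : topologicalType}.
Implicit Types K : atlas R TX.

Definition prod_chart (c : kchart R TX) : kchart R (R * TX)%type :=
  KChart (cylinder (kU c)) (fun p => ks c p.2) (fun p => (p.1, kpsi c p.2)).

Definition prod_fam K (V : dom_family K) I : set (R * kT (ach K I))%type :=
  unit_ivl R `*` V I.

Definition prod_atlas K : atlas R (R * TX)%type :=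
  @Atlas R (R * TX)%type (aN K) (unit_ivl R `*` aX K)
    (fun I => prod_chart (ach K I))
    (fun I J => unit_ivl R `*` aU K I J)
    (fun I J p => (p.1, aphi K J p.2))
    (fun I J => ahat K I J).

Definition prod_cobordism K : cobordism R (R * TX)%type :=
  @Cobordism R (R * TX)%type (prod_atlas K)
    (fun a => [set endpoint a] `*` aX K)
    (fun a t p => (t, p.2))
    (fun a I => slice a (kU (ach K I)))
    (fun a I t p => (t, p.2)).

(* A class in |[0,1] x K| is {t} x b with t in [0,1] and b in |K|. *)
Definition class_time K (b : set (point (prod_cobordism K))) : R :=
  xget 0 [set t | exists I (y : kT (ach K I)),
    b (@Point R (R * TX)%type (prod_cobordism K) I (t, y))].

Definition class_space K (b : set (point (prod_cobordism K)))
    : set (point K) :=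
  [set q | exists I t (y : kT (ach K I)),
    b (@Point R (R * TX)%type (prod_cobordism K) I (t, y)) /\ q = Point y].

Definition prod_metric K (d : metric_family K)
    : metric_family (prod_cobordism K) :=
  fun b c => `|class_time b - class_time c| + d (class_space b) (class_space c).

End Products.

(* Main.v *)
(** Transversality is achieved for one index J at a time, in the order of |J|,
   by perturbations that are compatible with the coordinate changes by
   construction: a function F from |K| to R^q, supported near a point of U_J,
   and a matrix p with q rows give the maps y |-> F([y]) p with values in E_J,
   carried to E_L by the linear injection on each U_L with J ⊂ L, and zero on
   all other charts.  If F = (f, f h), where f is a bump function and h a
   coordinate system of U_J, then such perturbations have the form g + b + h A
   with respect to U_J near the point.  They are transverse to 0 there for (A, b)
   arbitrarily close to any given value; this elementary case of Sard's theorem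
   is a counting argument, since failure at a point determines a column of A and
   the row b as Lipschitz functions of the remaining, lower-dimensional data.
   By compactness finitely many F suffice, and transversality on compact sets
   survives later small steps.

   Near the image of U_I, for I a proper subset of J, the perturbation takes
   values in E_I, so by tameness its zeros come from zeros in U_I and inherit
   their transversality.  The bound by sigma forces the zero set into the image
   of C.

   Given boundary perturbations are extended by their pullback along the collars
   times a cutoff function.  As the collared neighbourhoods are shrunk once more
   (|J| + 1 instead of |J|), the same induction applies, with functions F that
   vanish near the boundary.  The product cobordism has collars of width
   1/2 > 1/4 >= delta_V, so the bound by the collar width holds automatically. *)

(* A change of nu_J acts on every chart L containing J, but near the image of a chart H that does
   not contain J the value nu_L is dictated by nu_H and must stay. This is why V_J is divided: near
   the images of smaller charts transversality is inherited, elsewhere a function F may be added,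
   and F must vanish on the regions of such H. The regions occur in two sizes. With k = |J|, or |J|
   + 1 for cobordisms, the one of level k - 1/2 decides the division, the smaller one of level k -
   1/4 survives the step and is the set removed in the definition of sigma; the gap leaves room for
   the support of F. Openness of transversality needs compact sets and smoothness open ones, whence
   closures at level k inside open sets at level k - 1/8. Derivatives at boundary points are those
   of smooth extensions; one-sided difference quotients along the coordinate axes determine them,
   also in cylinder charts. *)
From Pilot Require Import Defs.
From HB Require Import structures.
From mathcomp Require Import all_boot all_order all_algebra.
From mathcomp Require Import all_classical all_reals all_analysis.
From mathcomp Require Import lra ring zify.

Set Implicit Arguments.
Unset Strict Implicit.
Unset Printing Implicit Defensive.

Import Order.TTheory GRing.Theory Num.Theory.
Import numFieldNormedType.Exports VectorInternalTheory.

Local Open Scope classical_set_scope.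
Local Open Scope ring_scope.
Import Pilot.Defs.

(** * Smooth functions on open subsets of R^n *)

Section RowVectors.
Context {R : realType}.

(** Merges radii found separately for finitely many coordinates or indices into one; the property
    has to be monotone in the radius. *)
Lemma fin_radius (I : finType) (Q : I -> R -> Prop) :
  (forall i, exists2 r : R, 0 < r & Q i r) ->
  (forall i r s, s <= r -> Q i r -> Q i s) ->
  exists2 r : R, 0 < r & forall i, Q i r.
Proof.
move=> H W; have /choice[f fP] : forall i, exists r : R, 0 < r /\ Q i r.
  by move=> i; have [r] := H i; exists r.
exists (\big[Num.min/1]_i f i).
  by apply: lt_bigmin => // i _; have [] := fP i.
by move=> i; apply: W (fP i).2; exact: bigmin_le_cond.
Qed.

Lemma norm_coord m n (v : 'M[R]_(m, n)) i j : `|v i j| <= `|v|.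
Proof.
rewrite [leRHS]/Num.Def.normr/= mx_normrE.
exact: (le_bigmax _ (fun ij => `|v ij.1 ij.2|) (i, j)).
Qed.

Lemma norm_leP m n (v : 'M[R]_(m, n)) (c : R) : 0 <= c ->
  (forall i j, `|v i j| <= c) -> `|v| <= c.
Proof.
move=> c0 vc; rewrite [leLHS]/Num.Def.normr/= mx_normrE.
by apply: bigmax_le => // -[i j] _ /=.
Qed.

Lemma norm_mulmx m n p (A : 'M[R]_(m, n)) (B : 'M[R]_(n, p)) :
  `|A *m B| <= n%:R * `|A| * `|B|.
Proof.
apply: norm_leP => [|i j]; first by rewrite !mulr_ge0.
rewrite mxE; apply: le_trans (ler_norm_sum _ _ _) _.
apply: (@le_trans _ _ (\sum_(k < n) `|A| * `|B|)).
  apply: ler_sum => k _; rewrite normrM.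
  by apply: ler_pM => //; exact: norm_coord.
by rewrite sumr_const card_ord -[leLHS]mulr_natl mulrA.
Qed.

Lemma norm_lt_near (V : normedModType R) (x : V) (P : set V) :
  (\forall y \near x, P y) <-> exists2 r : R, 0 < r & forall y, `|y - x| < r -> P y.
Proof.
split=> [/nbhs_ballP[r /= r0 rP]|[r r0 rP]].
  by exists r => // y yx; apply: rP; rewrite -ball_normE /= distrC.
apply/nbhs_ballP; exists r => //= y; rewrite -ball_normE /= distrC; exact: rP.
Qed.

Lemma open_ball_rV n (O : set 'rV[R]_n) (x : 'rV[R]_n) : open O -> O x ->
  exists2 r : R, 0 < r & forall y, `|y - x| < r -> O y.
Proof. by move=> oO Ox; apply/norm_lt_near; apply: open_nbhs_nbhs. Qed.

Lemma open_rV_ball n (x : 'rV[R]_n) (r : R) : open [set y | `|y - x| < r].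
Proof.
rewrite openE => y /= yx; suff : \forall z \near y, `|z - x| < r by [].
apply/norm_lt_near; exists (r - `|y - x|); first by rewrite subr_gt0.
move=> z zy; apply: le_lt_trans (_ : `|z - y| + `|y - x| < r).
  by rewrite -{1}(subrK y z) -addrA; exact: ler_normD.
by rewrite -ltrBrDr.
Qed.

End RowVectors.

(** * Scalar functions: strict differentiability and the classes C^k *)

Section ScalarSmooth.
Context {R : realType}.
Local Notation e_ i := (delta_mx 0 i).

Lemma is_derive_line n (f : 'rV[R]_n -> R) (y v : 'rV[R]_n) (t : R) :
  derivable f (y + t *: v) v ->
  is_derive t 1 (fun s : R => f (y + s *: v)) ('D_v f (y + t *: v)).
Proof.
move=> df.
have E : (fun h : R => h^-1 *: ((fun s : R => f (y + s *: v)) (h *: (1 : R) + t)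
            - f (y + t *: v)))
       = (fun h : R => h^-1 *: (f (h *: v + (y + t *: v)) - f (y + t *: v))).
  apply/funext => h; congr (_ *: (f _ - _)).
  by rewrite scalerDl [h *: (1 : R)]mulr1 addrCA.
by apply: DeriveDef; rewrite /derivable /derive E.
Qed.

(** The increment [c] may have either sign, so the mean value theorem is applied on the interval
    from min 0 c to max 0 c, and the intermediate point is rescaled by [c]. *)
Lemma mvt_line n (f : 'rV[R]_n -> R) (y v : 'rV[R]_n) (c : R) :
  (forall t, 0 <= t <= 1 -> derivable f (y + (t * c) *: v) v) ->
  exists2 t, 0 <= t <= 1 &
    f (y + c *: v) - f y = c * 'D_v f (y + (t * c) *: v).
Proof.
move=> df.
have [->|c0] := eqVneq c 0.
  by exists 0; rewrite ?lexx ?ler01 // scale0r addr0 subrr mul0r.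
have dg s : s \in `[Num.min 0 c, Num.max 0 c]%R ->
    is_derive s 1 (fun s : R => f (y + s *: v)) ('D_v f (y + s *: v)).
  move=> sI; apply: is_derive_line.
  suff /df : 0 <= s / c <= 1 by rewrite divfK.
  move: sI; rewrite in_itv /= /Num.min /Num.max; case: (ltgtP 0 c) c0 => // cc _ /andP[s0 s1].
    by rewrite divr_ge0 ?(ltW cc) //= ler_pdivrMr // mul1r.
  by rewrite -[s / c]mulrNN -invrN divr_ge0 ?oppr_ge0 ?(ltW cc) //=
    ler_pdivrMr ?oppr_gt0 // mul1r lerN2.
have mM : Num.min 0 c <= Num.max 0 c by rewrite ge_min !le_max lexx.
have gc : {within `[Num.min 0 c, Num.max 0 c], continuous (fun s => f (y + s *: v))}.
  by apply: derivable_within_continuous => s /dg h; exact: (@ex_derive _ _ _ _ _ _ _ h).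
have dg' s : s \in `]Num.min 0 c, Num.max 0 c[%R ->
    is_derive s 1 (fun s : R => f (y + s *: v)) ('D_v f (y + s *: v)).
  by move=> /subset_itv_oo_cc; exact: dg.
have [z zI E] := MVT_segment mM dg' gc.
exists (z / c); rewrite ?divfK //.
  move: zI; rewrite in_itv /= /Num.min /Num.max; case: (ltgtP 0 c) c0 => // cc _ /andP[s0 s1].
    by rewrite divr_ge0 ?(ltW cc) //= ler_pdivrMr // mul1r.
  by rewrite -[z / c]mulrNN -invrN divr_ge0 ?oppr_ge0 ?(ltW cc) //=
    ler_pdivrMr ?oppr_gt0 // mul1r lerN2.
move: E; rewrite /Num.min /Num.max; case: (ltgtP 0 c) c0 => // cc _.
    by rewrite scale0r addr0 subr0 mulrC.
  rewrite scale0r addr0 sub0r mulrN [_ * c]mulrC => /(congr1 -%R).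
  by rewrite opprK opprB.
Qed.

(** Vertices of the path from [y] to [z] that changes one coordinate at a time. The whole path stays
    in every ball of the maximum norm that contains both ends. *)
Definition splice n (y z : 'rV[R]_n) (k : nat) : 'rV[R]_n :=
  \row_i (if (i < k)%N then z 0 i else y 0 i).

Lemma spliceS n (y z : 'rV[R]_n) (k : 'I_n) :
  splice y z k.+1 = splice y z k + (z 0 k - y 0 k) *: e_ k.
Proof.
apply/rowP => i; rewrite !mxE eqxx /= ltnS leq_eqVlt val_eqE.
have [->|ik] := eqVneq i k; first by rewrite ltnn mulr1 addrC subrK.
by rewrite /= mulr0 addr0.
Qed.

Lemma splice_segment n (x y z : 'rV[R]_n) (k : 'I_n) (t r : R) :
  `|y - x| < r -> `|z - x| < r -> 0 <= t <= 1 ->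
  `|splice y z k + (t * (z 0 k - y 0 k)) *: e_ k - x| < r.
Proof.
move=> yr zr /andP[t0 t1].
have m0 : 0 <= Num.max `|y - x| `|z - x| by rewrite le_max normr_ge0.
apply: (@le_lt_trans _ _ (Num.max `|y - x| `|z - x|)); last by rewrite gt_max yr.
apply: norm_leP => // i j; rewrite (ord1 i) !mxE eqxx /=.
have hy : `|y 0 j - x 0 j| <= Num.max `|y - x| `|z - x|.
  by rewrite le_max; have := norm_coord (y - x) 0 j; rewrite !mxE => ->.
have hz : `|z 0 j - x 0 j| <= Num.max `|y - x| `|z - x|.
  by rewrite le_max; have := norm_coord (z - x) 0 j; rewrite !mxE => ->; rewrite orbT.
case: (eqVneq j k) => [jk|_]; last by rewrite mulr0 addr0; case: ifP.
rewrite -jk ltnn mulr1.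
have -> : y 0 j + t * (z 0 j - y 0 j) - x 0 j
        = (1 - t) * (y 0 j - x 0 j) + t * (z 0 j - x 0 j) by ring.
apply: le_trans (ler_normD _ _) _; rewrite !normrM (ger0_norm t0).
rewrite ger0_norm ?subr_ge0 //.
apply: (@le_trans _ _ ((1 - t) * Num.max `|y - x| `|z - x| + t * Num.max `|y - x| `|z - x|)).
  by apply: lerD; rewrite ler_wpM2l // subr_ge0.
by rewrite -mulrDl subrK mul1r.
Qed.

(* Telescope along the coordinate axes. *)
Lemma strict_estimate n (f : 'rV[R]_n -> R) (x : 'rV[R]_n) (r : R) (c : 'I_n -> R) (eps : R) :
  (forall y i, `|y - x| < r -> derivable f y (e_ i)) ->
  (forall y i, `|y - x| < r -> `|'D_(e_ i) f y - c i| <= eps) ->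
  forall y z, `|y - x| < r -> `|z - x| < r ->
  `|f z - f y - \sum_i (z 0 i - y 0 i) * c i| <= n%:R * eps * `|z - y|.
Proof.
move=> df dfc y z yr zr.
have -> : f z - f y = \sum_(k < n) (f (splice y z k.+1) - f (splice y z k)).
  rewrite -(big_mkord xpredT (fun k => f (splice y z k.+1) - f (splice y z k))).
  rewrite telescope_sumr //; congr (f _ - f _).
    by apply/rowP => i; rewrite mxE ltn_ord.
  by apply/rowP => i; rewrite mxE ltn0.
rewrite -sumrB; apply: le_trans (ler_norm_sum _ _ _) _.
have -> : n%:R * eps * `|z - y| = \sum_(k < n) eps * `|z - y|.
  by rewrite sumr_const card_ord -mulrA mulr_natl.
apply: ler_sum => k _; rewrite spliceS.
have [|t t01 ->] := @mvt_line n f (splice y z k) (e_ k) (z 0 k - y 0 k).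
  by move=> t t01; apply: df; exact: splice_segment.
rewrite -mulrBr normrM mulrC; apply: ler_pM => //.
  by apply: dfc; exact: splice_segment.
by have := norm_coord (z - y) 0 k; rewrite !mxE.
Qed.

(** Scalar counterpart of [Ck]; vector-valued statements reduce to it by components ([CkP]), where
    products and the chain rule are simpler. *)
Fixpoint Sk {n : nat} (k : nat) (O : set 'rV[R]_n) (f : 'rV[R]_n -> R) : Prop :=
  (forall x, O x -> {for x, continuous f}) /\
  if k is k'.+1 then
    forall i : 'I_n, (forall x, O x -> derivable f x (e_ i)) /\
      Sk k' O (fun x => 'D_(e_ i) f x)
  else True.

Lemma near_open n (O : set 'rV[R]_n) x : open O -> O x -> \forall y \near x, O y.
Proof. by move=> oO Ox; apply: open_nbhs_nbhs. Qed.

Lemma Sk_ext n k (O : set 'rV[R]_n) f g : open O -> (forall x, O x -> f x = g x) ->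
  Sk k O f -> Sk k O g.
Proof.
move=> oO; have fgn (f' g' : 'rV[R]_n -> R) x : (forall x, O x -> f' x = g' x) ->
    O x -> \forall y \near x, f' y = g' y.
  by move=> fg Ox; near=> y; apply: fg; near: y; exact: near_open.
have cg (f' g' : 'rV[R]_n -> R) : (forall x, O x -> f' x = g' x) ->
    (forall x, O x -> {for x, continuous f'}) -> forall x, O x -> {for x, continuous g'}.
  move=> fg cf x Ox; have := cf x Ox.
  rewrite /prop_for /continuous_at (fg _ Ox); apply: cvg_trans.
  exact: near_eq_cvg (fgn _ _ _ fg Ox).
elim: k f g => [|k IH] f g fg [cf df]; split=> //; try exact: (cg f).
move=> i; have [dfi Si] := df i; split=> [x Ox|].
  by apply: near_eq_derivable (dfi _ Ox); exact: fgn.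
by apply: IH Si => x Ox; apply: near_eq_derive; exact: fgn.
Unshelve. all: by end_near. Qed.

Lemma Sk_sub n k (O O' : set 'rV[R]_n) f : O' `<=` O -> Sk k O f -> Sk k O' f.
Proof.
move=> sO; elim: k f => [|k IH] f [cf df]; split=> //; try by move=> x /sO; exact: cf.
by move=> i; have [dfi Si] := df i; split; [move=> x /sO; exact: dfi|exact: IH].
Qed.

Lemma SkW n k (O : set 'rV[R]_n) f : Sk k.+1 O f -> Sk k O f.
Proof.
elim: k f => [|k IH] f [cf df]; split=> // i.
by have [dfi Si] := df i; split=> //; exact: IH.
Qed.

Lemma Sk_cst n k (O : set 'rV[R]_n) (c : R) : open O -> Sk k O (fun=> c).
Proof.
move=> oO; elim: k c => [|k IH] c; split=> //; try by move=> x _; exact: cst_continuous.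
move=> i; split=> [x _|]; first exact: derivable_cst.
by apply: Sk_ext (IH 0) => // x _; rewrite derive_cst.
Qed.

Lemma continuous_coord n (j : 'I_n) : continuous (fun x : 'rV[R]_n => x 0 j).
Proof. exact: coord_continuous. Qed.

Lemma is_derive_coord n (j : 'I_n) (x v : 'rV[R]_n) :
  is_derive x v (fun x : 'rV[R]_n => x 0 j) (v 0 j).
Proof.
have d : derivable (fun x : 'rV[R]_n => x) x v by exact: derivable_id.
have dj : derivable (fun x : 'rV[R]_n => x 0 j) x v.
  by move/derivable_mxP : d => /(_ 0 j).
apply: DeriveDef => //.
have := derive_mx d; rewrite derive_id => /rowP /(_ j); rewrite mxE => ->.
by [].
Qed.

Lemma Sk_coord n k (O : set 'rV[R]_n) (j : 'I_n) : open O -> Sk k O (fun x => x 0 j).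
Proof.
move=> oO; case: k => [|k]; split=> //; try by move=> x _; exact: continuous_coord.
move=> i; split=> [x _|]; first exact: (@ex_derive _ _ _ _ _ _ _ (is_derive_coord j x _)).
apply: Sk_ext (Sk_cst k ((e_ i : 'rV_n) 0 j) oO) => // x _.
by rewrite (@derive_val _ _ _ _ _ _ _ (is_derive_coord j x _)).
Qed.

Lemma SkD n k (O : set 'rV[R]_n) f g : open O -> Sk k O f -> Sk k O g ->
  Sk k O (fun x => f x + g x).
Proof.
move=> oO; elim: k f g => [|k IH] f g [cf df] [cg dg]; split=> //;
  try by move=> x Ox; apply: (@continuousD _ _ _ f g); [exact: cf|exact: cg].
move=> i; have [dfi Sf] := df i; have [dgi Sg] := dg i; split=> [x Ox|].
  by apply: (@derivableD _ _ _ f g); [exact: dfi|exact: dgi].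
apply: Sk_ext (IH _ _ Sf Sg) => // x Ox.
by rewrite -(@deriveD _ _ _ f g) //; [exact: dfi|exact: dgi].
Qed.

Lemma SkM n k (O : set 'rV[R]_n) f g : open O -> Sk k O f -> Sk k O g ->
  Sk k O (fun x => f x * g x).
Proof.
move=> oO; elim: k f g => [|k IH] f g hf hg; have [cf df] := hf; have [cg dg] := hg.
  by split=> // x Ox; apply: (@continuousM _ _ f g); [exact: cf|exact: cg].
split=> [x Ox|i].
  by apply: (@continuousM _ _ f g); [exact: cf|exact: cg].
have [dfi Sf] := df i; have [dgi Sg] := dg i; split=> [x Ox|].
  by apply: (@derivableM _ _ f g); [exact: dfi|exact: dgi].
have S1 := IH _ _ (SkW hf) Sg; have S2 := IH _ _ (SkW hg) Sf.
apply: Sk_ext (SkD oO S1 S2) => // x Ox.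
by rewrite (@deriveM _ _ f g) //; [exact: dfi|exact: dgi].
Qed.

Lemma Sk_sum n k (O : set 'rV[R]_n) (I : Type) (s : seq I) (f : I -> 'rV[R]_n -> R) :
  open O -> (forall i, Sk k O (f i)) -> Sk k O (fun x => \sum_(i <- s) f i x).
Proof.
move=> oO hf; elim: s => [|i s IH].
  by apply: Sk_ext (Sk_cst k 0 oO) => // x _; rewrite big_nil.
by apply: Sk_ext (SkD oO (hf i) IH) => // x _; rewrite big_cons.
Qed.

Definition grad n (f : 'rV[R]_n -> R) (x : 'rV[R]_n) : 'cV[R]_n :=
  \col_i 'D_(e_ i) f x.

Lemma mulmx_row_colE n (v : 'rV[R]_n) (c : 'cV[R]_n) : (v *m c) 0 0 = \sum_i v 0 i * c i 0.
Proof. by rewrite mxE. Qed.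

(** Continuity of the partial derivatives makes the function strictly differentiable, with both
    points moving. This form yields the derivative as well as local Lipschitz bounds. *)
Lemma Sk1_strict n (O : set 'rV[R]_n) f x : open O -> O x -> Sk 1 O f ->
  forall eps, 0 < eps -> exists2 r : R, 0 < r &
    forall y z, `|y - x| < r -> `|z - x| < r ->
    `|f z - f y - ((z - y) *m grad f x) 0 0| <= eps * `|z - y|.
Proof.
move=> oO Ox [_ df] eps e0.
(* The factor [n] lost in telescoping is absorbed here; [n.+1] avoids a division by 0. *)
have e1 : 0 < eps / n.+1%:R by rewrite divr_gt0.
have [r r0 rP] : exists2 r : R, 0 < r & forall y, `|y - x| < r ->
    O y /\ forall i, `|'D_(e_ i) f y - 'D_(e_ i) f x| <= eps / n.+1%:R.
  apply/norm_lt_near; near=> y; split; first by near: y; exact: near_open.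
  move=> i; move: i; near: y; apply: filter_forall => i.
  have [_ [cdf _]] := df i.
  have /cvgrPdist_le/(_ _ e1) := cdf x Ox.
  by apply: filterS => y; rewrite distrC.
exists r => // y z yr zr.
have := @strict_estimate n f x r (fun i => 'D_(e_ i) f x) (eps / n.+1%:R) _ _ y z yr zr.
have -> : ((z - y) *m grad f x) 0 0 = \sum_i (z 0 i - y 0 i) * 'D_(e_ i) f x.
  by rewrite mulmx_row_colE; apply: eq_bigr => i _; rewrite !mxE.
move=> H; apply: le_trans (H _ _) _.
- by move=> y' i /rP[Oy _]; have [dfi _] := df i; exact: dfi.
- by move=> y' i /rP[_ h]; exact: h.
apply: ler_wpM2r => //; rewrite mulrCA ger_pMr // ler_pdivrMr // mul1r.
by rewrite ler_nat.
Unshelve. all: by end_near. Qed.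

End ScalarSmooth.

(** Frechet differentiability in epsilon-delta form, with the derivative as an explicit map, so that
    the chain rule is a direct estimate. *)
Definition approx1 {R : realType} {V W : normedModType R} (f : V -> W) (x : V) (L : V -> W) :=
  forall eps : R, 0 < eps -> exists2 r : R, 0 < r &
    forall y, `|y - x| < r -> `|f y - f x - L (y - x)| <= eps * `|y - x|.

Section Approx.
Context {R : realType}.
Local Notation e_ i := (delta_mx 0 i).

Lemma approx1_is_derive (V W : normedModType R) (f : V -> W) (x v : V) (L : {linear V -> W}) :
  approx1 f x L -> is_derive x v f (L v).
Proof.
move=> fL.
have cv : h^-1 *: (f (h *: v + x) - f x) @[h --> 0^'] --> L v.
  apply/cvgrPdist_le => /= eps e0.
  have v1 : 0 < `|v| + 1 by rewrite ltr_wpDl.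
  have [r r0 rP] := fL _ (divr_gt0 e0 v1).
  near=> h.
  have h0 : h != 0 by near: h; exact: nbhs_dnbhs_neq.
  have hr : `|h *: v + x - x| < r.
    rewrite addrK normrZ; apply: (@le_lt_trans _ _ (`|h| * (`|v| + 1))).
      by rewrite ler_wpM2l // lerDl.
    rewrite -ltr_pdivlMr //; near: h; apply: dnbhs0_lt; exact: divr_gt0.
  have := rP _ hr; rewrite addrK linearZ /= => H.
  rewrite distrC -[L v]scale1r -(mulVf h0) -scalerA -scalerBr normrZ normfV.
  rewrite ler_pdivrMl ?normr_gt0 //; apply: le_trans H _.
  rewrite normrZ mulrCA ler_wpM2l // mulrAC ler_pdivrMr // ler_wpM2l ?(ltW e0) //.
  by rewrite lerDl.
split; first by apply/cvg_ex; exists (L v).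
exact: cvg_lim.
Unshelve. all: by end_near. Qed.

Lemma approx1_comp (U V W : normedModType R) (f : U -> V) (g : V -> W) x
    (L : {linear U -> V}) (M : {linear V -> W}) (cL cM : R) :
  (forall u, `|L u| <= cL * `|u|) -> (forall u, `|M u| <= cM * `|u|) ->
  approx1 f x L -> approx1 g (f x) M -> approx1 (g \o f) x (M \o L).
Proof.
move=> hL hM fL gM eps e0.
have cLp : 0 < `|cL| + 1 by rewrite ltr_wpDl.
have cMp : 0 < `|cM| + 1 by rewrite ltr_wpDl.
have hL' u : `|L u| <= `|cL| * `|u|.
  by apply: le_trans (hL u) _; rewrite ler_wpM2r // ler_norm.
have hM' u : `|M u| <= `|cM| * `|u|.
  by apply: le_trans (hM u) _; rewrite ler_wpM2r // ler_norm.
have e2 : 0 < eps / 2 by rewrite divr_gt0.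
have [s s0 sP] := gM _ (divr_gt0 e2 cLp).
have m0 : 0 < Num.min 1 (eps / 2 / (`|cM| + 1)).
  by rewrite lt_min ltr01 divr_gt0.
have [r r0 rP] := fL _ m0.
exists (Num.min r (s / (`|cL| + 1))); first by rewrite lt_min r0 divr_gt0.
move=> y; rewrite lt_min => /andP[yr ys].
have H := rP _ yr.
have fyx : `|f y - f x| <= (`|cL| + 1) * `|y - x|.
  rewrite -(subrK (L (y - x)) (f y - f x)); apply: le_trans (ler_normD _ _) _.
  rewrite addrC mulrDl mul1r; apply: lerD => //; apply: le_trans H _.
  by rewrite ler_piMl // ge_min lexx.
have fys : `|f y - f x| < s.
  by apply: le_lt_trans fyx _; rewrite mulrC -ltr_pdivlMr.
have H2 := sP _ fys.
rewrite /= -(subrK (M (f y - f x)) (g (f y) - g (f x))) -addrA -linearB.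
apply: le_trans (ler_normD _ _) _; rewrite [leRHS](_ : _ = eps / 2 * `|y - x| + eps / 2 * `|y - x|);
  last by rewrite -mulrDl -splitr.
apply: lerD.
  apply: le_trans H2 _; rewrite mulrAC ler_pdivrMr // -(mulrA (eps / 2)).
  by apply: ler_wpM2l; [exact: ltW|rewrite mulrC].
apply: le_trans (hM' _) _; apply: (@le_trans _ _ (`|cM| * (eps / 2 / (`|cM| + 1) * `|y - x|))).
  rewrite ler_wpM2l //; apply: le_trans H _.
  by rewrite ler_wpM2r // ge_min lexx orbT.
rewrite mulrA ler_wpM2r // mulrCA ler_piMr ?(ltW e2) //.
by rewrite ler_pdivrMr // mul1r lerDl.
Qed.

End Approx.

(** * Smooth maps between spaces of row vectors *)

Section VectorSmooth.
Context {R : realType}.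
Local Notation e_ i := (delta_mx 0 i).

Definition rowfun n (c : 'cV[R]_n) (v : 'rV[R]_n) : R := (v *m c) 0 0.

Fact rowfun_is_linear n (c : 'cV[R]_n) : linear (rowfun c).
Proof. by move=> a u v; rewrite /rowfun mulmxDl -scalemxAl !mxE. Qed.
HB.instance Definition _ n (c : 'cV[R]_n) :=
  GRing.isLinear.Build R 'rV[R]_n R _ (rowfun c) (rowfun_is_linear c).

Lemma norm_rowfun n (c : 'cV[R]_n) v : `|rowfun c v| <= n%:R * `|c| * `|v|.
Proof. by apply: le_trans (norm_coord _ 0 0) _; rewrite mulrAC; exact: norm_mulmx. Qed.

Lemma norm_mulmxr n m (J : 'M[R]_(n, m)) (v : 'rV[R]_n) :
  `|mulmxr J v| <= n%:R * `|J| * `|v|.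
Proof. by rewrite /= mulrAC; exact: norm_mulmx. Qed.

Lemma approx1P (V W : normedModType R) (f : V -> W) x L : approx1 f x L <->
  forall eps : R, 0 < eps ->
    \forall y \near x, `|f y - f x - L (y - x)| <= eps * `|y - x|.
Proof. by split=> H eps e0; [apply/norm_lt_near|apply/norm_lt_near]; exact: H. Qed.

Lemma eq_approx1 (V W : normedModType R) (f f' : V -> W) x L L' :
  f =1 f' -> L =1 L' -> approx1 f x L -> approx1 f' x L'.
Proof. by move=> ff LL fL eps /fL[r r0 rP]; exists r => // y /rP; rewrite !ff LL. Qed.

Lemma approx1_row n m (g : 'rV[R]_n -> 'rV[R]_m) x (J : 'M[R]_(n, m)) :
  (forall j, approx1 (fun y => g y 0 j) x (rowfun (col j J))) ->
  approx1 g x (mulmxr J).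
Proof.
move=> H; apply/approx1P => eps e0; near=> y.
apply: norm_leP => [|i j]; first by rewrite mulr_ge0 // ltW.
rewrite (ord1 i); have -> : (g y - g x - mulmxr J (y - x)) 0 j =
    g y 0 j - g x 0 j - rowfun (col j J) (y - x).
  by rewrite /rowfun /= !mxE; congr (_ - _); apply: eq_bigr => k _; rewrite !mxE.
move: j; near: y; apply: filter_forall => j.
by move/approx1P : (H j); apply.
Unshelve. all: by end_near. Qed.

Lemma approx1_unique n m (g : 'rV[R]_n -> 'rV[R]_m) x (J K : 'M[R]_(n, m)) :
  approx1 g x (mulmxr J) -> approx1 g x (mulmxr K) -> J = K.
Proof.
move=> hJ hK; apply/row_matrixP => i; rewrite !rowE.
have [_ E] := approx1_is_derive (e_ i) hJ.
have [_] := approx1_is_derive (e_ i) hK.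
by rewrite E.
Qed.

Lemma Sk1_approx1 n (O : set 'rV[R]_n) f x : open O -> O x -> Sk 1 O f ->
  approx1 f x (rowfun (grad f x)).
Proof.
move=> oO Ox Sf eps e0; have [r r0 rP] := Sk1_strict oO Ox Sf e0.
by exists r => // y yr; apply: rP => //; rewrite subrr normr0.
Qed.

(** Row convention: the derivative at [x] is v |-> v *m jac g x. Surjectivity thus reads [row_full],
    injectivity [row_free], and the Jacobian of f after g is [jac g x *m jac f (g x)]. *)
Definition jac n m (g : 'rV[R]_n -> 'rV[R]_m) (x : 'rV[R]_n) : 'M[R]_(n, m) :=
  \matrix_(i, j) 'D_(e_ i) (fun y => g y 0 j) x.

Lemma col_jac n m (g : 'rV[R]_n -> 'rV[R]_m) x j :
  col j (jac g x) = grad (fun y => g y 0 j) x.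
Proof. by apply/colP => i; rewrite !mxE. Qed.

Definition Sv n m k (O : set 'rV[R]_n) (g : 'rV[R]_n -> 'rV[R]_m) :=
  forall j, Sk k O (fun y => g y 0 j).

Lemma Sv1_approx1 n m (O : set 'rV[R]_n) (g : 'rV[R]_n -> 'rV[R]_m) x :
  open O -> O x -> Sv 1 O g -> approx1 g x (mulmxr (jac g x)).
Proof.
move=> oO Ox Sg; apply: approx1_row => j; rewrite col_jac.
exact: Sk1_approx1 (Sg j).
Qed.

Lemma cont_normP (V W : normedModType R) (f : V -> W) x : {for x, continuous f} <->
  forall eps : R, 0 < eps -> exists2 r : R, 0 < r &
    forall y, `|y - x| < r -> `|f y - f x| < eps.
Proof.
split=> [/cvgrPdist_lt H eps e0|H].
  by apply/norm_lt_near; apply: filterS (H _ e0) => y; rewrite distrC.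
apply/cvgrPdist_lt => eps e0; apply/norm_lt_near.
by have [r r0 rP] := H _ e0; exists r => // y /rP; rewrite distrC.
Qed.

Lemma continuous_rowP n m (g : 'rV[R]_n -> 'rV[R]_m) x :
  {for x, continuous g} <-> forall j, {for x, continuous (fun y => g y 0 j)}.
Proof.
split=> [cg j|H].
  apply: (@continuous_comp _ _ _ g (fun v : 'rV[R]_m => v 0 j)) => //.
  exact: coord_continuous.
apply/cont_normP => eps e0.
have [r r0 rP] : exists2 r : R, 0 < r & forall y, `|y - x| < r ->
    forall j, `|g y 0 j - g x 0 j| < eps / 2.
  have [|j r s|r r0 rP] := @fin_radius _ 'I_m (fun j r => forall y, `|y - x| < r ->
      `|g y 0 j - g x 0 j| < eps / 2).
  - by move=> j; move/cont_normP : (H j); apply; exact: divr_gt0.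
  - by move=> rs h y yr; apply: h; exact: lt_le_trans rs.
  - by exists r => // y yr j; exact: rP.
exists r => // y /rP yr; apply: (@le_lt_trans _ _ (eps / 2)); last first.
  by rewrite ltr_pdivrMr // ltr_pMr // ltr1n.
apply: norm_leP => [|i j]; first by rewrite divr_ge0 // ltW.
by rewrite (ord1 i) !mxE ltW.
Qed.

Lemma CkP n m k (O : set 'rV[R]_n) (g : 'rV[R]_n -> 'rV[R]_m) : open O ->
  Ck k O g <-> Sv k O g.
Proof.
move=> oO; elim: k g => [|k IH] g; split.
- by move=> [cg _] j; split=> // x Ox; move/continuous_rowP : (cg _ Ox); apply.
- by move=> H; split=> // x Ox; apply/continuous_rowP => j; have [c _] := H j; exact: c.
- move=> [cg dg] j; split=> [x Ox|i].
    by move/continuous_rowP : (cg _ Ox); apply.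
  have [dgi Sgi] := dg i; split=> [x Ox|].
    by move/derivable_mxP : (dgi _ Ox); apply.
  have /IH /(_ j) H := Sgi; apply: Sk_ext H => // x Ox.
  by rewrite derive_mx ?mxE //; exact: dgi.
- move=> H; split=> [x Ox|i].
    by apply/continuous_rowP => j; have [c _] := H j; exact: c.
  have dgi x : O x -> derivable g x (e_ i).
    move=> Ox; apply/derivable_mxP => i' j; rewrite (ord1 i').
    by have [_ /(_ i)[d _]] := H j; exact: d.
  split=> //; apply/IH => j; have [_ /(_ i)[_ S]] := H j.
  by apply: Sk_ext S => // x Ox; rewrite derive_mx ?mxE //; exact: dgi.
Qed.

Lemma SvW n m k (O : set 'rV[R]_n) (g : 'rV[R]_n -> 'rV[R]_m) : Sv k.+1 O g -> Sv k O g.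
Proof. by move=> H j; apply: SkW; exact: H. Qed.

Lemma Sk1W n k (O : set 'rV[R]_n) (f : 'rV[R]_n -> R) : Sk k.+1 O f -> Sk 1 O f.
Proof. by elim: k => // k IH /SkW. Qed.

Lemma approx1_comp_row n m p (g : 'rV[R]_n -> 'rV[R]_m) (f : 'rV[R]_m -> 'rV[R]_p) x J K :
  approx1 g x (mulmxr J) -> approx1 f (g x) (mulmxr K) ->
  approx1 (f \o g) x (mulmxr (J *m K)).
Proof.
move=> gJ fK.
have := approx1_comp (norm_mulmxr J) (norm_mulmxr K) gJ fK.
move=> H eps e0; have [r r0 rP] := H eps e0; exists r => // y /rP.
by rewrite /= mulmxA.
Qed.

(** By the chain rule every partial derivative of the composite is a sum of products of functions of
    class C^k, to which the induction hypothesis applies. *)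
Lemma Sk_comp n m k (O : set 'rV[R]_n) (O' : set 'rV[R]_m)
    (f : 'rV[R]_m -> R) (g : 'rV[R]_n -> 'rV[R]_m) :
  open O -> open O' -> (forall x, O x -> O' (g x)) ->
  Sk k O' f -> Sv k O g -> Sk k O (fun x => f (g x)).
Proof.
move=> oO oO' gO.
have cfg f' g' x : O x -> (forall x, O x -> O' (g' x)) ->
    (forall y, O' y -> {for y, continuous f'}) ->
    (forall j, {for x, continuous (fun y => g' y 0 j)}) ->
    {for x, continuous (fun x => (f' : 'rV[R]_m -> R) ((g' : 'rV[R]_n -> 'rV[R]_m) x))}.
  move=> Ox hO cf cg; apply: (@continuous_comp _ _ _ g' f').
    exact/continuous_rowP.
  exact: cf (hO _ Ox).
elim: k f => [|k IH] f hf hg.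
  have [cf _] := hf; split=> // x Ox; apply: cfg => // j.
  by have [c _] := hg j; exact: c.
have [cf df] := hf; split=> [x Ox|i].
  by apply: cfg => // j; have [c _] := hg j; exact: c.
have der x : O x -> is_derive x (e_ i) (fun x => f (g x))
    (\sum_j 'D_(e_ i) (fun y => g y 0 j) x * 'D_(e_ j) f (g x)).
  move=> Ox; have hg1 : Sv 1 O g by move=> j; exact: Sk1W (hg j).
  have A1 := Sv1_approx1 oO Ox hg1.
  have A2 := Sk1_approx1 oO' (gO _ Ox) (Sk1W hf).
  have A3 : approx1 (fun x => f (g x)) x (rowfun (jac g x *m grad f (g x))).
    have := approx1_comp (norm_mulmxr (jac g x)) (norm_rowfun (grad f (g x))) A1 A2.
    by apply: eq_approx1 => // v; rewrite /rowfun /= mulmxA.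
  have [d E] := approx1_is_derive (e_ i) A3; split=> //; rewrite E.
  rewrite /= /rowfun mulmxA -rowE mulmx_row_colE; apply: eq_bigr => j _.
  by rewrite !mxE.
split=> [x Ox|]; first exact: (@ex_derive _ _ _ _ _ _ _ (der x Ox)).
apply: (@Sk_ext _ _ _ _ (fun x => \sum_j 'D_(e_ i) (fun y => g y 0 j) x * 'D_(e_ j) f (g x))) => //.
  by move=> x Ox; rewrite (@derive_val _ _ _ _ _ _ _ (der x Ox)).
apply: Sk_sum => // j; apply: SkM => //.
  by have [_ /(_ i)[_]] := hg j.
by have [_ Sf] := df j; exact: (IH _ Sf (SvW hg)).
Qed.

End VectorSmooth.

(** * Bump functions *)

Section Bump.
Context {R : realType}.
Local Notation e_ i := (delta_mx 0 i).
Implicit Types (p : {poly R}) (x : R).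

(** Read on rows of length 1, so that [Sk] and its closure properties apply. *)
Definition smooth1 (F : R -> R) :=
  forall k, Sk k setT (fun v : 'rV[R]_1 => F (v 0 0)).

Lemma is_derive_rV1 (F : R -> R) (v : 'rV[R]_1) d :
  is_derive (v 0 0) 1 F d -> is_derive v (e_ 0) (fun v : 'rV[R]_1 => F (v 0 0)) d.
Proof.
have E : (fun h : R => h^-1 *: (F ((h *: e_ 0 + v : 'rV[R]_1) 0 0) - F (v 0 0)))
       = (fun h : R => h^-1 *: (F (h *: (1 : R) + v 0 0) - F (v 0 0))).
  by apply/funext => h; rewrite !mxE.
by move=> [d1 d2]; apply: DeriveDef; rewrite /derivable /derive E.
Qed.

(** A family closed under differentiation consists of smooth functions; the induction on k runs over
    all members at once. *)
Lemma smooth1_family (I : Type) (F : I -> R -> R) (D : I -> I) :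
  (forall i x, is_derive x 1 (F i) (F (D i) x)) -> forall i, smooth1 (F i).
Proof.
move=> dF i k; elim: k i => [|k IH] i.
all: have cF v : {for v, continuous (fun v : 'rV[R]_1 => F i (v 0 0))} by
  [apply: (@continuous_comp _ _ _ (fun v : 'rV[R]_1 => v 0 0) (F i));
   [exact: coord_continuous|
    apply: differentiable_continuous; apply/derivable1_diffP;
    exact: (@ex_derive _ _ _ _ _ _ _ (dF i _))]].
  by split=> // v _; exact: cF.
split=> [v _|j]; first exact: cF.
have dv v : is_derive v (e_ j) (fun v : 'rV[R]_1 => F i (v 0 0)) (F (D i) (v 0 0)).
  by rewrite (ord1 j); exact: is_derive_rV1.
split=> [v _|]; first exact: (@ex_derive _ _ _ _ _ _ _ (dv v)).
by apply: Sk_ext (IH (D i)) => [|v _]; [exact: openT|rewrite (@derive_val _ _ _ _ _ _ _ (dv v))].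
Qed.

Lemma Sk_comp1 n k (O : set 'rV[R]_n) (F : R -> R) f : open O -> smooth1 F -> Sk k O f ->
  Sk k O (fun v => F (f v)).
Proof.
move=> oO hF hf.
have hg : Sv k O (fun v => (\row_(j < 1) f v) : 'rV[R]_1).
  by move=> j; apply: Sk_ext hf => // v _; rewrite mxE.
have := @Sk_comp R n 1 k O setT _ _ oO openT (fun _ _ => I) (hF k) hg.
by apply: Sk_ext => // v _; rewrite mxE.
Qed.

(** The functions p(1/x) exp(-1/x), extended by 0, are closed under differentiation: the derivative
    replaces p by X^2 (p - p'). For p = 1 this is the classical flat function. *)
Definition flat p x : R := if 0 < x then p.[x^-1] * expR (- x^-1) else 0.

Lemma poly_growth p : exists C N, 0 <= C /\ forall y, 1 <= y -> `|p.[y]| <= C * y ^+ N.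
Proof.
elim/poly_ind: p => [|p c [C [N [C0 H]]]].
  by exists 0, 0%N; split=> // y _; rewrite horner0 normr0 mul0r.
exists (C + `|c|), N.+1; split=> [|y y1]; first exact: addr_ge0.
rewrite hornerMXaddC; apply: le_trans (ler_normD _ _) _; rewrite mulrDl lerD //.
  rewrite normrM exprSr mulrA (ger0_norm (le_trans ler01 y1)).
  by rewrite ler_wpM2r ?H // (le_trans ler01).
by rewrite ler_peMr // exprn_ege1.
Qed.

Lemma flat_bound p : exists2 C, 0 <= C & forall x, x <= 1 -> `|flat p x| <= C * `|x|.
Proof.
have [C [N [C0 H]]] := poly_growth p.
exists (C * N.+1%:R ^+ N.+1) => [|x x1]; first by rewrite mulr_ge0 // exprn_ge0.
rewrite /flat; case: ifPn => [x0|_]; last by rewrite normr0 !mulr_ge0 // exprn_ge0.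
have y1 : 1 <= x^-1 by rewrite invf_ge1.
rewrite normrM (ger0_norm (expR_ge0 _)) (gtr0_norm x0).
(* This is exp(y/(N+1)) >= y/(N+1) for y = 1/x, raised to the power N+1 and inverted. *)
have eb : expR (- x^-1) <= (N.+1%:R * x) ^+ N.+1.
  rewrite expRN -[X in _ <= X]invrK lef_pV2 ?posrE ?expR_gt0 ?invr_gt0 ?exprn_gt0 ?mulr_gt0 //.
  rewrite -exprVn [X in expR X](_ : _ = N.+1%:R * (N.+1%:R * x)^-1); last first.
    by rewrite invfM mulrA mulfV // mul1r.
  rewrite expRM_natl; apply: lerXn2r; rewrite ?nnegrE ?expR_ge0 ?invr_ge0 ?mulr_ge0 ?(ltW x0) //.
  by apply: le_trans (expR_ge1Dx _); rewrite lerDr.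
apply: le_trans (ler_pM _ _ (H _ y1) eb) _; rewrite ?expR_ge0 //.
rewrite exprMn [x ^+ N.+1]exprS exprVn.
have xN : x ^+ N != 0 by rewrite expf_neq0 // gt_eqF.
move: (x ^+ N) (N.+1%:R ^+ N.+1) xN => X Y X0.
by rewrite (_ : C * X^-1 * _ = C * Y * x) //; field.
Qed.

Lemma flat_derive p x : is_derive x 1 (flat p) (flat ('X^2 * (p - p^`())) x).
Proof.
case: (ltrgt0P x) => x0.
- have -> : flat ('X^2 * (p - p^`())) x =
     (p^`()).[x^-1] * (- x ^- 2) * expR (- x^-1) + p.[x^-1] * (expR (- x^-1) * (x ^- 2)).
    rewrite /flat x0 !hornerE /= exprVn; ring.
  have N : \near x, p.[x^-1] * expR (- x^-1) = flat p x.
    near=> y; rewrite /flat; suff -> : 0 < y by [].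
    by near: y; exact: lt_nbhsr.
  apply: (near_eq_is_derive N).
  have xn : x != 0 by rewrite gt_eqF.
  have dV : is_derive x 1 (fun y : R => y^-1) (- x ^- 2).
    have := @is_deriveV R id x 1 1 xn (is_derive_id _ _).
    by rewrite [_ *: _]mulr1.
  have dp := is_derive1_comp (is_derive_poly p x^-1) dV.
  have dN : is_derive x 1 (fun y : R => - y^-1) (x ^- 2).
    have := is_deriveN dV; rewrite opprK; exact.
  have de := @is_derive1_comp R expR (fun y : R => - y^-1) x _ _ (is_derive_expR (- x^-1)) dN.
  have := is_deriveM dp de.
  move=> [d1 d2]; split; first exact: d1.
  rewrite [LHS]d2 /= ![_ *: _]mulrC; ring.
- have N : \near x, 0 = flat p x.
    near=> y; rewrite /flat; suff /ltW : y < 0 by rewrite ltNge => ->.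
    by near: y; exact: lt_nbhsl.
  rewrite /flat ltNge (ltW x0) /=.
  by apply: (near_eq_is_derive N); exact: is_derive_cst.
- rewrite x0 {2}/flat ltxx.
  (* At 0 the difference quotient of [flat p] is [flat ('X * p)], which the linear bound sends to
     0. *)
  have [C C0 H] := flat_bound ('X * p).
  have cv : h^-1 *: (flat p (h *: (1 : R) + 0) - flat p 0) @[h --> 0^'] --> (0 : R).
    apply/cvgrPdist_le => eps e0.
    have C1 : 0 < C + 1 by rewrite ltr_wpDl.
    have eC : 0 < eps / (C + 1) by exact: divr_gt0.
    near=> h.
    have h0 : h != 0 by near: h; exact: nbhs_dnbhs_neq.
    rewrite {2}/flat ltxx subr0 addr0 sub0r normrN [h *: _]mulr1.
    have -> : h^-1 *: flat p h = flat ('X * p) h.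
      rewrite /flat; case: ifP => _; last by rewrite scaler0.
      by rewrite hornerM hornerX -mulrA.
    apply: le_trans (H _ _) _.
      apply: ltW; apply: le_lt_trans (ler_norm _) _.
      by near: h; exact: dnbhs0_lt.
    apply: (@le_trans _ _ ((C + 1) * `|h|)); first by rewrite ler_wpM2r // lerDl.
    rewrite mulrC -ler_pdivlMr //; apply: ltW; near: h; exact: dnbhs0_lt.
  by apply: DeriveDef; [apply/cvg_ex; exists 0|exact: cvg_lim].
Unshelve. all: by end_near. Qed.

Lemma flat_smooth p : smooth1 (flat p).
Proof. exact: (smooth1_family flat_derive). Qed.

Lemma smooth1_comp (F G : R -> R) : smooth1 F -> smooth1 G -> smooth1 (F \o G).
Proof. by move=> hF hG k; apply: (@Sk_comp1 1 k setT F _ openT hF); exact: hG. Qed.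

Lemma step_exists : exists th : R -> R, [/\ smooth1 th,
  forall x, 0 <= th x <= 1, forall x, x <= 0 -> th x = 1 & forall x, 1 <= x -> th x = 0].
Proof.
pose E := flat 1.
have Ege0 x : 0 <= E x by rewrite /E /flat; case: ifP => // _; rewrite hornerE mul1r expR_ge0.
have E1 : 0 < E 1 by rewrite /E /flat ltr01 hornerE mul1r expR_gt0.
have Emono x y : x <= y -> E x <= E y.
  rewrite /E /flat => xy; case: ifPn => x0; last exact: Ege0.
  rewrite (lt_le_trans x0 xy) !hornerC !mul1r ler_expR lerN2 lef_pV2 ?posrE //.
  exact: lt_le_trans xy.
(* Nesting [E] in itself avoids a quotient of functions: the inner argument is 1 for x <= 0 and
   nonpositive for x >= 1. *)
exists (fun x => (E 1)^-1 * E (1 - (E 1)^-1 * E x)); split.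
- have aff (a b : R) : smooth1 (fun x => a + b * x).
    move=> k; apply: SkD; [exact: openT|exact: Sk_cst openT|].
    by apply: SkM; [exact: openT|exact: Sk_cst openT|exact: Sk_coord openT].
  have -> : (fun x => (E 1)^-1 * E (1 - (E 1)^-1 * E x)) =
      (fun x => 0 + (E 1)^-1 * x) \o (E \o ((fun x => 1 + (- (E 1)^-1) * x) \o E)).
    by apply/funext => x /=; rewrite add0r mulNr.
  by do ! apply: smooth1_comp => //; exact: flat_smooth.
- move=> x; rewrite mulr_ge0 ?invr_ge0 ?(ltW E1) //=.
  rewrite mulrC ler_pdivrMr // mul1r; apply: Emono.
  by rewrite gerBl mulr_ge0 // invr_ge0 ltW.
- move=> x x0; rewrite (_ : E x = 0) ?mulr0 ?subr0 ?mulVf ?gt_eqF //.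
  by rewrite /E /flat ltNge x0.
- move=> x x1; rewrite (_ : E (1 - _) = 0) ?mulr0 //.
  rewrite /E {1}/flat ifN // -leNgt subr_le0 mulrC ler_pdivlMr // mul1r.
  exact: Emono.
Qed.

Definition Sinf n (O : set 'rV[R]_n) f := forall k, Sk k O f.

Lemma bump_exists n (v0 : 'rV[R]_n) (r : R) : 0 < r -> exists chi : 'rV[R]_n -> R,
  [/\ Sinf setT chi, forall v, 0 <= chi v <= 1,
      forall v, r <= `|v - v0| -> chi v = 0 &
      exists2 s : R, 0 < s & forall v, `|v - v0| < s -> chi v = 1].
Proof.
move=> r0; have [th [sth th01 th1 th0]] := step_exists.
(* The maximum norm is not smooth. The sum of squares is, it dominates the square of the norm, and
   it is at most n times the norm where the norm is at most 1. *)
pose q (v : 'rV[R]_n) := \sum_i (v 0 i - v0 0 i) ^+ 2.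
have b0 : 0 < r ^+ 2 / 2 by rewrite divr_gt0 // exprn_gt0.
exists (fun v => th ((r ^+ 2 / 2)^-1 * q v - 1)); split=> //.
- move=> k; apply: (Sk_comp1 openT sth); apply: SkD; [exact: openT| |exact: Sk_cst openT].
  apply: SkM; [exact: openT|exact: Sk_cst openT|].
  apply: Sk_sum; first exact: openT.
  move=> i; have S : Sk k setT (fun v : 'rV[R]_n => v 0 i - v0 0 i).
    by apply: SkD; [exact: openT|exact: Sk_coord openT|exact: Sk_cst openT].
  by apply: SkM => //; exact: openT.
- move=> v rv; apply: th0; rewrite lerBrDr -[1 + 1]/(2%:R) mulrC ler_pdivlMr //.
  rewrite mulrCA divff // mulr1; have [n0|n0] := eqVneq `|v - v0| 0.
    by move: rv; rewrite n0 leNgt r0.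
  have [i Hi] := mx_norm_neq0 n0; rewrite {}/q (bigD1 i.2) //=.
  apply: (@le_trans _ _ ((v 0 i.2 - v0 0 i.2) ^+ 2)); last by rewrite lerDl sumr_ge0 // => *; exact: sqr_ge0.
  rewrite -[leRHS]real_normK ?num_real //; apply: lerXn2r; rewrite ?nnegrE ?(ltW r0) //.
  apply: le_trans rv _; rewrite [leLHS]Hi; case: i {Hi} => i1 i2; rewrite (ord1 i1) /=.
  by rewrite !mxE.
- have n1 : 0 < (n.+1%:R : R) by [].
  exists (Num.min 1 (r ^+ 2 / 2 / n.+1%:R)); first by rewrite lt_min ltr01 divr_gt0.
  move=> v; rewrite lt_min => /andP[v1 vr]; apply: th1.
  rewrite subr_le0 mulrC ler_pdivrMr // [leRHS]mul1r.
  apply: (@le_trans _ _ (\sum_(i < n) `|v - v0|)); last first.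
    rewrite sumr_const card_ord -[leLHS]mulr_natl.
    apply: (@le_trans _ _ (n.+1%:R * `|v - v0|)); first by rewrite ler_wpM2r // ler_nat.
    by rewrite mulrC -ler_pdivlMr // ltW.
  apply: ler_sum => i _; rewrite -real_normK ?num_real //.
  have H := norm_coord (v - v0) 0 i; rewrite !mxE in H.
  apply: le_trans H; rewrite expr2 ler_piMl // (le_trans _ (ltW v1)) //.
  by have := norm_coord (v - v0) 0 i; rewrite !mxE.
Qed.

End Bump.

(** * Calculus of smooth vector-valued maps and their Jacobians *)

Section CinftyCalculus.
Context {R : realType}.
Local Notation e_ i := (delta_mx 0 i).

Lemma Cinfty_rowP n m (O : set 'rV[R]_n) (g : 'rV[R]_n -> 'rV[R]_m) : open O ->
  Cinfty O g <-> forall j, Sinf O (fun x => g x 0 j).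
Proof.
move=> oO; split=> [H j k|H k]; first by have /(CkP _ _ oO)/(_ j) := H k.
by apply/CkP => // j; exact: H.
Qed.

Lemma Sinf_sub n (O O' : set 'rV[R]_n) f : O' `<=` O -> Sinf O f -> Sinf O' f.
Proof. by move=> sO H k; exact: Sk_sub (H k). Qed.

Lemma Sinf_ext n (O : set 'rV[R]_n) f g : open O -> (forall x, O x -> f x = g x) ->
  Sinf O f -> Sinf O g.
Proof. by move=> oO fg H k; exact: Sk_ext (H k). Qed.

Lemma Sinf_cst n (O : set 'rV[R]_n) (c : R) : open O -> Sinf O (fun=> c).
Proof. by move=> oO k; exact: Sk_cst. Qed.

Lemma SinfD n (O : set 'rV[R]_n) f g : open O -> Sinf O f -> Sinf O g ->
  Sinf O (fun x => f x + g x).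
Proof. by move=> oO hf hg k; apply: SkD. Qed.

Lemma SinfM n (O : set 'rV[R]_n) f g : open O -> Sinf O f -> Sinf O g ->
  Sinf O (fun x => f x * g x).
Proof. by move=> oO hf hg k; apply: SkM. Qed.

Lemma Sinf_sum n (O : set 'rV[R]_n) (I : Type) (s : seq I) (f : I -> 'rV[R]_n -> R) :
  open O -> (forall i, Sinf O (f i)) -> Sinf O (fun x => \sum_(i <- s) f i x).
Proof. by move=> oO hf k; apply: Sk_sum => // i; exact: hf. Qed.

Section Vectors.
Context {n : nat} (O : set 'rV[R]_n) (oO : open O).

Lemma Cinfty_sub m (O' : set 'rV[R]_n) (g : 'rV[R]_n -> 'rV[R]_m) : open O' -> O' `<=` O ->
  Cinfty O g -> Cinfty O' g.
Proof.
by move=> oO' sO /Cinfty_rowP H; apply/Cinfty_rowP => // j; exact: Sinf_sub (H oO j).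
Qed.

Lemma Cinfty_cst m (c : 'rV[R]_m) : Cinfty O (fun=> c).
Proof. by apply/Cinfty_rowP => // j; exact: Sinf_cst. Qed.

Lemma CinftyD m (f g : 'rV[R]_n -> 'rV[R]_m) : Cinfty O f -> Cinfty O g ->
  Cinfty O (fun x => f x + g x).
Proof.
move=> /Cinfty_rowP hf /Cinfty_rowP hg; apply/Cinfty_rowP => // j.
by apply: Sinf_ext (SinfD oO (hf oO j) (hg oO j)) => // x _; rewrite mxE.
Qed.

Lemma Cinfty_id : Cinfty O id.
Proof. by apply/Cinfty_rowP => // j k; exact: Sk_coord. Qed.

Lemma Cinfty_mulmx m p (g : 'rV[R]_n -> 'rV[R]_m) (A : 'M[R]_(m, p)) : Cinfty O g ->
  Cinfty O (fun x => g x *m A).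
Proof.
move=> /Cinfty_rowP hg; apply/Cinfty_rowP => // j.
have S : Sinf O (fun x => \sum_i g x 0 i * A i j).
  by apply: Sinf_sum => // i; apply: SinfM => //; [exact: hg|exact: Sinf_cst].
by apply: Sinf_ext S => // x _; rewrite mxE.
Qed.

Lemma Cinfty_scale m (f : 'rV[R]_n -> R) (g : 'rV[R]_n -> 'rV[R]_m) : Sinf O f ->
  Cinfty O g -> Cinfty O (fun x => f x *: g x).
Proof.
move=> hf /Cinfty_rowP hg; apply/Cinfty_rowP => // j.
by apply: Sinf_ext (SinfM oO hf (hg oO j)) => // x _; rewrite mxE.
Qed.

Lemma Sinf_comp m (O' : set 'rV[R]_m) (f : 'rV[R]_m -> R) (g : 'rV[R]_n -> 'rV[R]_m) :
  open O' -> (forall x, O x -> O' (g x)) -> Sinf O' f -> Cinfty O g ->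
  Sinf O (fun x => f (g x)).
Proof.
move=> oO' gO hf hg k; apply: (Sk_comp oO oO' gO (hf k)).
by apply/CkP => //; exact: hg.
Qed.

Lemma Cinfty_comp m p (O' : set 'rV[R]_m) (f : 'rV[R]_m -> 'rV[R]_p)
    (g : 'rV[R]_n -> 'rV[R]_m) :
  open O' -> (forall x, O x -> O' (g x)) -> Cinfty O' f -> Cinfty O g ->
  Cinfty O (fun x => f (g x)).
Proof.
move=> oO' gO /Cinfty_rowP hf hg; apply/Cinfty_rowP => // j.
exact: Sinf_comp oO' gO (hf oO' j) hg.
Qed.

Lemma Cinfty_cont m (g : 'rV[R]_n -> 'rV[R]_m) x : O x -> Cinfty O g ->
  {for x, continuous g}.
Proof. by move=> Ox /(_ 0%N)[c _]; exact: c. Qed.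

Lemma approx1_jac m (g : 'rV[R]_n -> 'rV[R]_m) x : O x -> Cinfty O g ->
  approx1 g x (mulmxr (jac g x)).
Proof.
by move=> Ox hg; apply: (Sv1_approx1 oO Ox); apply/CkP => //; exact: hg.
Qed.

Lemma jac_unique m (g : 'rV[R]_n -> 'rV[R]_m) x (J : 'M[R]_(n, m)) : O x -> Cinfty O g ->
  approx1 g x (mulmxr J) -> jac g x = J.
Proof. by move=> Ox hg; apply: approx1_unique; exact: approx1_jac. Qed.

End Vectors.

Lemma jacD n m (f g : 'rV[R]_n -> 'rV[R]_m) (O : set 'rV[R]_n) x : open O -> O x ->
  Cinfty O f -> Cinfty O g -> jac (fun y => f y + g y) x = jac f x + jac g x.
Proof.
move=> oO Ox hf hg; apply: (jac_unique oO Ox (CinftyD oO hf hg)).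
move=> eps e0; have e2 : 0 < eps / 2 by rewrite divr_gt0.
have [r r0 rP] := approx1_jac oO Ox hf e2; have [s s0 sP] := approx1_jac oO Ox hg e2.
exists (Num.min r s); first by rewrite lt_min r0.
move=> y; rewrite lt_min => /andP[/rP h1 /sP h2].
have -> : f y + g y - (f x + g x) - mulmxr (jac f x + jac g x) (y - x) =
    (f y - f x - mulmxr (jac f x) (y - x)) + (g y - g x - mulmxr (jac g x) (y - x)).
  by rewrite /= mulmxDr !opprD !addrA; congr (_ - _); rewrite -!addrA; congr (_ + _);
     rewrite addrC -!addrA; congr (_ + _); rewrite addrC addrA.
apply: le_trans (ler_normD _ _) _; rewrite [leRHS](_ : _ = eps / 2 * `|y - x| + eps / 2 * `|y - x|).
  exact: (lerD h1 h2).
by rewrite -mulrDl -splitr.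
Qed.

Lemma jac_comp n m p (f : 'rV[R]_m -> 'rV[R]_p) (g : 'rV[R]_n -> 'rV[R]_m)
    (O : set 'rV[R]_n) (O' : set 'rV[R]_m) x : open O -> open O' -> O x ->
  (forall y, O y -> O' (g y)) -> Cinfty O' f -> Cinfty O g ->
  jac (fun y => f (g y)) x = jac g x *m jac f (g x).
Proof.
move=> oO oO' Ox gO hf hg.
apply: (jac_unique oO Ox (Cinfty_comp oO oO' gO hf hg)).
exact: approx1_comp_row (approx1_jac oO Ox hg) (approx1_jac oO' (gO _ Ox) hf).
Qed.

Lemma jac_affine n m (A : 'M[R]_(n, m)) (c : 'rV[R]_m) x :
  jac (fun y => y *m A + c) x = A.
Proof.
apply: (@jac_unique n setT openT _ _ x) => //.
  exact: (CinftyD openT (Cinfty_mulmx openT A (Cinfty_id openT)) (Cinfty_cst openT c)).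
move=> eps e0; exists 1 => // y _.
rewrite /= mulmxBl opprD addrACA subrr addr0 subrr normr0 mulr_ge0 //.
exact: ltW.
Qed.

Lemma jac_mulmx n m p (g : 'rV[R]_n -> 'rV[R]_m) (A : 'M[R]_(m, p)) (O : set 'rV[R]_n) x :
  open O -> O x -> Cinfty O g -> jac (fun y => g y *m A) x = jac g x *m A.
Proof.
move=> oO Ox hg.
have cA : Cinfty setT (fun y : 'rV[R]_m => y *m A + 0).
  exact: (CinftyD openT (Cinfty_mulmx openT A (Cinfty_id openT)) (Cinfty_cst openT 0)).
have := @jac_comp n m p (fun y => y *m A + 0) g O setT x oO openT Ox (fun _ _ => I) cA hg.
by rewrite jac_affine => <-; congr (jac _ x); apply/funext => y; rewrite addr0.
Qed.

Lemma diff_jac n m (g : 'rV[R]_n -> 'rV[R]_m) (O : set 'rV[R]_n) x v : open O -> O x ->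
  Cinfty O g -> 'd g x v = v *m jac g x.
Proof.
move=> oO Ox hg; have A := approx1_jac oO Ox hg.
have cJ : continuous (mulmxr (jac g x) : {linear 'rV[R]_n -> 'rV[R]_m}).
  move=> y; apply: (@Cinfty_cont n setT m _ y) => //.
  by apply: Cinfty_mulmx; [exact: openT|exact: Cinfty_id openT].
rewrite (diff_unique cJ) //; apply/eqaddoP => eps e0.
have [r r0 rP] := A _ e0; apply/(norm_lt_near (0 : 'rV[R]_n)).
exists r => // y; rewrite subr0 => yr.
have := rP (y + x); rewrite addrK => /(_ yr); apply: le_trans.
by rewrite !fctE /= opprD addrA lexx.
Qed.

(** One number is both the radius and the inverse of the Lipschitz constant; shrinking it weakens
    both assertions, so several such numbers can be replaced by their minimum. *)
Lemma lip_scalar n (O : set 'rV[R]_n) (f : 'rV[R]_n -> R) x : open O -> O x -> Sinf O f ->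
  exists2 t : R, 0 < t & forall y z, `|y - x| < t -> `|z - x| < t ->
    `|f z - f y| <= t^-1 * `|z - y|.
Proof.
move=> oO Ox hf; have [r r0 rP] := Sk1_strict oO Ox (hf 1%N) ltr01.
pose L := n%:R * `|grad f x| + 1.
have L0 : 0 < L by rewrite ltr_wpDl // mulr_ge0.
exists (Num.min r L^-1); first by rewrite lt_min r0 invr_gt0.
move=> y z; rewrite !lt_min => /andP[yr _] /andP[zr _].
have H := rP y z yr zr.
apply: (@le_trans _ _ (L * `|z - y|)); last first.
  rewrite ler_wpM2r // -[leLHS]invrK lef_pV2 ?posrE ?invr_gt0 ?lt_min ?r0 ?invr_gt0 //.
  by rewrite ge_min lexx orbT.
rewrite -(subrK (((z - y) *m grad f x) 0 0) (f z - f y)).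
apply: le_trans (ler_normD _ _) _; rewrite mulrDl addrC; apply: lerD => //.
exact: norm_rowfun.
Qed.

Lemma lip_jac n m (O : set 'rV[R]_n) (g : 'rV[R]_n -> 'rV[R]_m) x : open O -> O x ->
  Cinfty O g -> exists2 t : R, 0 < t & forall y z, `|y - x| < t -> `|z - x| < t ->
    [/\ O y, `|g z - g y| <= t^-1 * `|z - y| & `|jac g z - jac g y| <= t^-1 * `|z - y| ].
Proof.
move=> oO Ox /Cinfty_rowP hg.
have W (f : 'rV[R]_n -> R) (r s : R) : 0 < s -> s <= r -> (forall y z, `|y - x| < r -> `|z - x| < r ->
      `|f z - f y| <= r^-1 * `|z - y|) ->
    forall y z, `|y - x| < s -> `|z - x| < s -> `|f z - f y| <= s^-1 * `|z - y|.
  move=> s0 sr H y z ys zs; apply: le_trans (H y z (lt_le_trans ys sr) (lt_le_trans zs sr)) _.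
  by rewrite ler_wpM2r // lef_pV2 ?posrE // (lt_le_trans s0).
have [r r0 rP] := open_ball_rV oO Ox.
have [|j t1 t2 le H|t1 t10 t1P] := @fin_radius R 'I_m (fun j t => 0 < t -> forall y z,
    `|y - x| < t -> `|z - x| < t -> `|g z 0 j - g y 0 j| <= t^-1 * `|z - y|).
- move=> j; have [t t0 tP] := lip_scalar oO Ox (hg oO j); exists t => // _; exact: tP.
- by move=> t20; apply: (W (fun y => g y 0 j) t1) => //; apply: H; exact: lt_le_trans le.
have [|ij u1 u2 le H|t2 t20 t2P] := @fin_radius R ('I_n * 'I_m)%type (fun ij t => 0 < t -> forall y z,
    `|y - x| < t -> `|z - x| < t -> `|jac g z ij.1 ij.2 - jac g y ij.1 ij.2| <= t^-1 * `|z - y|).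
- move=> [i j]; have S : Sinf O (fun y => 'D_(e_ i) (fun y => g y 0 j) y).
    by move=> k; have [_ /(_ i)[]] := hg oO j k.+1.
  have [t t0 tP] := lip_scalar oO Ox S; exists t => // _ y z /tP H /H.
  by rewrite !mxE.
- by move=> u20; apply: (W (fun y => jac g y ij.1 ij.2) u1) => //; apply: H; exact: lt_le_trans le.
exists (Num.min r (Num.min t1 t2)); first by rewrite !lt_min r0 t10.
set t := Num.min _ _; have tt : 0 < t by rewrite !lt_min r0 t10.
have [tr tt1 tt2] : [/\ t <= r, t <= t1 & t <= t2].
  by rewrite /t !ge_min !lexx !orbT.
move=> y z yt zt; split; first by apply: rP; exact: lt_le_trans tr.
  apply: norm_leP => [|i j]; first by rewrite mulr_ge0 // invr_ge0 ltW.
  rewrite (ord1 i) !mxE.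
  exact: (W (fun y => g y 0 j) t1 t tt tt1 (t1P j t10)).
apply: norm_leP => [|i j]; first by rewrite mulr_ge0 // invr_ge0 ltW.
rewrite [X in `|X|]mxE [X in _ + X]mxE.
exact: (W (fun y => jac g y i j) t2 t tt tt2 (t2P (i, j) t20)).
Qed.

End CinftyCalculus.

(** * Transversality for a generic affine perturbation *)

Section EasyTransversality.
Context {R : realType}.

(** Take a nonzero column killed by J and divide by its entry of largest absolute value. The
    position [i] of that entry is one of finitely many, which is what allows it to be part of a code
    later. *)
Lemma not_row_full n m (J : 'M[R]_(n, m)) : ~~ row_full J ->
  exists i (l : 'cV[R]_m), [/\ l i 0 = 1, forall j, `|l j 0| <= 1 & J *m l = 0].
Proof.
rewrite -cokermx_eq0 => /matrix0Pn[a [b ab]].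
pose c := col b (cokermx J).
have Jc : J *m c = 0.
  apply/colP => k; have /matrixP/(_ k b) := mulmx_coker J; rewrite !mxE => E.
  by rewrite -[RHS]E; apply: eq_bigr => j _; rewrite mxE.
have [i _ ci] := @arg_maxP _ R _ a xpredT (fun j => `|c j 0|) isT.
have c0 : c i 0 != 0.
  rewrite -normr_gt0; apply: lt_le_trans (ci a isT).
  by rewrite normr_gt0 mxE.
exists i, ((c i 0)^-1 *: c); split.
- by rewrite mxE mulVf.
- move=> j; rewrite mxE normrM normfV ler_pdivrMl ?normr_gt0 // mulr1.
  exact: ci.
- by rewrite -scalemxAr Jc scaler0.
Qed.

Lemma natr_dist_lt1 (a b : nat) : `|a%:R - b%:R : R| < 1 -> a = b.
Proof.
rewrite ltr_norml => /andP[h1 h2]; apply/eqP; rewrite eqn_leq.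
have S (c d : nat) : c%:R - d%:R < (1 : R) -> (c <= d)%N.
  by move=> cd; rewrite -ltnS -(@ltr_nat R) -natr1; lra.
by rewrite !S //; lra.
Qed.

(** Index of the subinterval of length 1/K containing u in [0,1]; the endpoint u = 1 accounts for
    the value K. *)
Definition digit (K : nat) (u : R) : 'I_K.+1 := inord (Num.truncn (u * K%:R)).

Lemma digit_inj K (u v : R) : (0 < K)%N -> 0 <= u <= 1 -> 0 <= v <= 1 ->
  digit K u = digit K v -> `|u - v| <= K%:R^-1.
Proof.
move=> K0 /andP[u0 u1] /andP[v0 v1] /(congr1 val) /=.
have K1 : 0 < (K%:R : R) by rewrite ltr0n.
have B (w : R) : 0 <= w -> w <= 1 -> (Num.truncn (w * K%:R) < K.+1)%N.
  move=> w0 w1; rewrite ltnS -(@ler_nat R); apply: (@le_trans _ _ (w * K%:R)).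
    by have /truncn_itv/andP[] : 0 <= w * K%:R by rewrite mulr_ge0.
  by rewrite ger_pMl.
rewrite !inordK ?B // => E.
have /andP[a1 a2] : (Num.truncn (u * K%:R))%:R <= u * K%:R < (Num.truncn (u * K%:R)).+1%:R.
  by apply: truncn_itv; rewrite mulr_ge0.
have /andP[b1 b2] : (Num.truncn (v * K%:R))%:R <= v * K%:R < (Num.truncn (v * K%:R)).+1%:R.
  by apply: truncn_itv; rewrite mulr_ge0.
rewrite -(ler_pM2r K1) mulVf ?gt_eqF // -{1}(gtr0_norm K1) -normrM mulrBl.
rewrite -E in b1 b2; rewrite -natr1 in a2 b2.
by rewrite ler_norml; apply/andP; split; lra.
Qed.

(* Transversality of [g + b + h A] to 0 fails at y iff it vanishes there and a
   covector l annihilates its derivative; normalize [l i = 1], [|l| <= 1].  The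
   two equations determine column i of A, then b, by the remaining data. *)
Lemma bad_lipschitz n m (x : 'rV[R]_n) (r La P : R) (g : 'rV[R]_n -> 'rV[R]_m)
    (h : 'rV[R]_n -> 'rV[R]_n) (jg : 'rV[R]_n -> 'M[R]_(n, m)) (jh : 'rV[R]_n -> 'M[R]_n) :
  0 <= La -> 0 <= P ->
  (forall y z, `|y - x| < r -> `|z - x| < r -> [/\ `|g z - g y| <= La * `|z - y|,
     `|h z - h y| <= La * `|z - y|, `|jg z - jg y| <= La * `|z - y| &
     `|jh z - jh y| <= La * `|z - y| ]) ->
  (forall y, `|y - x| < r -> [/\ `|h y| <= La, `|jg y| <= La, `|jh y| <= La &
     forall w : 'cV[R]_n, `|w| <= 2 * `|jh y *m w| ]) ->
  exists C, 0 < C /\ forall (A A' : 'M[R]_(n, m)) (b b' : 'rV[R]_m) y y' (l l' : 'cV[R]_m) i (tau : R),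
    [/\ `|A| <= P, `|A'| <= P, `|y - x| < r & `|y' - x| < r] ->
    [/\ l i 0 = 1, l' i 0 = 1, `|l| <= 1 & `|l'| <= 1] ->
    (forall a j, j != i -> A a j = A' a j) ->
    g y + (b + h y *m A) = 0 -> g y' + (b' + h y' *m A') = 0 ->
    (jg y + jh y *m A) *m l = 0 -> (jg y' + jh y' *m A') *m l' = 0 ->
    `|y - y'| <= tau -> `|l - l'| <= tau ->
    `|A - A'| <= C * tau /\ (A = A' -> `|b - b'| <= C * tau).
Proof.
move=> La0 P0 lip bd.
pose C1 := 2 * (m%:R * La + m%:R * La + n%:R * La * (m%:R * P)) + m%:R * P.
pose C2 := La + n%:R * La * P.
have C10 : 0 <= C1 by rewrite /C1 addr_ge0 ?mulr_ge0 // ?addr_ge0 ?mulr_ge0.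
have C20 : 0 <= C2 by rewrite /C2 addr_ge0 ?mulr_ge0.
exists (C1 + C2 + 1); split; first by rewrite ltr_wpDl // addr_ge0.
move=> A A' b b' y y' l l' i tau [AP AP' yr yr'] [li li' l1 l1'] AA e1 e2 e3 e4 yt lt.
have t0 : 0 <= tau by apply: le_trans yt.
have [lg lh ljg ljh] := lip y' y yr' yr.
have [bh bjg bjh inv] := bd y yr; have [bh' bjg' bjh' _] := bd y' yr'.
split.
  (* The difference of the two derivative equations bounds [jh y *m w], and [w] itself is bounded
     because [jh y] contracts at most by the factor 2. *)
  pose w := A *m l - A' *m l'.
  have ew : jh y *m w = - ((jg y - jg y') *m l + jg y' *m (l - l')) + (jh y' - jh y) *m (A' *m l').
    rewrite /w; move: e3 e4; rewrite !mulmxDl => /addr0_eq e3 /addr0_eq e4.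
    rewrite !(mulmxDl, mulmxDr, mulNmx, mulmxN) !mulmxA -e3 -e4.
    move: (jg y *m l) (jg y' *m l) (jg y' *m l') (jh y *m A' *m l') => a1 a2 a3 a4.
    by apply/matrixP => ? ?; rewrite !mxE; ring.
  have nw : `|w| <= 2 * (m%:R * La + m%:R * La + n%:R * La * (m%:R * P)) * tau.
    apply: le_trans (inv w) _; rewrite -mulrA ler_wpM2l // ew.
    apply: le_trans (ler_normD _ _) _; rewrite normrN mulrDl; apply: lerD.
      apply: le_trans (ler_normD _ _) _; rewrite mulrDl; apply: lerD.
        apply: le_trans (norm_mulmx _ _) _; rewrite -mulrA.
        rewrite -[leRHS]mulrA ler_wpM2l //.
        apply: le_trans (ler_pM _ _ ljg l1) _; rewrite ?mulr_ge0 // mulr1.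
        by rewrite ler_wpM2l.
      apply: le_trans (norm_mulmx _ _) _; rewrite -mulrA -[leRHS]mulrA ler_wpM2l //.
      exact: ler_pM.
    apply: le_trans (norm_mulmx _ _) _.
    have nA : `|A' *m l'| <= m%:R * P.
      apply: le_trans (norm_mulmx _ _) _; rewrite -mulrA ler_wpM2l //.
      by rewrite -[leRHS]mulr1; exact: ler_pM.
    rewrite [leRHS]mulrAC; apply: ler_pM; rewrite ?mulr_ge0 //.
    rewrite -!mulrA ler_wpM2l // distrC.
    by apply: le_trans ljh _; rewrite ler_wpM2l.
  (* As [A] and [A'] agree off the column i and [l' i = 1], the product [(A - A') *m l'] is exactly
     the difference of the columns i. *)
  have cA : forall a, (A - A') a i = (w - A *m (l - l')) a 0.
    move=> a; have -> : w - A *m (l - l') = (A - A') *m l'.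
      rewrite /w mulmxBr mulmxBl.
      move: (A *m l) (A' *m l') (A *m l') => a1 a2 a3.
      by apply/matrixP => ? ?; rewrite !mxE; ring.
    rewrite [RHS]mxE (bigD1 i) //= big1 ?addr0 ?li' ?mulr1 // => j ji.
    by rewrite !mxE (AA a j ji) subrr mul0r.
  apply: norm_leP => [|a j].
    by rewrite mulr_ge0 // addr_ge0 // addr_ge0.
  have [->|ji] := eqVneq j i; last by rewrite !mxE (AA a j ji) subrr normr0 mulr_ge0 // addr_ge0 // addr_ge0.
  rewrite cA; apply: le_trans (norm_coord _ _ _) _.
  apply: (@le_trans _ _ (C1 * tau)); last by rewrite ler_wpM2r // -addrA lerDl addr_ge0.
  apply: le_trans (ler_normB _ _) _; rewrite mulrDl; apply: lerD => //.
  by apply: le_trans (norm_mulmx _ _) _; apply: ler_pM; rewrite ?mulr_ge0 // ler_wpM2l.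
move=> EA; subst A'.
have -> : b - b' = (g y' - g y) + (h y' - h y) *m A.
  have -> : b = - g y - h y *m A by rewrite -[LHS]addr0 -oppr0 -e1; move: (h y *m A) => c; apply/matrixP => ? ?; rewrite !mxE; ring.
  have -> : b' = - g y' - h y' *m A by rewrite -[LHS]addr0 -oppr0 -e2; move: (h y' *m A) => c; apply/matrixP => ? ?; rewrite !mxE; ring.
  by rewrite mulmxBl; move: (h y *m A) (h y' *m A) => c c'; apply/matrixP => ? ?; rewrite !mxE; ring.
rewrite distrC in lg; rewrite distrC in lh.
apply: (@le_trans _ _ (C2 * tau)); last by rewrite ler_wpM2r // [C1 + _]addrC -addrA lerDl addr_ge0.
apply: le_trans (ler_normD _ _) _; rewrite mulrDl; apply: lerD.
  by apply: le_trans lg _; rewrite ler_wpM2l.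
apply: le_trans (norm_mulmx _ _) _; rewrite [leRHS]mulrAC; apply: ler_pM; rewrite ?mulr_ge0 //.
rewrite -!mulrA ler_wpM2l //.
by apply: le_trans lh _; rewrite ler_wpM2l.
Qed.

Lemma leq_expl a b k : (a <= b)%N -> (a ^ k <= b ^ k)%N.
Proof. by move=> ab; case: k => // k; rewrite leq_exp2r. Qed.

(** On the left: choices of i, digits of the point, digits of the covector other than its entry i,
    and the entries of A off the column i. Only n' + m' + n' m' factors M occur, one fewer than
    there are parameters, so a large M wins over the constants. *)
Lemma card_code m n' m' c M : (m * c ^ (n' + m') < M)%N ->
  (m * ((c * M) ^ n' * ((c * M) ^ m' * M ^ (n' * m'))) < M ^ ((1 + n') * (1 + m')))%N.
Proof.
move=> H; have M0 : (0 < M)%N by apply: leq_ltn_trans H.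
have -> : ((1 + n') * (1 + m') = (n' + m' + n' * m').+1)%N by ring.
have -> : (m * ((c * M) ^ n' * ((c * M) ^ m' * M ^ (n' * m'))) =
    (m * c ^ (n' + m')) * M ^ (n' + m' + n' * m'))%N.
  by rewrite !expnMn !expnD; ring.
by rewrite expnS ltn_pmul2r // expn_gt0 M0.
Qed.

(** [p] stacks the row b on top of the matrix A, so that [row_mx 1 (h y) *m p] is b + h(y) A and the
    derivative involves A alone. *)
Definition good_at n m (g : 'rV[R]_n -> 'rV[R]_m) (h : 'rV[R]_n -> 'rV[R]_n)
    (p : 'M[R]_(1 + n, m)) (y : 'rV[R]_n) :=
  g y + row_mx 1%:M (h y) *m p = 0 -> row_full (jac g y + jac h y *m dsubmx p)%R.

(* Pigeonhole on a grid of parameters: a bad parameter is determined, up to an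
   error proportional to the mesh, by one digit less than it has entries. *)
Lemma dense_good n m (O : set 'rV[R]_n) (g : 'rV[R]_n -> 'rV[R]_m)
    (h : 'rV[R]_n -> 'rV[R]_n) x : open O -> O x -> Cinfty O g -> Cinfty O h ->
  (forall y, O y -> forall w : 'cV[R]_n, `|w| <= 2 * `|jac h y *m w|) ->
  exists2 r : R, 0 < r & (forall y, `|y - x| < r -> O y) /\
    forall (p0 : 'M[R]_(1 + n, m)) (rho : R), 0 < rho ->
    exists2 p, `|p - p0| < rho & forall y, `|y - x| < r -> good_at g h p y.
Proof.
case: m g => [|m] g oO Ox hg hh inv.
  have [r r0 rP] := open_ball_rV oO Ox; exists r => //; split=> // p0 rho rho0.
  exists p0 => [|y _ _]; first by rewrite subrr normr0.
  by rewrite /row_full -leqn0 rank_leq_col.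
have [t t0 tP] := lip_jac oO Ox hg; have [u u0 uP] := lip_jac oO Ox hh.
pose r := Num.min t u; have r0 : 0 < r by rewrite lt_min t0.
pose L0 := t^-1 + u^-1.
have L00 : 0 <= L0 by rewrite addr_ge0 // invr_ge0 ltW.
pose La := L0 + L0 * r + `|h x| + `|jac g x| + `|jac h x|.
have L0r : 0 <= L0 * r by rewrite mulr_ge0 // ltW.
have [nh ngx nhx] : [/\ 0 <= `|h x|, 0 <= `|jac g x| & 0 <= `|jac h x| ] by [].
have La0 : 0 <= La by rewrite /La; lra.
have LL : L0 <= La by rewrite /La; lra.
exists r => //.
have rO y : `|y - x| < r -> O y.
  by rewrite lt_min => /andP[yt _]; have [] := tP y y yt yt.
split=> // p0 rho rho0; apply: contrapT => /forall2NP Hbad.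
pose P := `|p0| + rho.
have P0 : 0 <= P by rewrite addr_ge0 // ltW.
have lip0 y z : `|y - x| < r -> `|z - x| < r -> [/\ `|g z - g y| <= L0 * `|z - y|,
     `|h z - h y| <= L0 * `|z - y|, `|jac g z - jac g y| <= L0 * `|z - y| &
     `|jac h z - jac h y| <= L0 * `|z - y| ].
  rewrite !lt_min => /andP[yt yu] /andP[zt zu].
  have [_ h1 h2] := tP y z yt zt; have [_ h3 h4] := uP y z yu zu.
  have T : t^-1 * `|z - y| <= L0 * `|z - y| by rewrite ler_wpM2r // lerDl invr_ge0 ltW.
  have U : u^-1 * `|z - y| <= L0 * `|z - y| by rewrite ler_wpM2r // lerDr invr_ge0 ltW.
  by split; [exact: le_trans h1 T|exact: le_trans h3 U|exact: le_trans h2 T|exact: le_trans h4 U].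
have [||C [C0 CP]] := @bad_lipschitz n m.+1 x r La P g h (jac g) (jac h) La0 P0.
- move=> y z yr zr; have [h1 h2 h3 h4] := lip0 y z yr zr.
  have W : L0 * `|z - y| <= La * `|z - y| by rewrite ler_wpM2r.
  by split; apply: le_trans W.
- move=> y yr; have xr : `|x - x| < r by rewrite subrr normr0.
  have [_ h2 h3 h4] := lip0 x y xr yr.
  have W : L0 * `|y - x| <= L0 * r by rewrite ler_wpM2l // ltW.
  have N m1 m2 (a b : 'M[R]_(m1, m2)) (c d : R) : `|a - b| <= c -> c <= d -> `|a| <= d + `|b|.
    move=> ab cd; rewrite -{1}(subrK b a); apply: le_trans (ler_normD _ _) _.
    by rewrite lerD2r (le_trans ab).
  split; last exact: inv (rO _ yr).
  + apply: le_trans (N _ _ _ _ _ _ h2 W) _; rewrite /La.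
    by have := normr_ge0 (jac g x); have := normr_ge0 (jac h x); lra.
  + apply: le_trans (N _ _ _ _ _ _ h3 W) _; rewrite /La.
    by have := normr_ge0 (h x); have := normr_ge0 (jac h x); lra.
  + apply: le_trans (N _ _ _ _ _ _ h4 W) _; rewrite /La.
    by have := normr_ge0 (jac g x); have := normr_ge0 (h x); lra.
have K0 : 0 < 2 * C * (2 * r + 4) / rho.
  by rewrite divr_gt0 // mulr_gt0 ?mulr_gt0 // ltr_wpDl // mulr_ge0 // ltW.
(* With K = c M digits the Lipschitz error C * tau stays below the grid spacing rho/(2M), whatever M
   is. Hence M can be fixed afterwards by the count alone. *)
pose c := (Num.truncn (2 * C * (2 * r + 4) / rho)).+1.
have cP : 2 * C * (2 * r + 4) / rho < c%:R.
  by have /truncn_itv/andP[] := ltW K0.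
pose M := (m.+1 * (2 * c) ^ (n + m)).+1.
have M0 : (0 < M)%N by [].
pose K := (c * M)%N.
have K1 : (0 < K)%N by rewrite muln_gt0.
pose grid (s : {ffun 'I_(1 + n) * 'I_m.+1 -> 'I_M}) : 'M[R]_(1 + n, m.+1) :=
  p0 + \matrix_(i, j) (rho / (2 * M%:R) * (s (i, j))%:R).
have MR : 0 < (M%:R : R) by rewrite ltr0n.
have gridP s : `|grid s - p0| < rho.
  rewrite /grid addrC addKr; apply: (@le_lt_trans _ _ (rho / 2)); last first.
    by rewrite ltr_pdivrMr // ltr_pMr // ltr1n.
  apply: norm_leP => [|i j]; first by rewrite divr_ge0 // ltW.
  rewrite mxE ger0_norm ?mulr_ge0 ?divr_ge0 ?(ltW rho0) ?mulr_ge0 //.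
  rewrite invfM mulrA -mulrA ger_pMr ?divr_gt0 // ler_pdivrMl // mulr1 ler_nat.
  exact: ltnW.
have gridN s : `|grid s| <= P.
  rewrite -(subrK p0 (grid s)); apply: le_trans (ler_normD _ _) _.
  by rewrite addrC lerD2l ltW.
have bad s : exists d : 'rV[R]_n * 'I_m.+1 * 'cV[R]_m.+1,
   [/\ `|d.1.1 - x| < r, g d.1.1 + row_mx 1%:M (h d.1.1) *m grid s = 0,
      d.2 d.1.2 0 = 1, forall j, `|d.2 j 0| <= 1 &
      (jac g d.1.1 + jac h d.1.1 *m dsubmx (grid s)) *m d.2 = 0].
  have [/(_ (gridP s))//|] := Hbad (grid s).
  move=> /existsNP[y /not_implyP[yr /not_implyP[ey /negP nf]]].
  have [i [l [li l1 Jl]]] := not_row_full nf.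
  by exists (y, i, l); split.
have [D DP] := choice bad.
pose U1 s a := ((D s).1.1 0 a - x 0 a + r) / (2 * r).
pose U2 s j := ((D s).2 j 0 + 1) / 2.
(* Approximate digits of the point and of the covector, but exact grid indices of A off the column
   i; neither that column nor the row b is recorded. *)
pose code s : 'I_m.+1 * ({ffun 'I_n -> 'I_K.+1} * ({ffun 'I_m -> 'I_K.+1} * {ffun 'I_n * 'I_m -> 'I_M})) :=
  let i := (D s).1.2 in
  (i, ([ffun a => digit K (U1 s a)], ([ffun j => digit K (U2 s (lift i j))],
     [ffun aj => s (rshift 1 aj.1, lift i aj.2)]))).
have inj : injective code.
  move=> s s' E.
  have [Ei Ey El Ea] : [/\ (D s).1.2 = (D s').1.2,
      forall a, digit K (U1 s a) = digit K (U1 s' a),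
      forall j, digit K (U2 s (lift (D s).1.2 j)) = digit K (U2 s' (lift (D s').1.2 j)) &
      forall a j, s (rshift 1 a, lift (D s).1.2 j) = s' (rshift 1 a, lift (D s').1.2 j)].
    move: E => [-> /ffunP E1 /ffunP E2 /ffunP E3]; split=> // [a|j|a j].
    - by have := E1 a; rewrite !ffunE.
    - by have := E2 j; rewrite !ffunE.
    - by have := E3 (a, j); rewrite !ffunE.
  have [yr e1 li l1 e3] := DP s; have [yr' e2 li' l1' e4] := DP s'.
  rewrite -Ei in El Ea li'.
  have KR : 0 < (K%:R : R) by rewrite ltr0n.
  have U1P (q : {ffun 'I_(1 + n) * 'I_m.+1 -> 'I_M}) a : 0 <= U1 q a <= 1.
    have [qr _ _ _ _] := DP q; have := le_lt_trans (norm_coord _ 0 a) qr.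
    rewrite !mxE ltr_norml => /andP[q1 q2]; rewrite /U1 divr_ge0 ?mulr_ge0 ?(ltW r0) //=; last by clear -q1 q2; lra.
    by rewrite ler_pdivrMr ?mulr_gt0 // mul1r; clear -q1 q2; lra.
  have U2P (q : {ffun 'I_(1 + n) * 'I_m.+1 -> 'I_M}) j : 0 <= U2 q j <= 1.
    have [_ _ _ qr _] := DP q; have := qr j; rewrite ler_norml => /andP[q1 q2].
    by rewrite /U2; apply/andP; clear -q1 q2; split; lra.
  pose tau := (2 * r + 4) * K%:R^-1.
  have tau0 : 0 <= tau by rewrite mulr_ge0 ?invr_ge0 ?(ltW KR) // addr_ge0 // mulr_ge0 // ltW.
  have ty : `|(D s).1.1 - (D s').1.1| <= tau.
    apply: norm_leP => // i a; rewrite (ord1 i) !mxE.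
    have := digit_inj K1 (U1P s a) (U1P s' a) (Ey a).
    rewrite /U1 -mulrBl normrM normfV (gtr0_norm (mulr_gt0 (ltr0Sn R 1) r0)).
    rewrite ler_pdivrMr ?mulr_gt0 // => H.
    have -> : (D s).1.1 0 a - (D s').1.1 0 a =
      (D s).1.1 0 a - x 0 a + r - ((D s').1.1 0 a - x 0 a + r) by ring.
    by apply: le_trans H _; rewrite /tau mulrC ler_wpM2r ?invr_ge0 ?(ltW KR) // lerDl.
  have tl : `|(D s).2 - (D s').2| <= tau.
    apply: norm_leP => // j i; rewrite (ord1 i) !mxE.
    have [->|ji] := eqVneq j (D s).1.2; first by rewrite li li' subrr normr0.
    have [j' ->] : exists j', j = lift (D s).1.2 j'.
      by rewrite eq_sym in ji; have [j' -> _] := unlift_some ji; exists j'.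
    have := digit_inj K1 (U2P s _) (U2P s' _) (El j').
    rewrite /U2 -mulrBl normrM normfV (gtr0_norm (ltr0Sn R 1)) ler_pdivrMr // => H.
    have -> : (D s).2 (lift (D s).1.2 j') 0 - (D s').2 (lift (D s).1.2 j') 0 =
      (D s).2 (lift (D s).1.2 j') 0 + 1 - ((D s').2 (lift (D s).1.2 j') 0 + 1) by ring.
    apply: le_trans H _; rewrite /tau mulrC ler_wpM2r ?invr_ge0 ?(ltW KR) //.
    by rewrite ler_wpDl ?mulr_ge0 ?(ltW r0) // ler_nat.
  have lN (l : 'cV[R]_m.+1) : (forall j, `|l j 0| <= 1) -> `|l| <= 1.
    by move=> H; apply: norm_leP => // a j; rewrite (ord1 j).
  have rowE (q : {ffun 'I_(1 + n) * 'I_m.+1 -> 'I_M}) y : row_mx 1%:M (h y) *m grid q =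
      usubmx (grid q) + h y *m dsubmx (grid q).
    by rewrite -{1}(vsubmxK (grid q)) mul_row_col mul1mx.
  have subN (q : {ffun 'I_(1 + n) * 'I_m.+1 -> 'I_M}) : `|dsubmx (grid q)| <= P.
    apply: norm_leP => // a j; rewrite mxE; apply: le_trans (gridN q); exact: norm_coord.
  rewrite !rowE in e1 e2.
  have AA a j : j != (D s).1.2 -> dsubmx (grid s) a j = dsubmx (grid s') a j.
    rewrite eq_sym => ji; have [j' -> _] := unlift_some ji.
    by rewrite !mxE Ea.
  have [hA hb] := CP _ _ _ _ _ _ _ _ _ tau (And4 (subN s) (subN s') yr yr')
     (And4 li li' (lN _ l1) (lN _ l1')) AA e1 e2 e3 e4 ty tl.
  have mesh : C * tau < rho / (2 * M%:R).
    rewrite /tau mulrA ltr_pdivrMr // natrM mulrA.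
    rewrite ltr_pdivrMr // in cP.
    rewrite -[X in _ < X]mulrA [_ * (c%:R * _)]mulrC -mulrA.
    have -> : M%:R * (rho / (2 * M%:R)) = rho / 2 by field; rewrite gt_eqF.
    by have := cP; clear; lra.
  have dig i j (q q' : {ffun 'I_(1 + n) * 'I_m.+1 -> 'I_M}) :
      `|grid q i j - grid q' i j| <= C * tau -> q (i, j) = q' (i, j).
    rewrite !mxE opprD addrACA subrr add0r -mulrBr normrM => H.
    have S0 : 0 < rho / (2 * M%:R) by rewrite divr_gt0 // mulr_gt0.
    have := le_lt_trans H mesh; rewrite (gtr0_norm S0) gtr_pMr //.
    move: (q (i, j)) (q' (i, j)) => [a ha] [b hb'] /= ab; apply: val_inj => /=.
    exact: natr_dist_lt1 ab.
  (* [A] is recovered first, since the bound on [b] presupposes that the two matrices agree. *)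
  have EA : dsubmx (grid s) = dsubmx (grid s').
    apply/matrixP => a j; rewrite !mxE.
    have H : `|grid s (rshift 1 a) j - grid s' (rshift 1 a) j| <= C * tau.
      by apply: le_trans hA; have := norm_coord (dsubmx (grid s) - dsubmx (grid s')) a j; rewrite !mxE.
    by rewrite (dig _ _ _ _ H).
  apply/ffunP => -[i j]; apply: dig.
  case: (split_ordP i) => [i' ->|i' ->].
    apply: le_trans (hb EA).
    by have := norm_coord (usubmx (grid s) - usubmx (grid s')) i' j; rewrite !mxE.
  apply: le_trans hA.
  by have := norm_coord (dsubmx (grid s) - dsubmx (grid s')) i' j; rewrite !mxE.
have := leq_card code inj.
rewrite !card_prod !card_ffun !card_prod !card_ord leqNgt => /negP; apply.
apply: leq_ltn_trans (card_code (c := 2 * c) _); last by rewrite /M.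
have KK : (K.+1 <= 2 * c * M)%N by rewrite -mulnA mul2n -addnn -/K -addn1 leq_add2l.
by rewrite leq_pmul2l //; apply: leq_mul; [exact: leq_expl|apply: leq_mul => //; exact: leq_expl].
Qed.

End EasyTransversality.

(** * Local representatives on manifolds *)

Section LocalReps.
Context {R : realType}.
Local Notation e_ i := (delta_mx 0 i).

Lemma within_open (T T' : topologicalType) (A : set T) (f : T -> T') x (O : set T') :
  {within A, continuous f} -> A x -> open O -> O (f x) ->
  exists Q, [/\ open Q, Q x & forall y, A y -> Q y -> O (f y)].
Proof.
move=> /subspace_continuousP cf Ax oO Ofx.
have : nbhs x [set y | A y -> O (f y)] := cf x Ax O (open_nbhs_nbhs (conj oO Ofx)).
rewrite nbhsE => -[Q [oQ Qx] QO].
by exists Q; split=> // y Ay Qy; exact: QO.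
Qed.

(** One-sided room along every positive coordinate axis. It holds in half-spaces and in their
    products with an interval, and suffices to make the derivative of a smooth extension independent
    of the extension. *)
Definition fat n (D : set 'rV[R]_n) (x : 'rV[R]_n) :=
  forall i, exists2 r : R, 0 < r & forall t, 0 <= t < r -> D (x + t *: e_ i).

Lemma fat_unique n m (D O : set 'rV[R]_n) (f g : 'rV[R]_n -> 'rV[R]_m) x :
  open O -> O x -> Cinfty O f -> Cinfty O g -> D x -> fat D x ->
  (forall y, D y -> O y -> f y = g y) -> jac f x = jac g x.
Proof.
move=> oO Ox hf hg Dx fD fg; apply/row_matrixP => i; rewrite !rowE.
apply/eqP; rewrite -subr_eq0 -mulmxBr -normr_le0; apply/ler_addgt0Pr => eps e0.
rewrite add0r; have e2 : 0 < eps / 2 by rewrite divr_gt0.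
have [r r0 rP] := approx1_jac oO Ox hf e2; have [s s0 sP] := approx1_jac oO Ox hg e2.
have [t t0 tP] := fD i; have [u u0 uP] := open_ball_rV oO Ox.
pose tau := Num.min (Num.min r s) (Num.min t u) / 2.
have m0 : 0 < Num.min (Num.min r s) (Num.min t u) by rewrite !lt_min r0 s0 t0 u0.
have tau0 : 0 < tau by rewrite divr_gt0.
have : tau < Num.min (Num.min r s) (Num.min t u).
  by rewrite ltr_pdivrMr // ltr_pMr // ltr1n.
rewrite !lt_min => /andP[/andP[tr ts] /andP[tt tu]].
pose y := x + tau *: e_ i.
have ne : `|(e_ i : 'rV[R]_n)| <= 1.
  by apply: norm_leP => // a b; rewrite mxE; case: (_ && _); rewrite ?normr1 ?normr0.
have yx : y - x = tau *: e_ i by rewrite /y addrC addKr.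
have ny : `|y - x| <= tau by rewrite yx normrZ gtr0_norm // ler_piMr // ltW.
have Dy : D y by apply: tP; rewrite ltW.
have Oy : O y by apply: uP; exact: le_lt_trans ny tu.
have h1 := rP y (le_lt_trans ny tr); have h2 := sP y (le_lt_trans ny ts).
have E : tau *: (e_ i *m (jac f x - jac g x)) = (g y - g x - mulmxr (jac g x) (y - x)) -
    (f y - f x - mulmxr (jac f x) (y - x)).
  rewrite !fg // /= yx -!scalemxAl mulmxBr scalerBr.
  move: (tau *: _) (tau *: _) (g y) (g x) => a b c d.
  by apply/matrixP => ? ?; rewrite !mxE; ring.
rewrite -(ler_pM2l tau0) -{1}(gtr0_norm tau0) -normrZ E.
apply: le_trans (ler_normB _ _) _.
rewrite (_ : tau * eps = eps / 2 * tau + eps / 2 * tau); last by field.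
by apply: lerD; [apply: le_trans h2 _|apply: le_trans h1 _]; rewrite ler_wpM2l // ltW.
Qed.

Lemma open_preimage n m (O : set 'rV[R]_n) (O' : set 'rV[R]_m) (g : 'rV[R]_n -> 'rV[R]_m) :
  open O -> open O' -> (forall x, O x -> {for x, continuous g}) ->
  open [set x | O x /\ O' (g x)].
Proof.
move=> oO oO' cg; rewrite openE => x [Ox O'x]; suff : \forall y \near x, O y /\ O' (g y) by [].
near=> y; split; first by near: y; exact: near_open.
near: y; apply: (cg x Ox); exact: open_nbhs_nbhs.
Unshelve. all: by end_near. Qed.

(** [smooth_extension] for row-valued maps, without the passage through [v2r]. *)
Definition ext n m (D : set 'rV[R]_n) (f : 'rV[R]_n -> 'rV[R]_m) x (g : 'rV[R]_n -> 'rV[R]_m) :=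
  exists U, [/\ open U, U x, Cinfty U g & forall y, D y -> U y -> g y = f y].

Lemma ext_comp n m p (D : set 'rV[R]_n) (D' : set 'rV[R]_m) (f : 'rV[R]_n -> 'rV[R]_m)
    (f' : 'rV[R]_m -> 'rV[R]_p) g g' x : D x -> (forall y, D y -> D' (f y)) ->
  ext D f x g -> ext D' f' (f x) g' -> ext D (f' \o f) x (g' \o g).
Proof.
move=> Dx DD [U [oO Ox hg gf]] [U' [oO' Ox' hg' gf']].
have oP := open_preimage oO oO' (fun y Oy => Cinfty_cont Oy hg).
exists [set y | U y /\ U' (g y)]; split=> //.
- by split=> //; rewrite gf.
- apply: (Cinfty_comp oP oO') => //; first by move=> y [].
  by apply: Cinfty_sub hg => // y [].
- move=> y Dy [Oy U'y] /=; have E := gf y Dy Oy.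
  by rewrite E in U'y *; exact: gf' (DD y Dy) U'y.
Qed.

Lemma jac_ext_comp n m p (D : set 'rV[R]_n) (D' : set 'rV[R]_m) (f : 'rV[R]_n -> 'rV[R]_m)
    (f' : 'rV[R]_m -> 'rV[R]_p) g g' x : D x ->
  ext D f x g -> ext D' f' (f x) g' -> jac (g' \o g) x = jac g x *m jac g' (f x).
Proof.
move=> Dx [U [oO Ox hg gf]] [U' [oO' Ox' hg' gf']].
have oP := open_preimage oO oO' (fun y Oy => Cinfty_cont Oy hg).
have Px : [set y | U y /\ U' (g y)] x by split=> //; rewrite gf.
have hgP : Cinfty [set y | U y /\ U' (g y)] g by apply: Cinfty_sub hg => // y [].
rewrite -(gf x Dx Ox).
by apply: (jac_comp oP oO' Px _ hg' hgP) => y [].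
Qed.

Lemma ext_unique n m (D : set 'rV[R]_n) (f : 'rV[R]_n -> 'rV[R]_m) g g' x :
  D x -> fat D x -> ext D f x g -> ext D f x g' -> jac g x = jac g' x.
Proof.
move=> Dx fD [U [oO Ox hg gf]] [U' [oO' Ox' hg' gf']].
have oI : open (U `&` U') by exact: openI.
apply: (@fat_unique _ _ D (U `&` U')) => //.
- by apply: Cinfty_sub hg => // y [].
- by apply: Cinfty_sub hg' => // y [].
- by move=> y Dy [Oy U'y]; rewrite gf // gf'.
Qed.

Lemma ext_sub n m (D D' : set 'rV[R]_n) (f : 'rV[R]_n -> 'rV[R]_m) g x :
  (forall y, D' y -> D y) -> ext D f x g -> ext D' f x g.
Proof. by move=> sD [U [oO Ox hg gf]]; exists U; split=> // y /sD; exact: gf. Qed.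

Lemma extD n m (D : set 'rV[R]_n) (f f' : 'rV[R]_n -> 'rV[R]_m) g g' x :
  ext D f x g -> ext D f' x g' ->
  ext D (fun y => f y + f' y) x (fun y => g y + g' y) /\
  jac (fun y => g y + g' y) x = jac g x + jac g' x.
Proof.
move=> [U [oO Ox hg gf]] [U' [oO' Ox' hg' gf']].
have oI : open (U `&` U') by exact: openI.
have h1 : Cinfty (U `&` U') g by apply: Cinfty_sub hg => // y [].
have h2 : Cinfty (U `&` U') g' by apply: Cinfty_sub hg' => // y [].
split; last exact: (jacD oI).
exists (U `&` U'); split=> //; first exact: CinftyD.
by move=> y Dy [Oy Oy']; rewrite gf // gf'.
Qed.

Lemma ext_mulmx n m p (D : set 'rV[R]_n) (f : 'rV[R]_n -> 'rV[R]_m) g x (B : 'M[R]_(m, p)) :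
  ext D f x g -> ext D (fun y => f y *m B) x (fun y => g y *m B) /\
  jac (fun y => g y *m B) x = jac g x *m B.
Proof.
move=> [U [oO Ox hg gf]]; split; last exact: jac_mulmx oO Ox hg.
exists U; split=> //; first exact: Cinfty_mulmx.
by move=> y Dy Oy; rewrite gf.
Qed.

(** If K J0 = 1, then K J is close to 1 for J close to J0. It is then injective: a vector v in its
    kernel would satisfy |v| < |v|. *)
Lemma row_full_near n m (J0 : 'M[R]_(n, m)) : row_full J0 ->
  exists2 eps : R, 0 < eps & forall J, `|J - J0| < eps -> row_full J.
Proof.
move=> /mulVpmx; set K := pinvmx J0 => KJ.
pose c := m.+1%:R * (n.+1%:R * (`|K| + 1)) : R.
have c0 : 0 < c by rewrite !mulr_gt0 ?ltr_wpDl.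
exists c^-1; rewrite ?invr_gt0 // => J JJ.
suff H : row_full (K *m J).
  rewrite -sub1mx; apply: submx_trans (submxMl K J); by rewrite sub1mx.
have : row_free (K *m J); last by rewrite row_free_unit row_full_unit.
apply/inj_row_free => v vK; apply/eqP; rewrite -normr_le0 leNgt; apply/negP => v0.
have : `|v| < `|v|; last by rewrite ltxx.
have E : v = v *m (K *m (J0 - J)) by rewrite !mulmxBr KJ mulmx1 vK subr0.
rewrite {1}E; apply: le_lt_trans (norm_mulmx _ _) _.
apply: (@le_lt_trans _ _ (m%:R * `|v| * (n%:R * `|K| * `|J - J0|))).
  by rewrite ler_wpM2l ?mulr_ge0 // distrC; exact: norm_mulmx.
rewrite (_ : _ * (_ * _) = `|v| * (m%:R * (n%:R * `|K|) * `|J - J0|)); last by ring.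
rewrite gtr_pMr //.
apply: (@le_lt_trans _ _ (c * `|J - J0|)); last by rewrite mulrC -ltr_pdivlMr ?mul1r.
rewrite ler_wpM2r // /c; apply: ler_pM; rewrite ?mulr_ge0 ?ler_nat //.
by apply: ler_pM; rewrite ?ler_nat // lerDl.
Qed.

Lemma row_full_surjP n m (J : 'M[R]_(n, m)) :
  row_full J <-> forall w : 'rV[R]_m, exists v, w = v *m J.
Proof.
split=> [fJ w|H].
  by have /submxP[v ->] := submx_full w fJ; exists v.
by rewrite -sub1mx; apply/row_subP => i; have [v ->] := H (row i 1%:M); exact: submxMl.
Qed.

Lemma row_full_mul n m p (A : 'M[R]_(n, m)) (B : 'M[R]_(m, p)) : row_full (A *m B) -> row_full B.
Proof.
by move=> /row_full_surjP H; apply/row_full_surjP => w; have [v ->] := H w;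
   exists (v *m A); rewrite mulmxA.
Qed.

(* What local computations need of [valid_chart]; unlike the latter it passes
   to products with an interval. *)
Definition fat_chart (T : topologicalType) n (M : set T) (c : chart R T n) :=
  let V := cmap c @` cdom c in
  [/\ open_in M (cdom c),
      forall x, cdom c x -> fat V (cmap c x),
      {within cdom c, continuous (cmap c)},
      {within V, continuous (cinv c)} &
      forall x, cdom c x -> cinv c (cmap c x) = x].

Definition smooth_atlas (T : topologicalType) (M : manifold R T) :=
  [/\ forall x, carrier M x -> exists2 c, charts M c & cdom c x,
      forall c, charts M c -> fat_chart (carrier M) c &
      forall c c', charts M c -> charts M c' ->
        smooth_in (cmap c @` (cdom c `&` cdom c')) (cmap c' \o cinv c)].

Lemma norm_step n (v : 'rV[R]_n) i (t : R) : 0 <= t -> `|v + t *: e_ i - v| <= t.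
Proof.
move=> t0; rewrite addrC addKr normrZ ger0_norm // ler_piMr //.
by apply: norm_leP => // a b; rewrite mxE; case: (_ && _); rewrite ?normr1 ?normr0.
Qed.

Lemma valid_fat_chart (T : topologicalType) n (M : set T) (c : chart R T n) :
  valid_chart M c -> fat_chart M c.
Proof.
move=> [oc oV cm ci ck]; split=> // x cx i.
have Vx : (cmap c @` cdom c) (cmap c x) by exists x.
case: oV => [oV|[U oU EV]].
  have [s s0 sP] := open_ball_rV oV Vx; exists s => // t /andP[t0 ts].
  by apply: sP; exact: le_lt_trans (norm_step _ i t0) ts.
rewrite EV in Vx *; case: Vx => hx Ux.
have [s s0 sP] := open_ball_rV oU Ux; exists s => // t /andP[t0 ts].
split; last by apply: sP; exact: le_lt_trans (norm_step _ i t0) ts.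
move=> k k0; rewrite !mxE addr_ge0 ?hx // mulr_ge0 //.
Qed.

Lemma manifold_smooth_atlas (T : topologicalType) (M : manifold R T) :
  is_manifold M -> smooth_atlas M.
Proof. by move=> [_ _ h1 h2 h3]; split=> // c /h2 /valid_fat_chart. Qed.

Lemma smooth_in_row n m (D : set 'rV[R]_n) (f : 'rV[R]_n -> 'rV[R]_m) x :
  smooth_in D f -> D x -> exists g, ext D f x g.
Proof.
move=> sf Dx; have [g [U [oU Ux hg gf]]] := sf x Dx.
exists (fun y => r2v (g y)); exists U; split=> //.
  have -> : (fun y => r2v (g y) : 'rV[R]_m) = (fun y => g y *m lin1_mx r2v).
    by apply/funext => y; rewrite mul_rV_lin1.
  exact: Cinfty_mulmx.
by move=> y Dy Uy; rewrite gf // v2rK.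
Qed.

Lemma open_in_nbhd (T : topologicalType) (A D : set T) x : open_in A D -> D x ->
  exists Q, [/\ open Q, Q x & forall y, A y -> Q y -> D y].
Proof. by move=> [Q oQ ->] [Ax Qx]; exists Q; split=> // y Ay Qy. Qed.

Lemma open_inI (T : topologicalType) (A D E : set T) : open_in A D -> open_in A E ->
  open_in A (D `&` E).
Proof.
move=> [Q oQ ->] [Q' oQ' ->]; exists (Q `&` Q'); first exact: openI.
by rewrite setIACA setIid.
Qed.

Section Charts.
Context (T : topologicalType) (M : manifold R T).
Hypothesis MA : smooth_atlas M.

Lemma cdom_open c : charts M c -> open_in (carrier M) (cdom c).
Proof. by case: MA => _ + _ => /[apply] -[]. Qed.

Lemma cmapK c x : charts M c -> cdom c x -> cinv c (cmap c x) = x.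
Proof. by case: MA => _ + _ => /[apply] -[_ _ _ _]; apply. Qed.

Lemma cdom_sub c x : charts M c -> cdom c x -> carrier M x.
Proof. by move=> /cdom_open[Q _ ->] []. Qed.

Lemma chart_ball c x (Q : set T) : charts M c -> cdom c x -> open Q -> Q x ->
  exists2 r : R, 0 < r & forall y, cdom c y -> `|cmap c y - cmap c x| < r -> Q y.
Proof.
move=> hc cx oQ Qx; case: MA => _ /(_ c hc)[_ _ _ cc _] _.
have Vx : (cmap c @` cdom c) (cmap c x) by exists x.
have Qx' : Q (cinv c (cmap c x)) by rewrite cmapK.
have [U [oU Ux UQ]] := within_open cc Vx oQ Qx'.
have [r r0 rP] := open_ball_rV oU Ux; exists r => // y cy yr.
rewrite -(cmapK hc cy); apply: UQ; first by exists y.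
exact: rP.
Qed.

Lemma chart_nbhd c x (U : set 'rV[R]_(mdim M)) : charts M c -> cdom c x -> open U ->
  U (cmap c x) -> exists Q, [/\ open_in (carrier M) Q, Q x &
     forall y, Q y -> cdom c y /\ U (cmap c y)].
Proof.
move=> hc cx oU Ux; case: MA => _ /(_ c hc)[oc _ cm _ _] _.
have [Q [oQ Qx QU]] := within_open cm cx oU Ux.
exists (cdom c `&` Q); split=> //.
  have [Q' oQ' ->] := oc; exists (Q' `&` Q); first exact: openI.
  by rewrite setIA.
by move=> y [cy Qy]; split=> //; exact: QU.
Qed.

Lemma chart_fat c x (D : set T) : charts M c -> open_in (carrier M) D -> D x -> cdom c x ->
  fat (cmap c @` (cdom c `&` D)) (cmap c x).
Proof.
move=> hc oD Dx cx i.
have [Q [oQ Qx QD]] := open_in_nbhd oD Dx.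
have [r r0 rP] := chart_ball hc cx oQ Qx.
case: MA => _ /(_ c hc)[_ /(_ x cx i)[s s0 sP] _ _ _] _.
exists (Num.min r s); first by rewrite lt_min r0.
move=> t; rewrite lt_min => /and3P[t0 tr ts].
have [|y cy Ey] := sP t; first by rewrite t0.
exists y => //; split=> //; apply: QD; first exact: cdom_sub cy.
apply: rP => //; rewrite Ey; exact: le_lt_trans (norm_step _ i t0) tr.
Qed.

Lemma chart_transition c c' x : charts M c -> charts M c' -> cdom c x -> cdom c' x ->
  exists g, ext (cmap c @` (cdom c `&` cdom c')) (cmap c' \o cinv c) (cmap c x) g.
Proof.
move=> hc hc' cx cx'; case: MA => _ _ /(_ c c' hc hc') /smooth_in_row; apply.
by exists x.
Qed.

End Charts.

(** * Local representatives of sections and transversality to 0 *)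

Section Representatives.
Context {T : topologicalType} {W : vectType R}.
Implicit Types (M : manifold R T) (D : set T) (f : T -> W).

(** Derivatives are computed on such smooth extensions of coordinate expressions, which treats
    interior and boundary points alike. *)
Definition rep M D f x (c : chart R T (mdim M)) (g : 'rV[R]_(mdim M) -> 'rV[R]_(dim W)) :=
  [/\ charts M c, cdom c x &
      ext (cmap c @` (cdom c `&` D)) (fun v => v2r (f (cinv c v))) (cmap c x) g].

Arguments rep M D f x c g : clear implicits.

Lemma rep_exists M D f x c : smooth_fun M D f -> D x -> charts M c -> cdom c x ->
  exists g, rep M D f x c g.
Proof.
by move=> sf Dx hc cx; have [|g hg] := sf c hc (cmap c x); [exists x|exists g; split].
Qed.

(** Only a factor K on the left is asserted. This is enough to transport surjectivity, as
    [row_full (K *m J)] implies [row_full J]. *)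
Lemma rep_change M D f x c c' g g' : smooth_atlas M -> open_in (carrier M) D -> D x ->
  rep M D f x c g -> rep M D f x c' g' ->
  exists K, jac g (cmap c x) = K *m jac g' (cmap c' x).
Proof.
move=> MA oD Dx [hc cx xg] [hc' cx' xg'].
have [h xh] := chart_transition MA hc hc' cx cx'.
have oDc : open_in (carrier M) (D `&` cdom c') by apply: open_inI => //; exact: cdom_open.
have ft := chart_fat MA hc oDc (conj Dx cx') cx.
pose S := cmap c @` (cdom c `&` (D `&` cdom c')).
have xh' : ext S (cmap c' \o cinv c) (cmap c x) h.
  by apply: ext_sub xh => _ [y [cy [_ cy']] <-]; exists y.
have Sx : S (cmap c x) by exists x.
have E : cmap c' x = (cmap c' \o cinv c) (cmap c x) by rewrite /= (cmapK MA).
rewrite E in xg'.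
have SD v : S v -> (cmap c' @` (cdom c' `&` D)) ((cmap c' \o cinv c) v).
  by move=> [y [cy [Dy cy']] <-] /=; rewrite (cmapK MA) //; exists y.
have xc := ext_comp Sx SD xh' xg'.
have xg1 : ext S (fun v => v2r (f (cinv c v))) (cmap c x) g.
  by apply: ext_sub xg => _ [y [cy [Dy _]] <-]; exists y.
have xc' : ext S (fun v => v2r (f (cinv c v))) (cmap c x) (g' \o h).
  case: xc => U [oU Ux hU UE]; exists U; split=> // v Sv Uv; rewrite UE //=.
  by case: Sv => y [cy [_ cy']] <-; rewrite !(cmapK MA).
exists (jac h (cmap c x)); rewrite E -(jac_ext_comp Sx xh' xg').
exact: ext_unique Sx ft xg1 xc'.
Qed.

(* Transversality of [f] to 0 at [x]. *)
Definition tv M D f x := f x = 0 ->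
  exists c g, rep M D f x c g /\ row_full (jac g (cmap c x)).

Lemma tv_rep M D f x c g : smooth_atlas M -> open_in (carrier M) D -> D x ->
  tv M D f x -> rep M D f x c g -> f x = 0 -> row_full (jac g (cmap c x)).
Proof.
move=> MA oD Dx tvx hr f0; have [c' [g' [hr' fr]]] := tvx f0.
have [K E] := rep_change MA oD Dx hr' hr.
by rewrite E in fr; exact: row_full_mul fr.
Qed.

Lemma deriv_in_ext n (D : set 'rV[R]_n) (f : 'rV[R]_n -> W) x :
  (exists g, ext D (fun y => v2r (f y)) x g) ->
  exists2 g, ext D (fun y => v2r (f y)) x g & forall v, v2r (deriv_in D f x v) = v *m jac g x.
Proof.
move=> [g0 hg0]; rewrite /deriv_in.
set g := xget _ _; have hg : smooth_extension D f x g.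
  by apply: (@xgetPex _ _ [set g | smooth_extension D f x g]); exists g0.
exists g => // v; have [U [oU Ux hU _]] := hg.
have -> : linfun (fun v => r2v ('d g x v)) = linfun (r2v \o 'd g x) :> 'Hom('rV[R]_n, W) by [].
by rewrite lfunE /= r2vK (diff_jac _ oU Ux hU).
Qed.

Lemma chart_atP M x : smooth_atlas M -> carrier M x ->
  charts M (chart_at M x) /\ cdom (chart_at M x) x.
Proof.
move=> [cov _ _] /cov[c hc cx].
by apply: (@xgetPex _ _ [set c | charts M c /\ cdom c x]); exists c.
Qed.

Lemma dfun_rep M D f x : smooth_atlas M -> D `<=` carrier M -> D x -> smooth_fun M D f ->
  exists2 g, rep M D f x (chart_at M x) g &
    forall v, v2r (dfun M D f x v) = v *m jac g (cmap (chart_at M x) x).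
Proof.
move=> MA sD Dx sf; have [hc cx] := chart_atP MA (sD _ Dx).
have [g [_ _ hg]] := rep_exists sf Dx hc cx.
have [|g' hg' E] := @deriv_in_ext _ (cmap (chart_at M x) @` (cdom (chart_at M x) `&` D))
  (f \o cinv (chart_at M x)) (cmap (chart_at M x) x); first by exists g.
by exists g'.
Qed.

Lemma limg_fullP n (h : 'Hom('rV[R]_n, W)) (J : 'M[R]_(n, dim W)) :
  (forall v, v2r (h v) = v *m J) -> limg h = fullv <-> row_full J.
Proof.
move=> hJ; split=> [hf|/row_full_surjP sJ].
  apply/row_full_surjP => w; have : r2v w \in limg h by rewrite hf memvf.
  by move=> /memv_imgP[v _ E]; exists v; rewrite -hJ -E r2vK.
apply/eqP; rewrite eqEsubv subvf /=; apply/subvP => w _.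
have [v E] := sJ (v2r w); apply/memv_imgP; exists v; first by rewrite memvf.
by apply: v2r_inj; rewrite hJ.
Qed.

Lemma limg_dfun_tv M D f x : smooth_atlas M -> D `<=` carrier M -> D x -> smooth_fun M D f ->
  (f x = 0 -> limg (dfun M D f x) = fullv) -> tv M D f x.
Proof.
move=> MA sD Dx sf H f0; have [g hg E] := dfun_rep MA sD Dx sf.
by exists (chart_at M x), g; split=> //; apply/(limg_fullP E)/H.
Qed.

Lemma tv_limg_dfun M D f x : smooth_atlas M -> open_in (carrier M) D -> D x -> smooth_fun M D f ->
  tv M D f x -> f x = 0 -> limg (dfun M D f x) = fullv.
Proof.
move=> MA oD Dx sf tvx f0.
have sD : D `<=` carrier M by case: oD => Q _ -> y [].
have [g hg E] := dfun_rep MA sD Dx sf.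
by apply/(limg_fullP E); exact: tv_rep tvx hg f0.
Qed.

Lemma rep_sub M D D' f x c g : D' `<=` D -> rep M D f x c g -> rep M D' f x c g.
Proof.
by move=> sD [hc cx hg]; split=> //; apply: ext_sub hg => _ [y [cy /sD Dy] <-]; exists y.
Qed.

Lemma rep_local M D D' f x c g (Q : set T) : smooth_atlas M -> open Q -> Q x ->
  (forall y, D y -> Q y -> D' y) -> rep M D' f x c g -> rep M D f x c g.
Proof.
move=> MA oQ Qx QD [hc cx [U [oU Ux hg gf]]]; split=> //.
have [r r0 rP] := chart_ball MA hc cx oQ Qx.
exists (U `&` [set v | `|v - cmap c x| < r]); split.
- by apply: openI => //; exact: open_rV_ball.
- by split=> //=; rewrite subrr normr0.
- apply: (Cinfty_sub oU _ _ hg) => [|v []] //; apply: openI => //; exact: open_rV_ball.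
- move=> _ [y [cy Dy] <-] [Uy yr]; apply: gf => //; exists y => //; split=> //.
  by apply: QD => //; exact: rP.
Qed.

Lemma rep_eq M D f f' x c g : smooth_atlas M -> (forall y, D y -> f y = f' y) ->
  rep M D f x c g -> rep M D f' x c g.
Proof.
move=> MA ff [hc cx [U [oU Ux hg gf]]]; split=> //; exists U; split=> // _ [y [cy Dy] <-] Uy.
by rewrite gf; [rewrite (cmapK MA) // ff|exists y|].
Qed.

(** [p] is the matrix of parameters. [B] will be the matrix of the linear injection of E_J into the
    fibre at hand, the identity in the chart J itself. *)
Definition pert k q (f : T -> W) (F : T -> 'rV[R]_q) (B : 'M[R]_(k, dim W))
  (p : 'M[R]_(q, k)) (y : T) : W := f y + r2v (F y *m p *m B).

Definition vrep q M D (F : T -> 'rV[R]_q) x (c : chart R T (mdim M)) h :=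
  [/\ charts M c, cdom c x & ext (cmap c @` (cdom c `&` D)) (F \o cinv c) (cmap c x) h].
Arguments vrep q M D F x c h : clear implicits.

Lemma rep_pert k q M D f (F : T -> 'rV[R]_q) (B : 'M[R]_(k, dim W)) p x c g h :
  rep M D f x c g -> vrep q M D F x c h ->
  rep M D (pert f F B p) x c (fun v => g v + h v *m p *m B) /\
  jac (fun v => g v + h v *m p *m B) (cmap c x) =
    jac g (cmap c x) + jac h (cmap c x) *m p *m B.
Proof.
move=> [hc cx hg] [_ _ hh].
have [h1 j1] := ext_mulmx (p *m B) hh.
have [h2 j2] := extD hg h1.
have E : (fun v => g v + h v *m p *m B) = (fun v => g v + h v *m (p *m B)).
  by apply/funext => v; rewrite mulmxA.
split; last by rewrite E j2 j1 mulmxA.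
split=> //; rewrite E; case: h2 => U [oU Ux hU UE]; exists U; split=> // v Dv Uv.
by rewrite UE // /pert linearD /= r2vK mulmxA.
Qed.

Lemma mulmx3_close (a q k b : nat) (A0 : 'M[R]_(a, q)) (p0 : 'M[R]_(q, k)) (B : 'M[R]_(k, b)) eps :
  0 < eps -> exists2 d : R, 0 < d & forall A p, `|A - A0| < d -> `|p - p0| < d ->
    `|A *m p *m B - A0 *m p0 *m B| < eps.
Proof.
move=> e0; pose c := k%:R * q%:R * (`|p0| + 1 + `|A0|) * `|B| + 1.
have c0 : 0 < c by rewrite ltr_wpDl // !mulr_ge0 // !addr_ge0.
exists (Num.min 1 (eps / c)); first by rewrite lt_min ltr01 divr_gt0.
move=> A p; rewrite !lt_min => /andP[A1 Ae] /andP[p1 pe].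
pose d := Num.max `|A - A0| `|p - p0|.
have d0 : 0 <= d by rewrite le_max normr_ge0.
have N a' (X : 'M[R]_(a', q)) (Y : 'M[R]_(q, k)) :
    `|X *m Y *m B| <= k%:R * q%:R * (`|X| * `|Y|) * `|B|.
  apply: le_trans (norm_mulmx _ _) _; rewrite ler_wpM2r // -mulrA ler_wpM2l //.
  by rewrite mulrA; exact: norm_mulmx.
have -> : A *m p *m B - A0 *m p0 *m B = (A - A0) *m p *m B + A0 *m (p - p0) *m B.
  rewrite !mulmxBl mulmxBr mulmxBl.
  by rewrite addrA subrK.
have np : `|p| <= `|p0| + 1.
  rewrite -{1}(subrK p0 p) addrC; apply: le_trans (ler_normD _ _) _.
  by rewrite lerD2l ltW.
apply: (@le_lt_trans _ _ (c * d)); last first.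
  by rewrite mulrC -ltr_pdivlMr // gt_max Ae.
apply: le_trans (ler_normD _ _) _.
apply: (@le_trans _ _ (k%:R * q%:R * (d * (`|p0| + 1)) * `|B| + k%:R * q%:R * (`|A0| * d) * `|B|)).
  apply: lerD; apply: le_trans (N _ _ _) _; rewrite ler_wpM2r // ler_wpM2l ?mulr_ge0 //.
    by apply: ler_pM => //; rewrite le_max lexx.
  by rewrite ler_wpM2l // le_max lexx orbT.
by rewrite /c; apply: (@le_trans _ _ (c * d - d)); [rewrite /c; lra|rewrite gerBl].
Qed.

(** Openness jointly in the point and the parameters: at a zero the full rank persists nearby, at
    any other point the section stays nonzero. *)
Lemma tv_open k q M D f (F : T -> 'rV[R]_q) (B : 'M[R]_(k, dim W)) p0 x c g h :
  smooth_atlas M -> open_in (carrier M) D -> D x ->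
  rep M D f x c g -> vrep q M D F x c h -> tv M D (pert f F B p0) x ->
  exists2 eps : R, 0 < eps & exists Q, [/\ open_in (carrier M) Q, Q x &
    forall p, `|p - p0| < eps -> forall y, Q y -> D y -> tv M D (pert f F B p) y].
Proof.
move=> MA oD Dx hr hh tvx.
have [hc cx [U [oU Ux hg gf]]] := hr; have [_ _ [U' [oU' Ux' hh' hF]]] := hh.
have rest y : cdom c y -> D y -> U (cmap c y) -> U' (cmap c y) ->
    rep M D f y c g /\ vrep q M D F y c h.
  by move=> cy Dy Uy Uy'; split; split=> //; [exists U|exists U'].
pose G p v := g v + h v *m p *m B.
have Gv p y : cdom c y -> D y -> U (cmap c y) -> U' (cmap c y) ->
    pert f F B p y = r2v (G p (cmap c y)).
  move=> cy Dy Uy Uy'; rewrite /pert /G linearD /=.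
  rewrite gf ?hF //=; last 2 first; [by exists y|by exists y|].
  by rewrite v2rK (cmapK MA).
have [t t0 tP] := lip_jac oU Ux hg; have [u u0 uP] := lip_jac oU' Ux' hh'.
have close m1 m2 (X : 'rV[R]_(mdim M) -> 'M[R]_(m1, m2)) (s : R) (d : R) : 0 < s -> 0 < d ->
    (forall y, `|y - cmap c x| < s -> `|X y - X (cmap c x)| <= s^-1 * `|y - cmap c x|) ->
    exists2 r : R, 0 < r & forall y, `|y - cmap c x| < r -> `|X y - X (cmap c x)| < d.
  move=> s0 d0 H; exists (Num.min s (s * d)); first by rewrite lt_min s0 mulr_gt0.
  move=> y; rewrite lt_min => /andP[ys yd]; apply: le_lt_trans (H _ ys) _.
  by rewrite -ltr_pdivlMl ?invr_gt0 // invrK.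
have cx0 : `|cmap c x - cmap c x| = 0 by rewrite subrr normr0.
case: (eqVneq (pert f F B p0 x) 0) => [fx0|fxn].
- have [hr' jr] := rep_pert B p0 hr hh.
  have := tv_rep MA oD Dx tvx hr' fx0; rewrite jr => /row_full_near[e e0 eP].
  have e2 : 0 < e / 2 by rewrite divr_gt0.
  have [d d0 dP] := @mulmx3_close _ _ _ _ (jac h (cmap c x)) p0 B _ e2.
  have [r r0 rP] : exists2 r : R, 0 < r & forall y, `|y - cmap c x| < r ->
      `|jac g y - jac g (cmap c x)| < e / 2.
    apply: (close _ _ (jac g) t) => // y yt; have [||] := tP (cmap c x) y => //.
    by rewrite cx0.
  have [s s0 sP] : exists2 r : R, 0 < r & forall y, `|y - cmap c x| < r ->
      `|jac h y - jac h (cmap c x)| < d.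
    apply: (close _ _ (jac h) u) => // y yt; have [||] := uP (cmap c x) y => //.
    by rewrite cx0.
  exists d => //.
  have oB : open (U `&` U' `&` ([set v | `|v - cmap c x| < r] `&` [set v | `|v - cmap c x| < s])).
    by apply: openI; apply: openI => //; exact: open_rV_ball.
  have [|Q [oQ Qx QP]] := chart_nbhd MA hc cx oB; first by do !split=> //=; rewrite cx0.
  exists Q; split=> // p pp y /QP[cy [[Uy Uy'] [yr ys]]] Dy f0.
  have [hry hhy] := rest y cy Dy Uy Uy'.
  have [hrp jp] := rep_pert B p hry hhy.
  exists c, (fun v => g v + h v *m p *m B); split=> //; rewrite jp; apply: eP.
  rewrite opprD addrACA; apply: le_lt_trans (ler_normD _ _) _; rewrite (splitr e).
  by apply: ltrD; [exact: rP|exact: dP (sP _ ys) pp].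
- have G0 : G p0 (cmap c x) != 0.
    by apply: contra_neq fxn; rewrite Gv // => ->; rewrite linear0.
  have n0 : 0 < `|G p0 (cmap c x)| / 2 by rewrite divr_gt0 // normr_gt0.
  have [d d0 dP] := @mulmx3_close _ _ _ _ (h (cmap c x)) p0 B _ n0.
  have [r r0 rP] : exists2 r : R, 0 < r & forall y, `|y - cmap c x| < r ->
      `|g y - g (cmap c x)| < `|G p0 (cmap c x)| / 2.
    apply: (close _ _ g t) => // y yt; have [||] := tP (cmap c x) y => //.
    by rewrite cx0.
  have [s s0 sP] : exists2 r : R, 0 < r & forall y, `|y - cmap c x| < r ->
      `|h y - h (cmap c x)| < d.
    apply: (close _ _ h u) => // y yt; have [||] := uP (cmap c x) y => //.
    by rewrite cx0.
  exists d => //.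
  have oB : open (U `&` U' `&` ([set v | `|v - cmap c x| < r] `&` [set v | `|v - cmap c x| < s])).
    by apply: openI; apply: openI => //; exact: open_rV_ball.
  have [|Q [oQ Qx QP]] := chart_nbhd MA hc cx oB; first by do !split=> //=; rewrite cx0.
  exists Q; split=> // p pp y /QP[cy [[Uy Uy'] [yr ys]]] Dy.
  rewrite /tv Gv // => /(congr1 v2r); rewrite r2vK linear0 => Gy.
  have : `|G p0 (cmap c x)| < `|G p0 (cmap c x)|; last by rewrite ltxx.
  rewrite {1}(_ : G p0 (cmap c x) = - (G p (cmap c y) - G p0 (cmap c x))); last by rewrite Gy sub0r opprK.
  rewrite normrN /G opprD addrACA; apply: le_lt_trans (ler_normD _ _) _.
  rewrite [X in _ < X]splitr.
  by apply: ltrD; [exact: rP|exact: dP (sP _ ys) pp].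
Qed.

(** [dense_good] read in a chart. The neighbourhood [Q] is fixed before [p0] and [rho], so a finite
    cover can be treated one set after the other. *)
Lemma tv_dense M D f (F : T -> 'rV[R]_(1 + mdim M)) x c g h U :
  smooth_atlas M -> open_in (carrier M) D -> D x -> rep M D f x c g ->
  open U -> U (cmap c x) -> Cinfty U h ->
  (forall y, U y -> forall w : 'cV[R]_(mdim M), `|w| <= 2 * `|jac h y *m w| ) ->
  (forall y, cdom c y -> D y -> U (cmap c y) -> F y = row_mx 1%:M (h (cmap c y))) ->
  exists Q, [/\ open_in (carrier M) Q, Q x &
    forall p0 (rho : R), 0 < rho -> exists2 p, `|p - p0| < rho &
      forall y, Q y -> D y -> tv M D (pert f F 1%:M p) y].
Proof.
move=> MA oD Dx [hc cx [V [oV Vx hg gf]]] oU Ux hh inv hF.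
have oI : open (U `&` V) by exact: openI.
have hgI : Cinfty (U `&` V) g by apply: (Cinfty_sub oV _ _ hg) => // v [].
have hhI : Cinfty (U `&` V) h by apply: (Cinfty_sub oU _ _ hh) => // v [].
have [|r r0 [rI rP]] := dense_good oI (conj Ux Vx) hgI hhI; first by move=> y [/inv].
have oB : open [set v | `|v - cmap c x| < r] by exact: open_rV_ball.
have [|Q [oQ Qx QP]] := chart_nbhd MA hc cx oB.
  by rewrite /= subrr normr0.
exists Q; split=> // p0 rho rho0; have [p pp pP] := rP p0 rho rho0.
exists p => // y Qy Dy; have [cy /= yr] := QP y Qy.
have [Uy Vy] := rI _ yr; have good := pP _ yr.
have hr : rep M D f y c g by split=> //; exists V.
pose h1 v := row_mx (1%:M : 'M[R]_1) (h v).
have h1E v : h1 v = h v *m row_mx 0 1%:M + row_mx 1%:M 0.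
  by rewrite /h1 mul_mx_row mulmx0 mulmx1 add_row_mx add0r addr0.
have hh1 : vrep _ M D F y c h1.
  split=> //; exists U; split=> //.
    have -> : h1 = (fun v => h v *m row_mx 0 1%:M + row_mx 1%:M 0) by apply/funext.
    exact: (CinftyD oU (Cinfty_mulmx oU _ hh) (Cinfty_cst oU _)).
  by move=> _ [z [cz Dz] <-] Uz /=; rewrite (cmapK MA) // hF.
have jh1 : jac h1 (cmap c y) = jac h (cmap c y) *m row_mx 0 1%:M.
  have -> : h1 = (fun v => h v *m row_mx 0 1%:M + row_mx 1%:M 0) by apply/funext.
  rewrite (jacD oU Uy (Cinfty_mulmx oU _ hh) (Cinfty_cst oU _)).
  rewrite (jac_mulmx _ oU Uy hh) -[RHS]addr0; congr (_ + _).
  apply: (jac_unique oU Uy (Cinfty_cst oU _)) => eps e0; exists 1 => // z _.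
  by rewrite subrr /= mulmx0 subrr normr0 mulr_ge0 // ltW.
have [hrp jp] := rep_pert 1%:M p hr hh1.
move=> f0; exists c, (fun v => g v + h1 v *m p *m 1%:M); split=> //.
rewrite jp jh1 mulmx1.
have -> : jac h (cmap c y) *m row_mx 0 1%:M *m p = jac h (cmap c y) *m dsubmx p.
  by rewrite -mulmxA -{1}(vsubmxK p) matrix.mul_row_col mul0mx add0r mul1mx.
apply: good; move: f0; rewrite /pert => /(congr1 v2r); rewrite linear0 linearD /= r2vK mulmx1.
by rewrite gf //; [rewrite (cmapK MA) // hF|exists y].
Qed.

End Representatives.

End LocalReps.
Arguments rep {R T W} M D f x c g.
Arguments vrep {R T} q M D F x c h.

(** * Tame atlases and their realization *)

Section Relative.
Context {R : realType} {T T' : topologicalType}.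

Lemma open_in_trans (A B C : set T) : open_in A B -> open_in B C -> open_in A C.
Proof.
move=> [U oU EU] [V oV EV]; exists (U `&` V); first exact: openI.
by rewrite EV EU setIA.
Qed.

Lemma open_in_preimage (A : set T) (f : T -> T') (Q : set T') :
  {within A, continuous f} -> open Q -> open_in A (A `&` f @^-1` Q).
Proof.
move=> cf oQ; pose F := [set O | open O /\ forall y, A y -> O y -> Q (f y)].
exists (\bigcup_(O in F) O); first by apply: bigcup_open => O [].
rewrite eqEsubset; split=> x [Ax hx]; split=> //.
  by have [V [oV Vx hV]] := within_open cf Ax oQ hx; exists V.
by case: hx => V [oV hV] Vx; exact: hV.
Qed.

Lemma jac_cst n m (c : 'rV[R]_m) (x : 'rV[R]_n) : jac (fun=> c) x = 0.
Proof.
rewrite -[RHS](jac_affine 0 c x); congr (jac _ x); apply/funext => y.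
by rewrite mulmx0 add0r.
Qed.

Lemma repD (W : vectType R) (M : manifold R T) D (f f' : T -> W) x c g g' :
  rep M D f x c g -> rep M D f' x c g' ->
  rep M D (fun y => f y + f' y) x c (fun v => g v + g' v).
Proof.
move=> [hc cx hg] [_ _ hg']; split=> //; have [[U [oU Ux hU UE]] _] := extD hg hg'.
by exists U; split=> // v Dv Uv; rewrite UE // linearD.
Qed.

End Relative.

Section Core.
Context {R : realType} {TX : topologicalType}.

(* The properties of tame atlases, possibly with boundary, on which the
   construction of perturbations relies; they pass to boundaries. *)
Record core (K : atlas R TX) : Prop := Core {
  co_man : forall I, idx K I -> smooth_atlas (kU (ach K I));
  co_s : forall I, idx K I -> smooth_fun (kU (ach K I)) (dom (ach K I)) (ks (ach K I));
  co_id : forall I, idx K I -> [/\ aU K I I = dom (ach K I),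
     forall x, dom (ach K I) x -> aphi K I x = x & forall e, ahat K I I e = e];
  co_open : forall I J, idx K I -> idx K J -> I \proper J ->
     open_in (dom (ach K I)) (aU K I J);
  co_map : forall I J, idx K I -> idx K J -> I \proper J ->
     smooth_map (kU (ach K I)) (kU (ach K J)) (aU K I J) (aphi K J);
  co_inj : forall I J (x y : kT (ach K I)), idx K I -> idx K J -> I \proper J -> aU K I J x -> aU K I J y ->
     aphi K J x = aphi K J y -> x = y;
  co_imm : forall I J (x : kT (ach K I)), idx K I -> idx K J -> I \proper J -> aU K I J x ->
     exists c c' g, [/\ charts (kU (ach K I)) c, cdom c x,
       charts (kU (ach K J)) c', cdom c' (aphi K J x) &
       ext (cmap c @` (cdom c `&` aU K I J `&` aphi K J @^-1` cdom c'))
         (cmap c' \o aphi K J \o cinv c) (cmap c x) g /\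
       row_free (jac g (cmap c x))];
  co_ks : forall I J (x : kT (ach K I)), idx K I -> idx K J -> I \proper J -> aU K I J x ->
     ks (ach K J) (aphi K J x) = ahat K I J (ks (ach K I) x);
  co_index : forall I J (x : kT (ach K I)), idx K I -> idx K J -> I \proper J -> aU K I J x ->
     exists c g, rep (kU (ach K J)) (dom (ach K J)) (ks (ach K J)) (aphi K J x) c g /\
       forall w, exists v e, w = v *m jac g (cmap c (aphi K J x)) + v2r (ahat K I J e);
  co_hat0 : forall I J, idx K I -> idx K J -> I \proper J -> lker (ahat K I J) = 0%VS;
  co_hat : forall I J L, idx K I -> idx K J -> idx K L -> I \proper J -> J \proper L ->
     forall e, ahat K J L (ahat K I J e) = ahat K I L e;
  co_phi : forall I J L (x : kT (ach K I)), idx K I -> idx K J -> idx K L -> I \proper J -> J \proper L ->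
     aU K I J x -> aU K J L (aphi K J x) ->
     aU K I L x /\ aphi K L (aphi K J x) = aphi K L x;
  co_tame : tame K }.

Section Combinatorics.
Context {K : atlas R TX} (hK : core K).
Implicit Types I J L : {set 'I_(aN K)}.

Lemma subset_eqVproper I J : I \subset J -> I = J \/ I \proper J.
Proof.
by move=> IJ; have [->|IJn] := eqVneq I J; [left|right; rewrite finset.properEneq IJn].
Qed.

Lemma aUid I : idx K I -> aU K I I = dom (ach K I).
Proof. by case/(co_id hK). Qed.

Lemma aphi_id I (x : kT (ach K I)) : idx K I -> dom (ach K I) x -> aphi K I x = x.
Proof. by case/(co_id hK) => _ + _; apply. Qed.

Lemma aU_dom I J (x : kT (ach K I)) : idx K I -> idx K J -> I \subset J -> aU K I J x -> dom (ach K I) x.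
Proof.
move=> hI hJ /subset_eqVproper[<-|IJ]; first by rewrite aUid.
by have [Q _ ->] := co_open hK hI hJ IJ; case.
Qed.

Lemma aphi_dom I J (x : kT (ach K I)) : idx K I -> idx K J -> I \subset J -> aU K I J x ->
  dom (ach K J) (aphi K J x).
Proof.
move=> hI hJ /subset_eqVproper[<-|IJ]; first by rewrite aUid // => xd; rewrite aphi_id.
by have [H _ _] := co_map hK hI hJ IJ => Ux; apply: H; exists x.
Qed.

Lemma aU_open I J : idx K I -> idx K J -> I \subset J -> open_in (dom (ach K I)) (aU K I J).
Proof.
move=> hI hJ /subset_eqVproper[<-|IJ]; last exact: co_open.
by rewrite aUid //; exists setT; [exact: openT|rewrite setIT].
Qed.

Lemma aphi_inj I J (x y : kT (ach K I)) : idx K I -> idx K J -> I \subset J -> aU K I J x -> aU K I J y ->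
  aphi K J x = aphi K J y -> x = y.
Proof.
move=> hI hJ /subset_eqVproper[<-|IJ]; last exact: co_inj.
by rewrite aUid // => xd yd; rewrite !aphi_id.
Qed.

Lemma ahatA I J L e : idx K I -> idx K J -> idx K L -> I \subset J -> J \subset L ->
  ahat K J L (ahat K I J e) = ahat K I L e.
Proof.
move=> hI hJ hL /subset_eqVproper[EIJ|IJ].
  by subst J => _; have [_ _ ->] := co_id hK hI.
move=> /subset_eqVproper[EJL|JL]; last exact: co_hat.
by subst L; have [_ _ ->] := co_id hK hJ.
Qed.

Lemma aphiA I J L (x : kT (ach K I)) : idx K I -> idx K J -> idx K L -> I \subset J -> J \subset L ->
  aU K I J x -> aU K J L (aphi K J x) ->
  aU K I L x /\ aphi K L (aphi K J x) = aphi K L x.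
Proof.
move=> hI hJ hL /subset_eqVproper[EIJ|IJ].
  by subst J => _; rewrite aUid // => xd; rewrite aphi_id.
move=> /subset_eqVproper[EJL|JL]; last exact: co_phi.
subst L => Ux _; split=> //; rewrite aphi_id //.
by apply: aphi_dom Ux => //; exact: proper_sub.
Qed.

Lemma idx_sub I J : I != finset.set0 -> I \subset J -> idx K J -> idx K I.
Proof.
move=> I0 /fintype.subsetP IJ [_ [p pJ]]; split=> //; exists p => i /IJ; exact: pJ.
Qed.

Lemma aU_sub I J L (x : kT (ach K I)) : idx K I -> idx K J -> idx K L -> I \subset J -> J \subset L ->
  aU K I L x -> aU K I J x.
Proof.
move=> hI hJ hL IJ JL Ux; have [_ t _] := co_tame hK.
have : (aU K I J `&` aU K I L) x.
  rewrite (t I J L hI hJ hL IJ (fintype.subset_trans IJ JL)) //=.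
  by have /finset.setUidPr -> := JL.
by case.
Qed.

Lemma aU_image I J L (x : kT (ach K I)) : idx K I -> idx K J -> idx K L -> I \subset J -> J \subset L ->
  aU K I L x -> aU K J L (aphi K J x).
Proof.
move=> hI hJ hL IJ JL Ux; have [_ _ t] := co_tame hK.
have : (aphi K J @` aU K I L) (aphi K J x) by exists x.
by rewrite (t I J L hI hJ hL IJ JL) => -[].
Qed.

Lemma aphi_trans I J L (x : kT (ach K I)) : idx K I -> idx K J -> idx K L -> I \subset J -> J \subset L ->
  aU K I L x -> aphi K L (aphi K J x) = aphi K L x.
Proof.
move=> hI hJ hL IJ JL Ux.
have UJ := aU_sub hI hJ hL IJ JL Ux.
by have [] := aphiA hI hJ hL IJ JL UJ (aU_image hI hJ hL IJ JL Ux).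
Qed.

(* Tameness makes [joined], which passes through a common larger chart, transitive. *)
Definition joined (p q : point K) := exists L,
  [/\ idx K (projT1 p), idx K (projT1 q), idx K L, projT1 p \subset L & projT1 q \subset L] /\
  [/\ aU K _ L (projT2 p), aU K _ L (projT2 q) &
      aphi K L (projT2 p) = aphi K L (projT2 q)].

(** The middle point lies in U_{J L1} and U_{J L2}, whose intersection is U_{J (L1 u L2)} by
    tameness. In particular the union L1 u L2 is an index, and both identifications can be pushed on
    to it. *)
Lemma joined_trans p q r : joined p q -> joined q r -> joined p r.
Proof.
move: p q r => [I x] [J y] [H z] [L1 [/= [hI hJ h1 I1 J1] [Ux Uy E1]]]
  [L2 [/= [_ hH h2 J2 H2] [Uy' Uz E2]]].
have [_ t _] := co_tame hK.
have : (aU K J L1 `&` aU K J L2) y by [].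
rewrite (t J L1 L2) // => -[hL ULy].
have [s1 s2] : L1 \subset (L1 :|: L2)%SET /\ L2 \subset (L1 :|: L2)%SET.
  by rewrite finset.subsetUl finset.subsetUr.
have W1 := aU_image hJ h1 hL J1 s1 ULy; have W2 := aU_image hJ h2 hL J2 s2 ULy.
have A1 := aphi_trans hJ h1 hL J1 s1 ULy; have A2 := aphi_trans hJ h2 hL J2 s2 ULy.
rewrite -E1 in W1; rewrite E2 in W2.
have [Ux' A1'] := aphiA hI h1 hL I1 s1 Ux W1; have [Uz' A2'] := aphiA hH h2 hL H2 s2 Uz W2.
exists (L1 :|: L2)%SET; split; split=> //=;
  [exact: fintype.subset_trans I1 s1|exact: fintype.subset_trans H2 s2|].
by rewrite -A1' -A2' E1 -E2 A1 A2.
Qed.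

Lemma equiv_joined p q : equiv p q -> p = q \/ joined p q.
Proof.
elim=> {p q} [p q [I [J [x [[hI hJ IJ Ux] [-> ->]]]]]|p|p q _ [->|[L [[h1 h2 hL s1 s2] [U1 U2 E]]]]
   |p q r _ IH1 _ IH2].
- right; exists J; split; split=> //=; first by rewrite aUid //; exact: aphi_dom Ux.
  by rewrite [RHS]aphi_id //; exact: aphi_dom Ux.
- by left.
- by left.
- by right; exists L; split; split.
- case: IH1 => [->|pq] //; case: IH2 => [<-|qr]; first by right.
  by right; exact: joined_trans qr.
Qed.

Lemma cls_refl I (x : kT (ach K I)) : cls x (Point x).
Proof. exact: Relation_Operators.rst_refl. Qed.

Lemma cls_eqP I J (x : kT (ach K I)) (y : kT (ach K J)) : cls x = cls y <-> equiv (Point x) (Point y).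
Proof.
split=> [E|xy]; first by have := cls_refl y; rewrite -E.
rewrite eqEsubset; split=> q h; apply: Relation_Operators.rst_trans h => //.
exact: Relation_Operators.rst_sym.
Qed.

Lemma cls_joined I J (x : kT (ach K I)) (y : kT (ach K J)) : idx K I -> dom (ach K I) x ->
  cls x = cls y -> joined (Point x) (Point y).
Proof.
move=> hI xd /cls_eqP/equiv_joined[<-|//].
by exists I; split; split=> //=; rewrite aUid.
Qed.

(** An identification in a larger chart L descends to J, because the coordinate change from J to L
    is injective. *)
Lemma cls_sub I J (x : kT (ach K I)) (y : kT (ach K J)) : idx K I -> dom (ach K I) x ->
  I \subset J -> cls x = cls y -> aU K I J x /\ y = aphi K J x.
Proof.
move=> hI xd IJ /cls_joined => /(_ hI xd)[L [/= [_ hJ hL IL JL] [Ux Uy E]]].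
split; first exact: aU_sub JL Ux.
apply: (aphi_inj hJ hL JL Uy); first exact: aU_image IJ JL Ux.
by rewrite -E aphi_trans.
Qed.

Lemma cls_aphi I J (x : kT (ach K I)) : idx K I -> idx K J -> I \subset J -> aU K I J x ->
  cls (aphi K J x) = cls x.
Proof.
move=> hI hJ IJ Ux; apply/cls_eqP/Relation_Operators.rst_sym/Relation_Operators.rst_step.
by exists I, J, x; split.
Qed.

Lemma cls_inj I (x y : kT (ach K I)) : idx K I -> dom (ach K I) x -> cls x = cls y -> x = y.
Proof. by move=> hI xd /(cls_sub hI xd (subxx I))[_ ->]; rewrite aphi_id. Qed.

Lemma v2r_lfun (U W : vectType R) (f : 'Hom(U, W)) v : v2r (f v) = v2r v *m f2mx f.
Proof. by rewrite unlock /= r2vK. Qed.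

Lemma f2mx_id J : idx K J -> f2mx (ahat K J J) = 1%:M.
Proof.
move=> hJ; apply/row_matrixP => i; rewrite !rowE mulmx1.
rewrite -[delta_mx 0 i]r2vK -v2r_lfun.
by have [_ _ ->] := co_id hK hJ.
Qed.

(* Zeros of a perturbed section on the image of [phi] inherit transversality,
   since [im ds_J + E_I = E_J] and [d nu_J] takes values in [E_I]. *)
Lemma tv_inherit I J (z : kT (ach K I)) (DI : set (kT (ach K I))) (DJ N : set (kT (ach K J)))
    (nI : kT (ach K I) -> kE (ach K I)) (nJ : kT (ach K J) -> kE (ach K J)) :
  idx K I -> idx K J -> I \proper J -> aU K I J z ->
  open_in (dom (ach K I)) DI -> DI z -> open_in (dom (ach K J)) N -> N `<=` DJ ->
  open_in (dom (ach K J)) DJ -> N (aphi K J z) ->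
  smooth_fun (kU (ach K I)) DI nI ->
  smooth_fun (kU (ach K J)) DJ nJ ->
  (forall y, N y -> nJ y \in limg (ahat K I J)) ->
  (forall x, DI x -> aU K I J x -> N (aphi K J x) -> nJ (aphi K J x) = ahat K I J (nI x)) ->
  tv (kU (ach K I)) DI (fun x => ks (ach K I) x + nI x) z ->
  tv (kU (ach K J)) DJ (fun x => ks (ach K J) x + nJ x) (aphi K J z).
Proof.
move=> hI hJ IJ Uz oI Iz oN NJ oJ Nz sI sJ nE nc tvz f0.
have MI := co_man hK hI; have MJ := co_man hK hJ.
have sNdom : DJ `<=` dom (ach K J) by case: oJ => Q _ -> y [].
have [c [gs [[hc cz hgs] ix]]] := co_index hK hI hJ IJ Uz.
have [gn [_ _ hgn]] := rep_exists sJ (NJ _ Nz) hc cz.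
pose A := f2mx (ahat K I J).
have fI0 : ks (ach K I) z + nI z = 0.
  have lk := co_hat0 hK hI hJ IJ.
  move: f0; rewrite nc // (co_ks hK hI hJ IJ Uz) -linearD => /eqP.
  by rewrite -memv_ker lk memv0 => /eqP.
have [c1 [g1 [[hc1 c1z hg1] fr]]] := tvz fI0.
have [_ cphi sphi] := co_map hK hI hJ IJ.
have oU := co_open hK hI hJ IJ.
pose P := aU K I J `&` aphi K J @^-1` (cdom c `&` N).
have oP : open_in (dom (ach K I)) P.
  have [Q oQ EQ] := open_inI (cdom_open MJ hc) oN.
  apply: (open_in_trans oU).
  have -> : P = aU K I J `&` aphi K J @^-1` Q.
    rewrite eqEsubset; split=> x [Ux hx]; split=> //.
      have : (cdom c `&` N) (aphi K J x) by [].
      by rewrite EQ => -[].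
    suff : (cdom c `&` N) (aphi K J x) by [].
    rewrite EQ; split=> //; apply: (aphi_dom hI hJ) => //; exact: proper_sub.
  exact: open_in_preimage.
pose D := DI `&` P.
have oD : open_in (dom (ach K I)) D by exact: open_inI.
have Dz : D z by split=> //; split.
have ft := chart_fat MI hc1 oD Dz c1z.
pose S := cmap c1 @` (cdom c1 `&` D).
have Sz : S (cmap c1 z) by exists z.
have [gp hgp0] : exists g, ext (cmap c1 @` (cdom c1 `&` aU K I J `&` aphi K J @^-1` cdom c))
    (cmap c \o aphi K J \o cinv c1) (cmap c1 z) g.
  by apply: smooth_in_row; [exact: sphi|exists z].
have hgp : ext S (cmap c \o aphi K J \o cinv c1) (cmap c1 z) gp.
  by apply: ext_sub hgp0 => _ [x [c1x [_ [Ux [cx _]]]] <-]; exists x.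
have E1 : (cmap c \o aphi K J \o cinv c1) (cmap c1 z) = cmap c (aphi K J z).
  by rewrite /= (cmapK MI).
pose S' := cmap c @` (cdom c `&` N).
have SS' v : S v -> S' ((cmap c \o aphi K J \o cinv c1) v).
  move=> [x [c1x [Ix [Ux [cx Nx]]]] <-]; exists (aphi K J x) => //.
  by rewrite /= (cmapK MI).
have hgs' : ext S' (fun v => v2r (ks (ach K J) (cinv c v))) (cmap c (aphi K J z)) gs.
  by apply: ext_sub hgs => _ [y [cy Ny] <-]; exists y => //; split=> //; exact/sNdom/NJ.
have hgn' : ext S' (fun v => v2r (nJ (cinv c v))) (cmap c (aphi K J z)) gn.
  by apply: ext_sub hgn => _ [y [cy Ny] <-]; exists y => //; split=> //; exact: NJ.
have [hf jf] := extD hgs' hgn'.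
have S'z : S' (cmap c (aphi K J z)) by exists (aphi K J z).
have hgA : ext S (fun v => v2r (ks (ach K I) (cinv c1 v) + nI (cinv c1 v)) *m A) (cmap c1 z)
    (fun v => g1 v *m A) /\ jac (fun v => g1 v *m A) (cmap c1 z) = jac g1 (cmap c1 z) *m A.
  apply: ext_mulmx; apply: ext_sub hg1 => _ [x [c1x [Ix _]] <-].
  by exists x.
(* The derivative of (s_J + nu_J) o phi = A o (s_I + nu_I), with A the matrix of E_I -> E_J. *)
have jE : jac gp (cmap c1 z) *m (jac gs (cmap c (aphi K J z)) + jac gn (cmap c (aphi K J z)))
   = jac g1 (cmap c1 z) *m A.
  rewrite -(proj2 hgA) -jf -E1; rewrite -E1 in hf.
  rewrite -(jac_ext_comp Sz hgp hf); apply: (ext_unique Sz ft _ (proj1 hgA)).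
  have := ext_comp Sz SS' hgp hf.
  move=> [U [oU' Uz' hU UE]]; exists U; split=> // v Sv Uv; rewrite UE //.
  case: Sv => x [c1x [Ix [Ux [cx Nx]]]] <- /=; rewrite (cmapK MI) // (cmapK MJ) //.
  by rewrite (nc x Ix Ux Nx) (co_ks hK hI hJ IJ Ux) !v2r_lfun -mulmxDl -linearD.
(* On [N] the values of nu_J lie in the fixed subspace E_I, so the composite with the cokernel of A
   vanishes there and so does its derivative. *)
have jnA : (jac gn (cmap c (aphi K J z)) <= A)%MS.
  rewrite submxE; apply/eqP.
  have [hB jB] := ext_mulmx (cokermx A) hgn'.
  rewrite -jB -[RHS](_ : jac (fun=> 0) (cmap c (aphi K J z)) = 0); last exact: jac_cst.
  have oN' : open_in (dom (ach K J)) N by [].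
  apply: (ext_unique S'z (chart_fat MJ hc oN Nz cz) hB).
  exists setT; split=> //; [exact: openT|by apply: Cinfty_cst; exact: openT|].
  move=> _ [y [cy Ny] <-] _; rewrite (cmapK MJ) //.
  have /memv_imgP[e _ ->] := nE y Ny.
  by rewrite v2r_lfun -mulmxA mulmx_coker mulmx0.
exists c, (fun v => gs v + gn v); split; last first.
  (* The index condition writes w as ds_J(v) plus an element of E_I. What is left after using s_J +
     nu_J in the direction v lies in E_I and is reached through phi, by transversality in U_I. *)
  rewrite jf; apply/row_full_surjP => w; have [v [e ->]] := ix w.
  have /submxP[e' e'E] : (v *m jac gn (cmap c (aphi K J z)) <= A)%MS.
    by apply: submx_trans jnA; exact: submxMl.
  have [u uE] := (row_full_surjP _).1 fr (v2r e - e').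
  exists (v + u *m jac gp (cmap c1 z)).
  rewrite mulmxDl -[u *m _ *m _]mulmxA jE mulmxA -uE mulmxBl -e'E v2r_lfun mulmxDr.
  by rewrite -addrA; congr (_ + _); rewrite addrCA subrr addr0.
apply: repD; last by split.
by apply: (rep_sub (D := dom (ach K J))) => //; split.
Qed.

End Combinatorics.
End Core.

(** * Numerical relations between the radii 2^-k delta and eta_k *)

Section Pow2.
Context {R : realType}.
Implicit Types k l : R.

Lemma pow2nD k l : pow2n (k + l) = pow2n k * pow2n l :> R.
Proof. by rewrite /pow2n opprD powRD // pnatr_eq0 implybT. Qed.

Lemma pow2n_gt0 k : 0 < pow2n k :> R.
Proof. exact: powR_gt0. Qed.

Lemma pow2n_ge0 k : 0 <= pow2n k :> R.
Proof. exact: ltW (pow2n_gt0 k). Qed.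

Lemma pow2n0 : pow2n 0 = 1 :> R.
Proof. by rewrite /pow2n oppr0 powRr0. Qed.

Lemma pow2n1 : pow2n 1 = 2^-1 :> R.
Proof. by rewrite /pow2n powRN powRr1. Qed.

Lemma pow2n_le k l : k <= l -> pow2n l <= pow2n k :> R.
Proof. by move=> kl; rewrite /pow2n ler_powR // ?ler1n // lerN2. Qed.

Lemma pow2n_lt k l : k < l -> pow2n l < pow2n k :> R.
Proof.
move=> kl; rewrite /pow2n /powR pnatr_eq0 /= ltr_expR ltr_pM2r ?ltrN2 //.
by rewrite ln_gt0 // ltr1n.
Qed.

Lemma pow2n4 : pow2n 4^-1 ^+ 4 = 2^-1 :> R.
Proof.
rewrite -pow2n1 -[1 in RHS](_ : 4^-1 + 4^-1 + (4^-1 + 4^-1) = 1); last by field.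
by rewrite !pow2nD !exprS expr0 mulr1 !mulrA.
Qed.

Lemma pow2n4_bounds : 3 / 4 < (pow2n 4^-1 : R) < 9 / 10.
Proof.
have := pow2n4; have := pow2n_gt0 4^-1; move: (pow2n _ : R) => a a0 a4.
have a2 : a ^+ 4 = (a ^+ 2) ^+ 2 by rewrite -exprM.
apply/andP; split; rewrite ltNge; apply/negP => h.
  have : a ^+ 4 <= (3 / 4) ^+ 4 by apply: lerXn2r; rewrite ?nnegrE // ltW.
  by rewrite a4; lra.
have : (9 / 10) ^+ 4 <= a ^+ 4 by apply: lerXn2r; rewrite ?nnegrE ?(ltW a0).
by rewrite a4; lra.
Qed.

Lemma eta_gt0 (delta k : R) : 0 < delta -> 0 < eta delta k.
Proof.
move=> d0; have /andP[_ h] := pow2n4_bounds.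
by rewrite /eta mulr_gt0 // mulr_gt0 ?pow2n_gt0 // subr_gt0; lra.
Qed.

Lemma eta_le (delta k l : R) : 0 < delta -> k <= l -> eta delta l <= eta delta k.
Proof.
move=> d0 kl; have /andP[_ h] := pow2n4_bounds.
rewrite /eta ler_wpM2r ?(ltW d0) // ler_wpM2r ?pow2n_le //.
by rewrite subr_ge0; lra.
Qed.

Lemma eta_lt (delta k l : R) : 0 < delta -> k < l -> eta delta l < eta delta k.
Proof.
move=> d0 kl; have /andP[_ h] := pow2n4_bounds.
rewrite /eta ltr_pM2r // ltr_pM2r ?subr_gt0; last by lra.
exact: pow2n_lt.
Qed.

(** The origin of the factor 1 - 2^(-1/4): eta at k - 1/4 is the gap between the radii of the levels
    k and k - 1/4. *)
Lemma eta_sum (delta k : R) : pow2n k * delta + eta delta (k - 4^-1) = pow2n (k - 4^-1) * delta.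
Proof.
have -> : pow2n k = pow2n (k - 4^-1) * pow2n 4^-1 by rewrite -pow2nD subrK.
by rewrite /eta; ring.
Qed.

(** With a = 2^(-1/4) the claim is a^2 + a^3 - a^4 < 1. It ensures that a point within eta_{k+1/4}
    of the level k lies well inside the level k - 1/2. *)
Lemma eta_room (delta k : R) : 0 < delta ->
  pow2n k * delta + eta delta (k + 4^-1) < pow2n (k - 2^-1) * delta.
Proof.
move=> d0; set a := pow2n 4^-1 : R.
have Ek : pow2n k = pow2n (k - 2^-1) * (a * a).
  by rewrite /a -!pow2nD; congr pow2n; field.
rewrite /eta pow2nD Ek -/a.
have -> : pow2n (k - 2^-1) * (a * a) * delta + pow2n (k - 2^-1) * (a * a) * a * (1 - a) * delta =
   pow2n (k - 2^-1) * delta * (a ^+ 2 + a ^+ 3 - a ^+ 4) by ring.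
rewrite gtr_pMr ?mulr_gt0 ?pow2n_gt0 // pow2n4.
have /andP[h1 h2] := pow2n4_bounds; rewrite -/a in h1 h2.
have a2 : a ^+ 2 < 3 / 4.
  rewrite ltNge; apply/negP => h; have := pow2n4; rewrite -/a.
  have -> : a ^+ 4 = a ^+ 2 * a ^+ 2 by ring.
  nra.
have a3 : a ^+ 3 < 7 / 10.
  have -> : a ^+ 3 = a * a ^+ 2 by ring.
  nra.
lra.
Qed.

End Pow2.

(** * Distances, open sets and compact sets in the charts of an atlas with admissible metric *)

Section Metric.
Context {R : realType} {TX : topologicalType} {K : atlas R TX}.
Hypothesis hK : core K.
Context {d : metric_family K}.
Hypothesis hd : admissible_metric d.
Implicit Types I J L H : {set 'I_(aN K)}.

Lemma real_cls I (x : kT (ach K I)) : idx K I -> dom (ach K I) x -> realization K (cls x).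
Proof. by move=> hI xd; exists I, x. Qed.

Lemma d_ge0 a b : realization K a -> realization K b -> 0 <= d a b.
Proof. by case: hd => -[h _ _ _] _ _; exact: h. Qed.

Lemma d_refl a : realization K a -> d a a = 0.
Proof. by case: hd => -[_ h _ _] _ _ ha; apply/h. Qed.

Lemma d_eq0 a b : realization K a -> realization K b -> d a b = 0 -> a = b.
Proof. by case: hd => -[_ h _ _] _ _ ha hb; move/h; apply. Qed.

Lemma d_sym a b : realization K a -> realization K b -> d a b = d b a.
Proof. by case: hd => -[_ _ h _] _ _; exact: h. Qed.

Lemma d_tri b a c : realization K a -> realization K b -> realization K c ->
  d a c <= d a b + d b c.
Proof. by case: hd => -[_ _ _ h] _ _; exact: h. Qed.

Lemma open_ball I (A : set (kT (ach K I))) x : idx K I -> open_in (dom (ach K I)) A -> A x ->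
  exists2 r : R, 0 < r & forall y, dom (ach K I) y -> d (cls x) (cls y) < r -> A y.
Proof.
move=> hI oA Ax; case: hd => _ _ /(_ I hI)[_ it].
have sA : A `<=` dom (ach K I) by case: oA => Q _ -> y [].
have [r r0 rA] := (it A sA).1 oA x Ax.
by exists r => // y yd yr; apply: rA.
Qed.

Lemma ball_open I (A : set (kT (ach K I))) : idx K I -> A `<=` dom (ach K I) ->
  (forall x, A x -> exists2 r : R, 0 < r &
     forall y, dom (ach K I) y -> d (cls x) (cls y) < r -> A y) ->
  open_in (dom (ach K I)) A.
Proof.
move=> hI sA H; case: hd => _ _ /(_ I hI)[_ it]; apply/(it A sA) => x Ax.
by have [r r0 rA] := H x Ax; exists r => // y [yd yr]; exact: rA.
Qed.

Lemma dball_open I a (r : R) : idx K I -> realization K a ->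
  open_in (dom (ach K I)) [set y | dom (ach K I) y /\ d a (cls y) < r].
Proof.
move=> hI ha; apply: ball_open => // [y []//|x [xd xr]].
exists (r - d a (cls x)); first by rewrite subr_gt0.
move=> y yd yr; split=> //.
apply: le_lt_trans (d_tri ha (real_cls hI xd) (real_cls hI yd)) _.
by rewrite -ltrBrDl.
Qed.

Lemma dball_coopen I a (r : R) : idx K I -> realization K a ->
  open_in (dom (ach K I)) [set y | dom (ach K I) y /\ r < d a (cls y)].
Proof.
move=> hI ha; apply: ball_open => // [y []//|x [xd xr]].
exists (d a (cls x) - r); first by rewrite subr_gt0.
move=> y yd yr; split=> //.
have := d_tri ha (real_cls hI yd) (real_cls hI xd).
rewrite [d (cls y) _]d_sym; [|exact: real_cls..].
by move: yr; lra.
Qed.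

Lemma closure_ball I (A : set (kT (ach K I))) x r : idx K I -> A `<=` dom (ach K I) ->
  closure_in (dom (ach K I)) A x -> 0 < r -> exists2 y, A y & d (cls x) (cls y) < r.
Proof.
move=> hI sA [xd cx] r0; have [U oU EU] := dball_open r hI (real_cls hI xd).
have Ux : U x.
  suff : (dom (ach K I) `&` U) x by case.
  by rewrite -EU; split=> //; rewrite d_refl //; exact: real_cls.
have [y [Ay Uy]] := cx U (open_nbhs_nbhs (conj oU Ux)).
exists y => //; suff : (dom (ach K I) `&` U) y by rewrite -EU => -[].
by split=> //; exact: sA.
Qed.

Lemma compact_cball I (A : set (kT (ach K I))) a (r : R) : idx K I -> realization K a ->
  A `<=` dom (ach K I) -> compact A -> compact (A `&` [set y | d a (cls y) <= r]).
Proof.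
move=> hI ha sA cA; have [U oU EU] := dball_coopen r hI ha.
have -> : A `&` [set y | d a (cls y) <= r] = A `&` ~` U.
  rewrite eqEsubset; split=> y [Ay hy]; split=> //.
    move=> Uy; have : (dom (ach K I) `&` U) y by split=> //; exact: sA.
    by rewrite -EU => -[_]; rewrite ltNge hy.
  rewrite /= leNgt; apply/negP => h; apply: hy.
  have : (dom (ach K I) `&` U) y by rewrite -EU; split=> //; exact: sA.
  by case.
by apply: compact_closedI => //; exact: open_closedC.
Qed.

(** Compactness as an induction principle. If [P A] failed, the sets containing A minus some B with
    [P B] would form a proper filter, and the local hypothesis at a cluster point would contradict
    it. *)
Lemma compact_ind I (A : set (kT (ach K I))) (P : set (kT (ach K I)) -> Prop) :
  idx K I -> A `<=` dom (ach K I) -> compact A ->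
  P set0 -> (forall B C, P B -> P C -> P (B `|` C)) ->
  (forall x, A x -> exists2 r : R, 0 < r & P (A `&` [set y | d (cls x) (cls y) <= r])) ->
  P A.
Proof.
move=> hI sA cA P0 PU Pl.
apply: contrapT => nPA.
pose F := [set S | exists B, [/\ B `<=` A, P B & A `\` B `<=` S]].
have FF : ProperFilter F.
  split; first by move=> [B [BA PB AB]]; apply: nPA; suff <- : B = A by [];
    rewrite eqEsubset; split=> // x Ax; apply: contrapT => Bx; exact: (AB x).
  split.
  - by exists set0; split=> //; exact: sub0set.
  - move=> S S' [B [BA PB AB]] [B' [BA' PB' AB']]; exists (B `|` B'); split.
    + by move=> x [/BA|/BA'].
    + exact: PU.
    + by move=> x [Ax nB]; split; [apply: AB|apply: AB']; split=> // h; apply: nB; [left|right].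
  - by move=> S S' SS' [B [BA PB AB]]; exists B; split=> // x /AB /SS'.
have FA : F A by exists set0; split=> // x [].
have [x [Ax cx]] := cA F FF FA.
have [r r0 Pr] := Pl x Ax.
have [U oU EU] := dball_open r hI (real_cls hI (sA _ Ax)).
have Ux : U x.
  suff : (dom (ach K I) `&` U) x by case.
  rewrite -EU; split; first exact: sA.
  by rewrite d_refl //; apply: real_cls => //; exact: sA.
have Fr : F (A `\` (A `&` [set y | d (cls x) (cls y) <= r])).
  by exists (A `&` [set y | d (cls x) (cls y) <= r]); split=> // y [].
have [y [[Ay nBy] Uy]] := cx _ _ Fr (open_nbhs_nbhs (conj oU Ux)).
apply: nBy; split=> //=; apply: ltW.
suff : (dom (ach K I) `&` U) y by rewrite -EU => -[].
by split=> //; exact: sA.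
Qed.

Lemma dist_compact I (A : set (kT (ach K I))) a : idx K I -> realization K a ->
  A `<=` dom (ach K I) -> compact A ->
  (exists2 y, A y & cls y = a) \/
  (exists2 r : R, 0 < r & forall y, A y -> r <= d a (cls y)).
Proof.
move=> hI ha sA cA; have [|nA] := pselect (exists2 y, A y & cls y = a); first by left.
right; apply: (@compact_ind I A (fun B => exists2 r : R, 0 < r & forall y, B y -> r <= d a (cls y))) => //.
- by exists 1.
- move=> B C [r r0 rB] [s s0 sC]; exists (Num.min r s); first by rewrite lt_min r0.
  by move=> y [/rB|/sC] h; rewrite ge_min h ?orbT.
move=> x Ax; have rx := real_cls hI (sA _ Ax).
have dx : 0 < d a (cls x).
  rewrite lt_def d_ge0 // andbT; apply/eqP => /d_eq0 E; apply: nA.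
  by exists x => //; rewrite E.
exists (d a (cls x) / 2); first by rewrite divr_gt0.
exists (d a (cls x) / 2); first by rewrite divr_gt0.
move=> y [Ay /= yx]; have ry := real_cls hI (sA _ Ay).
by have := d_tri ha ry rx; rewrite [d (cls y) _]d_sym //; lra.
Qed.

Lemma compact_closure_in I (A B : set (kT (ach K I))) : A `<=` B ->
  compact (closure_in (dom (ach K I)) B) -> compact (closure_in (dom (ach K I)) A).
Proof.
move=> AB cB; have -> : closure_in (dom (ach K I)) A = closure_in (dom (ach K I)) B `&` closure A.
  rewrite eqEsubset; split=> x; first by move=> [xd cx]; split=> //; split=> //; exact: closure_subset cx.
  by move=> [[xd _] cx].
by apply: compact_closedI => //; exact: closed_closure.
Qed.

End Metric.

(** * Smooth functions on manifolds: locality, composition and sums *)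

Section SmoothCalculus.
Context {R : realType} {T T' : topologicalType} {W : vectType R}.
Implicit Types (M : manifold R T) (D : set T) (f : T -> W).

Lemma smooth_fun_loc M D f : smooth_atlas M -> D `<=` carrier M ->
  (forall x, D x -> exists c g, rep M D f x c g) -> smooth_fun M D f.
Proof.
move=> MA sD H c hc _ [x [cx Dx] <-]; have [c' [g [hc' cx' hg]]] := H x Dx.
have [h hh] := chart_transition MA hc hc' cx cx'.
pose S := cmap c @` (cdom c `&` (D `&` cdom c')).
have hh' : ext S (cmap c' \o cinv c) (cmap c x) h.
  by apply: ext_sub hh => _ [y [cy [_ cy']] <-]; exists y.
have Sx : S (cmap c x) by exists x.
have SD v : S v -> (cmap c' @` (cdom c' `&` D)) ((cmap c' \o cinv c) v).
  by move=> [y [cy [Dy cy']] <-] /=; rewrite (cmapK MA) //; exists y.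
have E : cmap c' x = (cmap c' \o cinv c) (cmap c x) by rewrite /= (cmapK MA).
rewrite E in hg; have := ext_comp Sx SD hh' hg.
move=> [U [oU Ux hU UE]].
have [Q oQ EQ] := cdom_open MA hc'.
have hr : rep M (D `&` cdom c') f x c (g \o h).
  split=> //; exists U; split=> // _ [y [cy [Dy cy']] <-] Uy.
  by rewrite UE //=; [rewrite !(cmapK MA)|exists y].
have Qx : Q x by have : cdom c' x by []; rewrite EQ => -[].
have [|_ _ [U' [oU' Ux' hU' UE']]] := rep_local MA oQ Qx _ hr (D := D).
  by move=> y Dy Qy; split=> //; rewrite EQ; split=> //; exact: sD.
by exists (g \o h), U'.
Qed.

Lemma smooth_fun_rep M D f x : smooth_atlas M -> D `<=` carrier M -> smooth_fun M D f -> D x ->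
  exists c g, rep M D f x c g.
Proof.
move=> MA sD sf Dx; have [hc cx] := chart_atP MA (sD _ Dx).
by have [g hg] := rep_exists sf Dx hc cx; exists (chart_at M x), g.
Qed.

Lemma smooth_fun_glue M D f : smooth_atlas M -> D `<=` carrier M ->
  (forall x, D x -> exists Q D' f', [/\ open Q, Q x, D' x, D' `<=` carrier M &
     smooth_fun M D' f' /\ forall y, D y -> Q y -> D' y /\ f' y = f y]) ->
  smooth_fun M D f.
Proof.
move=> MA sD H; apply: smooth_fun_loc => // x Dx.
have [Q [D' [f' [oQ Qx D'x sD' [sf QD]]]]] := H x Dx.
have [c [g hr]] := smooth_fun_rep MA sD' sf D'x.
exists c, g; apply: (rep_local (D' := D `&` Q) MA oQ Qx) => //.
apply: (rep_eq (f := f')) => //; first by move=> y [Dy Qy]; case: (QD y Dy Qy).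
by apply: rep_sub hr => y [Dy Qy]; case: (QD y Dy Qy).
Qed.

Lemma smooth_fun_eq M D f f' : smooth_atlas M -> (forall y, D y -> f y = f' y) ->
  smooth_fun M D f -> smooth_fun M D f'.
Proof.
move=> MA ff sf c hc _ [x [cx Dx] <-]; have [g hr] := rep_exists sf Dx hc cx.
by have [_ _ hg] := rep_eq MA ff hr; exists g.
Qed.

Lemma smooth_fun_sub M D D' f : D' `<=` D -> smooth_fun M D f -> smooth_fun M D' f.
Proof.
move=> sD sf c hc _ [x [cx Dx] <-]; have [g hr] := rep_exists sf (sD _ Dx) hc cx.
by have [_ _ hg] := rep_sub sD hr; exists g.
Qed.

Lemma smooth_fun_comp (N : manifold R T') M D (D' : set T') (phi : T -> T') (f : T' -> W) :
  smooth_atlas M -> smooth_atlas N -> D `<=` carrier M -> D' `<=` carrier N ->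
  smooth_map M N D phi -> (forall x, D x -> D' (phi x)) ->
  smooth_fun N D' f -> smooth_fun M D (f \o phi).
Proof.
move=> MM MN sD sD' [_ cphi sphi] DD sf; apply: smooth_fun_loc => // x Dx.
have [hc cx] := chart_atP MM (sD _ Dx); set c := chart_at M x in hc cx *.
have [hc' cx'] := chart_atP MN (sD' _ (DD _ Dx)).
set c' := chart_at N (phi x) in hc' cx' *.
have [g [_ _ hg]] := rep_exists sf (DD _ Dx) hc' cx'.
pose S := cmap c @` (cdom c `&` D `&` phi @^-1` cdom c').
have Sx : S (cmap c x) by exists x.
have [gp hgp] := smooth_in_row (sphi c c' hc hc') Sx.
have SD v : S v -> (cmap c' @` (cdom c' `&` D')) ((cmap c' \o phi \o cinv c) v).
  move=> [y [[cy Dy] cy'] <-] /=; rewrite (cmapK MM) //; exists (phi y) => //.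
  by split=> //; exact: DD.
have E : cmap c' (phi x) = (cmap c' \o phi \o cinv c) (cmap c x) by rewrite /= (cmapK MM).
rewrite E in hg; have [U [oU Ux hU UE]] := ext_comp Sx SD hgp hg.
have [Q oQ EQ] := cdom_open MN hc'.
have [Q' oQ' EQ'] := open_in_preimage cphi oQ.
exists c, (g \o gp); apply: (rep_local (D' := D `&` phi @^-1` cdom c') MM oQ').
- suff : (D `&` Q') x by case.
  by rewrite -EQ'; split=> //=; have : cdom c' (phi x) by []; rewrite EQ => -[].
- move=> y Dy Qy; split=> //=; rewrite EQ; split; first exact/sD'/DD.
  suff : (D `&` phi @^-1` Q) y by case.
  by rewrite EQ'.
- split=> //; exists U; split=> // _ [y [cy [Dy cy']] <-] Uy.
  rewrite UE //=; last by exists y.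
  by rewrite (cmapK MM) // (cmapK MN).
Qed.

Lemma smooth_fun_cst M D w : smooth_fun M D (fun=> w : W).
Proof.
move=> c hc v Dv; exists (fun=> v2r w), setT; split=> //; first exact: openT.
by apply: Cinfty_cst; exact: openT.
Qed.

Lemma smooth_funD M D f f' : smooth_fun M D f -> smooth_fun M D f' ->
  smooth_fun M D (fun x => f x + f' x).
Proof.
move=> sf sf' c hc v Dv; have [g hg] := sf c hc v Dv; have [g' hg'] := sf' c hc v Dv.
have [[U [oU Ux hU UE]] _] := extD hg hg'; exists (fun y => g y + g' y), U; split=> //.
by move=> y Dy Uy; rewrite UE //= linearD.
Qed.

Lemma smooth_fun_pert k q M D f (F : T -> 'rV[R]_q) (B : 'M[R]_(k, dim W)) p :
  smooth_atlas M -> smooth_fun M D f -> smooth_fun M D F ->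
  smooth_fun M D (pert f F B p).
Proof.
move=> MA sf sF c hc _ [x [cx Dx] <-].
have [g hr] := rep_exists sf Dx hc cx.
have Sx : (cmap c @` (cdom c `&` D)) (cmap c x) by exists x.
have [h hh] := smooth_in_row (sF c hc) Sx.
have [|[_ _ hg] _] := rep_pert B p hr (F := F) (h := h); first by split.
by exists (fun v => g v + h v *m p *m B).
Qed.

End SmoothCalculus.

Lemma smooth_fun_chart (R : realType) (T : topologicalType) n (M : manifold R T) c (h : 'rV[R]_(mdim M) -> 'rV[R]_n) :
  smooth_atlas M -> charts M c -> Cinfty setT h -> smooth_fun M (cdom c) (h \o cmap c).
Proof.
move=> MA hc hh; apply: smooth_fun_loc => // [x /(cdom_sub MA)|x cx]; first exact.
have Cv : Cinfty setT (fun v => v2r (h v)).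
  have -> : (fun v => v2r (h v)) = (fun v => h v *m lin1_mx v2r).
    by apply/funext => y; rewrite mul_rV_lin1.
  by apply: Cinfty_mulmx => //; exact: openT.
exists c, (fun v => v2r (h v)); split=> //; exists setT; split=> //; first exact: openT.
by move=> _ [y [cy _] <-] _ /=; rewrite (cmapK MA).
Qed.

(** * Functions on the realization that come from one chart *)

Section Spread.
Context {R : realType} {TX : topologicalType} {K : atlas R TX} (hK : core K).
Context {W : vectType R} (M : {set 'I_(aN K)}) (hM : idx K M).

(** Values are attached to classes rather than to points of charts, so the pullbacks to all charts
    agree under the coordinate changes. *)
Definition spread (G : kT (ach K M) -> W) (a : set (point K)) : W :=
  if pselect (exists z, dom (ach K M) z /\ a = cls z) is left h then G (projT1 (cid h)) else 0.

Lemma spread_cls G z : dom (ach K M) z -> spread G (cls z) = G z.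
Proof.
move=> dz; rewrite /spread; case: pselect => [h|]; last by case; exists z.
by case: (cid h) => z' /= [dz' E]; rewrite (cls_inj hK hM dz E).
Qed.

Lemma spread_neq0 G a : spread G a != 0 -> exists z, [/\ dom (ach K M) z, a = cls z & G z != 0].
Proof.
rewrite /spread; case: pselect => [h|]; last by rewrite eqxx.
by case: (cid h) => z /= [dz E] Gz; exists z.
Qed.

(** On U_LM the pullback is the composite with the coordinate change to M. Smoothness can only fail
    at points outside U_LM, where the last hypothesis makes the function vanish nearby. *)
Lemma spread_smooth G L D : idx K L -> L \subset M ->
  smooth_fun (kU (ach K M)) (dom (ach K M)) G -> open_in (dom (ach K L)) D ->
  (forall y, D y -> ~ aU K L M y -> exists Q, [/\ open Q, Q y &
     forall y', D y' -> Q y' -> spread G (cls y') = 0]) ->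
  smooth_fun (kU (ach K L)) D (fun y => spread G (cls y)).
Proof.
move=> hL LM sG oD H; have ML := co_man hK hL; have MM := co_man hK hM.
have sD : D `<=` dom (ach K L) by case: oD => Q _ -> y [].
apply: smooth_fun_glue => // y Dy.
have [Uy|nUy] := pselect (aU K L M y); last first.
  have [Q [oQ Qy Q0]] := H y Dy nUy; exists Q, D, (fun=> 0); split=> //; split.
    exact: smooth_fun_cst.
  by move=> y' Dy' Qy'; rewrite Q0.
have oU := aU_open hK hL hM LM.
have [Q [oQ Qy QU]] := open_in_nbhd oU Uy.
have sU : aU K L M `<=` dom (ach K L) by move=> z; exact: aU_dom.
exists Q, (aU K L M), (G \o aphi K M); split=> //; split; last first.
  move=> y' Dy' Qy'; have Uy' := QU _ (sD _ Dy') Qy'; split=> //=.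
  by rewrite -(cls_aphi hL hM LM Uy') spread_cls //; exact: aphi_dom Uy'.
have [E|pLM] := subset_eqVproper LM.
  subst L; rewrite aUid //; apply: smooth_fun_eq sG => // z dz /=.
  by rewrite aphi_id.
apply: smooth_fun_comp sG => //; last by move=> x; exact: aphi_dom.
exact: co_map.
Qed.

End Spread.

(** * Levels of neighbourhoods of a reduction *)

Section Levels.
Context {R : realType} {TX : topologicalType} {K : atlas R TX}.
Implicit Types I J L H : {set 'I_(aN K)}.

(* Closed atlases are treated with j = 0, cobordisms with j = 1; perturbations
   of index J are defined on [Dlev] and made transverse on [Tlev]. *)
Definition lev (j : nat) J : R := (#|J| + j)%:R.

(** The shift by 1/8 yields an open set around the compact set [Tlev], and is less than the quarter
    by which the regions shrink. *)
Definition Dlev (d : metric_family K) (V : dom_family K) delta j : dom_family K :=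
  fun J => Vk d V delta (lev j J - 8^-1) J.

Definition Tlev (d : metric_family K) (V : dom_family K) delta j : dom_family K :=
  fun J => closure_in (dom (ach K J)) (Vk d V delta (lev j J) J).

(** Where the perturbation on J has to take values in E_H. For k = lev - 1/4 the radius is eta at
    lev - 1/2, and this is exactly the neighbourhood removed in the definition of [sigma]. *)
Definition Reg (d : metric_family K) (V : dom_family K) delta k J H : set (kT (ach K J)) :=
  nbhdU d (eta delta (k - 4^-1)) (Nk d V delta k J H).

Lemma lev_ge1 j J : idx K J -> 1 <= lev j J.
Proof.
by move=> hJ; rewrite /lev ler1n; case: hJ; rewrite -finset.card_gt0 => h _; rewrite addn_gt0 h.
Qed.

Lemma lev_lt j H J : H \proper J -> lev j H + 1 <= lev j J.
Proof. by move=> /proper_card h; rewrite /lev natr1 ler_nat -addSn leq_add2r. Qed.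

End Levels.
Arguments Dlev {R TX K} d V delta j I.
Arguments Tlev {R TX K} d V delta j I.
Arguments Reg {R TX K} d V delta k J H _.

Section Separated.
Context {R : realType} {TX : topologicalType} {K : atlas R TX} (hK : core K).
Context {d : metric_family K} (hd : admissible_metric d).
Context {V : dom_family K} {delta : R} (d0 : 0 < delta).
Arguments V : clear implicits.
Hypothesis hV : forall I, idx K I -> V I `<=` dom (ach K I).
Hypothesis sep : separating d V delta.
Implicit Types I J L H : {set 'I_(aN K)}.

Lemma nbhdU_open I (A : set (kT (ach K I))) r : idx K I -> A `<=` dom (ach K I) ->
  open_in (dom (ach K I)) (nbhdU d r A).
Proof.
move=> hI sA; apply: (ball_open hd hI) => [x []//|x [xd [y Ay xy]]].
exists (r - d (cls x) (cls y)); first by rewrite subr_gt0.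
move=> x' xd' xx'; split=> //; exists y => //; rewrite /pull_metric.
have rx := real_cls hI xd; have rx' := real_cls hI xd'; have ry := real_cls hI (sA _ Ay).
have := d_tri hd rx' rx ry; rewrite [d (cls x') (cls x)](d_sym hd) //.
by move: xx'; lra.
Qed.

Lemma Vk_dom I k x : Vk d V delta k I x -> dom (ach K I) x.
Proof. by case. Qed.

Lemma Vk_open I k : idx K I -> open_in (dom (ach K I)) (Vk d V delta k I).
Proof. by move=> hI; apply: nbhdU_open => //; exact: hV. Qed.

Lemma Vk_le I k l x : k <= l -> Vk d V delta l I x -> Vk d V delta k I x.
Proof.
move=> kl [xd [y Vy xy]]; split=> //; exists y => //; apply: lt_le_trans xy _.
by rewrite ler_wpM2r ?(ltW d0) // pow2n_le.
Qed.

Lemma Vk_near I k r x a : idx K I -> Vk d V delta k I x -> realization K a -> d a (cls x) < r ->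
  exists2 v, V I v & d a (cls v) < r + pow2n k * delta.
Proof.
move=> hI [xd [v Vv xv]] ra ax; exists v => //.
have := d_tri hd ra (real_cls hI xd) (real_cls hI (hV hI Vv)).
by move: xv ax; rewrite /pull_metric; lra.
Qed.

Lemma near_sep I J a : idx K I -> idx K J -> realization K a ->
  (exists2 v, V I v & d a (cls v) < 2 * delta) -> (exists2 v, V J v & d a (cls v) < 2 * delta) ->
  I \subset J \/ J \subset I.
Proof.
move=> hI hJ ra [v Vv av] [w Vw aw]; case: sep => _ /(_ I J hI hJ); apply.
exists a; split; split=> //; first by exists (cls v) => //; exists v.
by exists (cls w) => //; exists w.
Qed.

Lemma Vk_closure_near I k x r : idx K I -> closure_in (dom (ach K I)) (Vk d V delta k I) x ->
  0 < r -> exists2 v, V I v & d (cls x) (cls v) < r + pow2n k * delta.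
Proof.
move=> hI cx r0; have xd : dom (ach K I) x by case: cx.
have [y Vy xy] := closure_ball hd hI (@Vk_dom I k) cx r0.
exact: Vk_near hI Vy (real_cls hI xd) xy.
Qed.

Lemma Vk_closure_lt I k l x : idx K I -> k < l ->
  closure_in (dom (ach K I)) (Vk d V delta l I) x -> Vk d V delta k I x.
Proof.
move=> hI kl cx; split; first by case: cx.
have [|v Vv xv] := @Vk_closure_near I l x ((pow2n k - pow2n l) * delta) hI cx.
  by rewrite mulr_gt0 // subr_gt0 pow2n_lt.
by exists v => //; move: xv; rewrite /pull_metric mulrBl subrK.
Qed.

Lemma Vk_compact I k : idx K I -> 0 <= k ->
  compact (closure_in (dom (ach K I)) (Vk d V delta k I)).
Proof.
move=> hI k0; case: sep => /(_ I hI)[_ cV] _; apply: compact_closure_in cV => x [xd [v Vv xv]].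
split=> //; exists v => //; apply: lt_le_trans xv _; rewrite ler_wpM2r ?(ltW d0) //.
by have := pow2n_le k0; rewrite pow2n0; lra.
Qed.

Variable j : nat.
Local Notation D := (Dlev d V delta j).
Local Notation T := (Tlev d V delta j).

Lemma Dlev_open I : idx K I -> open_in (dom (ach K I)) (D I).
Proof. exact: Vk_open. Qed.

Lemma Dlev_dom I x : D I x -> dom (ach K I) x.
Proof. exact: Vk_dom. Qed.

Lemma Tlev_sub I : idx K I -> T I `<=` D I.
Proof. by move=> hI x; apply: Vk_closure_lt => //; rewrite ltrBlDr ltrDl invr_gt0. Qed.

Lemma Tlev_compact I : idx K I -> compact (T I).
Proof. by move=> hI; apply: Vk_compact; rewrite // /lev. Qed.

Lemma Dlev_closure_near I x r : idx K I -> closure_in (dom (ach K I)) (D I) x ->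
  0 < r -> exists2 v, V I v & d (cls x) (cls v) < r + delta.
Proof.
move=> hI cx r0; have [v Vv xv] := Vk_closure_near hI cx r0; exists v => //.
apply: lt_le_trans xv _; rewrite lerD2l ger_pMl // -[leRHS]pow2n0 pow2n_le //.
by have := lev_ge1 (R:=R) j hI; lra.
Qed.

Lemma Reg_dom k J H x : Reg d V delta k J H x -> dom (ach K J) x.
Proof. by case. Qed.

Lemma Nk_dom k J H x : Nk d V delta k J H x -> dom (ach K J) x.
Proof. by case=> /Vk_dom. Qed.

Lemma Reg_open k J H : idx K J -> open_in (dom (ach K J)) (Reg d V delta k J H).
Proof. by move=> hJ; apply: nbhdU_open => // x; exact: Nk_dom. Qed.

Lemma Reg_near k J H y : idx K J -> idx K H -> H \proper J -> Reg d V delta k J H y ->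
  exists2 v, V H v & d (cls y) (cls v) < pow2n (k - 4^-1) * delta.
Proof.
move=> hJ hH HJ [yd [w [Vw [z [Vz Uz] Ew]]]]; subst w; rewrite /pull_metric (cls_aphi hH hJ (proper_sub HJ)) // => yw.
have [v Vv yv] := Vk_near hH Vz (real_cls hJ yd) yw; exists v => //.
by move: yv; rewrite addrC eta_sum.
Qed.

Lemma Reg_aphi k J H z : idx K J -> idx K H -> H \proper J -> aU K H J z ->
  Reg d V delta k J H (aphi K J z) -> Vk d V delta (k - 4^-1) H z.
Proof.
move=> hJ hH HJ Uz /(Reg_near hJ hH HJ)[v Vv].
rewrite (cls_aphi hH hJ (proper_sub HJ)) // => zv; split; last by exists v.
exact: aU_dom (proper_sub HJ) Uz.
Qed.

(** Room for a function added at x0: it must vanish on all regions for H in L with J in L but not in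
    H, since nu_L is bound to nu_H there while nu_H does not change. If H is contained in J, a
    region of this kind close to x0 would put x0 in the larger region excluded by hypothesis;
    otherwise separation applies. *)
Lemma Reg_far J x0 : idx K J -> T J x0 ->
  (forall H, idx K H -> H \proper J -> ~ Reg d V delta (lev j J - 2^-1) J H x0) ->
  exists2 r : R, 0 < r & forall L H (k : R) y, idx K L -> idx K H -> H \proper L ->
    J \subset L -> ~ J \subset H ->
    (L = J /\ lev j J - 4^-1 <= k) \/ (J \proper L /\ lev j J + 2^-1 <= k) ->
    Reg d V delta k L H y -> r <= d (cls x0) (cls y).
Proof.
move=> hJ Tx nR; set k0 := lev j J in nR *.
(* [g1] is the difference of the region radii at levels k0 - 1/2 and k0 - 1/4. [g2] is the slack in
   [eta_room]; it places the image of z in V_J at level k0 - 1/2 when L is larger than J. *)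
pose g1 := eta delta (k0 - 2^-1 - 4^-1) - eta delta (k0 - 4^-1 - 4^-1).
pose g2 := pow2n (k0 - 2^-1) * delta - (pow2n k0 * delta + eta delta (k0 + 4^-1)).
have g10 : 0 < g1 by rewrite subr_gt0 eta_lt //; lra.
have g20 : 0 < g2 by rewrite subr_gt0; exact: eta_room.
exists (Num.min (delta / 2) (Num.min g1 (g2 / 2))).
  by rewrite !lt_min g10 !divr_gt0.
move=> L H k y hL hH HL JL JH kk Ry; rewrite leNgt !lt_min; apply/negP => /and3P[h1 h2 h3].
have k1 : 1 <= k0 by exact: lev_ge1.
have xd : dom (ach K J) x0 by case: Tx.
have yd := Reg_dom Ry.
have rx := real_cls hJ xd; have ry := real_cls hL yd.
have kge : 0 <= k - 4^-1 by case: kk => -[_ kk]; lra.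
have p1 : pow2n (k - 4^-1) <= 1 :> R by rewrite -[leRHS]pow2n0 pow2n_le.
have [HJ|HJ] := boolP (H \subset J).
- have pHJ : H \proper J by rewrite /(_ \proper _) HJ; apply/negP.
  case: Ry => _ [w [Vw [z [Vz Uz] Ew]]]; subst w; rewrite /pull_metric (cls_aphi hH hL (proper_sub HL)) //.
  have zd := aU_dom hK hH hL (proper_sub HL) Uz; have rz := real_cls hH zd.
  move=> yz; have xz := d_tri hd rx ry rz.
  case: kk => [[EL kk]|[pJL kk]].
  + subst L; apply: (nR H hH pHJ); split=> //; exists (aphi K J z).
      split; first by apply: Vk_le Vw; lra.
      by exists z => //; split=> //; apply: Vk_le Vz; lra.
    rewrite /pull_metric (cls_aphi hH hL HJ) //.
    have : eta delta (k - 4^-1) <= eta delta (k0 - 4^-1 - 4^-1) by apply: eta_le => //; lra.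
    by rewrite /g1 in h2; lra.
  + have Uz' := aU_sub hK hH hJ hL HJ (proper_sub pJL) Uz.
    have hk : eta delta (k - 4^-1) <= eta delta (k0 + 4^-1) by apply: eta_le => //; lra.
    apply: (nR H hH pHJ); split=> //; exists (aphi K J z); last first.
      rewrite /pull_metric (cls_aphi hH hJ HJ) //.
      have : eta delta (k0 + 4^-1) <= eta delta (k0 - 4^-1 - 4^-1) by apply: eta_le => //; lra.
      by rewrite /g1 in h2; lra.
    split; last by exists z => //; split=> //; apply: Vk_le Vz; lra.
    have zd' := aphi_dom hK hH hJ HJ Uz'; split=> //.
    have [|v Vv xv] := @Vk_closure_near J k0 x0 (g2 / 2) hJ Tx; first by rewrite divr_gt0.
    exists v => //; rewrite /pull_metric (cls_aphi hH hJ HJ) //.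
    have := d_tri hd rz rx (real_cls hJ (hV hJ Vv)).
    rewrite (d_sym hd rz rx); rewrite /g2 in h3 xv; lra.
(* Neither of H and J contains the other, so separation forbids a point this close to both V_J and
   V_H. *)
- have : J \subset H \/ H \subset J; last by case=> // h; move: HJ; rewrite h.
  apply: (near_sep hJ hH rx).
    have [v Vv xv] := Dlev_closure_near hJ (conj xd (subset_closure (Tlev_sub hJ Tx))) d0.
    by exists v => //; lra.
  have [v Vv yv] := Reg_near hL hH HL Ry; exists v => //.
  have := d_tri hd rx ry (real_cls hH (hV hH Vv)).
  have : pow2n (k - 4^-1) * delta <= delta by rewrite ger_pMl.
  by move: d0 h1 yv; clear; move: (d _ _) (d _ _) (d _ _) (pow2n _ * _) => ? ? ? ?; lra.
Qed.

End Separated.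

(** * Perturbations generated by functions on the realization *)

Lemma expand_near_id (R : realType) n (J : 'M[R]_n) : n%:R * `|J - 1%:M| <= 2^-1 ->
  forall w : 'cV[R]_n, `|w| <= 2 * `|J *m w|.
Proof.
move=> hJ w; have E : w = J *m w - (J - 1%:M) *m w by rewrite mulmxBl mul1mx subKr.
have h : `|(J - 1%:M) *m w| <= 2^-1 * `|w|.
  by apply: le_trans (norm_mulmx _ _) _; rewrite ler_wpM2r.
have : `|w| <= `|J *m w| + `|(J - 1%:M) *m w| by rewrite {1}E; exact: ler_normB.
by move: h; move: `|w| `|J *m w| `|_ *m w| => a b c; lra.
Qed.

Section Generators.
Context {R : realType} {TX : topologicalType} {K : atlas R TX} (hK : core K).
Context {d : metric_family K} (hd : admissible_metric d).
Context {V : dom_family K} {delta : R} (d0 : 0 < delta).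
Arguments V : clear implicits.
Hypothesis hV : forall I, idx K I -> V I `<=` dom (ach K I).
Hypothesis sep : separating d V delta.
Variable j : nat.
Implicit Types I J L H : {set 'I_(aN K)}.
Local Notation D := (Dlev d V delta j).
Local Notation T := (Tlev d V delta j).

(* The shape of the perturbations added while treating the index J: on the
   chart L they are [ahat K J L (F p)], with parameters p, if J ⊂ L, and 0
   otherwise.  As F lives on the realization, compatibility with the
   coordinate changes is automatic. *)
Record gen J (kap : {set 'I_(aN K)} -> R) (F0 : set (set (point K))) q
    (F : set (point K) -> 'rV[R]_q) : Prop := Gen {
  gen_smooth : forall L, idx K L -> J \subset L ->
    smooth_fun (kU (ach K L)) (D L) (fun y => F (cls y));
  gen_reg : forall L H y, idx K L -> idx K H -> H \proper L -> J \subset L -> ~ J \subset H ->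
    Reg d V delta (kap L) L H y -> F (cls y) = 0;
  gen_frozen : forall a, F0 a -> realization K a -> F a = 0;
  gen_bound : exists c, forall a, `|F a| <= c }.

(** The shape (1, h), with h expanding up to a factor, that [tv_dense] requires of F near y. *)
Definition good_form J q (F : set (point K) -> 'rV[R]_(1 + q)) (y : kT (ach K J))
    (e : mdim (kU (ach K J)) = q) :=
  exists (c : chart R (kT (ach K J)) (mdim (kU (ach K J)))) U (h : 'rV[R]_(mdim (kU (ach K J))) -> 'rV[R]_q),
  [/\ charts (kU (ach K J)) c /\ cdom c y, open U, U (cmap c y), Cinfty U h &
   (forall v, U v -> forall w : 'cV[R]_q, `|w| <= 2 * `|jac h v *m w| ) /\
   forall y', cdom c y' -> D J y' -> U (cmap c y') -> F (cls y') = row_mx 1%:M (h (cmap c y'))].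

Lemma aphi_chart I J (x : kT (ach K I)) : idx K I -> idx K J -> I \subset J -> aU K I J x ->
  exists c c' g, [/\ charts (kU (ach K I)) c, cdom c x,
    charts (kU (ach K J)) c', cdom c' (aphi K J x) &
    ext (cmap c @` (cdom c `&` aU K I J `&` aphi K J @^-1` cdom c'))
      (cmap c' \o aphi K J \o cinv c) (cmap c x) g /\ row_free (jac g (cmap c x))].
Proof.
move=> hI hJ /subset_eqVproper[E|IJ]; last exact: (co_imm hK).
subst J => Ux; have MI := co_man hK hI; have xd : dom (ach K I) x by rewrite -(aUid hK hI).
have [hc cx] := chart_atP MI xd; set c := chart_at _ x in hc cx *.
exists c, c, id; split=> //; first by rewrite (aphi_id hK).
split.
  exists setT; split=> //; [exact: openT|exact: Cinfty_id openT|].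
  move=> _ [y [[cy Uy] _] <-] _ /=; rewrite (cmapK MI) // (aphi_id hK) //.
  exact: cdom_sub cy.
have -> : (id : 'rV[R]_(mdim (kU (ach K I))) -> _) = (fun v => v *m 1%:M + 0).
  by apply/funext => v; rewrite mulmx1 addr0.
by rewrite jac_affine row_free_unit unitmx1.
Qed.

(** The indices L whose domains accumulate at x0 are pairwise comparable by separation, so there is
    a largest one. A function built in that chart pulls back to the smaller ones, and the remaining
    domains keep a distance from x0. *)
Lemma top_chart J x0 : idx K J -> T J x0 -> exists M, [/\ idx K M, J \subset M, aU K J M x0 &
  forall L, idx K L -> J \subset L -> (exists2 z, closure_in (dom (ach K L)) (D L) z & cls z = cls x0) ->
    L \subset M].
Proof.
move=> hJ Tx; have xd : dom (ach K J) x0 by case: Tx.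
pose P (L : {set 'I_(aN K)}) := `[< [/\ idx K L, J \subset L &
  exists2 z, closure_in (dom (ach K L)) (D L) z & cls z = cls x0] >].
have PJ : P J.
  apply/asboolP; split=> //; exists x0 => //; split=> //.
  exact/subset_closure/(Tlev_sub hd d0 hV hJ).
have [M mM JM] := maxset_exists PJ.
have /asboolP[hM _ [z0 Dz Ez]] := maxsetp mM.
have zd : dom (ach K M) z0 by case: Dz.
have [Ux zE] := cls_sub hK hJ xd JM (esym Ez).
exists M; split=> // L hL JL [z Lz zx].
have rx := real_cls hJ xd.
have PL : P L by apply/asboolP; split=> //; exists z.
have [||//|ML] := near_sep sep hL hM rx.
- have [v Vv zv] := Dlev_closure_near hd d0 hV hL Lz d0.
  by exists v => //; rewrite -zx; move: zv; rewrite mulrDl mul1r.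
- have [v Vv zv] := Dlev_closure_near hd d0 hV hM Dz d0.
  by exists v => //; rewrite -Ez; move: zv; rewrite mulrDl mul1r.
- by have -> := maxsetsup mM PL ML.
Qed.

Lemma gen_exists J kap F0 x0 (e : R) : idx K J -> T J x0 ->
  (forall H, idx K H -> H \proper J -> ~ Reg d V delta (lev j J - 2^-1) J H x0) ->
  lev j J - 4^-1 <= kap J -> (forall L, J \proper L -> lev j J + 2^-1 <= kap L) ->
  0 < e -> (forall a, F0 a -> realization K a -> e <= d (cls x0) a) ->
  exists F : set (point K) -> 'rV[R]_(1 + mdim (kU (ach K J))),
    gen J kap F0 F /\ exists2 r : R, 0 < r &
    forall y, dom (ach K J) y -> d (cls x0) (cls y) <= r -> good_form F y erefl.
Proof.
move=> hJ Tx nR kJ kL e0 hF0.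
have xd : dom (ach K J) x0 by case: Tx.
have rx := real_cls hJ xd.
have [M [hM JM Ux top]] := top_chart hJ Tx.
have MJ := co_man hK hJ; have MM := co_man hK hM.
have [c [c' [g [hc cx hc' cx' [hg fr]]]]] := aphi_chart hJ hM JM Ux.
set z0 := aphi K M x0 in cx' *.
have zd : dom (ach K M) z0 by exact: aphi_dom JM Ux.
have Ez : cls z0 = cls x0 by exact: cls_aphi.
have [rf rf0 far] := Reg_far hK hd d0 hV sep hJ Tx nR.
(* For L in M the radius keeps the ball inside U_LM; for other L it is the distance of x0 from the
   closure of D_L, positive because M is largest. *)
have [rL rL0 hrL] : exists2 r : R, 0 < r & forall L, idx K L -> J \subset L ->
   (L \subset M -> forall y, dom (ach K L) y -> d (cls x0) (cls y) < r -> aU K L M y) /\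
   (~ L \subset M -> forall y, D L y -> r <= d (cls x0) (cls y)).
  apply: fin_radius => [L|L r s sr h hL JL]; last first.
    have [h1 h2] := h hL JL; split=> [LM y yd yr|LM y Dy].
      by apply: h1 => //; exact: lt_le_trans yr sr.
    by apply: le_trans sr _; exact: h2.
  have [hL|nL] := pselect (idx K L); last by exists 1 => // /nL.
  have [JL|nL] := boolP (J \subset L); last by exists 1 => // _ JL; move: nL; rewrite JL.
  have [LM|nLM] := boolP (L \subset M).
    have UL := aU_sub hK hJ hL hM JL LM Ux.
    have UM := aU_image hK hJ hL hM JL LM Ux.
    have [r r0 rP] := open_ball hd hL (aU_open hK hL hM LM) UM.
    exists r => // _ _; split=> // _ y yd yr; apply: rP => //.
    by rewrite (cls_aphi hJ hL JL UL).
  have cD : compact (closure_in (dom (ach K L)) (D L)).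
    by apply: (Vk_compact d0 sep) => //; have := lev_ge1 (R := R) j hL; lra.
  have [|h|[r r0 rP]] := dist_compact hd hL rx _ cD; first by move=> y [].
    by case: (negP nLM); exact: top.
  exists r => // _ _; split=> // _ y Dy; apply: rP; split; first exact: Dlev_dom Dy.
  exact: subset_closure.
have [rc rc0 hrc] := open_ball hd hM (cdom_open MM hc') cx'.
pose r1 := Num.min (Num.min e rf) (Num.min rL rc) / 2.
have mm0 : 0 < Num.min (Num.min e rf) (Num.min rL rc) by rewrite !lt_min e0 rf0 rL0 rc0.
have r10 : 0 < r1 by rewrite divr_gt0.
have : r1 < Num.min (Num.min e rf) (Num.min rL rc) by rewrite ltr_pdivrMr // ltr_pMr // ltr1n.
rewrite !lt_min => /andP[/andP[r1e r1f] /andP[r1L r1c]].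
have [Q oQ EQ] := dball_open hd r1 hM (real_cls hM zd).
have Qz : Q z0.
  suff : (dom (ach K M) `&` Q) z0 by case.
  by rewrite -EQ; split=> //; rewrite d_refl //; exact: real_cls.
have [rho rho0 hrho] := chart_ball MM hc' cx' oQ Qz.
have [chi [schi chi01 chi0 [s1 s10 chi1]]] := bump_exists (cmap c' z0) rho0.
(* The coordinate change is an immersion, so its Jacobian has this right inverse; hence v |-> g(v) P
   has Jacobian 1 at x0 and is a coordinate system of U_J nearby. *)
pose P := pinvmx (jac g (cmap c x0)).
have jP : jac g (cmap c x0) *m P = 1%:M by exact: mulmxVp.
pose m := mdim (kU (ach K J)).
pose Fh v := chi v *: row_mx (1%:M : 'M[R]_1) (v *m P : 'rV[R]_m).
have sFh : Cinfty setT Fh.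
  apply: Cinfty_scale => //; first exact: openT.
  have -> : (fun v => row_mx (1%:M : 'M[R]_1) (v *m P : 'rV[R]_m)) = (fun v => v *m row_mx 0 P + row_mx 1%:M 0).
    by apply/funext => v; rewrite mul_mx_row mulmx0 add_row_mx add0r addr0.
  apply: CinftyD; [exact: openT| |by apply: Cinfty_cst; exact: openT].
  by apply: Cinfty_mulmx; [exact: openT|apply: Cinfty_id; exact: openT].
pose G z := if `[< cdom c' z >] then Fh (cmap c' z) else 0.
have G0 z : dom (ach K M) z -> G z != 0 -> cdom c' z /\ d (cls z0) (cls z) < r1.
  move=> dz; rewrite /G; case: asboolP => [cz Fz|_]; last by rewrite eqxx.
  split=> //; suff : (dom (ach K M) `&` Q) z by rewrite -EQ => -[].
  split=> //; apply: hrho => //; rewrite ltNge; apply: contraNN Fz => h.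
  by rewrite /Fh chi0 // scale0r.
have sG : smooth_fun (kU (ach K M)) (dom (ach K M)) G.
  apply: smooth_fun_glue => // z dz; have [cz|ncz] := pselect (cdom c' z).
    have [Oq oO EO] := cdom_open MM hc'; exists Oq, (cdom c'), (Fh \o cmap c'); split=> //.
    - by move: cz; rewrite EO => -[].
    - by move=> y; exact: cdom_sub.
    split; first exact: smooth_fun_chart.
    move=> y dy Oy; have cy : cdom c' y by rewrite EO.
    by split=> //=; rewrite /G; case: asboolP.
  have [Oq oO EO] := dball_coopen hd r1 hM (real_cls hM zd).
  have hO y : dom (ach K M) y -> Oq y -> r1 < d (cls z0) (cls y).
    by move=> dy Oy; suff : (dom (ach K M) `&` Oq) y by rewrite -EO => -[].
  exists Oq, (dom (ach K M)), (fun=> 0); split=> //.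
    suff : (dom (ach K M) `&` Oq) z by case.
    rewrite -EO; split=> //; rewrite ltNge; apply/negP => h; apply: ncz.
    by apply: hrc => //; exact: le_lt_trans h r1c.
  split; first exact: smooth_fun_cst.
  move=> y dy Oy; split=> //; apply/esym/eqP/negPn/negP => /(G0 y dy)[_].
  by apply/negP; rewrite -leNgt ltW // hO.
pose F := spread G.
have F0' a : F a != 0 -> d (cls x0) a < r1.
  by move=> /spread_neq0[z [dz -> /(G0 z dz)[_]]]; rewrite Ez.
have Fz a : r1 <= d (cls x0) a -> F a = 0.
  by move=> h; apply/eqP/negPn/negP => /F0'; rewrite ltNge h.
exists F; split.
- split.
  + move=> L hL JL; have [h1 h2] := hrL L hL JL.
    have ML := co_man hK hL; have oD : open_in (dom (ach K L)) (D L) by exact: (Dlev_open hd hV).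
    have [LM|LM] := boolP (L \subset M).
      apply: spread_smooth => // y Dy nU.
      have yd := Dlev_dom Dy.
      have yr : rL <= d (cls x0) (cls y) by rewrite leNgt; apply/negP => h; apply: nU; exact: h1.
      have [Oq oO EO] := dball_coopen hd r1 hL rx.
      exists Oq; split=> //.
        suff : (dom (ach K L) `&` Oq) y by case.
        by rewrite -EO; split=> //; exact: lt_le_trans yr.
      move=> y' Dy' Oy'; apply: Fz; apply: ltW.
      suff : (dom (ach K L) `&` Oq) y' by rewrite -EO => -[].
      by split=> //; exact: Dlev_dom Dy'.
    have s0 : smooth_fun (kU (ach K L)) (D L) (fun=> 0 : 'rV[R]_(1 + m)) by exact: smooth_fun_cst.
    apply: (smooth_fun_eq ML _ s0) => y Dy; rewrite Fz //.
    by apply: le_trans (h2 (negP LM) y Dy); exact: ltW.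
  + move=> L H y hL hH HL JL JH Ry; apply: Fz; apply: le_trans (ltW r1f) _.
    apply: (far L H (kap L) y) => //.
    have [E|pJL] := subset_eqVproper JL; first by left; rewrite -E.
    by right; split=> //; exact: kL.
  + by move=> a Fa ra; apply: Fz; apply: le_trans (ltW r1e) (hF0 a Fa ra).
  + exists (1 + (mdim (kU (ach K M)))%:R * (`|cmap c' z0| + rho) * `|P|) => a.
    set cc := 1 + _; have cc0 : 0 <= cc.
      by rewrite /cc addr_ge0 // !mulr_ge0 // addr_ge0 // ltW.
    have [->|/spread_neq0[z [dz -> Gz]]] := eqVneq (F a) 0; first by rewrite normr0.
    rewrite /F spread_cls // /G; case: asboolP => [cz|_]; last by rewrite normr0.
    rewrite /Fh; have [h|h] := leP rho `|cmap c' z - cmap c' z0|.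
      by rewrite chi0 // scale0r normr0.
    rewrite normrZ; have /andP[c0 c1] := chi01 (cmap c' z); rewrite ger0_norm //.
    apply: le_trans (ler_piMl _ c1) _ => //.
    have nz : `|cmap c' z| <= `|cmap c' z0| + rho.
      rewrite -[X in `|X| <= _](subrK (cmap c' z0)) addrC; apply: le_trans (ler_normD _ _) _.
      by rewrite addrC [leRHS]addrC lerD2r ltW.
    apply: norm_leP => // i k; rewrite mxE; case: splitP => k' _.
      rewrite mxE; case: eqP; rewrite ?normr1 ?normr0 // /cc lerDl.
      by rewrite !mulr_ge0 // addr_ge0 // ltW.
    apply: le_trans (norm_coord _ _ _) _; apply: le_trans (norm_mulmx _ _) _.
    rewrite /cc -[leLHS]add0r lerD // ler_wpM2r // ler_wpM2l //.
- have [Ug [oUg Ugx hgs gE]] := hg.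
  pose h v := g v *m P.
  have hh : Cinfty Ug h by exact: Cinfty_mulmx.
  have jh : jac h (cmap c x0) = 1%:M by rewrite (jac_mulmx _ oUg Ugx hgs).
  have [t t0 tP] := lip_jac oUg Ugx hh; have [u u0 uP] := lip_jac oUg Ugx hgs.
  have cphi : {within aU K J M, continuous (aphi K M)}.
    have [E|pJM] := subset_eqVproper JM; last by have [] := co_map hK hJ hM pJM.
    clear -E hK hJ; subst M; rewrite aUid //.
    have h : {within dom (ach K J), continuous (@id (kT (ach K J)))}.
      by apply: continuous_subspaceT => y; exact: cvg_id.
    apply: (subspace_eq_continuous _ h) => y; rewrite inE => dy.
    exact/esym/(aphi_id hK hJ).
  have [Oq [oO Ox hO]] : exists Oq, [/\ open Oq, Oq x0 & forall y, dom (ach K J) y -> Oq y ->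
     aU K J M y /\ cdom c' (aphi K M y)].
    have [Ow oOw EO1] := cdom_open MM hc'.
    have o2 := open_in_preimage cphi oOw.
    have o3 := open_in_trans (aU_open hK hJ hM JM) o2.
    have [|Oq [oO Ox hO]] := open_in_nbhd o3 (x := x0).
      by split=> //=; move: cx'; rewrite EO1 => -[].
    exists Oq; split=> // y dy Oy; have [Uy Owy] := hO y dy Oy; split=> //.
    by rewrite EO1; split=> //; exact: aphi_dom JM Uy.
  have [w w0 wP] := chart_ball MJ hc cx oO Ox.
  have mJ0 : 0 < 2 * (m%:R + 1) :> R by rewrite mulr_gt0 // ltr_wpDl.
  (* Here [s1 * u] keeps g(v) where the bump function is 1, and [t / (2 * (m%:R + 1))] keeps the
     Jacobian of h close enough to 1 for [expand_near_id]. *)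
  pose B := [set v | `|v - cmap c x0| < Num.min (Num.min t u) (Num.min (Num.min w (s1 * u)) (t / (2 * (m%:R + 1))))].
  have Bx : B (cmap c x0).
    by rewrite /B /= subrr normr0 !lt_min t0 u0 w0 mulr_gt0 // divr_gt0.
  have oB : open B by exact: open_rV_ball.
  have BP v : B v -> [/\ Ug v, chi (g v) = 1, m%:R * `|jac h v - 1%:M| <= 2^-1 &
      forall y, cdom c y -> cmap c y = v -> Oq y].
    rewrite /B /= !lt_min => /andP[/andP[vt vu] /andP[/andP[vw vs] vm]].
    have x0r (z : R) : 0 < z -> `|cmap c x0 - cmap c x0| < z by rewrite subrr normr0.
    have [_ _ hj] := tP (cmap c x0) v (x0r _ t0) vt.
    have [_ hgl _] := uP (cmap c x0) v (x0r _ u0) vu.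
    have [Uv _ _] := uP v v vu vu.
    split=> //.
    - apply: chi1; have -> : cmap c' z0 = g (cmap c x0).
        by rewrite gE //=; [rewrite (cmapK MJ)|exists x0].
      by apply: le_lt_trans hgl _; rewrite ltr_pdivrMl // mulrC.
    - rewrite jh in hj; apply: (@le_trans _ _ ((m%:R + 1) * (t^-1 * `|v - cmap c x0|))).
        by apply: ler_pM => //; rewrite lerDl.
      rewrite mulrA -ler_pdivlMl ?mulr_gt0 ?invr_gt0 ?ltr_wpDl //.
      apply: le_trans (ltW vm) _; rewrite !invfM invrK.
      by rewrite mulrA mulrAC [X in X / 2]mulrC.
    - by move=> y cy Ey; apply: wP => //; rewrite Ey.
  have [QB [oQB QBx hQB]] := chart_nbhd MJ hc cx oB Bx.
  have [r r0 rP] := open_ball hd hJ oQB QBx.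
  exists (r / 2); first by rewrite divr_gt0.
  move=> y yd yr; have [cy By] : cdom c y /\ B (cmap c y).
    by apply/hQB/rP => //; apply: le_lt_trans yr _; rewrite ltr_pdivrMr // ltr_pMr // ltr1n.
  exists c, B, h; split=> //.
    by apply: (Cinfty_sub oUg _ _ hh) => // v /BP[].
  split=> [v /BP[_ _ hv _]|y' cy' Dy' /BP[Uv chi1v _ Oy']]; first exact: expand_near_id.
  have [Uy' cy''] := hO y' (Dlev_dom Dy') (Oy' y' cy' erefl).
  rewrite -(cls_aphi hJ hM JM Uy') /F spread_cls //; last exact: aphi_dom JM Uy'.
  rewrite /G; case: asboolP => // _.
  have -> : cmap c' (aphi K M y') = g (cmap c y').
    by rewrite gE //=; [rewrite (cmapK MJ)|exists y'].
  by rewrite /Fh chi1v scale1r.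
Qed.

End Generators.
Arguments gen {R TX K} d V delta j J kap F0 {q} F.
Arguments good_form {R TX K} d V delta j {J q} F y e.

Section SmoothLinear.
Context {R : realType} {T : topologicalType} {W W' : vectType R}.

Lemma smooth_fun_lfun (M : manifold R T) D (f : T -> W) (A : 'Hom(W, W')) :
  smooth_fun M D f -> smooth_fun M D (A \o f).
Proof.
move=> sf c hc v Dv; have [g hg] := sf c hc v Dv.
have [[U [oU Ux hU UE]] _] := ext_mulmx (f2mx A) hg.
exists (fun y => g y *m f2mx A), U; split=> // y Dy Uy.
by rewrite UE // /= v2r_lfun.
Qed.

End SmoothLinear.

Lemma smooth_fun_row_mx (R : realType) (T : topologicalType) (M : manifold R T) D q q'
    (F : T -> 'rV[R]_q) (F' : T -> 'rV[R]_q') :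
  smooth_fun M D F -> smooth_fun M D F' -> smooth_fun M D (fun y => row_mx (F y) (F' y)).
Proof.
move=> sF sF'.
have h1 := smooth_fun_lfun (linfun (mulmxr (row_mx (1%:M : 'M[R]_q) (0 : 'M[R]_(q, q'))))) sF.
have h2 := smooth_fun_lfun (linfun (mulmxr (row_mx (0 : 'M[R]_(q', q)) (1%:M : 'M[R]_q')))) sF'.
have := smooth_funD h1 h2; congr (smooth_fun M D _); apply/funext => y.
by rewrite /= !lfunE /= !mul_mx_row !mulmx1 !mulmx0 add_row_mx addr0 add0r.
Qed.

(** * Making one index transverse with finitely many functions *)

Section Stage.
Context {R : realType} {TX : topologicalType} {K : atlas R TX} (hK : core K).
Context {d : metric_family K} (hd : admissible_metric d).
Context {V : dom_family K} {delta : R} (d0 : 0 < delta).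
Arguments V : clear implicits.
Hypothesis hV : forall I, idx K I -> V I `<=` dom (ach K I).
Hypothesis sep : separating d V delta.
Variable j : nat.
Implicit Types I J L H : {set 'I_(aN K)}.
Local Notation D := (Dlev d V delta j).
Local Notation T := (Tlev d V delta j).
Local Notation gen := (gen d V delta j).

Definition embed J L : 'M[R]_(dim (kE (ach K J)), dim (kE (ach K L))) :=
  if J \subset L then f2mx (ahat K J L) else 0.

Lemma gen0 J kap F0 : gen J kap F0 (fun=> 0 : 'rV[R]_0).
Proof.
split=> //; first by move=> L _ _; exact: smooth_fun_cst.
by exists 0 => a; rewrite normr0.
Qed.

Lemma gen_row_mx J kap F0 q q' (F : _ -> 'rV[R]_q) (F' : _ -> 'rV[R]_q') :
  gen J kap F0 F -> gen J kap F0 F' -> gen J kap F0 (fun a => row_mx (F a) (F' a)).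
Proof.
move=> [s1 r1 f1 [c1 b1]] [s2 r2 f2 [c2 b2]]; split.
- by move=> L hL JL; apply: smooth_fun_row_mx; [exact: s1|exact: s2].
- by move=> L H y hL hH HL JL JH Ry; rewrite (r1 L H) // (r2 L H) // row_mx0.
- by move=> a Fa ra; rewrite f1 // f2 // row_mx0.
- exists (Num.max c1 c2) => a; apply: norm_leP => [|i k].
    by rewrite le_max (le_trans (normr_ge0 _) (b1 a)).
  rewrite mxE le_max; case: splitP => k' _.
    by rewrite (le_trans (norm_coord _ _ _) (b1 a)).
  by rewrite (le_trans (norm_coord _ _ _) (b2 a)) orbT.
Qed.

Lemma pert_row_mx (W : vectType R) (w : W) q q' k (a : 'rV[R]_q)
    (b : 'rV[R]_q') (B : 'M[R]_(k, dim W)) p p' :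
  w + r2v (row_mx a b *m col_mx p p' *m B) =
  (w + r2v (a *m p *m B)) + r2v (b *m p' *m B).
Proof. by rewrite matrix.mul_row_col mulmxDl linearD addrA. Qed.

Lemma tv_open_compact L (A : set (kT (ach K L))) (f : kT (ach K L) -> kE (ach K L)) q k
    (F : kT (ach K L) -> 'rV[R]_q) (B : 'M[R]_(k, dim (kE (ach K L)))) p0 :
  idx K L -> compact A -> A `<=` D L -> smooth_fun (kU (ach K L)) (D L) f ->
  smooth_fun (kU (ach K L)) (D L) F ->
  (forall y, A y -> tv (kU (ach K L)) (D L) (pert f F B p0) y) ->
  exists2 eps : R, 0 < eps & forall p, `|p - p0| < eps ->
    forall y, A y -> tv (kU (ach K L)) (D L) (pert f F B p) y.
Proof.
move=> hL cA AD sf sF tA; have ML := co_man hK hL.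
have oD : open_in (dom (ach K L)) (D L) by exact: (Dlev_open hd hV).
have Ad : A `<=` dom (ach K L) by move=> y /AD /Dlev_dom.
apply: (compact_ind (P := fun B' => exists2 eps : R, 0 < eps & forall p, `|p - p0| < eps ->
    forall y, B' y -> tv (kU (ach K L)) (D L) (pert f F B p) y) hd hL Ad cA).
- by exists 1.
- move=> A1 A2 [e1 e10 h1] [e2 e20 h2]; exists (Num.min e1 e2); first by rewrite lt_min e10.
  by move=> p; rewrite lt_min => /andP[p1 p2] y [|]; [apply: h1|apply: h2].
move=> x Ax; have [hc cx] := chart_atP ML (Ad _ Ax).
have [g hr] := rep_exists sf (AD _ Ax) hc cx.
have Sx : (cmap (chart_at (kU (ach K L)) x) @` (cdom (chart_at (kU (ach K L)) x) `&` D L))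
    (cmap (chart_at (kU (ach K L)) x) x) by exists x => //; split=> //; exact: AD.
have [h hh] := smooth_in_row (sF _ hc) Sx.
have hv : vrep q (kU (ach K L)) (D L) F x (chart_at (kU (ach K L)) x) h by split.
have [eps e0 [Q [oQ Qx QP]]] := tv_open ML oD (AD _ Ax) hr hv (tA _ Ax).
have [r r0 rP] := open_ball hd hL oQ Qx.
exists (r / 2); first by rewrite divr_gt0.
exists eps => // p pp y [Ay yr]; apply: QP => //; last exact: AD.
by apply: rP; [exact: Ad|apply: le_lt_trans yr _; rewrite ltr_pdivrMr // ltr_pMr // ltr1n].
Qed.

(** On a union, parameters good for the first part are moved so little, by openness on compact sets,
    that they remain good while becoming good for the second part. *)
Lemma tv_dense_compact J (A : set (kT (ach K J))) (f : kT (ach K J) -> kE (ach K J))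
    (F : set (point K) -> 'rV[R]_(1 + mdim (kU (ach K J)))) :
  idx K J -> compact A -> A `<=` D J -> smooth_fun (kU (ach K J)) (D J) f ->
  smooth_fun (kU (ach K J)) (D J) (fun y => F (cls y)) ->
  (forall y, A y -> good_form d V delta j F y erefl) ->
  forall p0 (rho : R), 0 < rho -> exists2 p, `|p - p0| < rho &
    forall y, A y -> tv (kU (ach K J)) (D J) (pert f (fun y => F (cls y)) 1%:M p) y.
Proof.
move=> hJ cA AD sf sF gA; have MJ := co_man hK hJ.
have oD : open_in (dom (ach K J)) (D J) by exact: (Dlev_open hd hV).
have Ad : A `<=` dom (ach K J) by move=> y /AD /Dlev_dom.
suff [] : compact A /\ A `<=` D J /\ forall p0 (rho : R), 0 < rho -> exists2 p, `|p - p0| < rho &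
    forall y, A y -> tv (kU (ach K J)) (D J) (pert f (fun y => F (cls y)) 1%:M p) y by move=> _ [].
apply: (compact_ind (P := fun A => compact A /\ A `<=` D J /\ forall p0 (rho : R), 0 < rho ->
    exists2 p, `|p - p0| < rho &
    forall y, A y -> tv (kU (ach K J)) (D J) (pert f (fun y => F (cls y)) 1%:M p) y) hd hJ Ad cA).
- split; first exact: compact0.
  by split=> // p0 rho rho0; exists p0 => //; rewrite subrr normr0.
- move=> A1 A2 [c1 [s1 h1]] [c2 [s2 h2]]; split; first exact: compactU.
  split=> [y [/s1|/s2]//|p0 rho rho0].
  have r2 : 0 < rho / 2 by rewrite divr_gt0.
  have [p1 p10 t1] := h1 p0 (rho / 2) r2.
  have [eps e0 eP] := tv_open_compact hJ c1 s1 sf sF t1.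
  have [|p2 + t2] := h2 p1 (Num.min eps (rho / 2)); first by rewrite lt_min e0.
  rewrite lt_min => /andP[p2e p2r]; exists p2.
    rewrite -(subrK p1 p2) -addrA (splitr rho); apply: le_lt_trans (ler_normD _ _) _.
    exact: ltrD.
  by move=> y [/(eP p2 p2e)//|]; exact: t2.
move=> x Ax; have [c [U [h [[hc cx] oU Ux hh [inv hF]]]]] := gA _ Ax.
have [g hr] := rep_exists sf (AD _ Ax) hc cx.
have [Q [oQ Qx QP]] := tv_dense MJ oD (AD _ Ax) hr oU Ux hh inv hF.
have [r r0 rP] := open_ball hd hJ oQ Qx.
exists (r / 2); first by rewrite divr_gt0.
split; first by apply: (compact_cball hd) => //; apply: real_cls => //; exact: Ad.
split=> [y [/AD]//|p0 rho rho0]; have [p pp tp] := QP p0 rho rho0.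
exists p => // y [Ay yr]; apply: tp; last exact: AD.
by apply: rP; [exact: Ad|apply: le_lt_trans yr _; rewrite ltr_pdivrMr // ltr_pMr // ltr1n].
Qed.

(* Finitely many generators suffice by compactness of [T J]. *)
Lemma stage_generator J kap F0 (f : kT (ach K J) -> kE (ach K J)) :
  idx K J -> smooth_fun (kU (ach K J)) (D J) f ->
  (forall x, T J x -> tv (kU (ach K J)) (D J) f x \/
    exists F : set (point K) -> 'rV[R]_(1 + mdim (kU (ach K J))),
      gen J kap F0 F /\ exists2 r : R, 0 < r & forall y, dom (ach K J) y -> d (cls x) (cls y) <= r ->
        good_form d V delta j F y erefl) ->
  exists q (F : set (point K) -> 'rV[R]_q), gen J kap F0 F /\
    forall rho : R, 0 < rho -> exists2 p, `|p| < rho &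
      forall y, T J y -> tv (kU (ach K J)) (D J) (pert f (fun y => F (cls y)) 1%:M p) y.
Proof.
move=> hJ sf H; have MJ := co_man hK hJ.
have TD := Tlev_sub hd d0 hV (j := j) hJ.
have oD : open_in (dom (ach K J)) (D J) by exact: (Dlev_open hd hV).
have Td : T J `<=` dom (ach K J) by move=> y /TD /Dlev_dom.
(* The property must tolerate an arbitrary F' added before with a small parameter. Then F1 and F2
   can be concatenated: F2 is applied to the second set with (F', F1) as the earlier function. *)
pose P A := [/\ compact A, A `<=` D J & exists q (F : set (point K) -> 'rV[R]_q), gen J kap F0 F /\
  forall q' (F' : set (point K) -> 'rV[R]_q'), gen J kap F0 F' ->
  exists2 eps : R, 0 < eps & forall p', `|p'| < eps -> forall rho : R, 0 < rho ->
  exists2 p, `|p| < rho & forall y, A y ->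
    tv (kU (ach K J)) (D J) (pert (pert f (fun y => F' (cls y)) 1%:M p') (fun y => F (cls y)) 1%:M p) y].
have genS q (F : set (point K) -> 'rV[R]_q) : gen J kap F0 F ->
    smooth_fun (kU (ach K J)) (D J) (fun y => F (cls y)).
  by case=> s _ _ _; exact: s.
have pertS q (F : set (point K) -> 'rV[R]_q) p : gen J kap F0 F ->
    smooth_fun (kU (ach K J)) (D J) (pert f (fun y => F (cls y)) 1%:M p).
  by move=> /genS sF; exact: smooth_fun_pert.
suff [_ _ [q [F [gF hF]]]] : P (T J).
  exists q, F; split=> // rho rho0.
  have [eps e0 h] := hF _ _ (gen0 J kap F0).
  have [|p pr tp] := h 0 _ rho rho0; first by rewrite normr0.
  exists p => // y Ty; have := tp y Ty; congr (tv _ _ _ _); apply/funext => z.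
  by rewrite /pert mul0mx mul0mx linear0 addr0.
apply: (compact_ind hd hJ Td (Tlev_compact d0 sep (j := j) hJ)).
- split; [exact: compact0|by []|].
  exists 0%N, (fun=> 0); split; first exact: gen0.
  by move=> q' F' _; exists 1 => // p' _ rho rho0; exists 0 => //; rewrite normr0.
- move=> A1 A2 [c1 s1 [q1 [F1 [g1 h1]]]] [c2 s2 [q2 [F2 [g2 h2]]]].
  split; [exact: compactU|by move=> y [/s1|/s2]|].
  exists (q1 + q2)%N, (fun a => row_mx (F1 a) (F2 a)); split; first exact: gen_row_mx.
  move=> q' F' gF'; have [e1 e10 h1'] := h1 _ _ gF'.
  have [e2 e20 h2'] := h2 _ _ (gen_row_mx gF' g1).
  exists (Num.min e1 e2); first by rewrite lt_min e10.
  move=> p'; rewrite lt_min => /andP[p'1 p'2] rho rho0.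
  have [|p1 + t1] := h1' p' p'1 (Num.min rho e2); first by rewrite lt_min rho0.
  rewrite lt_min => /andP[p1r p1e].
  have nc m1 m2 k (a : 'M[R]_(m1, k)) (b : 'M[R]_(m2, k)) (r : R) : `|a| < r -> `|b| < r -> `|col_mx a b| < r.
    move=> ar br; apply: le_lt_trans (_ : Num.max `|a| `|b| < r); last by rewrite gt_max ar.
    apply: norm_leP => [|i l]; first by rewrite le_max normr_ge0.
    by rewrite mxE le_max; case: splitP => i' _; rewrite norm_coord ?orbT.
  have h2'' := h2' (col_mx p' p1) (nc _ _ _ _ _ _ p'2 p1e).
  pose f1 := pert (pert f (fun y => F' (cls y)) 1%:M p') (fun y => F1 (cls y)) 1%:M p1.
  have sf1 : smooth_fun (kU (ach K J)) (D J) f1.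
    by apply: smooth_fun_pert => //; [exact: pertS|exact: genS].
  have t1' y : A1 y -> tv (kU (ach K J)) (D J) (pert f1 (fun y => F2 (cls y)) 1%:M (0 : 'M[R]_(q2, dim (kE (ach K J))))) y.
    move=> /t1; congr (tv _ _ _ _); apply/funext => z.
    by rewrite /f1 /pert mulmx0 mul0mx linear0 addr0.
  have [e e0 eP] := tv_open_compact hJ c1 s1 sf1 (genS _ _ g2) t1'.
  have [|p2 + t2] := h2'' (Num.min rho e); first by rewrite lt_min rho0.
  rewrite lt_min => /andP[p2r p2e].
  exists (col_mx p1 p2); first exact: nc.
  have E : pert (pert f (fun y => F' (cls y)) 1%:M p') (fun y => row_mx (F1 (cls y)) (F2 (cls y))) 1%:M (col_mx p1 p2) =
     pert f1 (fun y => F2 (cls y)) 1%:M p2.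
    by apply/funext => z; rewrite /pert pert_row_mx.
  have E' : pert (pert f (fun y => row_mx (F' (cls y)) (F1 (cls y))) 1%:M (col_mx p' p1)) (fun y => F2 (cls y)) 1%:M p2 =
     pert f1 (fun y => F2 (cls y)) 1%:M p2.
    by apply/funext => z; rewrite /pert pert_row_mx.
  move=> y [A1y|A2y]; rewrite E; first by apply: eP => //; rewrite subr0.
  by rewrite -E'; exact: t2.
(* Where a function of good form is given, density holds for any earlier parameter. Where f is
   transverse already, openness suffices and no function is added (q = 0). *)
move=> x Tx; case: (H x Tx) => [tx|[F [gF [r r0 gr]]]]; last first.
  exists r => //; split.
  - by apply: (compact_cball hd) => //; [apply: real_cls => //; exact: Td|exact: (Tlev_compact d0 sep)].
  - by move=> y [/TD].
  exists _, F; split=> // q' F' gF'; exists 1 => // p' _ rho rho0.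
  have [|||p pr tp] := tv_dense_compact hJ _ _ (pertS _ _ p' gF') (genS _ _ gF) _ 0 rho0
     (A := T J `&` [set y | d (cls x) (cls y) <= r]).
  - by apply: (compact_cball hd) => //; [apply: real_cls => //; exact: Td|exact: (Tlev_compact d0 sep)].
  - by move=> y [/TD].
  - by move=> y [Ty yr]; apply: gr => //; exact: Td.
  by exists p => //; rewrite subr0 in pr.
have [hc cx] := chart_atP MJ (Td _ Tx).
have [g hr] := rep_exists sf (TD _ Tx) hc cx.
have hv : vrep 0 (kU (ach K J)) (D J) (fun=> 0) x (chart_at (kU (ach K J)) x) (fun=> 0).
  by split=> //; exists setT; split=> //; [exact: openT|apply: Cinfty_cst; exact: openT].
have E0 : @pert _ _ _ (dim (kE (ach K J))) 0 f (fun=> 0) 1%:M 0 = f.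
  by apply/funext => z; rewrite /pert !mul0mx linear0 addr0.
have [|eps e0 [Q [oQ Qx QP]]] := tv_open MJ oD (TD _ Tx) hr hv (B := 1%:M) (p0 := 0).
  by rewrite E0.
have [r r0 rP] := open_ball hd hJ oQ Qx.
exists (r / 2); first by rewrite divr_gt0.
have cB : compact (T J `&` [set y | d (cls x) (cls y) <= r / 2]).
  by apply: (compact_cball hd) => //; [apply: real_cls => //; exact: Td|exact: (Tlev_compact d0 sep)].
have sB : (T J `&` [set y | d (cls x) (cls y) <= r / 2]) `<=` D J by move=> y [/TD].
split=> //; exists 0%N, (fun=> 0); split; first exact: gen0.
move=> q' F' gF'.
have [|e' e'0 e'P] := tv_open_compact (p0 := 0) (B := 1%:M) hJ cB sB sf (genS _ _ gF').
  move=> y [Ty yr]; have -> : @pert _ _ _ (dim (kE (ach K J))) _ f (fun y => F' (cls y)) 1%:M 0 = f.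
    by apply/funext => z; rewrite /pert mulmx0 mul0mx linear0 addr0.
  rewrite -E0; apply: QP; [by rewrite subrr normr0| |exact: TD].
  by apply: rP; [exact: Td|apply: le_lt_trans yr _; rewrite ltr_pdivrMr // ltr_pMr // ltr1n].
exists e' => // p' p'e rho rho0; exists 0; first by rewrite normr0.
move=> y By; have -> : pert (pert f (fun y0 => F' (cls y0)) 1%:M p') (fun=> 0 : 'rV[R]_0) 1%:M 0 =
    @pert _ _ _ (dim (kE (ach K J))) _ f (fun y => F' (cls y)) 1%:M p'.
  by apply/funext => z; rewrite /pert !mul0mx linear0 addr0.
by apply: e'P => //; rewrite subr0.
Qed.

End Stage.

(** * The induction over all indices *)

Section Induction.
Context {R : realType} {TX : topologicalType} {K : atlas R TX} (hK : core K).
Context {d : metric_family K} (hd : admissible_metric d).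
Context {V : dom_family K} {delta : R} (d0 : 0 < delta).
Arguments V : clear implicits.
Hypothesis hV : forall I, idx K I -> V I `<=` dom (ach K I).
Hypothesis sep : separating d V delta.
Variable j : nat.
Implicit Types I J L H : {set 'I_(aN K)}.
Local Notation D := (Dlev d V delta j).
Local Notation T := (Tlev d V delta j).
Local Notation gen := (gen d V delta j).
Local Notation Reg := (Reg d V delta).
Implicit Type nu : section_family K.

(** Values in E_H on the whole region, and agreement with nu_H on the image of U_H. Together these
    allow [tv_inherit]. *)
Definition reg_cond (nu : section_family K) k L H := forall y, D L y -> Reg k L H y ->
  nu L y \in limg (ahat K H L) /\
  forall z, aU K H L z -> y = aphi K L z -> nu L y = ahat K H L (nu H z).

Definition tvs (nu : section_family K) L := 
  tv (kU (ach K L)) (D L) (fun y => ks (ach K L) y + nu L y).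

Arguments tvs : clear implicits.

Lemma Reg_le k l L H y : k <= l -> Reg l L H y -> Reg k L H y.
Proof.
move=> kl [yd [w [Vw [z [Vz Uz] zw]] yw]]; split=> //; exists w.
  by split; [exact: Vk_le kl Vw|exists z => //; split=> //; exact: Vk_le kl Vz].
by apply: lt_le_trans yw _; apply: eta_le => //; rewrite lerB.
Qed.

(** At a zero in the region, s_J = -nu_J lies in E_H, so by tameness the point is in the image of
    U_H. Its preimage lies in [Tlev] of H, where transversality is known. *)
Lemma tv_region nu J H x : idx K J -> idx K H -> H \proper J -> T J x ->
  Reg (lev j J - 2^-1) J H x -> reg_cond nu (lev j J - 2^-1) J H ->
  smooth_fun (kU (ach K J)) (D J) (nu J) -> smooth_fun (kU (ach K H)) (D H) (nu H) ->
  (forall z, T H z -> tvs nu H z) -> tvs nu J x.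
Proof.
move=> hJ hH HJ Tx Rx rc sJ sH tH f0.
have Dx := Tlev_sub hd d0 hV hJ Tx; have [nE _] := rc x Dx Rx.
have : (aphi K J @` aU K H J) x.
  have [_ _ t] := co_tame hK; rewrite (t H J J hH hJ hJ (proper_sub HJ) (subxx J)).
  rewrite (aUid hK hJ); split; first exact: Dlev_dom Dx.
  split; first exact: Dlev_dom Dx.
  by move: f0 => /eqP; rewrite addr_eq0 => /eqP ->; rewrite memvN.
move=> [z Uz zx]; subst x; have hl := lev_lt (R := R) j HJ.
have Tz : T H z.
  have Vz := Reg_aphi hK hd hV hJ hH HJ Uz Rx.
  split; first exact: Vk_dom Vz.
  by apply: subset_closure; apply: Vk_le Vz => //; lra.
suff h : tvs nu J (aphi K J z) by exact: h.
apply: (tv_inherit hK hH hJ HJ Uz (DI := D H) (DJ := D J) (N := D J `&` Reg (lev j J - 2^-1) J H) (nI := nu H)) => //.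
- exact: (Dlev_open hd hV).
- exact: (Tlev_sub hd d0 hV hH).
- by apply: open_inI; [exact: (Dlev_open hd hV)|exact: (Reg_open hd)].
- exact: (Dlev_open hd hV).
- by move=> y [Dy Ry]; have [] := rc y Dy Ry.
- by move=> y Dy Uy [Dy' Ry]; have [_] := rc _ Dy' Ry; apply.
- exact: tH.
Qed.

(* It vanishes on the charts L not containing J since then [embed J L = 0]. *)
Definition bumped J q (F : set (point K) -> 'rV[R]_q) (p : 'M[R]_(q, dim (kE (ach K J))))
  (nu : section_family K) : section_family K :=
  fun L => pert (nu L) (fun y => F (cls y)) (embed J L) p.

Lemma bumped_sub J q F p nu L y : J \subset L ->
  @bumped J q F p nu L y = nu L y + ahat K J L (r2v (F (cls y) *m p)).
Proof.
move=> JL; rewrite /bumped /pert /embed JL; congr (_ + _); apply: v2r_inj.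
by rewrite v2r_lfun !r2vK.
Qed.

Lemma bumped_nsub J q F p nu L y : ~~ (J \subset L) -> @bumped J q F p nu L y = nu L y.
Proof.
by move=> JL; rewrite /bumped /pert /embed (negbTE JL) mulmx0 linear0 addr0.
Qed.

(** If J is in H, both sides change compatibly. If J is in L only, F vanishes on the region. If J is
    not in L, nothing changes. *)
Lemma bumped_reg J kap F0 q F p nu L H : idx K J -> idx K L -> idx K H -> H \proper L ->
  gen J kap F0 F -> reg_cond nu (kap L) L H -> reg_cond (@bumped J q F p nu) (kap L) L H.
Proof.
move=> hJ hL hH HL [_ gr _ _] rc y Dy Ry; have [nE nC] := rc y Dy Ry.
have [JL|JL] := boolP (J \subset L); last first.
  have JH : ~~ (J \subset H).
    by apply: contra JL => JH; exact: fintype.subset_trans JH (proper_sub HL).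
  rewrite bumped_nsub //; split=> // z Uz E; rewrite bumped_nsub //; exact: nC.
rewrite bumped_sub //; have [JH|JH] := boolP (J \subset H).
  rewrite -(ahatA hK _ hJ hH hL JH (proper_sub HL)); split.
    by rewrite memvD // memv_img // memvf.
  move=> z Uz E; rewrite bumped_sub // linearD (nC z Uz E) E.
  by rewrite (cls_aphi hH hL (proper_sub HL)).
rewrite (gr L H y) // ?mul0mx ?linear0 ?addr0; last exact/negP.
split=> // z Uz E; rewrite bumped_nsub //; exact: nC.
Qed.

Variables (n : norm_family K) (s : R) (F0 F1 : set (set (point K))).
Hypothesis hn : forall L, idx K L -> exists c, 0 <= c /\ forall v w, n (v + r2v w : kE (ach K L)) <= n v + c * `|w|.
Hypothesis hF : forall J x, idx K J -> T J x -> ~ F1 (cls x) ->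
  exists2 e : R, 0 < e & forall a, F0 a -> realization K a -> e <= d (cls x) a.
Hypothesis hZ : forall J, idx K J -> compact (T J `&` [set x | F1 (cls x)]).

(** [P] holds the treated indices; [kap L] is lev - 1/2 before and lev - 1/4 after the treatment of
    L. On [F0] the perturbation keeps its initial values, on [F1] it is transverse from the start.
    The bound is some s' < s, so that finitely many small changes fit below s. *)
Record progress (nu0 : section_family K) (kap : {set 'I_(aN K)} -> R) (P : set {set 'I_(aN K)})
    (nu : section_family K) : Prop := Progress {
  pr_smooth : forall L, idx K L -> smooth_fun (kU (ach K L)) (D L) (nu L);
  pr_reg : forall L H, idx K L -> idx K H -> H \proper L -> reg_cond nu (kap L) L H;
  pr_bound : exists2 s' : R, s' < s & forall L y, idx K L -> D L y -> n (nu L y) <= s';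
  pr_tv : forall L y, idx K L -> P L -> T L y -> tvs nu L y;
  pr_tvF : forall L y, idx K L -> T L y -> F1 (cls y) -> tvs nu L y;
  pr_frozen : forall L y, idx K L -> D L y -> F0 (cls y) -> nu L y = nu0 L y }.

Lemma ks_pert J q (F : set (point K) -> 'rV[R]_q) p nu L :
  (fun y => ks (ach K L) y + @bumped J q F p nu L y) =
  pert (fun y => ks (ach K L) y + nu L y) (fun y => F (cls y)) (embed J L) p.
Proof. by apply/funext => y; rewrite /bumped /pert addrA. Qed.

Lemma bumped_tv_open J kap q (F : set (point K) -> 'rV[R]_q) nu L A :
  idx K L -> gen J kap F0 F -> smooth_fun (kU (ach K L)) (D L) (nu L) ->
  compact A -> A `<=` D L -> (forall y, A y -> tvs nu L y) ->
  exists2 r : R, 0 < r & forall p, `|p| < r -> forall y, A y -> tvs (@bumped J q F p nu) L y.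
Proof.
move=> hL [gs _ _ _] snu cA AD tA; rewrite /tvs.
have sf : smooth_fun (kU (ach K L)) (D L) (fun y => ks (ach K L) y + nu L y).
  apply: smooth_funD => //; apply: smooth_fun_sub (co_s hK hL) => y; exact: Dlev_dom.
have [JL|JL] := boolP (J \subset L); last first.
  exists 1 => // p _ y /tA; congr (tv _ _ _ _); apply/funext => z.
  by rewrite bumped_nsub.
have [|r r0 rP] := tv_open_compact hK hd hV (p0 := 0) (B := embed J L) hL cA AD sf (gs L hL JL).
  move=> y /tA; congr (tv _ _ _ _); apply/funext => z.
  by rewrite /pert mulmx0 mul0mx linear0 addr0.
by exists r => // p pr y Ay; rewrite ks_pert; apply: rP => //; rewrite subr0.
Qed.

(** A point of [Tlev] of J lies in F1, or in a region where transversality is inherited from a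
    smaller, already treated H, or admits a function by [gen_exists]. *)
Lemma progress_step nu0 kap kap' P J nu : idx K J ->
  progress nu0 kap P nu -> kap J = lev j J - 2^-1 -> lev j J - 4^-1 <= kap' J ->
  (forall L, kap L <= kap' L) -> (forall L, J \proper L -> lev j J + 2^-1 <= kap' L) ->
  (forall H, idx K H -> H \proper J -> P H) ->
  exists nu', progress nu0 kap' (P `|` [set J]) nu'.
Proof.
move=> hJ [ps pr [s' ss' pb] pt pf pz] kJ kJ' kk kL dP.
have sf L : idx K L -> smooth_fun (kU (ach K L)) (D L) (fun y => ks (ach K L) y + nu L y).
  move=> hL; apply: smooth_funD; last exact: ps.
  apply: smooth_fun_sub (co_s hK hL) => y; exact: Dlev_dom.
have [x Tx|q [F [gF hF']]] := stage_generator hK hd d0 hV sep (kap := kap') (F0 := F0) hJ (sf J hJ).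
  have [Fx|nF] := pselect (F1 (cls x)); first by left; exact: pf.
  have [[H [hH HJ Rx]]|nR] := pselect (exists H, [/\ idx K H, H \proper J & Reg (lev j J - 2^-1) J H x]).
    left; apply: (tv_region hJ hH HJ Tx Rx); [by rewrite -kJ; exact: pr|exact: ps|exact: ps|].
    by move=> z Tz; apply: pt => //; exact: dP.
  right; have [e e0 eP] := hF hJ Tx nF.
  by apply: (gen_exists hK hd d0 hV sep hJ Tx _ kJ' kL e0) => // H hH HJ Rx; apply: nR; exists H.
have rc L H : idx K L -> idx K H -> H \proper L -> reg_cond nu (kap' L) L H.
  by move=> hL hH HL y Dy /(Reg_le (kk L)); exact: pr.
have TD L : idx K L -> T L `<=` D L by move=> hL; exact: (Tlev_sub hd d0 hV).
have [r1 r10 h1] : exists2 r : R, 0 < r & forall L, idx K L -> P L -> forall p, `|p| < r ->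
    forall y, T L y -> tvs (@bumped J q F p nu) L y.
  apply: fin_radius => [L|L r t tr h hL PL p pt' y]; last first.
    by apply: h => //; exact: lt_le_trans tr.
  have [hL|nL] := pselect (idx K L); last by exists 1 => // /nL.
  have [PL|nP] := pselect (P L); last by exists 1 => // _ /nP.
  have [r r0 rP] := bumped_tv_open hL gF (ps L hL) (Tlev_compact d0 sep (j := j) hL) (TD L hL) (fun y => pt L y hL PL).
  by exists r.
have [r2 r20 h2] : exists2 r : R, 0 < r & forall L, idx K L -> forall p, `|p| < r ->
    forall y, T L y -> F1 (cls y) -> tvs (@bumped J q F p nu) L y.
  apply: fin_radius => [L|L r t tr h hL p pt' y]; last first.
    by apply: h => //; exact: lt_le_trans tr.
  have [hL|nL] := pselect (idx K L); last by exists 1 => // /nL.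
  have [|y [Ty Fy]|r r0 rP] := bumped_tv_open hL gF (ps L hL) (hZ hL).
  - by move=> y [/(TD L hL)].
  - exact: pf.
  - by exists r => // _ p pp y Ty Fy; apply: rP.
have [c cF] := gen_bound gF.
have c0 : 0 <= c by apply: le_trans (cF set0).
have [r3 r30 h3] : exists2 r : R, 0 < r & forall L, idx K L -> forall p, `|p| < r ->
    forall y, D L y -> n (@bumped J q F p nu L y) <= (s' + s) / 2.
  apply: fin_radius => [L|L r t tr h hL p pt' y]; last first.
    by apply: h => //; exact: lt_le_trans tr.
  have [hL|nL] := pselect (idx K L); last by exists 1 => // /nL.
  have [cn [cn0 hcn]] := hn hL.
  pose C := cn * ((dim (kE (ach K J)))%:R * (q%:R * c) * `|embed J L|) + 1.
  have C0 : 0 < C by rewrite ltr_wpDl // !mulr_ge0.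
  have ss : 0 < (s - s') / 2 by rewrite divr_gt0 // subr_gt0.
  exists ((s - s') / 2 / C) => [|_ p pp y Dy]; first by rewrite divr_gt0.
  apply: le_trans (hcn _ _) _.
  have -> : (s' + s) / 2 = s' + (s - s') / 2 by field.
  apply: lerD; first exact: pb.
  apply: (@le_trans _ _ (C * `|p|)); last by rewrite mulrC -ler_pdivlMr // ltW.
  apply: (@le_trans _ _ ((C - 1) * `|p|)); last by rewrite ler_wpM2r // gerBl.
  rewrite /C addrK -mulrA ler_wpM2l //; apply: le_trans (norm_mulmx _ _) _.
  have hFp : `|F (cls y) *m p| <= q%:R * c * `|p|.
    by apply: le_trans (norm_mulmx _ _) _; rewrite ler_wpM2r // ler_wpM2l.
  rewrite [leRHS]mulrAC ler_wpM2r //.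
  by rewrite -[leRHS]mulrA ler_wpM2l.
(* A parameter below all three radii makes J transverse and preserves transversality on treated
   indices and on F1, as well as the bound. *)
have [|p + tp] := hF' (Num.min r1 (Num.min r2 r3)); first by rewrite !lt_min r10 r20 r30.
rewrite !lt_min => /and3P[p1 p2 p3].
exists (bumped F p nu); split.
- move=> L hL; have [JL|JL] := boolP (J \subset L).
    by apply: smooth_fun_pert; [exact: (co_man hK)|exact: ps|exact: (gen_smooth gF)].
  by apply: (smooth_fun_eq (co_man hK hL) _ (ps L hL)) => y _; rewrite bumped_nsub.
- by move=> L H hL hH HL; apply: (bumped_reg p hJ) gF _ => //; exact: rc.
- exists ((s' + s) / 2); first by lra.
  by move=> L y hL Dy; exact: h3.
- move=> L y hL [PL Ty|/= EL]; [exact: h1|subst L => Ty].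
  rewrite /tvs ks_pert /embed subxx (f2mx_id hK hJ); exact: tp.
- by move=> L y hL Ty Fy; exact: h2.
- move=> L y hL Dy Fy; rewrite -pz //.
  rewrite /bumped /pert (gen_frozen gF) // ?mul0mx ?linear0 ?addr0 //.
  by apply: real_cls => //; exact: Dlev_dom Dy.
Qed.

Lemma progress_eq nu0 kap kap' (P P' : set {set 'I_(aN K)}) nu : progress nu0 kap P nu ->
  (forall L, idx K L -> kap L = kap' L) -> (forall L, idx K L -> P' L -> P L) ->
  progress nu0 kap' P' nu.
Proof.
move=> [ps pr pb pt pf pz] E PP; split=> //.
  by move=> L H hL hH HL; rewrite -E //; exact: pr.
by move=> L y hL /(PP L hL); exact: pt.
Qed.

(* The indices are treated in the order of their cardinality. *)
Theorem perturbation_induction nu0 :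
  progress nu0 (fun L => lev j L - 2^-1) set0 nu0 ->
  exists nu, progress nu0 (fun L => lev j L - 4^-1) setT nu.
Proof.
move=> h0.
pose kp (P : {set {set 'I_(aN K)}}) L : R := if L \in P then lev j L - 4^-1 else lev j L - 2^-1.
have kpb P L : lev j L - 2^-1 <= kp P L by rewrite /kp; case: ifP => _; lra.
suff [P [cP [nu hnu]]] : exists P : {set {set 'I_(aN K)}}, #|P| = #|{set 'I_(aN K)}| /\
    exists nu, progress nu0 (kp P) [set L | L \in P] nu.
  have PT : P = finset.setT by apply/eqP; rewrite finset.eqEcard finset.subsetT cardsT cP leqnn.
  exists nu; apply: progress_eq hnu _ _ => L _; first by rewrite /kp PT finset.in_setT.
  by move=> _; rewrite /= PT finset.in_setT.
suff H m : (m <= #|{set 'I_(aN K)}|)%N -> exists P : {set {set 'I_(aN K)}},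
   [/\ #|P| = m, forall L H, L \in P -> H \proper L -> H \in P &
       exists nu, progress nu0 (kp P) [set L | L \in P] nu].
  by have [P [cP _ hP]] := H _ (leqnn _); exists P.
elim: m => [_|m IH lm].
  exists finset.set0; split; [by rewrite cards0|by move=> L H; rewrite finset.in_set0|].
  exists nu0; apply: progress_eq h0 _ _ => L _; first by rewrite /kp finset.in_set0.
  by rewrite /= finset.in_set0.
have [P [cP dP [nu hnu]]] := IH (ltnW lm).
have [J0 J0P] : exists J0, J0 \notin P.
  apply/existsP; rewrite -negb_forall; apply/negP => /forallP h; move: lm.
  rewrite -cP ltnNge; apply/negP; rewrite negbK; apply: subset_leq_card.
  by apply/fintype.subsetP => L _; exact: h.
(* An index set of least cardinality outside P has all its proper subsets in P. *)
have [J JP Jmin] := @arg_minnP _ J0 (fun J => J \notin P) (fun J : {set 'I_(aN K)} => #|J|) J0P.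
have dJ H : H \proper J -> H \in P.
  move=> HJ; apply/negPn/negP => /Jmin; rewrite leqNgt => /negP; apply.
  exact: proper_card.
exists (J |: P)%SET; split.
- by rewrite cardsU1 JP cP.
- move=> L H; rewrite !inE => /orP[/eqP->|LP] HL; first by rewrite dJ // orbT.
  by rewrite (dP L) ?orbT.
have [hJ|nJ] := pselect (idx K J); last first.
  exists nu; apply: progress_eq hnu _ _ => L hL.
    by rewrite /kp !inE; case: eqP => // E; case: nJ; rewrite -E.
  by rewrite /= !inE; case: eqP => // E; case: nJ; rewrite -E.
have [|||||nu' hnu'] := progress_step (kap' := kp (J |: P)%SET) hJ hnu.
- by rewrite /kp (negbTE JP).
- by rewrite /kp !inE eqxx.
- by move=> L; rewrite /kp !inE; case: eqP => // _ /=; case: ifP => _; lra.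
- by move=> L /(lev_lt (R := R) j) h; apply: le_trans (kpb _ L); lra.
- by move=> H hH /dJ.
exists nu'; apply: progress_eq hnu' _ _ => // L _.
by rewrite /= !inE => /orP[/eqP ->|]; [right|left].
Qed.

End Induction.
Arguments reg_cond {R TX K} d V delta j nu k L H.
Arguments tvs {R TX K} d V delta j nu L x.
Arguments progress {R TX K} d V delta j n s F0 F1 nu0 kap P nu.

(** * Adapted perturbations of closed atlases *)

Section Norms.
Context {R : realType}.

Lemma norm_sum_le (W : vectType R) (N : W -> R) : is_norm N -> forall (I : finType) (r : seq I) (P : pred I) (F : I -> W),
  N (\sum_(i <- r | P i) F i) <= \sum_(i <- r | P i) N (F i).
Proof.
move=> [n0 _ nZ nD] I r P F.
have N0 : N 0 = 0 by rewrite -(scale0r 0) nZ normr0 mul0r.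
elim/big_rec2 : _ => [|i y x _ h]; first by rewrite N0.
by apply: le_trans (nD _ _) _; rewrite lerD2l.
Qed.

Lemma norm_r2v (W : vectType R) (N : W -> R) : is_norm N ->
  exists c, 0 <= c /\ forall v w, N (v + r2v w) <= N v + c * `|w|.
Proof.
move=> hN; have [n0 _ nZ nD] := hN.
exists (\sum_i N (r2v (delta_mx 0 i))); split; first by apply: sumr_ge0.
move=> v w; apply: le_trans (nD _ _) _; rewrite lerD2l.
rewrite {1}(row_sum_delta w) linear_sum; apply: le_trans (norm_sum_le hN _ _ _) _.
rewrite mulr_suml; apply: ler_sum => i _; rewrite linearZ nZ mulrC ler_wpM2l //.
exact: norm_coord.
Qed.

Lemma norm_zero (W : vectType R) (N : W -> R) : is_norm N -> N 0 = 0.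
Proof. by move=> [_ _ nZ _]; rewrite -(scale0r 0) nZ normr0 mul0r. Qed.

Lemma norm_opp (W : vectType R) (N : W -> R) v : is_norm N -> N (- v) = N v.
Proof. by move=> [_ _ nZ _]; rewrite -scaleN1r nZ normrN1 mul1r. Qed.

Lemma norm_near (W : vectType R) (N : W -> R) v : is_norm N -> 0 < N v ->
  exists2 r : R, 0 < r & forall w, `|v2r w - v2r v| < r -> N v / 2 <= N w.
Proof.
move=> hN v0; have [c [c0 hc]] := norm_r2v hN.
exists (N v / 2 / (c + 1)); first by rewrite !divr_gt0 // ltr_wpDl.
move=> w wv; have := hc w (v2r v - v2r w).
rewrite linearB /= !v2rK addrC subrK => h.
have h2 : c * `|v2r v - v2r w| <= N v / 2.
  apply: (@le_trans _ _ ((c + 1) * `|v2r v - v2r w|)); first by rewrite ler_wpM2r // lerDl.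
  by rewrite mulrC -ler_pdivlMr ?ltr_wpDl // distrC ltW.
by move: h h2; lra.
Qed.

Lemma additive_is_norm {TX : topologicalType} (K : atlas R TX) (n : norm_family K) :
  additive K -> additive_norms n -> forall I, idx K I -> is_norm (n I).
Proof.
move=> aK [n1 nI] I hI; have [sur inj] := aK I hI.
have hi i : i \in I -> is_norm (n (finset.set1 i)).
  move=> iI; apply: n1; apply: idx_sub hI; last by rewrite finset.sub1set.
  by apply/finset.set0Pn; exists i; rewrite finset.in_set1.
have b0 e : 0 <= \big[Num.max/0]_(i in I) n (finset.set1 i) (e i).
  by elim/big_ind : _ => // [x y x0 y0|i /hi[]//]; rewrite le_max x0.
have bi e i : i \in I -> n (finset.set1 i) (e i) <= \big[Num.max/0]_(i in I) n (finset.set1 i) (e i).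
  by move=> iI; exact: (le_bigmax_cond _ (fun i => n (finset.set1 i) (e i))).
have hZ a e : sum_hat I (fun i => a *: e i) = a *: sum_hat I e.
  by rewrite /sum_hat scaler_sumr; apply: eq_bigr => i _; rewrite linearZ.
have hD e e' : sum_hat I (fun i => e i + e' i) = sum_hat I e + sum_hat I e'.
  by rewrite /sum_hat -big_split; apply: eq_bigr => i _; rewrite linearD.
split.
- by move=> v; have [e ->] := sur v; rewrite nI.
- move=> v; have [e ->] := sur v; rewrite nI // => E.
  rewrite /sum_hat big1 // => i iI; have [n0 nz _ _] := hi i iI.
  by rewrite (nz (e i)) ?linear0 //; apply/eqP; rewrite eq_le n0 -E bi.
- move=> a v; have [e ->] := sur v; rewrite -hZ !nI //.
  apply/eqP; rewrite eq_le; apply/andP; split.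
    apply: bigmax_le => [|i iI]; first by rewrite mulr_ge0.
    by have [_ _ nZ _] := hi i iI; rewrite nZ ler_wpM2l // bi.
  have [->|a0] := eqVneq a 0; first by rewrite normr0 mul0r.
  rewrite -ler_pdivlMl ?normr_gt0 //; apply: bigmax_le => [|i iI].
    by rewrite mulr_ge0 ?invr_ge0.
  rewrite ler_pdivlMl ?normr_gt0 //; have [_ _ nZ _] := hi i iI; rewrite -nZ.
  exact: (bi (fun i => a *: e i)).
- move=> v w; have [e ->] := sur v; have [e' ->] := sur w; rewrite -hD !nI //.
  apply: bigmax_le => [|i iI]; first by rewrite addr_ge0.
  have [_ _ _ nD] := hi i iI; apply: le_trans (nD _ _) _.
  by apply: lerD; exact: bi.
Qed.

End Norms.

(** * Positivity of sigma and location of the perturbed zeros *)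

Section Zeros.
Context {R : realType} {TX : topologicalType} {K : atlas R TX} (hK : core K).
Context {d : metric_family K} (hd : admissible_metric d).
Context {V C : dom_family K} {delta : R} (d0 : 0 < delta).
Arguments V : clear implicits.
Arguments C : clear implicits.
Hypothesis hV : forall I, idx K I -> V I `<=` dom (ach K I).
Hypothesis sep : separating d V delta.
Hypothesis oC : forall I, idx K I -> open_in (dom (ach K I)) (C I).
Hypothesis CV : forall I, idx K I -> C I `<=` V I.
Hypothesis zC : forall I x, idx K I -> zeros (ach K I) x -> projK C (cls x).
Context {n : norm_family K}.
Hypothesis hn : forall I, idx K I -> is_norm (n (I:=I)).
Variable j : nat.
Implicit Types I J L H : {set 'I_(aN K)}.
Local Notation D := (Dlev d V delta j).
Local Notation T := (Tlev d V delta j).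
Local Notation Reg := (Reg d V delta).

Lemma V_Vk I k x : idx K I -> V I x -> Vk d V delta k I x.
Proof.
move=> hI Vx; have xd := hV hI Vx; split=> //; exists x => //.
by rewrite /pull_metric (d_refl hd) ?mulr_gt0 ?pow2n_gt0 //; exact: real_cls.
Qed.

Lemma Nk_Reg k J H x : idx K J -> Nk d V delta k J H x -> Reg k J H x.
Proof.
move=> hJ Nx; have xd := Nk_dom Nx; split=> //; exists x => //.
by rewrite /pull_metric (d_refl hd) ?eta_gt0 //; exact: real_cls.
Qed.

Lemma smooth_near M (x : kT (ach K M)) D (f : kT (ach K M) -> kE (ach K M)) (r : R) :
  idx K M -> open_in (dom (ach K M)) D -> D x ->
  smooth_fun (kU (ach K M)) D f -> 0 < r ->
  exists Q, [/\ open_in (dom (ach K M)) Q, Q x & forall y, Q y -> D y -> `|v2r (f y) - v2r (f x)| < r].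
Proof.
move=> hM oD Dx sf r0; have MM := co_man hK hM.
have sD : D `<=` dom (ach K M) by case: oD => Q _ -> y [].
have [hc cx] := chart_atP MM (sD _ Dx); set c := chart_at _ x in hc cx *.
have [g [_ _ [U [oU Ux hg gE]]]] := rep_exists sf Dx hc cx.
have [t t0 tP] := lip_jac oU Ux hg.
have oB : open [set v | `|v - cmap c x| < Num.min t (t * r)] by exact: open_rV_ball.
have [|Q [oQ Qx hQ]] := chart_nbhd MM hc cx oB.
  by rewrite /= subrr normr0 lt_min t0 mulr_gt0.
exists Q; split=> // y Qy Dy; have [cy] := hQ y Qy; rewrite /= lt_min => /andP[yt yr].
have x0 : `|cmap c x - cmap c x| < t by rewrite subrr normr0.
have [_ h _] := tP (cmap c x) (cmap c y) x0 yt; have [Uy _ _] := tP _ _ yt yt.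
have E z : cdom c z -> D z -> U (cmap c z) -> v2r (f z) = g (cmap c z).
  by move=> cz Dz Uz; rewrite gE //; [rewrite (cmapK MM)|exists z].
rewrite !E //; apply: le_lt_trans h _; by rewrite ltr_pdivrMl.
Qed.

Lemma Ctilde_open J : idx K J -> open_in (dom (ach K J)) (@Ctilde R TX K C J).
Proof.
move=> hJ; apply: (ball_open hd hJ) => [x [L [hL JL] [Ux _]]|x [L [hL JL] [Ux Cx]]].
  exact: aU_dom JL Ux.
have [r r0 rP] := open_ball hd hL (oC hL) Cx.
have [r' r'0 rP'] := open_ball hd hJ (aU_open hK hJ hL JL) Ux.
exists (Num.min r r'); first by rewrite lt_min r0.
move=> y yd; rewrite lt_min => /andP[yr yr']; have Uy := rP' y yd yr'.
exists L => //; split=> //; apply: rP; first exact: aphi_dom JL Uy.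
by rewrite !cls_aphi.
Qed.

Lemma Reg_half k J H : Reg (k - 4^-1) J H = nbhdU d (eta delta (k - 2^-1)) (Nk d V delta (k - 4^-1) J H).
Proof. by rewrite /Reg (_ : k - 4^-1 - 4^-1 = k - 2^-1); last by field.
Qed.

(** On the compact set over which the infimum is taken, s_J has no zero: a zero has its class in the
    image of some C_I, and I is comparable to J by separation. If J is in I, the point is in
    [Ctilde]; if I is a proper subset of J, it is in a removed region. *)
Lemma sigma_gt0 : (0 < sigma d V C n delta j)%E.
Proof.
have [r r0 rP] : exists2 r : R, 0 < r & forall J, idx K J -> forall x, T J x -> ~ Ctilde C x ->
    (forall I, idx K I -> I \proper J -> ~ Reg (lev j J - 4^-1) J I x) -> r <= n (ks (ach K J) x).
  apply: fin_radius => [J|J r s sr h hJ x Tx nC nR]; last by apply: le_trans sr _; exact: h.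
  have [hJ|nJ] := pselect (idx K J); last by exists 1 => // /nJ.
  pose N := [set x | dom (ach K J) x /\ (Ctilde C x \/ exists I, [/\ idx K I, I \proper J & Reg (lev j J - 4^-1) J I x])].
  have oN : open_in (dom (ach K J)) N.
    apply: (ball_open hd hJ) => [x []//|x [xd [Cx|[I [hI IJ Rx]]]]].
      have [r r0 rP] := open_ball hd hJ (Ctilde_open hJ) Cx.
      by exists r => // y yd yr; split=> //; left; exact: rP.
    have [r r0 rP] := open_ball hd hJ (Reg_open hd _ _ hJ) Rx.
    by exists r => // y yd yr; split=> //; right; exists I; split=> //; exact: rP.
  have Td : T J `<=` dom (ach K J) by move=> x [].
  pose S := T J `\` N.
  have cS : compact S.
    have [Q oQ EQ] := oN; have -> : S = T J `&` ~` Q.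
      rewrite eqEsubset; split=> x [Tx nx]; split=> // h; apply: nx.
        by rewrite EQ; split=> //; exact: Td.
      by move: h; rewrite EQ => -[].
    by apply: compact_closedI; [exact: (Tlev_compact d0 sep)|exact: open_closedC].
  have [r r0 rP] : exists2 r : R, 0 < r & forall x, S x -> r <= n (ks (ach K J) x).
  - apply: (compact_ind (P := fun S => exists2 r : R, 0 < r & forall x, S x -> r <= n (ks (ach K J) x)) hd hJ _ cS).
    + by move=> x [/Td].
    + by exists 1.
    + move=> A B [r r0 rA] [s s0 sB]; exists (Num.min r s); first by rewrite lt_min r0.
      by move=> x [/rA|/sB] h; rewrite ge_min h ?orbT.
    move=> x [Tx nN]; have xd := Td _ Tx; have rx := real_cls hJ xd.
    have s0 : 0 < n (ks (ach K J) x).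
      have [n0 nz _ _] := hn hJ; rewrite lt_def n0 andbT; apply/eqP => /nz sx.
      have [I hI [c Cc Ec]] := zC hJ (conj xd sx); apply: nN; split=> //.
      have [v Vv xv] := Dlev_closure_near hd d0 hV (j := j) hJ (conj xd (subset_closure (Tlev_sub hd d0 hV hJ Tx))) d0.
      have [||IJ|JI] := near_sep sep hI hJ rx.
      * by exists c; [exact: CV|rewrite -Ec (d_refl hd) ?mulr_gt0 // Ec].
      * by exists v => //; move: xv; rewrite mulrDl mul1r.
      * have cd := hV hI (CV hI Cc).
        have [Uc xE] := cls_sub hK hI cd IJ Ec.
        have [E|pIJ] := subset_eqVproper IJ.
          left; clear -E Cc xE hI hK cd; subst J; exists I => //.
          rewrite (aUid hK) //; rewrite (aphi_id hK) // in xE; subst x; split=> //.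
          by rewrite (aphi_id hK).
        right; exists I; split=> //; apply: Nk_Reg => //; split.
          by apply: (Vk_closure_lt hd d0 hV hJ _ Tx); rewrite ltrBlDr ltrDl invr_gt0.
        by exists c => //; split=> //; apply: V_Vk => //; exact: CV.
      * left; have [Ux xE] := cls_sub hK hJ xd JI (esym Ec).
        by exists I => //; split=> //; rewrite -xE.
    have oT : open_in (dom (ach K J)) (dom (ach K J)) by exists setT; [exact: openT|rewrite setIT].
    have [r r0 rP] := norm_near (hn hJ) s0.
    have [Q [oQ Qx hQ]] := smooth_near hJ oT xd (co_s hK hJ) r0.
    have [t t0 tP] := open_ball hd hJ oQ Qx.
    exists (t / 2); first by rewrite divr_gt0.
    exists (n (ks (ach K J) x) / 2); first by rewrite divr_gt0.
    move=> y [[Ty _] yr]; apply: rP; apply: hQ; last exact: Td.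
    by apply: tP; [exact: Td|apply: le_lt_trans yr _; rewrite ltr_pdivrMr // ltr_pMr // ltr1n].
  exists r => // _ x Tx nC nR; apply: rP; split=> // -[_ [//|[I [hI IJ Rx]]]].
  exact: nR Rx.
apply: (@lt_le_trans _ _ r%:E); first by rewrite lte_fin.
apply: le_ereal_inf_tmp => _ [J [x [hJ Tx nC nR ->]]]; rewrite lee_fin; apply: rP => //.
by move=> I hI IJ; rewrite Reg_half; exact: nR.
Qed.

(** Off [Ctilde] and the regions |s_J| >= sigma > |nu_J|, so no zero occurs. In a region a zero
    comes from a zero in some U_H with |H| < |J|, hence the induction on |J|. *)
Lemma zeros_in_C (nu : section_family K) (s : R) : (s%:E <= sigma d V C n delta j)%E ->
  (forall L H, idx K L -> idx K H -> H \proper L -> reg_cond d V delta j nu (lev j L - 4^-1) L H) ->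
  (forall L y, idx K L -> D L y -> n (nu L y) < s) ->
  forall J x, idx K J -> Vk d V delta (lev j J) J x -> ks (ach K J) x + nu J x = 0 -> projK C (cls x).
Proof.
move=> ss rc nb J x; have [m] := ubnP #|J|; elim: m J x => // m IH J x lm hJ Vx f0.
have xd := Vk_dom Vx; have Tx : T J x by split=> //; exact: subset_closure.
have Dx := Tlev_sub hd d0 hV hJ Tx.
have [Cx|nC] := pselect (Ctilde C x).
  have [L [hL JL] [Ux Cx']] := Cx; exists L => //; exists (aphi K L x) => //.
  exact: cls_aphi.
have [[H [hH HJ Rx]]|nR] := pselect (exists H, [/\ idx K H, H \proper J & Reg (lev j J - 4^-1) J H x]); last first.
  have : (sigma d V C n delta j <= (n (ks (ach K J) x))%:E)%E.
    apply: ereal_inf_lbound; exists J, x; split=> // H hH HJ; rewrite -Reg_half => Rx.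
    by apply: nR; exists H.
  move=> /(le_trans ss); rewrite lee_fin leNgt => /negP; case.
  move/eqP: f0; rewrite addr_eq0 => /eqP ->; rewrite norm_opp; last exact: hn.
  exact: nb.
have [nE nC'] := rc J H hJ hH HJ x Dx Rx.
have : (aphi K J @` aU K H J) x.
  have [_ _ t] := co_tame hK; rewrite (t H J J hH hJ hJ (proper_sub HJ) (subxx J)).
  rewrite (aUid hK hJ); split=> //; split=> //.
  by move: f0 => /eqP; rewrite addr_eq0 => /eqP ->; rewrite memvN.
move=> [z Uz zx]; rewrite -zx (cls_aphi hH hJ (proper_sub HJ)) //.
apply: IH => //; first by apply: leq_trans (proper_card HJ) _; rewrite -ltnS.
  rewrite -zx in Rx; have := Reg_aphi hK hd hV hJ hH HJ Uz Rx; apply: Vk_le => //.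
  by have := lev_lt (R := R) j HJ; lra.
move: f0; rewrite (nC' z Uz (esym zx)) -zx (co_ks hK hH hJ HJ Uz) -linearD => /eqP.
by rewrite -memv_ker (co_hat0 hK hH hJ HJ) memv0 => /eqP.
Qed.

End Zeros.

(** * Existence of adapted perturbations *)

Section Adapted.
Context {R : realType} {TX : topologicalType} {K : atlas R TX} (hK : core K).
Context {d : metric_family K} (hd : admissible_metric d).
Context {V C : dom_family K} {delta : R} (d0 : 0 < delta).
Arguments V : clear implicits.
Arguments C : clear implicits.
Hypothesis hV : forall I, idx K I -> V I `<=` dom (ach K I).
Hypothesis sep : separating d V delta.
Context {n : norm_family K}.
Hypothesis hn : forall I, idx K I -> is_norm (n (I:=I)).
Implicit Types I J L H : {set 'I_(aN K)}.

Lemma progress_compat j s F0 F1 nu0 kap P nu k I J x : progress d V delta j n s F0 F1 nu0 kap P nu ->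
  idx K I -> idx K J -> I \proper J -> kap J <= k -> lev j J - 8^-1 <= k ->
  Vk d V delta k I x -> aU K I J x -> Vk d V delta k J (aphi K J x) ->
  nu J (aphi K J x) = ahat K I J (nu I x).
Proof.
move=> pr hI hJ IJ kk kl Vx Ux Vy.
have Dy : Dlev d V delta j J (aphi K J x) by apply: Vk_le Vy.
have Ry : Reg d V delta (kap J) J I (aphi K J x).
  apply: (Reg_le d0 kk); apply: (Nk_Reg hd d0) => //; split=> //.
  by exists x.
by have [_] := pr_reg pr hJ hI IJ Dy Ry; apply.
Qed.

Lemma tvs_limg nu j I k x : idx K I -> lev j I - 8^-1 <= k ->
  smooth_fun (kU (ach K I)) (Dlev d V delta j I) (nu I) ->
  Vk d V delta k I x -> tvs d V delta j nu I x ->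
  pert_section nu x = 0 -> limg (dfun (kU (ach K I)) (Vk d V delta k I) (@pert_section R TX K nu I) x) = fullv.
Proof.
move=> hI kl sn Vx tx f0; have MI := co_man hK hI.
have VD : Vk d V delta k I `<=` Dlev d V delta j I by move=> y; exact: Vk_le.
apply: (tv_limg_dfun MI) => //; first exact: (Vk_open hd hV).
  apply: smooth_funD; last exact: smooth_fun_sub sn.
  by apply: smooth_fun_sub (co_s hK hI) => y /Vk_dom.
by move=> f0'; have [c [g [hr fr]]] := tx f0'; exists c, g; split=> //; exact: rep_sub hr.
Qed.

(** The induction is started at 0 with nothing frozen. The conditions at a level k >= |I| follow
    from those at level |I|, as the neighbourhoods and the radii eta decrease in k. *)
Lemma adapted_exists s : delta < delta_red d V -> 0 < s -> (s%:E <= sigma d V C n delta 0)%E ->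
  exists nu, adapted d V C n delta s nu.
Proof.
move=> ddr s0 ss.
have hn' L : idx K L -> exists c, 0 <= c /\ forall v w, n (v + r2v w : kE (ach K L)) <= n v + c * `|w|.
  by move=> /hn /norm_r2v.
pose nu0 : section_family K := fun I x => 0.
have p0 : progress d V delta 0 n s set0 set0 nu0 (fun L => lev 0 L - 2^-1) set0 nu0.
  split=> //.
  - by move=> L hL; exact: smooth_fun_cst.
  - move=> L H hL hH HL y Dy Ry; split; first exact: mem0v.
    by move=> z _ _; rewrite /nu0 linear0.
  - exists (s / 2); first by rewrite ltr_pdivrMr // ltr_pMr // ltr1n.
    by move=> L y hL _; rewrite /nu0 norm_zero ?divr_ge0 ?(ltW s0) //; exact: hn.
have [||nu pr] := perturbation_induction hK hd d0 hV sep hn' _ _ p0.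
- by move=> J x hJ Tx _; exists 1.
- move=> J hJ; have -> : Tlev d V delta 0 J `&` [set x | set0 (cls x)] = set0.
    by rewrite eqEsubset; split=> x // [].
  exact: compact0.
have lE I : lev 0 I = #|I|%:R :> R by rewrite /lev addn0.
have sV I k : lev 0 I <= k -> Vk d V delta k I `<=` Dlev d V delta 0 I.
  by move=> h x; apply: Vk_le => //; lra.
have VVk I k x : idx K I -> V I x -> Vk d V delta k I x by exact: (V_Vk hd d0 hV).
have [s' ss' pb] := pr_bound pr.
exists nu; split=> //; first by rewrite d0.
  split.
    move=> I hI; apply: smooth_fun_sub (pr_smooth pr hI) => x Vx.
    exact: VVk.
  move=> I J hI hJ IJ x Vx Ux Vy; have l2 := lev_ge1 (R := R) 0 hJ.
  apply: (progress_compat (k := lev 0 J) pr) => //; [lra|lra|exact: VVk|exact: VVk].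
exists nu; split.
  move=> I hI; split=> // ; apply: smooth_fun_sub (pr_smooth pr hI).
  by apply: sV; rewrite lE.
move=> k k1 _ I hI Ik.
have lk : lev 0 I <= k%:R :> R by rewrite lE ler_nat.
split.
- move=> H hH HI x Vx Ux Vy; apply: (progress_compat (k := k%:R) pr) => //; lra.
- move=> x Vx f0; apply: (tvs_limg hI _ (pr_smooth pr hI) Vx) => //; first by lra.
  apply: (pr_tv pr) => //; split; first exact: Vk_dom Vx.
  by apply: subset_closure; exact: Vk_le Vx.
- move=> H hH HI x [xd [y [Vy [z [Vz Uz] zy]] xy]] Vx.
  have Dx : Dlev d V delta 0 I x by apply: (sV I #|I|%:R _ x Vx); rewrite lE.
  have [] // := pr_reg pr hI hH HI (y := x) Dx.
  split=> //; exists y.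
    have kl : lev 0 I - 4^-1 <= k%:R :> R by apply: le_trans lk; rewrite gerBl.
    split; first exact: (Vk_le d0 kl Vy).
    by exists z => //; split=> //; exact: (Vk_le d0 kl Vz).
  apply: lt_le_trans xy _; apply: eta_le => //.
  by apply: le_trans lk; rewrite -addrA gerDl; lra.
- move=> x Vx f0; apply: (zeros_in_C hK hd d0 hV hn (nu := nu) ss) => //.
  + by move=> L H hL hH HL; exact: (pr_reg pr hL hH HL).
  + by move=> L y hL Dy; exact: le_lt_trans (pb L y hL Dy) ss'.
  + exact: Vk_le Vx.
- apply: (@le_lt_trans _ _ s'%:E); last by rewrite lte_fin.
  apply: ge_ereal_sup => _ [x Vx <-]; rewrite lee_fin; apply: pb => //.
  exact: sV Vx.
Qed.

End Adapted.

(** * Collars and cobordism perturbations *)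

Section Collars.
Context {R : realType} {TY : topologicalType} {K : cobordism R TY}.
Implicit Types (a : bool) (I J L : {set 'I_(aN K)}) (t e : R).

Definition bdset a I : set (kT (ach K I)) := carrier (cbdU K a I).
Arguments bdset : clear implicits.

Definition collar a e I : set (kT (ach K I)) := collar_im a e (@ccolU _ _ K a I) (bdset a I).
Arguments collar a e {I} _.

(* The properties of collars used below, in terms of the inverse
   [y |-> (tm y, pr y)] of the collar map [(t, x) |-> ccolU K a t x]. *)
Record collars e (tm : forall a I, kT (ach K I) -> R)
    (pr : forall a I, kT (ach K I) -> kT (ach K I)) : Prop := MkCollars {
  cl_e : 0 < e;
  cl_idx : forall a I, idx (bd_atlas a K) I <-> idx K I /\ bdset a I !=set0;
  cl_bd : forall a I x, idx K I -> bdset a I x -> dom (ach K I) x;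
  cl_col : forall a I t x, idx K I -> collar_ivl a e t -> bdset a I x ->
    [/\ dom (ach K I) (ccolU K a t x), tm a I (ccolU K a t x) = t &
        pr a I (ccolU K a t x) = x];
  cl_end : forall a I (x : kT (ach K I)), idx K I -> bdset a I x -> ccolU K a (endpoint a) x = x;
  cl_open : forall a I, idx K I -> open_in (dom (ach K I)) (@collar a e I);
  cl_ks : forall a I t (x : kT (ach K I)), idx K I -> collar_ivl a e t -> bdset a I x ->
    ks (ach K I) (ccolU K a t x) = ks (ach K I) x;
  cl_phi : forall a I J t (x : kT (ach K I)), idx K I -> idx K J -> I \proper J ->
    collar_ivl a e t -> bdset a I x -> aU K I J x ->
    [/\ aU K I J (ccolU K a t x), bdset a J (aphi K J x) &
        aphi K J (ccolU K a t x) = ccolU K a t (aphi K J x)];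
  cl_phiW : forall a I J t (x : kT (ach K I)), idx K I -> idx K J -> I \proper J ->
    collar_ivl a e t -> bdset a I x -> aU K I J (ccolU K a t x) -> aU K I J x;
  cl_phiWV : forall a I J (y : kT (ach K I)), idx K I -> idx K J -> I \proper J ->
    aU K I J y -> collar a e (aphi K J y) -> collar a e y;
  cl_disj : forall a I (x : kT (ach K I)), idx K I -> bdset a I x -> ~ collar (~~ a) e x;
  cl_pr : forall a I, idx K I -> smooth_map (kU (ach K I)) (cbdU K a I) (@collar a e I) (pr a I);
  cl_tm : forall a I, idx K I -> smooth_fun (kU (ach K I)) (@collar a e I)
    (fun y => const_mx (ivl_coord a (tm a I y)) : 'rV[R]_1);
  cl_sub : forall a I y, idx K I -> collar a e y -> exists c c' g,
    [/\ charts (kU (ach K I)) c, cdom c y, charts (cbdU K a I) c', cdom c' (pr a I y) &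
      ext (cmap c @` (cdom c `&` @collar a e I `&` pr a I @^-1` cdom c'))
        (cmap c' \o pr a I \o cinv c) (cmap c y) g /\ row_full (jac g (cmap c y))];
  cl_core : forall a, core (bd_atlas a K) }.

Lemma collar_ivlE a e t : collar_ivl a e t <-> 0 <= ivl_coord a t < e.
Proof.
rewrite /collar_ivl /ivl_coord /=; case: a => //.
by split=> /andP[h1 h2]; apply/andP; split; lra.
Qed.

Lemma ivl_coord_abs a e t : collar_ivl a e t -> ivl_coord a t = `|t - endpoint a|.
Proof.
move=> /collar_ivlE /andP[h _]; move: h; rewrite /ivl_coord /endpoint; case: a => h /=.
  by rewrite distrC ger0_norm.
by rewrite subr0 ger0_norm.
Qed.

Lemma ivl_coord_dist a t t' : `|ivl_coord a t - ivl_coord a t'| = `|t - t'|.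
Proof.
case: a => //=; rewrite /ivl_coord distrC; congr `|_|; ring.
Qed.

Lemma collar_endpoint a e : 0 < e -> collar_ivl a e (endpoint a).
Proof.
by move=> e0; apply/collar_ivlE; rewrite /ivl_coord /endpoint; case: a; rewrite ?subrr lexx.
Qed.

Context {e : R} {tm : forall a I, kT (ach K I) -> R}
  {pr : forall a I, kT (ach K I) -> kT (ach K I)}.
Hypothesis hC : collars e tm pr.
Hypothesis hK : core K.

Lemma real_bd a I (x : kT (ach K I)) : idx K I -> bdset a I x -> realization K (cls x).
Proof. by move=> hI Bx; apply: real_cls => //; exact: (cl_bd hC hI Bx). Qed.

Lemma col_phi a I J t (x : kT (ach K I)) : idx K I -> idx K J -> I \subset J ->
    collar_ivl a e t -> bdset a I x -> aU K I J x ->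
    [/\ aU K I J (ccolU K a t x), bdset a J (aphi K J x) &
        aphi K J (ccolU K a t x) = ccolU K a t (aphi K J x)].
Proof.
move=> hI hJ /subset_eqVproper[E|IJ]; last exact: (cl_phi hC).
subst J => ht Bx Ux; have [xd _ _] := cl_col hC hI ht Bx.
by rewrite !(aphi_id hK) ?(aUid hK) //; exact: (cl_bd hC hI Bx).
Qed.

Lemma col_phiW a I J t (x : kT (ach K I)) : idx K I -> idx K J -> I \subset J ->
    collar_ivl a e t -> bdset a I x -> aU K I J (ccolU K a t x) -> aU K I J x.
Proof.
move=> hI hJ /subset_eqVproper[E|IJ]; last exact: (cl_phiW hC).
by subst J => ht Bx _; rewrite (aUid hK) //; exact: (cl_bd hC hI Bx).
Qed.

Lemma col_phiWV a I J (y : kT (ach K I)) : idx K I -> idx K J -> I \subset J ->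
    aU K I J y -> collar a e (aphi K J y) -> collar a e y.
Proof.
move=> hI hJ /subset_eqVproper[E|IJ]; last exact: (cl_phiWV hC).
by subst J; rewrite (aUid hK) // => yd; rewrite (aphi_id hK).
Qed.

Lemma idx_bd a I (x : kT (ach K I)) : idx K I -> bdset a I x -> idx (bd_atlas a K) I.
Proof. by move=> hI Bx; apply/(cl_idx hC); split=> //; exists x. Qed.

Lemma idx_bdK a I : idx (bd_atlas a K) I -> idx K I.
Proof. by case/(cl_idx hC). Qed.

Definition bcls a {I} (x : kT (ach K I)) := @cls R TY (bd_atlas a K) I x.
Arguments bcls a {I} x.

(** In a common larger chart L both points have collar coordinates, which are unique; so the times
    agree and the boundary points are identified already in the boundary atlas. *)
Lemma collar_transfer a I J t (x : kT (ach K I)) (y : kT (ach K J)) :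
  idx K I -> idx K J -> dom (ach K J) y -> bdset a I x -> collar_ivl a e t ->
  cls y = cls (ccolU K a t x) ->
  exists x', [/\ bdset a J x', y = ccolU K a t x' & bcls a x' = bcls a x].
Proof.
move=> hI hJ yd Bx ht /(cls_joined hK hJ yd)[L [/= [_ _ hL JL IL] [Uy Ux E]]].
have UxL := col_phiW hI hL IL ht Bx Ux.
have [_ BL EL] := col_phi hI hL IL ht Bx UxL.
have Wy : collar a e y.
  by apply: (col_phiWV hJ hL JL) => //; rewrite E EL; exists t, (aphi K L x).
case: Wy => t' [x' [ht' Bx' Ey]]; rewrite Ey in Uy E yd *.
have UxL' := col_phiW hJ hL JL ht' Bx' Uy.
have [_ BL' EL'] := col_phi hJ hL JL ht' Bx' UxL'.
rewrite EL EL' in E.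
have [_ t1 p1] := cl_col hC hL ht BL; have [_ t2 p2] := cl_col hC hL ht' BL'.
have tt : t' = t by rewrite -t2 E t1.
have pp : aphi K L x' = aphi K L x by rewrite -p2 E p1.
exists x'; split=> //; first by rewrite tt.
have bI := idx_bd hI Bx; have bJ := idx_bd hJ Bx'; have bL := idx_bd hL BL.
rewrite /bcls -[LHS](@cls_aphi R TY (bd_atlas a K) J L) //.
by rewrite -[RHS](@cls_aphi R TY (bd_atlas a K) I L) // -[in RHS]pp.
Qed.

Lemma bcls_inj a I J (x : kT (ach K I)) (y : kT (ach K J)) : idx K I -> idx K J ->
  bdset a I x -> bdset a J y -> cls x = cls y -> bcls a x = bcls a y.
Proof.
move=> hI hJ Bx By; have h0 := collar_endpoint a (cl_e hC).
rewrite -{1}(cl_end hC hI Bx) => E.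
have [x' [Bx' -> <-]] := collar_transfer hI hJ (cl_bd hC hJ By) Bx h0 (esym E).
by rewrite (cl_end hC).
Qed.

Lemma col_bcls a I J t (x : kT (ach K I)) (y : kT (ach K J)) : bdset a I x -> idx K I ->
  collar_ivl a e t -> bcls a x = bcls a y ->
  [/\ idx K J, bdset a J y & cls (ccolU K a t x) = cls (ccolU K a t y)].
Proof.
move=> Bx hI ht E; have bI := idx_bd hI Bx.
have hB := cl_core hC a.
have [L [/= [_ bJ bL IL JL] [[UI _] [UJ By] E']]] := cls_joined hB bI Bx E.
have hJ := idx_bdK bJ; have hL := idx_bdK bL.
split=> //; have [U1 B1 E1] := col_phi hI hL IL ht Bx UI; have [U2 B2 E2] := col_phi hJ hL JL ht By UJ.
by rewrite -(cls_aphi hI hL IL U1) -(cls_aphi hJ hL JL U2) E1 E2 E'.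
Qed.

Lemma bcls_cls a I J (x : kT (ach K I)) (y : kT (ach K J)) : bdset a I x -> idx K I ->
  bcls a x = bcls a y -> cls x = cls y.
Proof.
move=> Bx hI E; have [hJ By] := col_bcls Bx hI (collar_endpoint a (cl_e hC)) E.
by rewrite !(cl_end hC).
Qed.

Lemma iota_bcls a I t (x : kT (ach K I)) : idx K I -> bdset a I x -> collar_ivl a e t ->
  iota_real t (bcls a x) = cls (ccolU K a t x).
Proof.
move=> hI Bx ht; rewrite eqEsubset; split=> q.
  move=> [J [y [xy yq]]].
  have /(col_bcls Bx hI ht)[_ _ ->] // : bcls a x = bcls a y.
  by apply/cls_eqP.
by move=> xq; exists I, x; split=> //; exact: cls_refl.
Qed.

Lemma bd_realization a b : realization (bd_atlas a K) b <->
  exists I x, [/\ idx K I, bdset a I x & b = bcls a x].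
Proof.
split=> -[I [x [hI Bx ->]]]; exists I, x; split=> //; first exact: idx_bdK hI.
exact: idx_bd Bx.
Qed.

Lemma iota_bd a I (x : kT (ach K I)) : idx K I -> bdset a I x ->
  iota_real (endpoint a) (bcls a x) = cls x.
Proof.
by move=> hI Bx; rewrite (iota_bcls hI Bx (collar_endpoint a (cl_e hC))) (cl_end hC).
Qed.

Context {d : metric_family K} (hd : admissible_metric d).
Hypothesis dcol : forall a I J t t' (x : kT (ach K I)) (y : kT (ach K J)), idx K I -> idx K J ->
  bdset a I x -> bdset a J y -> collar_ivl a e t -> collar_ivl a e t' ->
  d (cls (ccolU K a t x)) (cls (ccolU K a t' y)) = `|t - t'| + d (cls x) (cls y).
Hypothesis dout : forall a I J t (x : kT (ach K I)) (y : kT (ach K J)), idx K I -> idx K J ->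
  bdset a I x -> dom (ach K J) y -> collar_ivl a e t -> ~ collar a e y ->
  e - ivl_coord a t <= d (cls y) (cls (ccolU K a t x)).

Lemma bd_metricE a I J (x : kT (ach K I)) (y : kT (ach K J)) : idx K I -> idx K J ->
  bdset a I x -> bdset a J y -> bd_metric d (bcls a x) (bcls a y) = d (cls x) (cls y).
Proof. by move=> hI hJ Bx By; rewrite /bd_metric !iota_bd. Qed.

Lemma collar_near a I J t (x : kT (ach K I)) (y : kT (ach K J)) : idx K I -> idx K J ->
  bdset a I x -> dom (ach K J) y -> collar_ivl a e t ->
  d (cls y) (cls (ccolU K a t x)) + ivl_coord a t < e ->
  exists s x', [/\ collar_ivl a e s, bdset a J x', y = ccolU K a s x' &
    d (cls y) (cls (ccolU K a t x)) = `|s - t| + d (cls x') (cls x)].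
Proof.
move=> hI hJ Bx yd ht yt; have [[s [x' [hs Bx' Ey]]]|nW] := pselect (collar a e y).
  by exists s, x'; split=> //; rewrite Ey dcol.
by have := dout hI hJ Bx yd ht nW; move: yt; lra.
Qed.

(** The open set of U_I cutting out A is the union of the balls of U_I around points of A whose
    trace on the boundary lies in A. *)
Lemma bd_open_ball a I (A : set (kT (ach K I))) : idx K I -> A `<=` bdset a I ->
  (forall x, A x -> exists2 r : R, 0 < r & forall y, bdset a I y -> d (cls x) (cls y) < r -> A y) ->
  open_in (bdset a I) A.
Proof.
move=> hI sA H.
pose A' := [set y | dom (ach K I) y /\ exists x (r : R), [/\ A x, 0 < r,
   forall y, bdset a I y -> d (cls x) (cls y) < r -> A y & d (cls x) (cls y) < r]].
have oA : open_in (dom (ach K I)) A'.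
  apply: (ball_open hd hI) => [y []//|y [yd [x [r [Ax r0 rA xy]]]]].
  have xd : dom (ach K I) x by apply: (cl_bd hC hI (a := a)); exact: sA.
  exists (r - d (cls x) (cls y)); first by rewrite subr_gt0.
  move=> z zd yz; split=> //; exists x, r; split=> //.
  apply: le_lt_trans (d_tri hd (real_cls hI xd) (real_cls hI yd) (real_cls hI zd)) _.
  by rewrite -ltrBrDl.
have [Q oQ EQ] := oA; exists Q => //; rewrite eqEsubset; split=> y.
  move=> Ay; have By := sA _ Ay; split=> //; suff : A' y by rewrite EQ => -[].
  have yd := cl_bd hC hI By; split=> //; have [r r0 rA] := H y Ay.
  exists y, r; split=> //; rewrite (d_refl hd) //; exact: real_cls.
move=> [By Qy]; have : A' y by rewrite EQ; split=> //; exact: (cl_bd hC hI By).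
by move=> [_ [x [r [Ax r0 rA xy]]]]; exact: rA.
Qed.

Lemma bd_admissible a : admissible_metric (bd_metric (a:=a) d).
Proof.
split.
- split.
  + move=> b c /bd_realization[I [x [hI Bx ->]]] /bd_realization[J [y [hJ By ->]]].
    by rewrite bd_metricE // (d_ge0 hd (real_bd hI Bx) (real_bd hJ By)).
  + move=> b c /bd_realization[I [x [hI Bx ->]]] /bd_realization[J [y [hJ By ->]]].
    have rx := real_bd hI Bx; have ry := real_bd hJ By.
    rewrite bd_metricE //; split=> [/(d_eq0 hd rx ry)|/(bcls_cls Bx hI) E]; first exact: bcls_inj.
    by rewrite E (d_refl hd).
  + move=> b c /bd_realization[I [x [hI Bx ->]]] /bd_realization[J [y [hJ By ->]]].
    by rewrite !bd_metricE // (d_sym hd (real_bd hI Bx) (real_bd hJ By)).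
  + move=> b c b' /bd_realization[I [x [hI Bx ->]]] /bd_realization[J [y [hJ By ->]]] /bd_realization[L [z [hL Bz ->]]].
    by rewrite !bd_metricE // (d_tri hd (real_bd hI Bx) (real_bd hJ By) (real_bd hL Bz)).
- case: hd => _ [M hM] _; exists M.
  move=> b c /bd_realization[I [x [hI Bx ->]]] /bd_realization[J [y [hJ By ->]]].
  by rewrite bd_metricE // (hM _ _ (real_bd hI Bx) (real_bd hJ By)).
move=> I bI; have hI := idx_bdK bI.
have E x y : bdset a I x -> bdset a I y ->
    @pull_metric R TY (bd_atlas a K) (bd_metric (a:=a) d) I x y = d (cls x) (cls y).
  by move=> Bx By; exact: (@bd_metricE a I I x y).
split.
  split.
  + by move=> x y Bx By; rewrite E // (d_ge0 hd (real_bd hI Bx) (real_bd hI By)).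
  + move=> x y Bx By; rewrite E //; have xd := cl_bd hC hI Bx; have yd := cl_bd hC hI By.
    split=> [/(d_eq0 hd (real_cls hI xd) (real_cls hI yd))/(cls_inj hK hI xd)//|->].
    by rewrite (d_refl hd) //; exact: real_cls.
  + by move=> x y Bx By; rewrite !E // (d_sym hd (real_bd hI Bx) (real_bd hI By)).
  + by move=> x y z Bx By Bz; rewrite !E // (d_tri hd (real_bd hI Bx) (real_bd hI By) (real_bd hI Bz)).
move=> A sA; split=> [[Q oQ ->] x [Bx Qx]|H].
  have xd := cl_bd hC hI Bx.
  have oQ' : open_in (dom (ach K I)) (dom (ach K I) `&` Q) by exists Q.
  have [r r0 rP] := open_ball hd hI oQ' (conj xd Qx); exists r => // y [By].
  rewrite /= E // => xy; split=> //.
  by have [] := rP y (cl_bd hC hI By) xy.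
apply: bd_open_ball => // x Ax; have [r r0 rP] := H x Ax; exists r => // y By xy.
by apply: rP; split=> //=; rewrite E //; exact: sA.
Qed.

(** A point off the boundary has positive distance from it: at least its collar time if it lies in
    the collar, and at least e otherwise. *)
Lemma bd_closed a I : idx K I -> exists2 Q, open Q & bdset a I = dom (ach K I) `&` ~` Q.
Proof.
move=> hI; have e0 := cl_e hC.
have : open_in (dom (ach K I)) (dom (ach K I) `\` bdset a I).
  apply: (ball_open hd hI) => [x []//|x [xd nB]].
  have rx := real_cls hI xd.
  have [[t [x' [ht Bx' Ex]]]|nW] := pselect (collar a e x).
    have tne : 0 < `|t - endpoint a|.
      rewrite normr_gt0 subr_eq0; apply/eqP => E; apply: nB.
      by rewrite Ex E (cl_end hC).
    exists `|t - endpoint a| => // y yd xy; split=> // By; move: xy.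
    rewrite -[y](cl_end hC hI By) {1}Ex dcol //; last exact: collar_endpoint.
    by rewrite ltNge lerDl (d_ge0 hd (real_bd hI Bx') (real_bd hI By)).
  exists e => // y yd xy; split=> // By.
  have := dout hI hI By xd (collar_endpoint a e0) nW.
  rewrite (cl_end hC) //; rewrite (ivl_coord_abs (collar_endpoint a e0)) subrr normr0 subr0.
  by rewrite leNgt xy.
move=> [Q oQ EQ]; exists Q => //; rewrite eqEsubset; split=> x.
  move=> Bx; have xd := cl_bd hC hI Bx; split=> // Qx.
  by have [_ /(_ Bx)] : (dom (ach K I) `\` bdset a I) x by rewrite EQ; split.
move=> [xd nQ]; apply: contrapT => nB; apply: nQ.
by have : (dom (ach K I) `\` bdset a I) x by []; rewrite EQ => -[].
Qed.

Lemma bd_separating a V delta : separating d V delta ->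
  separating (bd_metric (a:=a) d) (bd_fam a V) delta.
Proof.
move=> [h1 h2]; split.
  move=> I bI; have hI := idx_bdK bI; split; first by move=> x [].
  set N := nbhdU _ _ _; have [_ cV] := h1 I hI.
  have [Q oQ EQ] := bd_closed a hI.
  have sN : N `<=` nbhdU d (2 * delta) (V I).
    move=> x [Bx [v [Vv Bv] xv]]; split; first exact: (cl_bd hC hI Bx).
    exists v => //; move: xv; by rewrite /pull_metric -!/(bcls a _) bd_metricE.
  have -> : closure_in (dom (ach (bd_atlas a K) I)) N =
      (closure_in (dom (ach K I)) (nbhdU d (2 * delta) (V I))) `&` (closure N `&` ~` Q).
    rewrite eqEsubset; split=> x.
      move=> [Bx cx]; have Bx' : bdset a I x by [].
      split; first by split; [exact: (cl_bd hC hI Bx)|exact: closure_subset cx].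
      by split=> //; move: Bx'; rewrite EQ => -[].
    move=> [[xd _] [cx nQ]]; split=> //.
    by have -> : dom (ach (bd_atlas a K) I) = bdset a I by []; rewrite EQ.
  by apply: compact_closedI => //; apply: closedI; [exact: closed_closure|exact: open_closedC].
move=> I J bI bJ [b [[rb [c [x [Vx Bx] <-] bc]] [_ [c' [y [Vy By] <-] bc']]]].
have hI := idx_bdK bI; have hJ := idx_bdK bJ.
apply: (h2 I J hI hJ); case/bd_realization: rb bc bc' => L [z [hL Bz ->]].
rewrite -!/(bcls a _) !bd_metricE // => bc bc'.
exists (cls z); split; split; try exact: (real_bd hL Bz).
  by exists (@cls R TY K I x); [exists x|exact: bc].
by exists (@cls R TY K J y); [exists y|exact: bc'].
Qed.

(** Radii that separate V also separate its boundary part, so the supremum for the boundary is no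
    smaller. *)
Lemma bd_delta_red a V delta : 0 < delta -> delta < delta_red d V ->
  separating d V delta /\ delta < delta_red (bd_metric (a:=a) d) (bd_fam a V).
Proof.
rewrite /delta_red; set S := [set r | _] => d0 dS.
(* The supremum of the empty set is 0 by convention, which 0 < delta excludes. *)
have S0 : S !=set0.
  apply/set0P/eqP => E; move: dS; rewrite E sup0 => h; have := lt_trans d0 h.
  by rewrite ltxx.
have ub (T : set R) : (forall r, T r -> r <= 4^-1) -> has_ubound T by exists 4^-1.
have hS : has_sup S by split=> //; apply: ub => r [/andP[]].
have [r [r4 rS] dr] := sup_gt S0 dS.
split; first by apply: rS; rewrite d0.
apply: lt_le_trans dS _; apply: le_sup => //.
  move=> r' [r'4 r'S]; exists r'; split=> //; split=> // delta' h; apply: bd_separating.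
  exact: r'S.
split; last by apply: ub => r' [/andP[]].
by exists r; split=> // delta' h; apply: bd_separating; exact: rS.
Qed.

End Collars.
Arguments bdset {R TY} K a I _.
Arguments collar {R TY K} a e {I} _.
Arguments collars {R TY} K e tm pr.
Arguments bcls {R TY} K a {I} x.

(** * Transfer of smoothness and transversality along maps; the cutoff function *)

Section LocalTransfer.
Context {R : realType} {T T' : topologicalType} {W : vectType R}.

Lemma smooth_map_sub (M : manifold R T) (N : manifold R T') D D' (phi : T -> T') :
  D' `<=` D -> smooth_map M N D phi -> smooth_map M N D' phi.
Proof.
move=> sD [im cphi sphi]; split.
- by move=> _ [x /sD Dx <-]; apply: im; exists x.
- exact: continuous_subspaceW cphi.
- move=> c c' hc hc' _ [x [[cx /sD Dx] cx'] <-].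
  have [|g [U [oU Ux hg gE]]] := sphi c c' hc hc' (cmap c x); first by exists x.
  exists g, U; split=> // _ [y [[cy /sD Dy] cy'] <-] Uy; apply: gE => //.
  by exists y.
Qed.

Lemma smooth_fun_scale (M : manifold R T) D (f : T -> W) (tau : T -> 'rV[R]_1) (beta : 'rV[R]_1 -> R) :
  smooth_fun M D f -> smooth_fun M D tau -> Sinf setT beta ->
  smooth_fun M D (fun y => beta (tau y) *: f y).
Proof.
move=> sf st sb c hc v Dv; have [g [U [oU Ux hg gE]]] := sf c hc v Dv.
have [h [U' [oU' Ux' hh hE]]] := smooth_in_row (st c hc) Dv.
have oI : open (U `&` U') by exact: openI.
exists (fun y => beta (h y) *: g y), (U `&` U'); split=> //.
- apply: Cinfty_scale => //; last by apply: (Cinfty_sub oU _ _ hg) => // z [].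
  apply: (Sinf_comp oI openT) => //.
  by apply: (Cinfty_sub oU' _ _ hh) => // z [].
- by move=> y Dy [Uy Uy']; rewrite gE // hE //= linearZ.
Qed.

(** Locally f = f' o phi. In the row convention the Jacobian is a product of two surjective
    matrices. *)
Lemma tv_submersion (M : manifold R T) (N : manifold R T') (D Q W0 : set T) (D' : set T')
    (phi : T -> T') (f : T -> W) (f' : T' -> W) y c c' g :
  smooth_atlas M -> smooth_atlas N -> D y -> open Q -> Q y -> W0 y ->
  open_in (carrier N) D' -> {within W0, continuous phi} -> phi @` W0 `<=` carrier N ->
  charts M c -> cdom c y -> charts N c' -> cdom c' (phi y) ->
  ext (cmap c @` (cdom c `&` W0 `&` phi @^-1` cdom c')) (cmap c' \o phi \o cinv c) (cmap c y) g ->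
  row_full (jac g (cmap c y)) ->
  (forall y', D y' -> Q y' -> [/\ W0 y', D' (phi y') & f y' = f' (phi y')]) ->
  smooth_fun N D' f' -> tv N D' f' (phi y) -> tv M D f y.
Proof.
move=> MM MN Dy oQ Qy Wy oD' cphi imW hc cy hc' cy' hg fr H sf' tv' f0.
have [_ D'y fE] := H y Dy Qy; rewrite fE in f0.
have [g' hr'] := rep_exists sf' D'y hc' cy'.
have fr' := tv_rep MN oD' D'y tv' hr' f0.
have [Qc oQc EQc] := cdom_open MN hc'.
have [Q' oQ' EQ'] := open_in_preimage cphi oQc.
have inQ z : W0 z -> Q' z <-> cdom c' (phi z).
  move=> Wz; have Nz : carrier N (phi z) by apply: imW; exists z.
  split=> [Qz|cz].
    have : (W0 `&` phi @^-1` Qc) z by rewrite EQ'.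
    by rewrite EQc => -[_ Qcz].
  suff : (W0 `&` Q') z by case.
  by rewrite -EQ'; split=> //; move: cz; rewrite EQc => -[].
pose D1 := D `&` Q `&` phi @^-1` cdom c'.
pose S := cmap c @` (cdom c `&` D1).
have hg1 : ext S (cmap c' \o phi \o cinv c) (cmap c y) g.
  apply: ext_sub hg => _ [z [cz [[Dz Qz] cz']] <-].
  by have [Wz _ _] := H z Dz Qz; exists z.
have Sy : S (cmap c y) by exists y.
have SD v : S v -> (cmap c' @` (cdom c' `&` D')) ((cmap c' \o phi \o cinv c) v).
  move=> [z [cz [[Dz Qz] cz']] <-]; rewrite /= (cmapK MM) //; exists (phi z) => //.
  by have [_ D'z _] := H z Dz Qz.
have [_ _ hg'] := hr'.
have E : cmap c' (phi y) = (cmap c' \o phi \o cinv c) (cmap c y) by rewrite /= (cmapK MM).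
rewrite E in hg' fr'.
exists c, (g' \o g); split; last first.
  rewrite (jac_ext_comp Sy hg1 hg'); apply/row_full_surjP => w.
  have [u ->] := (row_full_surjP _).1 fr' w; have [v ->] := (row_full_surjP _).1 fr u.
  by exists v; rewrite mulmxA.
apply: (rep_local (D' := D1) (Q := Q `&` Q') MM).
- exact: openI.
- by split=> //; apply/inQ.
- by move=> z Dz [Qz Qz']; split=> //; apply/inQ => //; have [] := H z Dz Qz.
split=> //; have [U [oU Ux hU UE]] := ext_comp Sy SD hg1 hg'.
exists U; split=> // _ [z [cz [[Dz Qz] cz']] <-] Uz; rewrite UE //=; last by exists z.
by rewrite (cmapK MM) // (cmapK MN) //; have [_ _ ->] := H z Dz Qz.
Qed.

(** The cutoff ends at 3e/8 < e/2: extensions from the two ends have disjoint supports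
    ([collars_apart]) and live in the half collars, where the neighbourhoods of V project to those
    of its boundary. *)
Lemma cutoff_exists (e : R) : 0 < e -> exists beta : R -> R,
  [/\ Sinf setT (fun v : 'rV[R]_1 => beta (v 0 0)), forall x, 0 <= beta x <= 1,
      forall x, x <= e / 4 -> beta x = 1 & forall x, 3 / 8 * e <= x -> beta x = 0].
Proof.
move=> e0; have [th [sth th01 th1 th0]] := (@step_exists R).
exists (fun x => th (8 / e * x + (-2))); split=> // [|x h|x h].
- move=> k; apply: (Sk_comp1 openT sth); apply: SkD; [exact: openT| |exact: Sk_cst openT].
  apply: SkM; [exact: openT|exact: Sk_cst openT|exact: Sk_coord openT].
- apply: th1; rewrite subr_le0 mulrAC ler_pdivrMr //; lra.
- apply: th0; rewrite lerBrDr mulrAC ler_pdivlMr //; lra.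
Qed.

End LocalTransfer.

(** * Extending adapted boundary perturbations along the collars *)

Section BoundaryExtension.
Context {R : realType} {TY : topologicalType} {K : cobordism R TY}.
Implicit Types (a : bool) (I J L H : {set 'I_(aN K)}) (t : R).
Context {e : R} {tm : forall a I, kT (ach K I) -> R}
  {pr : forall a I, kT (ach K I) -> kT (ach K I)}.
Hypothesis hC : collars K e tm pr.
Hypothesis hK : core K.
Context {d : metric_family K} (hd : admissible_metric d).
Hypothesis dcol : forall a I J t t' (x : kT (ach K I)) (y : kT (ach K J)), idx K I -> idx K J ->
  bdset K a I x -> bdset K a J y -> collar_ivl a e t -> collar_ivl a e t' ->
  d (cls (ccolU K a t x)) (cls (ccolU K a t' y)) = `|t - t'| + d (cls x) (cls y).
Hypothesis dout : forall a I J t (x : kT (ach K I)) (y : kT (ach K J)), idx K I -> idx K J ->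
  bdset K a I x -> dom (ach K J) y -> collar_ivl a e t -> ~ collar a e y ->
  e - ivl_coord a t <= d (cls y) (cls (ccolU K a t x)).
Context {V : dom_family K} {delta : R} (d0 : 0 < delta) (de : delta < e).
Arguments V : clear implicits.
Hypothesis hV : forall I, idx K I -> V I `<=` dom (ach K I).
Hypothesis sep : separating d V delta.
Hypothesis colV : forall a I t x, idx K I -> bdset K a I x -> collar_ivl a e t ->
  (V I (ccolU K a t x) <-> V I x).
Context {n : norm_family K}.
Hypothesis hn : forall I, idx K I -> is_norm (n (I:=I)).

Definition Vb a (k : R) J : set (kT (ach K J)) :=
  Vk (bd_metric (a:=a) d) (bd_fam a V) delta k J.
Arguments Vb : clear implicits.

(* What the extensions nu' in the definition of an adapted perturbation on the
   boundary provide. *)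
Record bdext a (s : R) (mu : section_family K) : Prop := MkBdext {
  be_smooth : forall J, idx (bd_atlas a K) J -> smooth_fun (cbdU K a J) (Vb a #|J|%:R J) (mu J);
  be_compat : forall H J (x : kT (ach K H)), idx (bd_atlas a K) H -> idx (bd_atlas a K) J -> H \proper J ->
    Vb a #|J|%:R H x -> aU K H J x -> bdset K a H x -> Vb a #|J|%:R J (aphi K J x) ->
    mu J (aphi K J x) = ahat K H J (mu H x);
  be_tv : forall J (x : kT (ach K J)), idx (bd_atlas a K) J -> Vb a #|J|%:R J x ->
    tv (cbdU K a J) (Vb a #|J|%:R J) (fun y => ks (ach K J) y + mu J y) x;
  be_reg : forall H J (x x' : kT (ach K J)), idx (bd_atlas a K) H -> idx (bd_atlas a K) J -> H \proper J ->
    Vb a #|J|%:R J x ->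
    @Nk R TY (bd_atlas a K) (bd_metric (a:=a) d) (bd_fam a V) delta #|J|%:R J H x' ->
    d (cls x) (cls x') < eta delta #|J|%:R -> mu J x \in limg (ahat K H J);
  be_bound : exists2 s' : R, s' < s & forall J (x : kT (ach K J)), idx (bd_atlas a K) J -> Vb a #|J|%:R J x ->
    n (mu J x) <= s' }.

Lemma Vb_bd a k J x : Vb a k J x -> bdset K a J x.
Proof. by case. Qed.

(** The last clause makes the restriction of the final perturbation adapted: adaptedness involves nu
    only through its values on V, the extensions being chosen separately. *)
Lemma adapted_bdext a (C : dom_family K) s (nu : section_family (bd_atlas a K)) :
  bd_adapted d V C n delta s nu ->
  exists mu, bdext a s mu /\
    (forall J x, idx (bd_atlas a K) J -> bd_fam a V J x -> mu J x = nu J x) /\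
    forall nu2 : section_family (bd_atlas a K),
      (forall J x, idx (bd_atlas a K) J -> bd_fam a V J x -> nu2 J x = nu J x) ->
      bd_adapted d V C n delta s nu2.
Proof.
move=> [h1 h2 h3 [h4s h4c] [mu [mus mua]]].
have hB := cl_core hC a; have hdb := bd_admissible hC hK hd a.
have hVb I : idx (bd_atlas a K) I -> bd_fam a V I `<=` dom (ach (bd_atlas a K) I) by move=> _ x [].
have kJ J : idx (bd_atlas a K) J -> (1 <= #|J|)%N.
  by move=> [J0 _]; rewrite card_gt0.
have ex J : idx (bd_atlas a K) J -> exists2 L, idx (bd_atlas a K) L & (#|J| <= #|L|)%N by exists J.
exists mu; split; last first.
  split; first by move=> J x hJ Vx; have [_ /(_ x Vx)] := mus J hJ.
  move=> nu2 E; split=> //; last first.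
    exists mu; split=> // I hI; have [ms me] := mus I hI; split=> // x Vx.
    by rewrite E // me.
  split=> [I hI|I J hI hJ IJ x Vx Ux Vy]; last by rewrite !E //; exact: h4c.
  by apply: (smooth_fun_eq (co_man hB hI) _ (h4s I hI)) => x Vx; rewrite E.
split.
- by move=> J hJ; have [] := mus J hJ.
- move=> H J x hH hJ HJ Vx Ux Bx Vy.
  by have [hc _ _ _ _] := mua _ (kJ J hJ) (ex J hJ) J hJ (leqnn _); apply: (hc H hH HJ x Vx).
- move=> J x hJ Vx; have [_ ht _ _ _] := mua _ (kJ J hJ) (ex J hJ) J hJ (leqnn _).
  have [ms _] := mus J hJ.
  have sD : Vb a #|J|%:R J `<=` carrier (cbdU K a J) by move=> y [].
  apply: (limg_dfun_tv (co_man hB hJ) sD Vx) => //; last exact: ht.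
  apply: smooth_funD => //.
  by apply: smooth_fun_sub (co_s hB hJ) => y [].
- move=> H J x x' hH hJ HJ Vx Nx xx'.
  have [_ _ hr _ _] := mua _ (kJ J hJ) (ex J hJ) J hJ (leqnn _).
  apply: (hr H hH HJ x) => //; split; first exact: Vb_bd Vx.
  exists x' => //; have Bx' : bdset K a J x' by case: Nx => -[].
  have hJ' := idx_bdK hC hJ.
  rewrite /pull_metric -/(bcls K a _) -/(bcls K a _) (bd_metricE hC hK) //.
  exact: Vb_bd Vx.
- have [r r0 rP] : exists2 r : R, 0 < r & forall J, idx (bd_atlas a K) J -> forall x,
      Vb a #|J|%:R J x -> n (mu J x) <= s - r.
    apply: fin_radius => [J|J r r' rr h hJ x Vx]; last first.
      by apply: le_trans (h hJ x Vx) _; rewrite lerB.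
    have [hJ|nJ] := pselect (idx (bd_atlas a K) J); last by exists 1 => // /nJ.
    have [_ _ _ _ hb] := mua _ (kJ J hJ) (ex J hJ) J hJ (leqnn _).
    set S := [set _ | _ in _] in hb.
    have ub x : Vb a #|J|%:R J x -> ((n (mu J x))%:E <= ereal_sup S)%E.
      by move=> Vx; apply: ereal_sup_ubound; exists x.
    case E : (ereal_sup S) ub hb => [r| |] ub hb //.
      exists (s - r); first by rewrite subr_gt0 -lte_fin.
      by move=> _ x Vx; rewrite subKr -lee_fin ub.
    (* A supremum -oo occurs only if there is no point at all. *)
    by exists 1 => // _ x /ub; rewrite leeNy_eq.
  exists (s - r) => [|J x hJ Vx]; first by rewrite ltrBlDr ltrDl.
  exact: rP.
Qed.

Lemma Vb_le a k l J x : k <= l -> Vb a l J x -> Vb a k J x.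
Proof. exact: (Vk_le d0). Qed.

Lemma pow2n_half k : 1 <= k -> pow2n k * delta <= delta / 2.
Proof.
move=> k1; rewrite mulrC ler_wpM2l ?(ltW d0) // -(@pow2n1 R); exact: pow2n_le.
Qed.

(** For k >= 1 the radius is at most delta/2 < e/2, so a point of the half collar is only close to
    points of V inside the collar, where metric and V are products. This uses delta < e. *)
Lemma Vk_collar a I k t (x : kT (ach K I)) : idx K I -> 1 <= k -> bdset K a I x -> collar_ivl a e t ->
  ivl_coord a t <= e / 2 -> Vk d V delta k I (ccolU K a t x) -> Vb a k I x.
Proof.
move=> hI k1 Bx ht te [yd [v Vv yv]]; have vd := hV hI Vv.
have ry := real_cls hI yd; have rv := real_cls hI vd.
rewrite /pull_metric (d_sym hd ry rv) in yv.
have [|s [x' [hs Bx' Ev dE]]] := collar_near dcol dout hI hI Bx vd ht.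
  by have := pow2n_half k1; move: yv te de; lra.
split=> //; exists x'; first by split=> //; apply/(colV hI Bx' hs); rewrite -Ev.
rewrite /pull_metric -/(bcls K a _) -/(bcls K a _) (bd_metricE hC hK) //.
rewrite (d_sym hd (real_bd hC hI Bx) (real_bd hC hI Bx')).
by apply: le_lt_trans yv; rewrite dE lerDr.
Qed.

Lemma bd_col_dist a I t (x : kT (ach K I)) : idx K I -> bdset K a I x -> collar_ivl a e t ->
  d (cls x) (cls (ccolU K a t x)) = ivl_coord a t.
Proof.
move=> hI Bx ht; rewrite -{1}(cl_end hC hI Bx) dcol //; last exact: collar_endpoint (cl_e hC).
by rewrite (d_refl hd (real_bd hC hI Bx)) addr0 distrC (ivl_coord_abs ht).
Qed.

(** A common point would put x within 3e/4 of the opposite boundary; but x is outside the opposite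
    collar and so at distance at least e from that boundary. *)
Lemma collars_apart a I t t' (x x' : kT (ach K I)) : idx K I -> bdset K a I x -> bdset K (~~ a) I x' ->
  collar_ivl a e t -> collar_ivl (~~ a) e t' -> ivl_coord a t < 3 / 8 * e -> ivl_coord (~~ a) t' < 3 / 8 * e ->
  ccolU K a t x <> ccolU K (~~ a) t' x'.
Proof.
move=> hI Bx Bx' ht ht' te te' E.
have rx := real_bd hC hI Bx; have rx' := real_bd hC hI Bx'.
have [yd _ _] := cl_col hC hI ht Bx; have ry := real_cls hI yd.
have [cx|ncx] := pselect (collar (~~ a) e x); first exact: (cl_disj hC hI Bx).
have h0 := collar_endpoint (~~ a) (cl_e hC).
have := dout hI hI Bx' (cl_bd hC hI Bx) h0 ncx.
rewrite (cl_end hC) // (ivl_coord_abs h0) subrr normr0 subr0.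
have := bd_col_dist hI Bx' ht'; rewrite -E (d_sym hd rx' ry) => q.
by have := d_tri hd rx ry rx'; rewrite (bd_col_dist hI Bx ht) q; have := cl_e hC; lra.
Qed.

Variable beta : R -> R.
Hypothesis sbeta : Sinf setT (fun v : 'rV[R]_1 => beta (v 0 0)).
Hypothesis beta01 : forall x, 0 <= beta x <= 1.
Hypothesis beta1 : forall x, x <= e / 4 -> beta x = 1.
Hypothesis beta0 : forall x, 3 / 8 * e <= x -> beta x = 0.

Definition collar_ext a (mu : section_family K) : section_family K := fun I y =>
  if `[< collar a e y >] then beta (ivl_coord a (tm a y)) *: mu I (pr a y) else 0.

Lemma collar_ext_col a mu I t (x : kT (ach K I)) : idx K I -> bdset K a I x -> collar_ivl a e t ->
  collar_ext a mu (ccolU K a t x) = beta (ivl_coord a t) *: mu I x.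
Proof.
move=> hI Bx ht; rewrite /collar_ext; case: asboolP => [_|nW].
  by have [_ -> ->] := cl_col hC hI ht Bx.
by case: nW; exists t, x.
Qed.

Lemma collar_ext_neq0 a mu I (y : kT (ach K I)) : idx K I -> collar_ext a mu y != 0 ->
  exists t x, [/\ collar_ivl a e t, bdset K a I x, y = ccolU K a t x & ivl_coord a t < 3 / 8 * e].
Proof.
move=> hI; rewrite /collar_ext; case: asboolP => [[t [x [ht Bx Ey]]]|_]; last by rewrite eqxx.
have [_ E1 E2] := cl_col hC hI ht Bx; rewrite Ey E1 E2 => h.
exists t, x; split=> //; rewrite ltNge; apply: contraNN h => h; by rewrite beta0 // scale0r.
Qed.

Lemma lev1E J : lev 1 J = #|J|%:R + 1 :> R.
Proof. by rewrite /lev addn1 -natr1. Qed.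

Lemma card_ge1 J : idx K J -> 1 <= #|J|%:R :> R.
Proof. by move=> hJ; have := lev_ge1 (R := R) 0 hJ; rewrite /lev addn0. Qed.

(** The collar projection takes the domains of level |I| + 7/8 into the boundary neighbourhoods of
    level |I|, on which the boundary data are given. *)
Lemma Dlev_collar a I t (x : kT (ach K I)) : idx K I -> bdset K a I x -> collar_ivl a e t ->
  ivl_coord a t <= e / 2 -> Dlev d V delta 1 I (ccolU K a t x) -> Vb a #|I|%:R I x.
Proof.
move=> hI Bx ht te Dy; have := card_ge1 hI => c1.
have := Vk_collar hI _ Bx ht te Dy; rewrite lev1E => h.
by apply: Vb_le (h _); lra.
Qed.

Lemma collar_ext_smooth a s mu I : idx K I -> bdext a s mu ->
  smooth_fun (kU (ach K I)) (Dlev d V delta 1 I) (collar_ext a mu (I:=I)).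
Proof.
move=> hI hmu; have MI := co_man hK hI; have e0 := cl_e hC.
have sD : Dlev d V delta 1 I `<=` dom (ach K I) by move=> y; exact: Dlev_dom.
apply: smooth_fun_glue => // y Dy; have yd := sD _ Dy; have ry := real_cls hI yd.
pose D' := Dlev d V delta 1 I `&` [set y | exists t x, [/\ collar_ivl a e t, bdset K a I x,
  y = ccolU K a t x & ivl_coord a t < e / 2]].
have [[t [x [ht Bx Ey te]]]|ny] := pselect (exists t x, [/\ collar_ivl a e t, bdset K a I x,
  y = ccolU K a t x & ivl_coord a t < e / 2]).
- have bI := idx_bd hC hI Bx.
  have [Q oQ EQ] := dball_open hd (e / 2 - ivl_coord a t) hI ry.
  exists Q, D', (collar_ext a mu (I:=I)); split=> //.
  + suff : (dom (ach K I) `&` Q) y by case.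
    by rewrite -EQ; split=> //; rewrite (d_refl hd) // subr_gt0.
  + by split=> //; exists t, x.
  + by move=> z [/sD].
  split; last first.
    move=> y' Dy' Qy'; split=> //; split=> //; have yd' := sD _ Dy'.
    have : (dom (ach K I) `&` Q) y' by [].
    rewrite -EQ => -[_ /= yy']; rewrite (d_sym hd) // in yy'; last exact: real_cls.
    rewrite Ey in yy'; have [|t' [x' [ht' Bx' Ey' dE]]] := collar_near dcol dout hI hI Bx yd' ht; first by lra.
    exists t', x'; split=> //; rewrite dE in yy'.
    have h : `|t' - t| < e / 2 - ivl_coord a t.
      apply: le_lt_trans yy'; by rewrite lerDl (d_ge0 hd (real_bd hC hI Bx') (real_bd hC hI Bx)).
    rewrite -(ivl_coord_dist a) in h; move: h; rewrite ltr_norml => /andP[]; lra.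
  have sW : D' `<=` @collar _ _ K a e I by move=> z [_ [t' [x' [ht' Bx' Ez _]]]]; exists t', x'.
  have MB := co_man (cl_core hC a) bI.
  have sB : Vb a #|I|%:R I `<=` carrier (cbdU K a I) by move=> z [].
  have hp : forall z, D' z -> Vb a #|I|%:R I (pr a z).
    move=> z [Dz [t' [x' [ht' Bx' Ez te']]]]; have [_ _ prz] := cl_col hC hI ht' Bx'.
    by rewrite Ez prz; apply: (Dlev_collar hI Bx' ht' (ltW te')); rewrite -Ez.
  have sm := smooth_map_sub sW (cl_pr hC a hI).
  have s1 : smooth_fun (kU (ach K I)) D' (mu I \o pr a (I:=I)).
    apply: (smooth_fun_comp MI MB _ sB sm hp (be_smooth hmu bI)).
    by move=> z [/sD].
  have := smooth_fun_scale s1 (smooth_fun_sub sW (@cl_tm _ _ _ _ _ _ hC a I hI)) sbeta.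
  apply: (smooth_fun_eq MI) => z D'z; rewrite /collar_ext; case: asboolP => [_|]; first by rewrite mxE.
  by case; exact: sW.
- have [Q oQ EQ] := dball_open hd (e / 16) hI ry.
  exists Q, (Dlev d V delta 1 I), (fun=> 0); split=> //.
    suff : (dom (ach K I) `&` Q) y by case.
    by rewrite -EQ; split=> //; rewrite (d_refl hd) // divr_gt0.
  split; first exact: smooth_fun_cst.
  move=> y' Dy' Qy'; split=> //; apply/esym/eqP/negPn/negP => /(collar_ext_neq0 hI).
  move=> [t [x [ht Bx Ey te]]]; apply: ny.
  have : (dom (ach K I) `&` Q) y' by split=> //; exact: sD.
  rewrite -EQ => -[_ /= yy']; rewrite Ey in yy'.
  have [|t' [x' [ht' Bx' Ey' dE]]] := collar_near dcol dout hI hI Bx yd ht; first by lra.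
  exists t', x'; split=> //; rewrite dE in yy'.
  have h : `|t' - t| < e / 16.
    apply: le_lt_trans yy'; by rewrite lerDl (d_ge0 hd (real_bd hC hI Bx') (real_bd hC hI Bx)).
  rewrite -(ivl_coord_dist a) in h; move: h; rewrite ltr_norml => /andP[]; lra.
Qed.

(** Here the extra level of cobordisms is used: the initial regions have level |J| + 1/2 and radius
    eta at |J| + 1/4, so their projections lie where adaptedness at level |J| controls mu. *)
Lemma collar_ext_reg a s mu J H : idx K J -> idx K H -> H \proper J -> bdext a s mu ->
  reg_cond d V delta 1 (collar_ext a mu) (lev 1 J - 2^-1) J H.
Proof.
move=> hJ hH HJ hmu y Dy Ry; have e0 := cl_e hC.
have c1 := card_ge1 hJ; have yd := Dlev_dom Dy.
have HsJ := proper_sub HJ.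
(* A radius of at most delta/8 < e/8 keeps the centre w in the half collar, as y has time below
   3e/8. *)
have eta8 : eta delta (lev 1 J - 2^-1 - 4^-1) <= delta / 8.
  have /andP[h1 h2] := @pow2n4_bounds R.
  have p1 : pow2n (lev 1 J - 2^-1 - 4^-1) <= 2^-1 :> R.
    by rewrite -[leRHS](@pow2n1 R); apply: pow2n_le; rewrite lev1E; lra.
  rewrite /eta; apply: (@le_trans _ _ (2^-1 * 4^-1 * delta)); last by lra.
  rewrite ler_wpM2r ?(ltW d0) //; apply: ler_pM => //; [exact: pow2n_ge0|lra|lra].
have etaJ : eta delta (lev 1 J - 2^-1 - 4^-1) <= eta delta #|J|%:R.
  by apply: eta_le => //; rewrite lev1E; lra.
split.
  have [->|/(collar_ext_neq0 hJ)[t [x [ht Bx Ey te]]]] := eqVneq (collar_ext a mu y) 0; first exact: mem0v.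
  rewrite Ey collar_ext_col // memvZ //; have bJ := idx_bd hC hJ Bx.
  case: Ry => _ [w [Vw [z [Vz Uz] zw]] yw]; have wd := Vk_dom Vw.
  rewrite /pull_metric Ey (d_sym hd) in yw; [|by rewrite -Ey; exact: real_cls|exact: real_cls].
  have [|t' [x' [ht' Bx' Ew dE]]] := collar_near dcol dout hJ hJ Bx wd ht.
    by move: yw eta8 te de; lra.
  rewrite dE in yw.
  have dx0 := d_ge0 hd (real_bd hC hJ Bx') (real_bd hC hJ Bx).
  have te' : ivl_coord a t' < e / 2.
    have h : `|t' - t| < delta / 8 by move: yw dx0 eta8; lra.
    rewrite -(ivl_coord_dist a) in h; move: h; rewrite ltr_norml => /andP[]; move: te de; lra.
  have Wz : collar a e z by apply: (col_phiWV hC hK hH hJ HsJ Uz); rewrite zw Ew; exists t', x'.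
  case: Wz => [t2 [z' [ht2 Bz' Ez]]]; rewrite Ez in Uz zw Vz.
  have Uz' := col_phiW hC hK hH hJ HsJ ht2 Bz' Uz.
  have [_ Bz2 Ez2] := col_phi hC hK hH hJ HsJ ht2 Bz' Uz'.
  have [_ tt pp] := cl_col hC hJ ht2 Bz2; have [_ tt' pp'] := cl_col hC hJ ht' Bx'.
  rewrite Ez2 Ew in zw; have t2t : t2 = t' by rewrite -tt zw tt'.
  have px : aphi K J z' = x' by rewrite -pp zw pp'.
  have bH := idx_bd hC hH Bz'.
  have k1 : 1 <= lev 1 J - 2^-1 :> R by rewrite lev1E; lra.
  have kJ : #|J|%:R <= lev 1 J - 2^-1 :> R by rewrite lev1E; lra.
  have Vz' := Vk_collar hH k1 Bz' ht2 _ Vz.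
  rewrite Ew in Vw; have Vx' := Vk_collar hJ k1 Bx' ht' (ltW te') Vw.
  apply: (be_reg hmu bH bJ HJ (x' := x')).
  - by apply: (Dlev_collar hJ Bx ht _); [move: te; lra|rewrite -Ey].
  - split; first exact: Vb_le Vx'.
    by exists z' => //; split=> //; apply: (Vb_le kJ); apply: Vz'; rewrite t2t ltW.
  - rewrite (d_sym hd (real_bd hC hJ Bx) (real_bd hC hJ Bx')); apply: lt_le_trans etaJ.
    by apply: le_lt_trans yw; rewrite lerDr.
move=> z Uz Ey; rewrite Ey in Dy Ry yd *.
have [[t [x [ht Bx Ez]]]|nW] := pselect (collar a e z); last first.
  have nW' : ~ collar a e (aphi K J z) by move=> /(col_phiWV hC hK hH hJ HsJ Uz).
  by rewrite /collar_ext; case: asboolP => // _; case: asboolP => // _; rewrite linear0.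
have Vz := Reg_aphi hK hd hV hJ hH HJ Uz Ry.
rewrite Ez in Uz Vz Ry Dy *; have Ux := col_phiW hC hK hH hJ HsJ ht Bx Uz.
have [_ Bx' E'] := col_phi hC hK hH hJ HsJ ht Bx Ux.
rewrite E' in Dy *; rewrite !collar_ext_col // linearZ /=.
have [te|te] := leP (3 / 8 * e) (ivl_coord a t); first by rewrite beta0 // !scale0r.
have te2 : ivl_coord a t <= e / 2 by move: te; lra.
congr (_ *: _); apply: (be_compat hmu) => //.
- exact: (idx_bd hC hH Bx).
- exact: (idx_bd hC hJ Bx').
- have k1 : 1 <= lev 1 J - 2^-1 - 4^-1 :> R by rewrite lev1E; lra.
  by apply: (@Vb_le a _ (lev 1 J - 2^-1 - 4^-1)); [rewrite lev1E; lra|exact: Vk_collar hH k1 Bx ht te2 Vz].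
- exact: (Dlev_collar hJ Bx' ht te2 Dy).
Qed.

End BoundaryExtension.
Arguments Vb {R TY K} d V delta a k J _.
Arguments bdext {R TY K} d V delta n a s mu.
Arguments collar_ext {R TY K} e tm pr beta a mu I y.

Lemma limg_dfun_sub (R : realType) (T : topologicalType) (W' W : vectType R) (M : manifold R T)
    (D Q : set T) (f : T -> W) (A : 'Hom(W', W)) y :
  smooth_atlas M -> open_in (carrier M) D -> D y -> open_in (carrier M) Q -> Q y ->
  smooth_fun M D f -> (forall z, D z -> Q z -> f z \in limg A) -> (limg (dfun M D f y) <= limg A)%VS.
Proof.
move=> MA oD Dy oQ Qy sf H.
have sD : D `<=` carrier M by case: oD => O _ -> z [].
have [g [hc cy hg] E] := dfun_rep MA sD Dy sf; set c := chart_at M y in hc cy hg E.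
pose S := cmap c @` (cdom c `&` (D `&` Q)).
have Sy : S (cmap c y) by exists y.
have ft := chart_fat MA hc (open_inI oD oQ) (conj Dy Qy) cy.
have hg1 : ext S (fun v => v2r (f (cinv c v))) (cmap c y) g.
  by apply: ext_sub hg => _ [z [cz [Dz Qz]] <-]; exists z.
have [hB jB] := ext_mulmx (cokermx (f2mx A)) hg1.
have jA : (jac g (cmap c y) <= f2mx A)%MS.
  rewrite submxE; apply/eqP; rewrite -jB -[RHS](_ : jac (fun=> 0) (cmap c y) = 0); last exact: jac_cst.
  apply: (ext_unique Sy ft hB).
  exists setT; split=> //; [exact: openT|by apply: Cinfty_cst; exact: openT|].
  move=> _ [z [cz [Dz Qz]] <-] _; rewrite (cmapK MA) //.
  by have /memv_imgP[u _ ->] := H z Dz Qz; rewrite v2r_lfun -mulmxA mulmx_coker mulmx0.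
apply/subvP => w /memv_imgP[v _ ->].
have /submxP[u uE] : (v *m jac g (cmap c y) <= f2mx A)%MS by apply: submx_trans jA; exact: submxMl.
apply/memv_imgP; exists (r2v u); first exact: memvf.
by apply: v2r_inj; rewrite E v2r_lfun r2vK uE.
Qed.

(** * Perturbations of cobordisms with given boundary values *)

Section CobordismTheorem.
Context {R : realType} {TY : topologicalType} {K : cobordism R TY}.
Implicit Types (a : bool) (I J L H : {set 'I_(aN K)}) (t : R).
Context {e : R} {tm : forall a I, kT (ach K I) -> R}
  {pr : forall a I, kT (ach K I) -> kT (ach K I)}.
Hypothesis hC : collars K e tm pr.
Hypothesis hK : core K.
Context {d : metric_family K} (hd : admissible_metric d).
Hypothesis dcol : forall a I J t t' (x : kT (ach K I)) (y : kT (ach K J)), idx K I -> idx K J ->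
  bdset K a I x -> bdset K a J y -> collar_ivl a e t -> collar_ivl a e t' ->
  d (cls (ccolU K a t x)) (cls (ccolU K a t' y)) = `|t - t'| + d (cls x) (cls y).
Hypothesis dout : forall a I J t (x : kT (ach K I)) (y : kT (ach K J)), idx K I -> idx K J ->
  bdset K a I x -> dom (ach K J) y -> collar_ivl a e t -> ~ collar a e y ->
  e - ivl_coord a t <= d (cls y) (cls (ccolU K a t x)).
Context {V C : dom_family K} {delta : R} (d0 : 0 < delta) (de : delta < e).
Arguments V : clear implicits.
Arguments C : clear implicits.
Hypothesis hV : forall I, idx K I -> V I `<=` dom (ach K I).
Hypothesis ddr : delta < delta_red d V.
Hypothesis colV : forall a I t x, idx K I -> bdset K a I x -> collar_ivl a e t ->
  (V I (ccolU K a t x) <-> V I x).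
Context {n : norm_family K}.
Hypothesis hn : forall I, idx K I -> is_norm (n (I:=I)).

Let e0 : 0 < e := cl_e hC.
Let sep : separating d V delta := (bd_delta_red hC hK hd dcol dout true d0 ddr).1.

Section Start.
Variable beta : R -> R.
Hypothesis sbeta : Sinf setT (fun v : 'rV[R]_1 => beta (v 0 0)).
Hypothesis beta01 : forall x, 0 <= beta x <= 1.
Hypothesis beta1 : forall x, x <= e / 4 -> beta x = 1.
Hypothesis beta0 : forall x, 3 / 8 * e <= x -> beta x = 0.
Variables (s : R) (mu : bool -> section_family K).
Hypothesis s0 : 0 < s.
Hypothesis hmu : forall a, bdext d V delta n a s (mu a).

Local Notation cext a := (collar_ext e tm pr beta a (mu a)).

Definition start : section_family K := fun I y => cext false I y + cext true I y.

Definition level (r : R) : set (set (point K)) := [set b | exists a I t (x : kT (ach K I)),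
  [/\ idx K I, bdset K a I x, collar_ivl a e t, ivl_coord a t <= r & b = cls (ccolU K a t x)]].

Lemma startE a I y : start y = cext a I y + cext (~~ a) I y.
Proof. by case: a => //=; rewrite addrC. Qed.

Lemma start_col a I t (x : kT (ach K I)) : idx K I -> bdset K a I x -> collar_ivl a e t ->
  ivl_coord a t < 3 / 8 * e -> start (ccolU K a t x) = beta (ivl_coord a t) *: mu a x.
Proof.
move=> hI Bx ht te; rewrite (startE a) (collar_ext_col hC) // [X in _ + X](_ : _ = 0) ?addr0 //.
apply/eqP/negPn/negP => /(collar_ext_neq0 hC beta0 hI)[t' [x' [ht' Bx' E te']]].
exact: (collars_apart hC hd dcol dout hI Bx Bx' ht ht' te te').
Qed.

Lemma level_rep r J (y : kT (ach K J)) : idx K J -> dom (ach K J) y -> level r (cls y) ->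
  exists a t x, [/\ bdset K a J x, collar_ivl a e t, ivl_coord a t <= r & y = ccolU K a t x].
Proof.
move=> hJ yd [a [I [t [x [hI Bx ht tr E]]]]].
by have [x' [Bx' Ey _]] := collar_transfer hC hK hI hJ yd Bx ht E; exists a, t, x'.
Qed.

Lemma level_far J x : idx K J -> dom (ach K J) x -> ~ level (e / 8) (cls x) ->
  exists2 r : R, 0 < r & forall b, level (e / 16) b -> realization K b -> r <= d (cls x) b.
Proof.
move=> hJ xd nF; exists (e / 16); first by rewrite divr_gt0.
move=> _ [a [I [t [x' [hI Bx' ht te ->]]]]] _; rewrite leNgt; apply/negP => h; apply: nF.
have [|u [x2 [hu Bx2 Ex dE]]] := collar_near dcol dout hI hJ Bx' xd ht; first by move: e0 te h; lra.
exists a, J, u, x2; split=> //; last by rewrite Ex.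
have h2 : `|u - t| < e / 16.
  by apply: le_lt_trans h; rewrite dE lerDl (d_ge0 hd (real_bd hC hJ Bx2) (real_bd hC hI Bx')).
rewrite -(ivl_coord_dist a) in h2; move: h2; rewrite ltr_norml => /andP[]; move: te; lra.
Qed.

Lemma level_closed J (A : set (kT (ach K J))) : idx K J -> A `<=` dom (ach K J) -> compact A ->
  compact (A `&` [set x | level (e / 8) (cls x)]).
Proof.
move=> hJ Ad cA.
have : open_in (dom (ach K J)) [set x | dom (ach K J) x /\ ~ level (e / 8) (cls x)].
  apply: (ball_open hd hJ) => [x []//|x [xd nF]].
  suff H a : exists2 r : R, 0 < r & forall t x', bdset K a J x' -> collar_ivl a e t -> ivl_coord a t <= e / 8 ->
      r <= d (cls x) (cls (ccolU K a t x')).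
    have [r r0 rP] := H false; have [u u0 uP] := H true.
    exists (Num.min r u); first by rewrite lt_min r0.
    move=> y yd; rewrite lt_min => /andP[yr yu]; split=> // /(level_rep hJ yd)[a [t [x' [Bx' ht te Ey]]]].
    case: a Bx' ht te Ey => Bx' ht te Ey.
      by have := uP t x' Bx' ht te; rewrite -Ey leNgt yu.
    by have := rP t x' Bx' ht te; rewrite -Ey leNgt yr.
  have [[t [x' [ht Bx' Ex]]]|nW] := pselect (collar a e x); last first.
    exists (e / 2) => [|t x' Bx' ht te]; first by rewrite divr_gt0.
    by have := dout hJ hJ Bx' xd ht nW; move: e0 te; lra.
  exists (ivl_coord a t - e / 8).
    rewrite subr_gt0 ltNge; apply/negP => te; apply: nF; exists a, J, t, x'; split=> //.
    by rewrite Ex.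
  move=> u x2 Bx2 hu ue; rewrite Ex dcol //.
  have := d_ge0 hd (real_bd hC hJ Bx') (real_bd hC hJ Bx2).
  have := ler_norm (ivl_coord a t - ivl_coord a u); rewrite ivl_coord_dist.
  by move: ue; lra.
move=> [Q oQ EQ]; have -> : A `&` [set x | level (e / 8) (cls x)] = A `&` ~` Q.
  rewrite eqEsubset; split=> x [Ax hx]; split=> //.
    move=> Qx; have : (dom (ach K J) `&` Q) x by split=> //; exact: Ad.
    by rewrite -EQ => -[_]; apply.
  apply: contrapT => nl; apply: hx.
  have : (dom (ach K J) `&` Q) x by rewrite -EQ; split=> //; exact: Ad.
  by case.
by apply: compact_closedI => //; exact: open_closedC.
Qed.

Lemma start_progress : progress d V delta 1 n s (level (e / 16)) (level (e / 8)) start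
  (fun L => lev 1 L - 2^-1) set0 start.
Proof.
have sm a I : idx K I -> smooth_fun (kU (ach K I)) (Dlev d V delta 1 I) (cext a I).
  by move=> hI; exact: (collar_ext_smooth hC hK hd dcol dout d0 de hV colV sbeta beta0 hI (hmu a)).
split=> //.
- by move=> L hL; apply: smooth_funD; exact: sm.
- move=> L H hL hH HL y Dy Ry.
  have rg a := collar_ext_reg hC hK hd dcol dout d0 de hV colV beta0 hL hH HL (hmu a) Dy Ry.
  have [l0 c0] := rg false; have [l1 c1] := rg true; split; first exact: memvD.
  by move=> z Uz E; rewrite /start (c0 z) // (c1 z) // linearD.
- have [s1 s1s b1] := be_bound (hmu false); have [s2 s2s b2] := be_bound (hmu true).
  exists (Num.max 0 (Num.max s1 s2)); first by rewrite !gt_max s0 s1s.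
  move=> L y hL Dy.
  have [E|[a]] : start y = 0 \/ exists a, cext a L y != 0.
    have [E0|] := eqVneq (cext false L y) 0; last by right; exists false.
    have [E1|] := eqVneq (cext true L y) 0; last by right; exists true.
    by left; rewrite /start E0 E1 addr0.
    by rewrite E norm_zero ?le_max ?lexx //; exact: hn.
  move=> /(collar_ext_neq0 hC beta0 hL)[t [x [ht Bx Ey te]]].
  have Vx : Vb d V delta a #|L|%:R L x.
    by apply: (Dlev_collar hC hK hd dcol dout d0 de hV colV hL Bx ht); [move: e0 te; lra|rewrite -Ey].
  rewrite Ey start_col //; have [n0 _ nZ _] := hn hL; rewrite nZ.
  have /andP[b0 b11] := beta01 (ivl_coord a t); rewrite ger0_norm //.
  apply: le_trans (ler_piMl (n0 _) b11) _; rewrite !le_max.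
  have bL := idx_bd hC hL Bx.
  by case: a Bx ht te Ey Vx b0 b11 bL => Bx ht te Ey Vx b0' b11 bL; rewrite ?b1 ?b2 ?orbT.
(* Within e/16 of a point of time at most e/8 all times are below e/4. There the section is the
   pullback of the boundary section by the submersion [pr]. *)
- move=> L y hL Ty /(level_rep hL) [|a [t [x [Bx ht te Ey]]]]; first by case: Ty.
  have Dy := Tlev_sub hd d0 hV hL Ty; have yd := Dlev_dom Dy; have ry := real_cls hL yd.
  have Wy : collar a e y by exists t, x.
  have bL := idx_bd hC hL Bx; have MB := co_man (cl_core hC a) bL.
  have [c [c' [g [hc cy hc' cy' [hg fr]]]]] := cl_sub hC hL Wy.
  have [imp cp _] := cl_pr hC a hL.
  have [Q oQ EQ] := dball_open hd (e / 16) hL ry.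
  have Ep : pr a y = x by rewrite Ey; have [_ _ ->] := cl_col hC hL ht Bx.
  have near y' : Dlev d V delta 1 L y' -> Q y' -> exists u x', [/\ collar_ivl a e u, bdset K a L x',
      y' = ccolU K a u x' & ivl_coord a u <= e / 4].
    move=> Dy' Qy'; have yd' := Dlev_dom Dy'.
    have : (dom (ach K L) `&` Q) y' by [].
    rewrite -EQ => -[_ /= yy']; rewrite (d_sym hd ry (real_cls hL yd')) Ey in yy'.
    have [|u [x' [hu Bx' Ey' dE]]] := collar_near dcol dout hL hL Bx yd' ht; first by move: e0 te yy'; lra.
    exists u, x'; split=> //.
    have h : `|u - t| < e / 16.
      by apply: le_lt_trans yy'; rewrite dE lerDl (d_ge0 hd (real_bd hC hL Bx') (real_bd hC hL Bx)).
    rewrite -(ivl_coord_dist a) in h; move: h; rewrite ltr_norml => /andP[]; move: e0 te; lra.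
  apply: (tv_submersion (Q := Q) (W0 := @collar _ _ K a e L) (D' := Vb d V delta a #|L|%:R L) (phi := pr a (I:=L))
    (f' := fun z => ks (ach K L) z + mu a z) (co_man hK hL) MB Dy oQ _ Wy _ cp imp hc cy hc' cy' hg fr).
  + suff : (dom (ach K L) `&` Q) y by case.
    by rewrite -EQ; split=> //; rewrite (d_refl hd) // divr_gt0.
  + have hdb := bd_admissible hC hK hd a.
    by apply: (Vk_open hdb) => // I _ z [].
  + move=> y' Dy' Qy'; have [u [x' [hu Bx' Ey' ue]]] := near y' Dy' Qy'.
    have [_ _ prE] := cl_col hC hL hu Bx'; rewrite Ey' prE; split; first by exists u, x'.
      apply: (Dlev_collar hC hK hd dcol dout d0 de hV colV hL Bx' hu); last by rewrite -Ey'.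
      by move: e0 ue; lra.
    rewrite start_col //; last by move: e0 ue; lra.
    by rewrite beta1 // scale1r (cl_ks hC).
  + apply: smooth_funD; last exact: (be_smooth (hmu a)).
    by apply: smooth_fun_sub (co_s (cl_core hC a) bL) => z [].
  + rewrite Ep; apply: (be_tv (hmu a)) => //.
    by apply: (Dlev_collar hC hK hd dcol dout d0 de hV colV hL Bx ht); [move: e0 te; lra|rewrite -Ey].
Qed.

Lemma start_bd a I t (x : kT (ach K I)) : idx K I -> bdset K a I x -> collar_ivl a (e / 16) t ->
  level (e / 16) (cls (ccolU K a t x)) /\ start (ccolU K a t x) = mu a x.
Proof.
move=> hI Bx /collar_ivlE /andP[t0 te].
have ht : collar_ivl a e t by apply/collar_ivlE; rewrite t0; move: e0 te; lra.
split; first by exists a, I, t, x; split=> //; exact: ltW.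
rewrite start_col //; last by move: e0 te; lra.
by rewrite beta1 ?scale1r //; move: e0 te; lra.
Qed.

End Start.

Hypothesis oV : forall I, idx K I -> open_in (dom (ach K I)) (V I).
Hypothesis oC : forall I, idx K I -> open_in (dom (ach K I)) (C I).
Hypothesis CV : forall I, idx K I -> C I `<=` V I.
Hypothesis zC : forall I x, idx K I -> zeros (ach K I) x -> projK C (cls x).
Hypothesis nest : exists2 e' : R, 0 < e' & nested_cobordism_reduction e' C V.

Lemma bd_open a I (A : set (kT (ach K I))) : idx K I -> open_in (dom (ach K I)) A ->
  open_in (bdset K a I) (A `&` bdset K a I).
Proof.
move=> hI [Q oQ ->]; exists Q => //; rewrite eqEsubset; split=> x; first by move=> [[_ Qx] Bx].
by move=> [Bx Qx]; split=> //; split=> //; exact: (cl_bd hC hI Bx).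
Qed.

Lemma bd_zeros a I x : idx (bd_atlas a K) I -> zeros (ach (bd_atlas a K) I) x ->
  projK (bd_fam a C) (@cls R TY (bd_atlas a K) I x).
Proof.
move=> bI [Bx zx]; have hI := idx_bdK hC bI; have xd := cl_bd hC hI Bx.
have [J hJ [c Cc Ec]] := zC hI (conj xd zx).
have cd := hV hJ (CV hJ Cc); have h0 := collar_endpoint a e0.
rewrite -(cl_end hC hI Bx) in Ec.
have [x' [Bx' Ec' E]] := collar_transfer hC hK hI hJ cd Bx h0 Ec.
rewrite (cl_end hC) // in Ec'; subst x'.
by exists J; [exact: (idx_bd hC hJ Bx')|exists c].
Qed.

Lemma cobordism_sigma_rel_gt0 : (0 < sigma_rel d V C n delta)%E.
Proof.
have hs a : (0 < sigma (bd_metric (a:=a) d) (bd_fam a V) (bd_fam a C) n delta 0)%E.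
  have [_ _] := bd_delta_red hC hK hd dcol dout a d0 ddr.
  apply: (sigma_gt0 (cl_core hC a) (bd_admissible hC hK hd a) d0).
  - by move=> I _ x [].
  - exact: (bd_separating hC hK hd dcol dout a sep).
  - by move=> I /(idx_bdK hC) hI; exact: bd_open (oC hI).
  - by move=> I /(idx_bdK hC) hI x [Cx Bx]; split=> //; exact: CV.
  - exact: bd_zeros.
  - by move=> I /(idx_bdK hC); exact: hn.
rewrite /sigma_rel !lt_min !hs /=.
exact: (sigma_gt0 hK hd d0 hV sep oC CV zC hn).
Qed.

Lemma cobordism_relative : relative_perturbations_exist d V C n delta.
Proof.
move=> s s0 ss nu' ad; move: ss; rewrite /sigma_rel !le_min => /and3P[ss0 ss1 ss].
have [beta [sb b01 b1 b0]] := cutoff_exists e0.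
have /choice[mu hmu] : forall a, exists mu : section_family K,
    bdext d V delta n a s mu /\
    (forall J x, idx (bd_atlas a K) J -> bd_fam a V J x -> mu J x = nu' a J x) /\
    forall nu2 : section_family (bd_atlas a K),
      (forall J x, idx (bd_atlas a K) J -> bd_fam a V J x -> nu2 J x = nu' a J x) ->
      bd_adapted d V C n delta s nu2.
  by move=> a; exact: (adapted_bdext hC hK hd (ad a)).
have hmu1 a := (hmu a).1.
have hn' L : idx K L -> exists c, 0 <= c /\ forall v w, n (v + r2v w : kE (ach K L)) <= n v + c * `|w|.
  by move=> /hn /norm_r2v.
have [||nu prg] := perturbation_induction hK hd d0 hV sep hn' _ _ (start_progress sb b01 b1 b0 s0 hmu1).
- by move=> J x hJ [xd _]; exact: level_far.
- by move=> J hJ; apply: level_closed => // [x []//|]; exact: (Tlev_compact d0 sep).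
have VVk I k x : idx K I -> V I x -> Vk d V delta k I x by exact: (V_Vk hd d0 hV).
have VD I x : idx K I -> V I x -> Dlev d V delta 1 I x by exact: VVk.
have nuE a I x t : idx K I -> bd_fam a V I x -> collar_ivl a (e / 16) t -> nu I (ccolU K a t x) = mu a I x.
  move=> hI [Vx Bx] ht; have [lx <-] := start_bd b1 b0 mu hI Bx ht.
  apply: (pr_frozen prg) => //; apply: VD => //; apply/(colV hI Bx) => //.
  move: ht => /collar_ivlE /andP[t0 te]; apply/collar_ivlE; rewrite t0; move: e0 te; lra.
have e16 : 0 < e / 16 by rewrite divr_gt0.
have nu0E a I x : idx K I -> bd_fam a V I x -> nu I x = mu a I x.
  move=> hI Vx; rewrite -{1}(cl_end hC hI Vx.2); apply: nuE => //.
  exact: collar_endpoint.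
have nuA a J (x : kT (ach K J)) : idx (bd_atlas a K) J -> bd_fam a V J x -> nu J x = nu' a J x.
  move=> bJ Vx; rewrite (nu0E a) //; last exact: (idx_bdK hC bJ).
  by have [_ [-> ]] := hmu a.
have snu I : idx K I -> smooth_fun (kU (ach K I)) (V I) (nu I).
  by move=> hI; apply: smooth_fun_sub (pr_smooth prg hI) => x; exact: VD.
have [s' ss' pb] := pr_bound prg.
exists nu; split; last by move=> a I x bI Vx; exact: nuA.
split.
- move=> I J hI hJ IJ y Vy [x [Vx Ux] xy].
  apply: (limg_dfun_sub (Q := Reg d V delta (lev 1 J - 4^-1) J I) (co_man hK hJ) (oV hJ) Vy) => //.
  + exact: (Reg_open hd).
  + apply: (Nk_Reg hd d0) => //; split; first exact: VVk.
    by exists x => //; split=> //; exact: VVk.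
  + exact: snu.
  + by move=> z Vz Rz; have [] := pr_reg prg hJ hI IJ (VD J z hJ Vz) Rz.
- split.
  + split=> // I J hI hJ IJ x Vx Ux Vy.
    apply: (progress_compat hd d0 (k := lev 1 J) prg) => //; [lra|lra|exact: VVk|exact: VVk].
  + exists (e / 16) => // a I bI t x ht Vx; have hI := idx_bdK hC bI.
    by rewrite (nuE a I x t) // (nu0E a).
  + move=> I hI x [Vx _] f0; have MI := co_man hK hI.
    have Vk1 := VVk I (lev 1 I) x hI Vx.
    have Tx : Tlev d V delta 1 I x by split; [exact: Vk_dom Vk1|exact: subset_closure].
    apply: (tv_limg_dfun MI (oV hI) Vx) => //.
      apply: smooth_funD; last exact: snu.
      by apply: smooth_fun_sub (co_s hK hI); exact: hV.
    have tx := pr_tv prg hI Logic.I Tx; move=> f0'; have [c [g [hr fr]]] := tx f0'; exists c, g; split=> //.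
    by apply: rep_sub hr => y; exact: VD.
  (* The given reduction C serves as the reduction C' of the definition. *)
  + have [e' e'0 ne] := nest; exists C, e'; split=> // _ [I hI [x [Vx f0] <-]].
    apply: (zeros_in_C hK hd d0 hV hn (nu := nu) ss) => //.
    * by move=> L H hL hH HL; exact: (pr_reg prg hL hH HL).
    * by move=> L y hL Dy; exact: le_lt_trans (pb L y hL Dy) ss'.
    * exact: VVk.
- move=> _ [I hI [x [Vx f0] <-]].
  apply: (zeros_in_C hK hd d0 hV hn (nu := nu) ss) => //.
  + by move=> L H hL hH HL; exact: (pr_reg prg hL hH HL).
  + by move=> L y hL Dy; exact: le_lt_trans (pb L y hL Dy) ss'.
  + exact: VVk.
- by move=> a; have [_ [_]] := hmu a; apply=> J x bJ Vx; exact: nuA.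
Qed.

(** The closed case on the two boundaries provides the boundary values for the relative
    statement. *)
Lemma cobordism_perturbations : perturbations_exist d V C n delta.
Proof.
move=> s s0 ss; have : (s%:E <= sigma_rel d V C n delta)%E by [].
rewrite /sigma_rel !le_min => /and3P[ss0 ss1 _].
have ex a : (s%:E <= sigma (bd_metric (a:=a) d) (bd_fam a V) (bd_fam a C) n delta 0)%E ->
    exists nu : section_family (bd_atlas a K), bd_adapted d V C n delta s nu.
  move=> ssa; have [_ ddb] := bd_delta_red hC hK hd dcol dout a d0 ddr.
  apply: (adapted_exists (cl_core hC a) (bd_admissible hC hK hd a) d0) => //.
  - by move=> I _ x [].
  - exact: (bd_separating hC hK hd dcol dout a sep).
  - by move=> I /(idx_bdK hC); exact: hn.
have [nu0 h0] := ex false ss0; have [nu1 h1] := ex true ss1.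
have [|nu [good _]] := cobordism_relative s0 ss
   (nu' := fun a => if a return section_family (bd_atlas a K) then nu1 else nu0).
  by case.
by exists nu.
Qed.

End CobordismTheorem.

(** * Atlases and cobordisms in the sense of the definitions *)

Section FromCoordChange.
Context {R : realType}.

Lemma row_smooth_in n m (D : set 'rV[R]_n) (f : 'rV[R]_n -> 'rV[R]_m) :
  (forall x, D x -> exists g, ext D f x g) -> smooth_in D f.
Proof.
move=> H x Dx; have [g [U [oU Ux hg gE]]] := H x Dx.
exists (fun y => v2r (g y)), U; split=> //; last by move=> y Dy Uy; rewrite gE.
have -> : (fun y => v2r (g y)) = (fun y => g y *m lin1_mx v2r).
  by apply/funext => y; rewrite mul_rV_lin1.
exact: Cinfty_mulmx.
Qed.

Lemma deriv_in_row n m (D : set 'rV[R]_n) (f : 'rV[R]_n -> 'rV[R]_m) x g :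
  D x -> fat D x -> ext D f x g -> forall v, v *m jac g x = 0 -> deriv_in D f x v = 0.
Proof.
move=> Dx fD hg v v0; have [U [oU Ux hU gE]] := hg.
have hv : ext D (fun y => v2r (f y)) x (fun y => g y *m lin1_mx v2r).
  exists U; split=> //; first exact: Cinfty_mulmx.
  by move=> y Dy Uy; rewrite mul_rV_lin1 gE.
have [|g' hg' E] := @deriv_in_ext _ _ _ D f x; first by exists (fun y => g y *m lin1_mx v2r).
apply: v2r_inj; rewrite E linear0 (ext_unique Dx fD hg' hv) (jac_mulmx _ oU Ux hU).
by rewrite mulmxA v0 mul0mx.
Qed.

Context {TX : topologicalType} {K : atlas R TX}.
Implicit Types I J L : {set 'I_(aN K)}.

Record local_core I J : Prop := LocalCore {
  lc_open : open_in (dom (ach K I)) (aU K I J);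
  lc_map : smooth_map (kU (ach K I)) (kU (ach K J)) (aU K I J) (aphi K J);
  lc_inj : forall x y : kT (ach K I), aU K I J x -> aU K I J y ->
     aphi K J x = aphi K J y -> x = y;
  lc_imm : forall x : kT (ach K I), aU K I J x ->
     exists c c' g, [/\ charts (kU (ach K I)) c, cdom c x,
       charts (kU (ach K J)) c', cdom c' (aphi K J x) &
       ext (cmap c @` (cdom c `&` aU K I J `&` aphi K J @^-1` cdom c'))
         (cmap c' \o aphi K J \o cinv c) (cmap c x) g /\
       row_free (jac g (cmap c x))];
  lc_ks : forall x : kT (ach K I), aU K I J x ->
     ks (ach K J) (aphi K J x) = ahat K I J (ks (ach K I) x);
  lc_index : forall x : kT (ach K I), aU K I J x ->
     exists c g, rep (kU (ach K J)) (dom (ach K J)) (ks (ach K J)) (aphi K J x) c g /\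
       forall w, exists v e, w = v *m jac g (cmap c (aphi K J x)) + v2r (ahat K I J e);
  lc_hat0 : lker (ahat K I J) = 0%VS }.

Lemma coord_change_local I J : smooth_atlas (kU (ach K I)) -> smooth_atlas (kU (ach K J)) ->
  smooth_fun (kU (ach K J)) (dom (ach K J)) (ks (ach K J)) ->
  is_coord_change I J -> local_core I J.
Proof.
move=> MI MJ sJ [oU _ [[im cphi sphi] imm [[_ inj _] _ _]] [hat0 hks _ hindex]].
have Ud : aU K I J `<=` dom (ach K I) by case: oU => Q _ -> x [].
split=> //.
- by move=> x y Ux Uy; apply: inj; rewrite inE.
- move=> x Ux; have [hc cx] := chart_atP MI (Ud _ Ux).
  have dy : dom (ach K J) (aphi K J x) by apply: im; exists x.
  have [hc' cy] := chart_atP MJ dy.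
  have := imm x Ux; rewrite /dmap; set c := chart_at _ x in hc cx *; set c' := chart_at _ _ in hc' cy *.
  set D := cmap c @` _ => lk.
  have Dx : D (cmap c x) by exists x.
  have [g hg] := smooth_in_row (sphi c c' hc hc') Dx.
  exists c, c', g; split=> //; split=> //.
  have [Qc oQc EQc] := cdom_open MJ hc'.
  have oP : open_in (dom (ach K I)) (aU K I J `&` aphi K J @^-1` cdom c').
    have -> : aU K I J `&` aphi K J @^-1` cdom c' = aU K I J `&` aphi K J @^-1` Qc.
      rewrite eqEsubset; split=> z [Uz hz]; split=> //=; have dz : dom (ach K J) (aphi K J z) by apply: im; exists z.
        by move: hz; rewrite /= EQc => -[].
      by rewrite EQc.
    exact: (open_in_trans oU (open_in_preimage cphi oQc)).
  have ft : fat D (cmap c x).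
    have := chart_fat MI hc oP (conj Ux cy) cx; congr (fat _ _).
    by rewrite /D setIA.
  apply: inj_row_free => v v0; apply/eqP; rewrite -memv0 -lk memv_ker.
  by apply/eqP; exact: (deriv_in_row Dx ft hg v0).
- move=> x Ux; have dy : dom (ach K J) (aphi K J x) by apply: im; exists x.
  have [g hg E] := dfun_rep MJ (fun y h => h) dy sJ.
  exists (chart_at (kU (ach K J)) (aphi K J x)), g; split=> // w.
  have [_ hx] := hindex x Ux.
  set dI := dfun (kU (ach K I)) (dom (ach K I)) (ks (ach K I)) x in hx.
  (* Applied to any complement of im ds_I, the index condition gives im ds_J + E_I = E_J. *)
  have [||full _] := hx (limg dI)^C%VS; [exact: addv_complf|exact: capv_compl|].
  have : r2v w \in fullv by exact: memvf.
  rewrite -full => /memv_addP[_ /memv_imgP[v _ ->] [_ /memv_imgP[u _ ->] Ew]].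
  by exists v, u; rewrite -[w]r2vK Ew linearD -E.
Qed.

Lemma core_intro :
  (forall I, idx K I -> smooth_atlas (kU (ach K I))) ->
  (forall I, idx K I -> smooth_fun (kU (ach K I)) (dom (ach K I)) (ks (ach K I))) ->
  (forall I, idx K I -> [/\ aU K I I = dom (ach K I),
     forall x, dom (ach K I) x -> aphi K I x = x & forall e, ahat K I I e = e]) ->
  (forall I J, idx K I -> idx K J -> I \proper J -> local_core I J) ->
  (forall I J L, idx K I -> idx K J -> idx K L -> I \proper J -> J \proper L ->
    [/\ forall e, ahat K J L (ahat K I J e) = ahat K I L e,
        aU K I J `&` aphi K J @^-1` aU K J L `<=` aU K I L &
        forall x, aU K I J x -> aU K J L (aphi K J x) ->
          aphi K L (aphi K J x) = aphi K L x]) ->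
  tame K -> core K.
Proof.
move=> hM hs hid hl hc ht; split=> //.
- by move=> I J hI hJ /(hl _ _ hI hJ)/lc_open.
- by move=> I J hI hJ /(hl _ _ hI hJ)/lc_map.
- by move=> I J x y hI hJ /(hl _ _ hI hJ)/lc_inj; apply.
- by move=> I J x hI hJ /(hl _ _ hI hJ)/lc_imm; apply.
- by move=> I J x hI hJ /(hl _ _ hI hJ)/lc_ks; apply.
- by move=> I J x hI hJ /(hl _ _ hI hJ)/lc_index; apply.
- by move=> I J hI hJ /(hl _ _ hI hJ)/lc_hat0.
- by move=> I J L hI hJ hL IJ JL; have [] := hc I J L hI hJ hL IJ JL.
- move=> I J L x hI hJ hL IJ JL Ux Uy; have [_ h1 h2] := hc I J L hI hJ hL IJ JL.
  by split; [apply: h1|exact: h2].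
Qed.

Lemma atlas_core D : atlas_axioms K D -> (forall I, idx K I -> is_bkchart (aX K) (ach K I)) ->
  tame K -> core K.
Proof.
move=> [_ _ _ _ [hid hcc hco]] hch ht.
have hM I : idx K I -> smooth_atlas (kU (ach K I)).
  by move=> /hch[/manifold_smooth_atlas].
have hs I : idx K I -> smooth_fun (kU (ach K I)) (dom (ach K I)) (ks (ach K I)).
  by move=> /hch[].
apply: core_intro => // I J hI hJ IJ.
by apply: coord_change_local; [exact: hM|exact: hM|exact: hs|exact: hcc].
Qed.

(** The class iota(psi_I(x)) is that of x: zeros in the charts I and J over the same point p have
    the same image in the chart of I u J, which is an index because p lies in its footprint. *)
Lemma tame_closed D C I x : atlas_axioms K D -> (forall I, idx K I -> is_bkchart (aX K) (ach K I)) ->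
  core K -> @iotaX R TX K @` aX K `<=` projK C -> idx K I -> zeros (ach K I) x -> projK C (cls x).
Proof.
move=> [_ _ _ hft [_ hcc _]] hch hK hC hI zx.
have [_ _ _ [Q _ EQ] _] := hch I hI.
have px : aX K (kpsi (ach K I) x).
  have : footprint (ach K I) (kpsi (ach K I) x) by exists x.
  by rewrite EQ => -[].
have up I0 J0 (z : kT (ach K I0)) : idx K I0 -> idx K J0 -> I0 \subset J0 -> zeros (ach K I0) z ->
    footprint (ach K J0) (kpsi (ach K I0) z) -> aU K I0 J0 z /\ zeros (ach K J0) (aphi K J0 z) /\
    kpsi (ach K J0) (aphi K J0 z) = kpsi (ach K I0) z.
  move=> h0 hJ0 /subset_eqVproper[E|IJ] zz fz.
    by subst J0; rewrite (aUid hK) // (aphi_id hK) //; case: zz.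
  have [_ EU _ [_ hks hpsi _]] := hcc I0 J0 h0 hJ0 IJ.
  have [Uz _] : (aU K I0 J0 `&` zeros (ach K I0)) z.
    by rewrite EU; split=> //; split=> //; exists z.
  split=> //; split; last by apply: hpsi.
  split; first exact: aphi_dom (proper_sub IJ) Uz.
  by rewrite hks //; have [_ ->] := zz; rewrite linear0.
suff <- : iotaX (kpsi (ach K I) x) = cls x by apply: hC; exists (kpsi (ach K I) x).
rewrite eqEsubset; split=> q; last by move=> xq; exists I, x.
move=> [J [y [hJ zy Ep yq]]]; suff -> : cls x = cls y by [].
have hU : idx K (I :|: J)%SET.
  split; first by have [I0 _] := hI; apply: contraNneq I0 => E; rewrite -finset.subset0 -E finset.subsetUl.
  exists (kpsi (ach K I) x) => i; rewrite finset.inE => /orP[iI|iJ].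
    have [fI _] := hft I hI; have : footprint (ach K I) (kpsi (ach K I) x) by exists x.
    by rewrite fI; apply.
  have [fJ _] := hft J hJ; have : footprint (ach K J) (kpsi (ach K J) y) by exists y.
  by rewrite Ep fJ; apply.
have fU : footprint (ach K (I :|: J)%SET) (kpsi (ach K I) x).
  have [-> _] := hft _ hU => i; rewrite finset.inE => /orP[iI|iJ].
    have [fI _] := hft I hI; have : footprint (ach K I) (kpsi (ach K I) x) by exists x.
    by rewrite fI; apply.
  have [fJ _] := hft J hJ; have : footprint (ach K J) (kpsi (ach K J) y) by exists y.
  by rewrite Ep fJ; apply.
have [Ux [zx' px']] := up I _ x hI hU (finset.subsetUl _ _) zx fU.
have [|Uy [zy' py']] := up J _ y hJ hU (finset.subsetUr _ _) zy; first by rewrite Ep.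
have [_ _ _ _ [[_ inj _] _ _]] := hch _ hU.
rewrite -(cls_aphi hI hU (finset.subsetUl _ _) Ux) -(cls_aphi hJ hU (finset.subsetUr _ _) Uy).
congr cls; apply: inj; rewrite ?inE //.
by rewrite px' py' Ep.
Qed.

End FromCoordChange.
Arguments local_core {R TX} K I J.

Lemma within_openP {S S' : topologicalType} (A : set S) (f : S -> S') :
  (forall x Q, A x -> open Q -> Q (f x) -> exists P, [/\ open P, P x & forall y, A y -> P y -> Q (f y)]) ->
  {within A, continuous f}.
Proof.
move=> H; apply/subspace_continuousP => x Ax B; rewrite nbhsE => -[Q [oQ Qx] QB].
have [P [oP Px PQ]] := H x Q Ax oQ Qx.
change (nbhs x [set y | A y -> B (f y)]); rewrite nbhsE.
by exists P; [split|move=> y Py Ay; apply/QB/PQ].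
Qed.

(** * Topology of products *)

Section Products.
Context {R : realType} {T1 T2 T : topologicalType}.

Lemma open_box (Q : set (T1 * T2)) p : open Q -> Q p -> exists Q1 Q2,
  [/\ open Q1, open Q2, Q1 p.1, Q2 p.2 & forall u v, Q1 u -> Q2 v -> Q (u, v)].
Proof.
case: p => u0 v0 oQ Qp; have : nbhs (u0, v0) Q by exact: open_nbhs_nbhs.
move=> [[A1 A2] /= []]; rewrite !nbhsE => -[Q1 [oq1 h1] s1] [Q2 [oq2 h2] s2] sub.
by exists Q1, Q2; split=> // u v /s1 Au /s2 Av; apply: sub; split.
Qed.

Lemma open_times (Q1 : set T1) (Q2 : set T2) : open Q1 -> open Q2 -> open (Q1 `*` Q2).
Proof.
move=> oq1 oq2; rewrite openE => -[u v] [/= h1 h2].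
by exists (Q1, Q2) => //; split; exact: open_nbhs_nbhs.
Qed.

Lemma within_snd (A : set T) (g : T -> T1 * T2) : {within A, continuous g} ->
  {within A, continuous (snd \o g)}.
Proof.
move=> cg; apply: within_openP => x Q Ax oQ Qx.
have [|P [oP Px PQ]] := within_open cg Ax (open_times openT oQ); first by split.
by exists P; split=> // y Ay Py; have [] := PQ y Ay Py.
Qed.

Lemma within_slice (A : set T1) (B : set T2) (f : T1 * T2 -> T) u : A u ->
  {within A `*` B, continuous f} -> {within B, continuous (fun v => f (u, v))}.
Proof.
move=> Au cf; apply: within_openP => x Q Bx oQ Qx.
have [|P [oP Px PQ]] := within_open cf (x := (u, x)) _ oQ Qx; first by split.
have [Q1 [Q2 [oq1 oq2 h1 h2 sub]]] := open_box oP Px.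
by exists Q2; split=> // y By Qy; apply: PQ; [split|exact: sub].
Qed.

Lemma open_real (Q : set R) t : open Q -> Q t -> exists2 r : R, 0 < r & forall u, `|u - t| < r -> Q u.
Proof.
move=> oQ Qt; have /nbhs_ballP[r /= r0 rQ] := open_nbhs_nbhs (conj oQ Qt).
by exists r => // u ur; apply: rQ; rewrite /ball /= distrC.
Qed.

End Products.

(** * The projection and the time of a collar *)

Section HalfCylinder.
Context {R : realType} {T : topologicalType}.
Context {M N : manifold R T} {a : bool} {e : R} {W : set T} {col : R -> T -> T} {g : T -> R * T}.
Hypothesis MM : smooth_atlas M.
Hypothesis MN : smooth_atlas N.
Hypothesis oW : open_in (carrier M) W.
Hypothesis hW : forall y, W y <-> exists t x, [/\ collar_ivl a e t, carrier N x & y = col t x].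
Hypothesis sf : smooth_map (half_cylinder a e N) M (carrier (half_cylinder a e N)) (fun p => col p.1 p.2).
Hypothesis sg : smooth_map M (half_cylinder a e N) W g.
Hypothesis gK : forall t x, collar_ivl a e t -> carrier N x -> g (col t x) = (t, x).

Local Notation pr := (snd \o g).
Local Notation cyl c := (cyl_chart a e c).

Lemma ivl_coordK t : ivl_coord a (ivl_coord a t) = t :> R.
Proof. by rewrite /ivl_coord; case: a => //; ring. Qed.

Lemma g_col y : W y -> [/\ collar_ivl a e (g y).1, carrier N (g y).2 & y = col (g y).1 (g y).2].
Proof. by move=> /hW[t [x [ht Nx ->]]]; rewrite gK. Qed.

Lemma proj_cont : {within W, continuous pr}.
Proof. by apply: within_snd; case: sg. Qed.

Lemma proj_open (Q : set T) : open_in (carrier N) Q -> open_in W (W `&` pr @^-1` Q).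
Proof.
move=> [Q' oQ' ->]; have [P oP EP] := open_in_preimage proj_cont oQ'; exists P => //; rewrite -EP.
by rewrite eqEsubset; split=> y [Wy hy]; split=> //; [case: hy|split=> //; case: (g_col Wy)].
Qed.

Lemma cyl_ext c c' y : charts M c -> cdom c y -> W y -> charts N c' -> cdom c' (pr y) -> exists h,
  ext (cmap c @` (cdom c `&` W `&` pr @^-1` cdom c'))
    (fun v => cmap (cyl c') (g (cinv c v))) (cmap c y) h.
Proof.
move=> hc cy Wy hc' cy'; case: sg => _ _ /(_ c (cyl c') hc) sgc.
have hcc : charts (half_cylinder a e N) (cyl c') by exists c'.
have [|h hh] := smooth_in_row (sgc hcc) (x := cmap c y).
  by exists y => //; split=> //; split=> //; case: (g_col Wy).
exists h; apply: ext_sub hh => _ [z [[cz Wz] cz'] <-]; exists z => //; split=> //; split=> //.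
by case: (g_col Wz).
Qed.

Lemma proj_ext c c' y : charts M c -> cdom c y -> W y -> charts N c' -> cdom c' (pr y) -> exists h,
  ext (cmap c @` (cdom c `&` W `&` pr @^-1` cdom c')) (cmap c' \o pr \o cinv c) (cmap c y) h.
Proof.
move=> hc cy Wy hc' cy'; have [h hh] := cyl_ext hc cy Wy hc' cy'.
have [h1 _] := ext_mulmx (col_mx 0 1%:M : 'M[R]_(1 + mdim N, mdim N)) hh.
exists (fun v => h v *m col_mx 0 1%:M); case: h1 => U [oU Ux hU UE].
exists U; split=> // v Dv Uv; rewrite UE //= matrix.mul_row_col mulmx0 add0r.
exact: mulmx1.
Qed.

Lemma proj_smooth : smooth_map M N W pr.
Proof.
split; [by move=> _ [y /g_col[_ h _] <-]|exact: proj_cont|].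
move=> c c' hc hc'; apply: row_smooth_in => _ [y [[cy Wy] cy'] <-].
exact: proj_ext.
Qed.

Lemma time_smooth : smooth_fun M W (fun y => const_mx (ivl_coord a (g y).1) : 'rV[R]_1).
Proof.
have sW : W `<=` carrier M by case: oW => Q _ -> y [].
apply: smooth_fun_loc => // y Wy; have [hc cy] := chart_atP MM (sW _ Wy).
have [_ Ny _] := g_col Wy; have [hc' cy'] := chart_atP MN Ny.
set c := chart_at M y in hc cy *; set c' := chart_at N _ in hc' cy' *.
have [h hh] := cyl_ext hc cy Wy hc' cy'.
have [h1 _] := ext_mulmx (col_mx 1%:M 0 : 'M[R]_(1 + mdim N, 1)) hh.
have [Q oQ EQ] := proj_open (cdom_open MN hc').
have Qy : Q y by have : (W `&` pr @^-1` cdom c') y by []; rewrite EQ => -[].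
have sv : Cinfty setT (fun v : 'rV[R]_1 => v2r v).
  have -> : (fun v : 'rV[R]_1 => v2r v) = (fun y => y *m lin1_mx v2r).
    by apply/funext => v; rewrite mul_rV_lin1.
  by apply: Cinfty_mulmx; [exact: openT|apply: Cinfty_id; exact: openT].
exists c, (fun v => v2r (h v *m col_mx 1%:M 0)).
apply: (rep_local (D' := W `&` pr @^-1` cdom c') MM oQ Qy).
  by move=> z Wz Qz; rewrite EQ.
split=> //; case: h1 => U [oU Ux hU UE]; exists U; split=> //.
  exact: (Cinfty_comp oU openT (fun _ _ => I) sv hU).
move=> _ [z [cz [Wz cz']] <-] Uz; rewrite UE; [|by exists z|by []].
by rewrite /= matrix.mul_row_col mulmx0 addr0 mulmx1 (cmapK MM).
Qed.

Lemma col_ext c c' t x : charts N c' -> cdom c' x -> collar_ivl a e t -> charts M c -> cdom c (col t x) ->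
  exists h, ext (cmap (cyl c') @` (cdom (cyl c') `&` [set p | cdom c (col p.1 p.2)]))
    (fun v => cmap c (col (cinv (cyl c') v).1 (cinv (cyl c') v).2)) (cmap (cyl c') (t, x)) h.
Proof.
move=> hc' cx ht hc cy; case: sf => _ _ /(_ (cyl c') c) sfc.
have hcc : charts (half_cylinder a e N) (cyl c') by exists c'.
have Nx := cdom_sub MN hc' cx.
have [|h hh] := smooth_in_row (sfc hcc hc) (x := cmap (cyl c') (t, x)).
  by exists (t, x) => //.
exists h; apply: ext_sub hh => _ [p [[tp cp] cp'] <-]; exists p => //; split=> //; split=> //.
by split=> //; exact: (cdom_sub MN hc').
Qed.

Lemma cylK c p : charts N c -> cdom (cyl c) p -> cinv (cyl c) (cmap (cyl c) p) = p.
Proof.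
move=> hc [tp cp]; rewrite /= row_mxKl row_mxKr mxE ivl_coordK (cmapK MN) //.
by case: p {tp cp}.
Qed.

Lemma proj_submersion y : W y -> exists c c' h,
  [/\ charts M c, cdom c y, charts N c', cdom c' (pr y) &
    ext (cmap c @` (cdom c `&` W `&` pr @^-1` cdom c'))
      (cmap c' \o pr \o cinv c) (cmap c y) h /\ row_full (jac h (cmap c y))].
Proof.
move=> Wy; have sW : W `<=` carrier M by case: oW => Q _ -> z [].
have [hc cy] := chart_atP MM (sW _ Wy); have [ht Ny Ey] := g_col Wy.
have [hc' cy'] := chart_atP MN Ny.
set c := chart_at M y in hc cy *; set c' := chart_at N _ in hc' cy' *.
have [h hh] := proj_ext hc cy Wy hc' cy'.
exists c, c', h; split=> //; split=> //.
set t := (g y).1 in ht Ey *; set x := (g y).2 in Ny Ey cy' *.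
have cy2 : cdom c (col t x) by rewrite -Ey.
have [k hk] := col_ext hc' cy' ht hc cy2.
pose S1 := cmap c' @` (cdom c' `&` [set z | carrier N z /\ cdom c (col t z)]).
pose sg1 (v : 'rV[R]_(mdim N)) := row_mx (const_mx (ivl_coord a t) : 'rV[R]_1) v.
have S1x : S1 (cmap c' x) by exists x => //; split=> //; split=> //=; rewrite -Ey.
have fS1 : fat S1 (cmap c' x).
  apply: (chart_fat MN hc' _ _ cy'); last by split=> //; rewrite -Ey.
  have [Q oQ EQ] := cdom_open MM hc.
  have cs : {within carrier N, continuous (col t)}.
    by case: sf => _ cf _; exact: (within_slice ht cf).
  have [P oP EP] := open_in_preimage cs oQ; exists P => //; rewrite -EP.
  rewrite eqEsubset; split=> z [Nz hz]; split=> //=; first by move: hz; rewrite EQ => -[].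
  rewrite EQ; split=> //; apply: sW; apply/hW; by exists t, z.
have e1 : ext S1 sg1 (cmap c' x) sg1.
  exists setT; split=> //; first exact: openT.
  have -> : sg1 = (fun v => v *m row_mx 0 1%:M + row_mx (const_mx (ivl_coord a t)) 0).
    by apply/funext => v; rewrite /sg1 mul_mx_row mulmx0 mulmx1 add_row_mx add0r addr0.
  apply: CinftyD; [exact: openT| |by apply: Cinfty_cst; exact: openT].
  by apply: Cinfty_mulmx; [exact: openT|apply: Cinfty_id; exact: openT].
have S1S v : S1 v -> (cmap (cyl c') @` (cdom (cyl c') `&` [set p | cdom c (col p.1 p.2)])) (sg1 v).
  by move=> [z [cz [Nz cz']] <-]; exists (t, z).
have e2 := ext_comp S1x S1S e1 hk.
pose phi := (fun v => cmap c (col (cinv (cyl c') v).1 (cinv (cyl c') v).2)) \o sg1.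
have phiE z : cdom c' z -> phi (cmap c' z) = cmap c (col t z).
  by move=> cz; exact: (congr1 (fun p => cmap c (col p.1 p.2)) (@cylK c' (t, z) hc' (conj ht cz))).
have Ex : phi (cmap c' x) = cmap c y by rewrite phiE // Ey.
rewrite -Ex in hh.
have S1S' v : S1 v -> (cmap c @` (cdom c `&` W `&` pr @^-1` cdom c')) (phi v).
  move=> [z [cz [Nz cz']] <-]; rewrite phiE //; exists (col t z) => //.
  split; first by split=> //; apply/hW; exists t, z.
  by rewrite /= gK.
have e3 := ext_comp S1x S1S' e2 hh.
have e4 : ext S1 ((cmap c' \o pr \o cinv c) \o phi) (cmap c' x) id.
  exists setT; split=> //; [exact: openT|by apply: Cinfty_id; exact: openT|].
  by move=> _ [z [cz [Nz cz']] <-] _; rewrite /= -/(phi _) phiE // (cmapK MM) // gK.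
have := jac_ext_comp S1x e2 hh; rewrite (ext_unique S1x fS1 e3 e4).
have -> : (id : 'rV[R]_(mdim N) -> _) = (fun v => v *m 1%:M + 0).
  by apply/funext => v; rewrite mulmx1 addr0.
rewrite jac_affine -/(phi _) Ex => E1; apply: (@row_full_mul _ _ _ _ (jac (k \o sg1) (cmap c' x))).
by rewrite -E1 row_full_unit unitmx1.
Qed.

(* A point at positive height on the collar is no boundary point: in a chart
   onto a subset of a half-space, the first coordinate would have a minimum
   there along the collar coordinates, so their Jacobian would be singular. *)
Lemma collar_interior c c' y : charts M c -> cdom c y -> valid_chart (carrier M) c -> W y ->
  0 < ivl_coord a (g y).1 -> charts N c' -> cdom c' (pr y) ->
  interior (cmap c' @` cdom c') (cmap c' (pr y)) -> interior (cmap c @` cdom c) (cmap c y).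
Proof.
move=> hc cy [_ oV _ _ _] Wy t0 hc' cy' int'.
have sW : W `<=` carrier M by case: oW => Q _ -> z [].
have [ht Ny Ey] := g_col Wy; set t := (g y).1 in ht Ey t0 *; set x := (g y).2 in Ny Ey.
have Vy : (cmap c @` cdom c) (cmap c y) by exists y.
case: oV => [oV|[P oP EV]]; first by exact: open_nbhs_nbhs.
have [hy Py] : (@halfspace R (mdim M) `&` P) (cmap c y) by rewrite -EV.
(* If the first coordinate is positive, the half-space is a neighbourhood; the other case leads to a
   contradiction. *)
have [allp|] := pselect (forall k : 'I_(mdim M), nat_of_ord k = 0%N -> 0 < cmap c y 0 k).
  rewrite EV; have : nbhs (cmap c y) P by exact: open_nbhs_nbhs.
  have : nbhs (cmap c y) (@halfspace R (mdim M)).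
    pose r := \big[Num.min/1]_(k < mdim M | nat_of_ord k == 0%N) cmap c y 0 k.
    have r0 : 0 < r by apply: lt_bigmin => // k /eqP; exact: allp.
    have : nbhs (cmap c y) [set v | `|v - cmap c y| < r].
      by apply: open_nbhs_nbhs; split; [exact: open_rV_ball|rewrite /= subrr normr0].
    apply: filterS => v /= vr k k0; have := norm_coord (v - cmap c y) 0 k; rewrite !mxE => h1.
    have h2 : r <= cmap c y 0 k by apply: bigmin_le_cond; rewrite k0.
    have := le_lt_trans h1 vr; rewrite ltr_norml => /andP[]; lra.
  by move=> h1 h2; exact: (filterI h1 h2).
move=> /existsNP[k /not_implyP[k0 /negP]]; rewrite -leNgt => kle; exfalso.
have yk : cmap c y 0 k = 0 by apply/eqP; rewrite eq_le kle hy.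
have [h hh] := cyl_ext hc cy Wy hc' cy'.
have cy2 : cdom c (col t x) by rewrite -Ey.
have [f hf] := col_ext hc' cy' ht hc cy2.
pose F (v : 'rV[R]_(1 + mdim N)) := cmap c (col (cinv (cyl c') v).1 (cinv (cyl c') v).2).
have FE p : cdom (cyl c') p -> F (cmap (cyl c') p) = cmap c (col p.1 p.2).
  by move=> cp; exact: (congr1 (fun p => cmap c (col p.1 p.2)) (cylK hc' cp)).
rewrite -/F in hf; set SF := cmap (cyl c') @` _ in hf; set p0 := cmap (cyl c') _ in hf.
have gy : g y = (t, x) by rewrite /t /x; case: (g y).
have G0 : cmap (cyl c') (g (cinv c (cmap c y))) = p0 by rewrite (cmapK MM) // gy.
pose S := cmap c @` (cdom c `&` W `&` pr @^-1` cdom c').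
have Sy : S (cmap c y) by exists y.
have fS : fat S (cmap c y).
  have := chart_fat MM hc (open_in_trans oW (proj_open (cdom_open MN hc'))) (conj Wy cy') cy.
  by rewrite /S setIA.
have SSF v : S v -> SF (cmap (cyl c') (g (cinv c v))).
  move=> [z [[cz Wz] cz'] <-]; rewrite (cmapK MM) //; exists (g z) => //.
  have [tz Nz Ez] := g_col Wz; split; first by split.
  by rewrite /= -Ez.
rewrite -G0 in hf.
have e1 := ext_comp Sy SSF hh hf; have jE := jac_ext_comp Sy hh hf.
have e2 : ext S (F \o (fun v => cmap (cyl c') (g (cinv c v)))) (cmap c y) id.
  exists setT; split=> //; [exact: openT|by apply: Cinfty_id; exact: openT|].
  move=> _ [z [[cz Wz] cz'] <-] _; have [tz Nz Ez] := g_col Wz.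
  have E2 := FE (g z) (conj tz cz'); rewrite -Ez in E2.
  by rewrite /comp (cmapK MM) // E2.
rewrite (ext_unique Sy fS e1 e2) G0 in jE.
have idE : (id : 'rV[R]_(mdim M) -> _) = (fun v => v *m 1%:M + 0).
  by apply/funext => v; rewrite mulmx1 addr0.
rewrite idE jac_affine in jE.
(* Collar coordinates followed by their inverse give the identity, so the Jacobian of f cannot have
   a zero column k. *)
suff J0 i : jac f p0 i k = 0.
  have := congr1 (fun A : 'M[R]_(mdim M) => A k k) jE; rewrite !mxE eqxx /=.
  by under eq_bigr do rewrite J0 mulr0; rewrite big1 // => /eqP; rewrite oner_eq0.
rewrite G0 in hf; have [U [oU Ux hU UE]] := hf.
have [Q' [oQ' Qx' Q'P]] : exists Q', [/\ open Q', Q' (t, x) & forall p, collar_ivl a e p.1 -> carrier N p.2 -> Q' p -> cdom c (col p.1 p.2)].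
  have [Q oQ EQ] := cdom_open MM hc; case: sf => _ cf _.
  have [||P' [oP' P'x hP']] := within_open cf (x := (t, x)) _ oQ; [by split| |].
    by rewrite /= -Ey; move: cy; rewrite EQ => -[].
  exists P'; split=> // p tp Np Pp; rewrite EQ; split; last by apply: hP'.
  by apply: sW; apply/hW; exists p.1, p.2.
have [Q1 [Q2 [oq1 oq2 h1 h2 sub]]] := open_box oQ' Qx'.
have [r1 r10 hr1] := open_real oq1 h1; have [r2 r20 hr2] := chart_ball MN hc' cy' oq2 h2.
have [r3 r30 hr3] := open_ball_rV (open_interior _) int'.
have [r4 r40 hr4] := open_ball_rV oU Ux.
have te : ivl_coord a t < e by move: ht => /collar_ivlE /andP[].
pose r := Num.min (Num.min (Num.min r1 r2) (Num.min r3 r4)) (Num.min (ivl_coord a t) (e - ivl_coord a t)).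
have r0 : 0 < r by rewrite !lt_min r10 r20 r30 r40 t0 subr_gt0.
(* All parameters near p0 belong to the domain of the collar: its boundary has interior chart
   images, and the time is strictly between 0 and e. Thus f is half-space valued near p0. *)
have nonneg z : `|z - p0| < r -> U z /\ 0 <= f z 0 k.
  rewrite !lt_min => /andP[/andP[/andP[z1 z2] /andP[z3 z4]] /andP[z5 z6]].
  have Uz := hr4 z z4; split=> //.
  have zE := hsubmxK z; set s := lsubmx z 0 0; set v := rsubmx z in zE.
  have hs : `|s - ivl_coord a t| <= `|z - p0|.
    have E1 : p0 0 (lshift (mdim N) 0) = ivl_coord a t by rewrite /p0 /= row_mxEl mxE.
    have := norm_coord (z - p0) 0 (lshift (mdim N) 0); rewrite mxE [X in _ + X]mxE E1.
    by rewrite /s [lsubmx z 0 0]mxE.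
  have hv : `|v - cmap c' x| <= `|z - p0|.
    apply: norm_leP => // i0 l; have E1 : p0 0 (rshift 1 l) = cmap c' x 0 l by rewrite /p0 /= row_mxEr.
    have := norm_coord (z - p0) 0 (rshift 1 l); rewrite mxE [X in _ + X]mxE E1.
    by rewrite (ord1 i0) [(v - _) _ _]mxE [X in _ -> `|_ + X| <= _]mxE /v [rsubmx z 0 l]mxE.
  have [x2 cx2 Ex2] : (cmap c' @` cdom c') v.
    by apply: interior_subset; apply: hr3; exact: le_lt_trans hv z3.
  have ts : collar_ivl a e (ivl_coord a s).
    apply/collar_ivlE; rewrite ivl_coordK.
    have := le_lt_trans hs z5; have := le_lt_trans hs z6; rewrite !ltr_norml => /andP[] ? ? /andP[] ? ?.
    by apply/andP; split; lra.
  have zE' : cmap (cyl c') (ivl_coord a s, x2) = z.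
    rewrite /= ivl_coordK Ex2 -[RHS]zE; congr row_mx; apply/matrixP => i0 l.
    by rewrite !mxE (ord1 i0) (ord1 l) /s mxE.
  have cz : cdom c (col (ivl_coord a s) x2).
    apply: (Q'P (ivl_coord a s, x2)) => //; first exact: (cdom_sub MN hc' cx2).
    apply: sub.
      apply: hr1; rewrite -(ivl_coord_dist a) ivl_coordK; exact: le_lt_trans hs z1.
    by apply: hr2 => //; rewrite Ex2; exact: le_lt_trans hv z2.
  have SFz : SF z by exists (ivl_coord a s, x2).
  have FV : (@halfspace R (mdim M) `&` P) (F z).
    rewrite -EV -zE' (FE (_, _)) //; exact: imageP.
  by rewrite (UE z SFz Uz); case: FV => h0 _; exact: h0.
have f0 : f p0 0 k = 0.
  have SF0 : SF p0 by exists (t, x) => //; split=> //; rewrite /= -Ey.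
  by rewrite (UE p0 SF0 Ux) (FE (t, x)) //= -Ey.
apply/eqP; rewrite -normr_le0; apply/ler_addgt0Pr => eps eps0; rewrite add0r.
have [rr rr0 hrr] := approx1_jac oU Ux hU eps0.
pose tau := Num.min r rr / 2.
have m0 : 0 < Num.min r rr by rewrite lt_min r0.
have tau0 : 0 < tau by rewrite divr_gt0.
have : tau < Num.min r rr by rewrite ltr_pdivrMr // ltr_pMr // ltr1n.
rewrite lt_min => /andP[tr trr].
(* At a minimum with value 0 the linear term is at least minus the error; b = tau and b = -tau bound
   it from both sides. *)
have key (b : R) : `|b| = tau -> - (eps * tau) <= b * jac f p0 i k.
  move=> ab; pose z := p0 + b *: delta_mx 0 i.
  have zp : z - p0 = b *: delta_mx 0 i by rewrite /z addrC addKr.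
  have nz : `|z - p0| <= tau.
    rewrite zp normrZ ab ler_piMr // ?(ltW tau0) //.
    by apply: norm_leP => // q l; rewrite mxE; case: (_ && _); rewrite ?normr1 ?normr0.
  have [_ fz] := nonneg z (le_lt_trans nz tr).
  have := hrr z (le_lt_trans nz trr); set A := f z - f p0 - _ => hA.
  have := le_trans (norm_coord A 0 k) (le_trans hA (ler_wpM2l (ltW eps0) nz)).
  rewrite /A /= zp -scalemxAl -rowE; move: (jac f p0) => J.
  rewrite !mxE f0 subr0 ler_norml => /andP[_ h3].
  by move: fz h3; move: (_ * _) => q; lra.
have h3 := key tau (gtr0_norm tau0); have h4 : `|- tau| = tau by rewrite normrN gtr0_norm.
have := key _ h4; rewrite mulNr => h5.
rewrite -(ler_pM2l tau0) -{1}(gtr0_norm tau0) -normrM ler_norml; apply/andP; split; lra.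
Qed.

End HalfCylinder.

(** * The boundary atlas inherits the core properties *)

Section BoundaryCore.
Context {R : realType} {TY : topologicalType} {K : cobordism R TY} {a : bool}.
Implicit Types I J L : {set 'I_(aN K)}.
Hypothesis hK : core K.
Hypothesis bidx : forall I, idx (bd_atlas a K) I <-> idx K I /\ bdset K a I !=set0.
Hypothesis bdom : forall I x, idx K I -> bdset K a I x -> dom (ach K I) x.
Hypothesis bphi : forall I J (x : kT (ach K I)), idx K I -> idx K J -> I \proper J ->
  aU K I J x -> (bdset K a I x <-> bdset K a J (aphi K J x)).

Lemma bd_phi I J (x : kT (ach K I)) : idx K I -> idx K J -> I \subset J ->
  aU K I J x -> (bdset K a I x <-> bdset K a J (aphi K J x)).
Proof.
move=> hI hJ /subset_eqVproper[E|IJ]; last exact: bphi.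
by subst J; rewrite (aUid hK) // => xd; rewrite (aphi_id hK).
Qed.

(** Coordinate changes both preserve and reflect boundary points, so the two tameness identities can
    be intersected with the boundary. *)
Lemma bd_tame : tame (bd_atlas a K).
Proof.
have [add hU hp] := co_tame hK.
have bK I : idx (bd_atlas a K) I -> idx K I by case/bidx.
split.
- by move=> I /bK; exact: add.
- move=> I J L bI bJ bL IJ IL; have hI := bK _ bI; have hJ := bK _ bJ; have hL := bK _ bL.
  have E := hU I J L hI hJ hL IJ IL; rewrite eqEsubset; split=> x.
    move=> [[U1 Bx] [U2 _]].
    have : (aU K I J `&` aU K I L) x by []; rewrite E => -[hJL Ux].
    split; last by split.
    have IJL : I \subset J :|: L by exact: (fintype.subset_trans IJ (finset.subsetUl _ _)).
    apply/bidx; split=> //; exists (aphi K (J :|: L)%SET x).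
    by apply/(bd_phi hI hJL IJL Ux).
  move=> [bJL [Ux Bx]].
  have : (aU K I J `&` aU K I L) x by rewrite E; split=> //; exact: bK.
  by case.
- move=> I J L bI bJ bL IJ JL; have hI := bK _ bI; have hJ := bK _ bJ; have hL := bK _ bL.
  have E := hp I J L hI hJ hL IJ JL; rewrite eqEsubset; split=> y.
    move=> [x [Ux Bx] <-].
    have : (aphi K J @` aU K I L) (aphi K J x) by exists x.
    rewrite E => -[Uy [yd ky]].
    have By : bdset K a J (aphi K J x).
      by apply/(bd_phi hI hJ IJ _) => //; exact: (aU_sub hK hI hJ hL IJ JL).
    by split; split.
  move=> [[Uy By] [_ ky]].
  have : (aU K J L `&` [set y | dom (ach K J) y /\ ks (ach K J) y \in limg (ahat K I J)]) y.
    by split=> //; split=> //; exact: bdom.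
  rewrite -E => -[x Ux xy]; exists x => //; split=> //.
  have UJ : aU K I J x by exact: (aU_sub hK hI hJ hL IJ JL).
  by apply/(bd_phi hI hJ IJ UJ); rewrite xy.
Qed.

Lemma bd_core :
  (forall I, idx (bd_atlas a K) I -> smooth_atlas (cbdU K a I)) ->
  (forall I, idx (bd_atlas a K) I -> smooth_fun (cbdU K a I) (bdset K a I) (ks (ach K I))) ->
  (forall I J, idx (bd_atlas a K) I -> idx (bd_atlas a K) J -> I \proper J ->
     local_core (bd_atlas a K) I J) ->
  core (bd_atlas a K).
Proof.
move=> hM hs hl; have bK I : idx (bd_atlas a K) I -> idx K I by case/bidx.
apply: core_intro => //; last exact: bd_tame.
- move=> I bI; have hI := bK _ bI; split; last by have [_ _] := co_id hK hI.
    rewrite /= (aUid hK) // eqEsubset; split=> x; first by case.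
    by move=> Bx; split=> //; exact: bdom.
  by move=> x Bx; apply: (aphi_id hK) => //; exact: bdom.
- move=> I J L bI bJ bL IJ JL; have hI := bK _ bI; have hJ := bK _ bJ; have hL := bK _ bL.
  split; first exact: (co_hat hK).
    move=> x [[Ux Bx] [Uy _]]; split=> //.
    by have [] := co_phi hK hI hJ hL IJ JL Ux Uy.
  by move=> x [Ux _] [Uy _]; have [] := co_phi hK hI hJ hL IJ JL Ux Uy.
Qed.

End BoundaryCore.

(** * Collar data of a Kuranishi cobordism *)

Section FromCobordism.
Context {R : realType} {TY : topologicalType} {K : cobordism R TY} {D : int} {e : R}.
Implicit Types (a : bool) (I J L : {set 'I_(aN K)}) (t : R).
Hypothesis e0 : 0 < e.
Hypothesis hco : is_cobordism K D e.
Hypothesis ht : tame K.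

Lemma cob_chart I : idx K I -> is_bkchart (aX K) (ach K I).
Proof. by case: hco => _ _ h _ /h[[]|[[]]]. Qed.

Let hK : core K.
Proof. by case: hco => hA _ _ _; exact: (atlas_core hA cob_chart ht). Qed.

Lemma cob_bd_nonempty a I : idx K I -> bdset K a I !=set0 <-> bd_foot a I !=set0.
Proof.
case: hco => _ _ h _ /h[[_ _ _ _ /(_ a)[]//]|[_ [FX _] B0]].
split=> [[x]|[p [/FX [_ np] Yp]]]; first by rewrite /bdset B0.
by case: np; case: a Yp => Yp; [right|left].
Qed.

Lemma cob_data a I : idx K I -> bdset K a I !=set0 ->
  [/\ is_kchart (cbdY K a) (bd_chart a I),
      footprint (bd_chart a I) = bd_foot a I,
      (forall x, carrier (cbdU K a I) x -> ccolU K a (endpoint a) x = x),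
      (open_in (dom (ach K I)) (@collar _ _ K a e I) /\
       diffeo_onto (half_cylinder a e (cbdU K a I)) (kU (ach K I)) (@collar _ _ K a e I)
            (fun p => ccolU K a p.1 p.2)) &
      forall t x, collar_ivl a e t -> carrier (cbdU K a I) x ->
           ks (ach K I) (ccolU K a t x) = ks (ach K I) x].
Proof.
move=> hI B0; have F0 := (cob_bd_nonempty a hI).1 B0.
case: hco => _ _ h _; have [[_ _ _ _ /(_ a)[_ /(_ F0)[h1 h2 h3 h4 h5]]]|[_ _ E]] := h I hI.
  by split=> // t x tx Bx; have [] := h5 t x tx Bx.
by case: B0 => x; rewrite /bdset E.
Qed.

Lemma cob_bd_dom a I x : idx K I -> bdset K a I x -> dom (ach K I) x.
Proof.
case: hco => _ _ h _ /h[[_ _ _ [E _] _] Bx|[_ _ E]]; last by rewrite /bdset E.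
have : boundary (kU (ach K I)) x by rewrite E; case: a Bx => Bx; [right|left].
by case.
Qed.

Lemma cob_idx a I : idx (bd_atlas a K) I <-> idx K I /\ bdset K a I !=set0.
Proof.
case: hco => -[_ _ [fne _] hft _] _ _ _.
have h1 i : idx K (finset.set1 i).
  split; first by apply/finset.set0Pn; exists i; rewrite finset.inE.
  have [p hp] := fne i; exists p => j; rewrite finset.inE => /eqP ->; exact: hp.
have fb i : footprint (bd_chart a (finset.set1 i)) = footprint (@basic _ _ K i) `&` cbdY K a.
  have [B0|nB] := pselect (bdset K a (finset.set1 i) !=set0).
    by have [_ ->] := cob_data (h1 i) B0.
  rewrite -[RHS]/(bd_foot a (finset.set1 i)).
  have -> : bd_foot a (finset.set1 i) = set0.
    by apply/eqP/negPn/negP => /set0P/(cob_bd_nonempty a (h1 i)).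
  by rewrite -subset0 => p [x [Bx _] _]; case: nB; exists x.
have key I0 : I0 != finset.set0 -> foot (K := bd_atlas a K) I0 = foot (K := K) I0 `&` cbdY K a.
  move=> I00; rewrite eqEsubset; split=> p.
    move=> hp; have pi i : i \in I0 -> (footprint (@basic _ _ K i) `&` cbdY K a) p.
      by move=> /hp; rewrite -fb.
    by split=> [i /pi[]//|]; have /finset.set0Pn[i /pi[]] := I00.
  by move=> [hp Yp] i /hp ?; change (footprint (bd_chart a (finset.set1 i)) p); rewrite fb.
split=> [[I0 []]|[hI B0]].
  rewrite key // => p [fp Yp]; have hI : idx K I by split=> //; exists p.
  split=> //; apply/(cob_bd_nonempty a hI); exists p; split=> //.
  by have [-> _] := hft I hI.
have [I0 _] := hI; split=> //; rewrite key //.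
have [p [fp Yp]] := (cob_bd_nonempty a hI).1 B0; exists p; split=> //.
by have [<- _] := hft I hI.
Qed.

(** A collar comes only with the existence of a smooth inverse; [collars] needs time and projection
    as functions, so one inverse is fixed here. *)
Definition collar_inv a I : kT (ach K I) -> R * kT (ach K I) :=
  xget (fun y => (0, y)) [set g | smooth_map (kU (ach K I)) (half_cylinder a e (cbdU K a I))
      (@collar _ _ K a e I) g /\
    forall t x, collar_ivl a e t -> bdset K a I x -> g (ccolU K a t x) = (t, x)].

Lemma collar_invP a I : idx K I -> bdset K a I !=set0 ->
  smooth_map (kU (ach K I)) (half_cylinder a e (cbdU K a I)) (@collar _ _ K a e I) (@collar_inv a I) /\
  forall t x, collar_ivl a e t -> bdset K a I x -> collar_inv a (ccolU K a t x) = (t, x).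
Proof.
move=> hI /(cob_data hI)[_ _ _ [_ [_ _ [g sg gK]]] _].
rewrite /collar_inv; case: xgetP => [g' -> []//|/(_ g)[]].
by split=> // t x tx Bx; exact: (gK (t, x)).
Qed.

Lemma cob_end a I x : idx K I -> bdset K a I x -> ccolU K a (endpoint a) x = x.
Proof.
move=> hI Bx; have [|_ _ h _ _] := cob_data hI (a := a); first by exists x.
exact: h.
Qed.

Lemma cob_col_inj a I t t' x x' : idx K I -> bdset K a I x -> bdset K a I x' ->
  collar_ivl a e t -> collar_ivl a e t' -> ccolU K a t x = ccolU K a t' x' -> t = t' /\ x = x'.
Proof.
move=> hI Bx Bx' tt tt' E; have [|_ gK] := @collar_invP a I hI; first by exists x.
by have := gK _ _ tt' Bx'; rewrite -E (gK _ _ tt Bx) => -[].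
Qed.

Lemma cob_phi a I J t (x : kT (ach K I)) : idx K I -> idx K J -> I \proper J ->
  collar_ivl a e t -> bdset K a I x -> aU K I J x ->
  [/\ aU K I J (ccolU K a t x), bdset K a J (aphi K J x) &
      aphi K J (ccolU K a t x) = ccolU K a t (aphi K J x)].
Proof.
move=> hI hJ IJ tx Bx Ux; case: hco => _ _ _ /(_ I J hI hJ IJ a)[E [h1 h2]].
have cx0 : (aU K I J `&` @collar _ _ K a e I) x.
  by split=> //; exists (endpoint a), x; split=> //; [exact: collar_endpoint|rewrite cob_end].
have [F0|nF] := pselect (bd_foot a J !=set0); last first.
  have := h2 _; rewrite /collar in cx0; move: cx0 => /[swap] ->; first by [].
  by apply/eqP/negPn/negP => /set0P.
have [[_ _ [[im _ _] _ _] _] hphi _] := h1 F0.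
split.
- have : collar_im a e (@ccolU _ _ K a I) (aU K I J `&` bdset K a I) (ccolU K a t x) by exists t, x.
  by rewrite -E => -[].
- by apply: im; exists x.
- exact: hphi.
Qed.

Lemma cob_phiW a I J t (x : kT (ach K I)) : idx K I -> idx K J -> I \proper J ->
  collar_ivl a e t -> bdset K a I x -> aU K I J (ccolU K a t x) -> aU K I J x.
Proof.
move=> hI hJ IJ tx Bx Ux; case: hco => _ _ _ /(_ I J hI hJ IJ a)[E _].
have : (aU K I J `&` @collar _ _ K a e I) (ccolU K a t x) by split=> //; exists t, x.
rewrite /collar E => -[t' [x' [tx' [Ux' Bx'] /(cob_col_inj hI Bx Bx' tx tx')[_ ->]]]]; exact: Ux'.
Qed.

Lemma cob_phiWV a I J (y : kT (ach K I)) : idx K I -> idx K J -> I \proper J ->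
  aU K I J y -> collar a e (aphi K J y) -> collar a e y.
Proof.
move=> hI hJ IJ Uy Wy; case: hco => _ _ _ /(_ I J hI hJ IJ a)[_ [h1 _]].
have F0 : bd_foot a J !=set0.
  by apply/(cob_bd_nonempty a hJ); case: Wy => t [x [_ Bx _]]; exists x.
have [_ hphi E] := h1 F0.
have : (aphi K J @` aU K I J `&` @collar _ _ K a e J) (aphi K J y) by split=> //; exists y.
rewrite /collar E => -[t [_ [tx [x' [Ux' Bx'] <-] Ey]]].
have [Ut _ Et] := cob_phi hI hJ IJ tx Bx' Ux'.
exists t, x'; split=> //; apply: (co_inj hK hI hJ IJ Uy Ut).
by rewrite Et Ey.
Qed.

Lemma cob_bphi a I J (x : kT (ach K I)) : idx K I -> idx K J -> I \proper J ->
  aU K I J x -> (bdset K a I x <-> bdset K a J (aphi K J x)).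
Proof.
move=> hI hJ IJ Ux; have h0 := collar_endpoint a e0; split=> [Bx|By].
  by have [] := cob_phi hI hJ IJ h0 Bx Ux.
have [|t [x' [tx Bx' Ex]]] := cob_phiWV (a := a) hI hJ IJ Ux.
  by exists (endpoint a), (aphi K J x); split=> //; rewrite cob_end.
have Ux' : aU K I J x' by apply: (cob_phiW hI hJ IJ tx Bx'); rewrite -Ex.
have [_ By' E] := cob_phi hI hJ IJ tx Bx' Ux'.
rewrite -Ex -[aphi K J x](cob_end hJ By) in E.
have [te _] := cob_col_inj hJ By By' h0 tx E.
by rewrite Ex -te cob_end.
Qed.

(** At time 0 the point would be on both boundary parts, which are disjoint. At positive time it
    would be an interior point by [collar_interior]. *)
Lemma cob_disj a I (x : kT (ach K I)) : idx K I -> bdset K a I x -> ~ collar (~~ a) e x.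
Proof.
move=> hI Bx [t [x' [tx Bx' Ex]]]; case: hco => _ _ h _.
have [[_ _ _ [EB dis] _]|[_ _ E]] := h I hI; last by move: Bx; rewrite /bdset E.
have xB : boundary (kU (ach K I)) x by rewrite EB; case: (a) Bx => Bx; [right|left].
have B0 : bdset K (~~ a) I !=set0 by exists x'.
have [t0|tp] := eqVneq (ivl_coord (~~ a) t) 0.
  have te : t = endpoint (~~ a).
    by move: t0; rewrite /ivl_coord /endpoint; case: (~~ a) => //= t0; apply/esym/eqP; rewrite -subr_eq0 t0.
  move: Ex; rewrite te cob_end // => Ex; subst x'.
  suff : (set0 : set (kT (ach K I))) x by [].
  by rewrite -dis; case: (a) Bx Bx' => ? ?; split.
have tpos : 0 < ivl_coord (~~ a) t.
  by rewrite lt_neqAle eq_sym tp /=; move: tx => /collar_ivlE /andP[].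
have [[[mB _ _ _ _] bB] _ _ [oW [_ sf _]] _] := cob_data hI B0.
have [sg gK] := collar_invP hI B0.
have [xd nint] := xB.
have hM := co_man hK hI; have hN := manifold_smooth_atlas mB.
have [c' hc' [cx' int']] : exists2 c', charts (cbdU K (~~ a) I) c' &
    cdom c' x' /\ interior (cmap c' @` cdom c') (cmap c' x').
  apply: contrapT => n; suff : boundary (cbdU K (~~ a) I) x' by rewrite bB.
  by split=> // c' hc' cx' int'; apply: n; exists c'.
have [[_ _ _ hv _] _ _ _ _] := cob_chart hI.
have [c hc cx] : exists2 c, charts (kU (ach K I)) c & cdom c x by case: hM => + _ _; exact.
have gx : collar_inv (~~ a) x = (t, x') by rewrite Ex gK.
apply: (nint c hc cx); apply: (collar_interior hM hN oW _ sf sg gK hc cx (hv c hc) _ _ hc').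
all: rewrite /= ?gx //.
by exists t, x'.
Qed.

Lemma cob_core_bd a : core (bd_atlas a K).
Proof.
have bM I : idx (bd_atlas a K) I -> smooth_atlas (cbdU K a I).
  by move=> /cob_idx[hI /(cob_data hI)[[[/manifold_smooth_atlas + _ _ _ _] _] _ _ _ _]].
have bS I : idx (bd_atlas a K) I -> smooth_fun (cbdU K a I) (bdset K a I) (ks (ach K I)).
  by move=> /cob_idx[hI /(cob_data hI)[[[]]]].
apply: bd_core => //; [exact: cob_idx|by move=> I x; exact: cob_bd_dom|exact: cob_bphi|].
move=> I J bI bJ IJ; have [hI _] := (cob_idx a I).1 bI; have [hJ BJ] := (cob_idx a J).1 bJ.
apply: coord_change_local; [exact: bM|exact: bM|exact: bS|].
case: hco => _ _ _ /(_ I J hI hJ IJ a)[_ [h1 _]].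
by have [] := h1 ((cob_bd_nonempty a hJ).1 BJ).
Qed.

Lemma cobordism_collars :
  collars K e (fun a I y => (@collar_inv a I y).1) (fun a I y => (@collar_inv a I y).2).
Proof.
have HC a I (y : kT (ach K I)) : idx K I -> collar a e y -> bdset K a I !=set0.
  by move=> hI [t [x [_ Bx _]]]; exists x.
have hW a I (y : kT (ach K I)) : collar a e y <->
    exists t x, [/\ collar_ivl a e t, carrier (cbdU K a I) x & y = ccolU K a t x] by [].
have E0 a I : ~ (bdset K a I !=set0) -> @collar _ _ K a e I = set0.
  by move=> n; rewrite -subset0 => y [t [x [_ Bx _]]]; apply: n; exists x.
split=> //.
- exact: cob_idx.
- by move=> a I x; exact: cob_bd_dom.
- move=> a I t x hI tx Bx; have B0 : bdset K a I !=set0 by exists x.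
  have [_ gK] := collar_invP hI B0; rewrite gK //; split=> //.
  have [_ _ _ [[Q _ EQ] _] _] := cob_data hI B0.
  have : collar a e (ccolU K a t x) by exists t, x.
  by rewrite EQ => -[].
- by move=> a I x; exact: cob_end.
- move=> a I hI; have [B0|n] := pselect (bdset K a I !=set0).
    by have [_ _ _ [oW _] _] := cob_data hI B0.
  by rewrite (E0 _ _ n); exists set0; [exact: open0|rewrite setI0].
- move=> a I t x hI tx Bx; have B0 : bdset K a I !=set0 by exists x.
  by have [_ _ _ _ ->] := cob_data hI B0.
- exact: cob_phi.
- exact: cob_phiW.
- exact: cob_phiWV.
- exact: cob_disj.
- move=> a I hI; have [B0|n] := pselect (bdset K a I !=set0); last first.
    rewrite (E0 _ _ n); split; [by move=> _ [y []]|by apply: within_openP|].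
    by move=> c c' _ _ _ [y [[_ []]]].
  have [[[mB _ _ _ _] _] _ _ [oW [_ sf _]] _] := cob_data hI B0.
  have [sg gK] := collar_invP hI B0.
  exact: (proj_smooth (hW a I) sg gK).
- move=> a I hI; have [B0|n] := pselect (bdset K a I !=set0); last first.
    by rewrite (E0 _ _ n) => c _ _ [y [_ []]].
  have [[[mB _ _ _ _] _] _ _ [oW [_ sf _]] _] := cob_data hI B0.
  have [sg gK] := collar_invP hI B0.
  exact: (time_smooth (co_man hK hI) (manifold_smooth_atlas mB) oW (hW a I) sg gK).
- move=> a I y hI Wy; have B0 := HC a I y hI Wy.
  have [[[mB _ _ _ _] _] _ _ [oW [_ sf _]] _] := cob_data hI B0.
  have [sg gK] := collar_invP hI B0.
  exact: (proj_submersion (co_man hK hI) (manifold_smooth_atlas mB) oW (hW a I) sf sg gK Wy).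
- exact: cob_core_bd.
Qed.

End FromCobordism.

(** * The collared metric in terms of representatives *)

Section CollaredMetric.
Context {R : realType} {TY : topologicalType} {K : cobordism R TY} {e : R}.
Implicit Types (a : bool) (I J L : {set 'I_(aN K)}) (t : R).
Context {tm : forall a I, kT (ach K I) -> R} {pr : forall a I, kT (ach K I) -> kT (ach K I)}.
Hypothesis hC : collars K e tm pr.
Hypothesis hK : core K.
Context {d : metric_family K} (cd : collared_metric e d).

Lemma collared_dcol a I J t t' (x : kT (ach K I)) (y : kT (ach K J)) : idx K I -> idx K J ->
  bdset K a I x -> bdset K a J y -> collar_ivl a e t -> collar_ivl a e t' ->
  d (cls (ccolU K a t x)) (cls (ccolU K a t' y)) = `|t - t'| + d (cls x) (cls y).
Proof.
move=> hI hJ Bx By tx ty; have [h _] := cd a.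
rewrite -(iota_bcls hC hK hI Bx tx) -(iota_bcls hC hK hJ By ty) h //.
- by rewrite (bd_metricE hC hK).
- by apply/(bd_realization hC); exists I, x.
- by apply/(bd_realization hC); exists J, y.
Qed.

Lemma collared_dout a I J t (x : kT (ach K I)) (y : kT (ach K J)) : idx K I -> idx K J ->
  bdset K a I x -> dom (ach K J) y -> collar_ivl a e t -> ~ collar a e y ->
  e - ivl_coord a t <= d (cls y) (cls (ccolU K a t x)).
Proof.
move=> hI hJ Bx yd tx nW; have [_ h] := cd a.
rewrite -(iota_bcls hC hK hI Bx tx) (ivl_coord_abs tx); apply: h => //.
- exact: real_cls.
- move=> [t' [b [tt' /(bd_realization hC)[L [z [hL Bz ->]]]]]].
  rewrite (iota_bcls hC hK hL Bz tt') => /(collar_transfer hC hK hL hJ yd Bz tt')[y' [By' Ey _]].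
  by apply: nW; exists t', y'.
- by apply/(bd_realization hC); exists I, x.
Qed.

End CollaredMetric.

Lemma cobordism_perturbation_theorem (R : realType) (TY : topologicalType) (K : cobordism R TY)
    (D : int) (d : metric_family K) (C V : dom_family K) (n : norm_family K) (e delta : R) :
  0 < e -> metric_tame_cobordism D e d -> nested_cobordism_reduction e C V ->
  additive_norms n -> 0 < delta -> delta < Num.min e (delta_red d V) ->
  [/\ (0 < sigma_rel d V C n delta)%E, perturbations_exist d V C n delta &
      relative_perturbations_exist d V C n delta].
Proof.
move=> e0 [hco ht hd cd] hn an d0; rewrite lt_min => /andP[de ddr].
have hC := cobordism_collars e0 hco ht.
have hK : core K by case: (hco) => hA _ _ _; exact: (atlas_core hA (cob_chart hco) ht).
have [[[oC _ _ _ cC] _] [[oV pV _ _ _] colV'] nCV] := hn.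
have hV I : idx K I -> V I `<=` dom (ach K I) by move=> /pV[].
have CV I : idx K I -> C I `<=` V I by move=> /nCV[].
have nI I : idx K I -> is_norm (n I) by apply: additive_is_norm => //; case: ht.
have colV a I t x : idx K I -> bdset K a I x -> collar_ivl a e t -> (V I (ccolU K a t x) <-> V I x).
  by move=> hI Bx tx; have [h _] := colV' a I (idx_bd hC hI Bx); exact: h.
have zC I (x : kT (ach K I)) : idx K I -> zeros (ach K I) x -> projK C (cls x).
  by case: (hco) => hA _ _ _; exact: (tame_closed hA (cob_chart hco) hK cC).
have nest : exists2 e' : R, 0 < e' & nested_cobordism_reduction e' C V by exists e.
have dc := collared_dcol hC hK cd; have dt := collared_dout hC hK cd.
split.
- exact: (cobordism_sigma_rel_gt0 hC hK hd dc dt d0 hV ddr nI oC CV zC).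
- exact: (cobordism_perturbations hC hK hd dc dt d0 de hV ddr colV nI oV nest).
- exact: (cobordism_relative hC hK hd dc dt d0 de hV ddr colV nI oV nest).
Qed.

(** * Product cobordisms *)

Lemma within_continuous {S T : topologicalType} (A : set S) (f : S -> T) :
  continuous f -> {within A, continuous f}.
Proof. exact: continuous_subspaceT. Qed.

Section Continuity.
Context {R : realType} {S T T1 T2 : topologicalType}.

Lemma within_pair (A : set S) (f : S -> T1) (g : S -> T2) : {within A, continuous f} ->
  {within A, continuous g} -> {within A, continuous (fun x => (f x, g x))}.
Proof.
move=> cf cg; apply: within_openP => x Q Ax oQ Qx.
have [Q1 [Q2 [oq1 oq2 h1 h2 sub]]] := open_box oQ Qx.
have [P1 [op1 P1x h3]] := within_open cf Ax oq1 h1.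
have [P2 [op2 P2x h4]] := within_open cg Ax oq2 h2.
by exists (P1 `&` P2); split=> [|//|y Ay [y1 y2]]; [exact: openI|apply: sub; [exact: h3|exact: h4]].
Qed.

Lemma within_comp (A : set S) (B : set T) (f : S -> T) (g : T -> T1) :
  (forall x, A x -> B (f x)) -> {within A, continuous f} -> {within B, continuous g} ->
  {within A, continuous (fun x => g (f x))}.
Proof.
move=> AB cf cg; apply: within_openP => x Q Ax oQ Qx.
have [P [oP Px hP]] := within_open cg (AB _ Ax) oQ Qx.
have [P' [oP' P'x hP']] := within_open cf Ax oP Px.
by exists P'; split=> // y Ay Py; apply: hP; [exact: AB|exact: hP'].
Qed.

End Continuity.

Section RowContinuity.
Context {R : realType} {S : topologicalType}.

Lemma lipschitz1_continuous (V W : normedModType R) (f : V -> W) :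
  (forall x y, `|f x - f y| <= `|x - y|) -> continuous f.
Proof.
move=> H x; apply/cvgrPdist_lt => eps e0; near=> y; apply: le_lt_trans (H _ _) _; near: y.
exact: cvgr_dist_lt.
Unshelve. all: by end_near. Qed.

Lemma lsubmx_lipschitz n (v w : 'rV[R]_(1 + n)) :
  `|lsubmx v 0 0 - lsubmx w 0 0| <= `|v - w|.
Proof. by have := norm_coord (v - w) 0 (lshift n 0); rewrite !mxE. Qed.

Lemma rsubmx_lipschitz n (v w : 'rV[R]_(1 + n)) : `|rsubmx v - rsubmx w| <= `|v - w|.
Proof.
apply: norm_leP => // i j; have := norm_coord (v - w) 0 (rshift 1 j).
by rewrite (ord1 i) !mxE.
Qed.

Lemma within_row n (A : set S) (f : S -> R) (g : S -> 'rV[R]_n) : {within A, continuous f} ->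
  {within A, continuous g} -> {within A, continuous (fun x => row_mx (const_mx (f x) : 'rV[R]_1) (g x))}.
Proof.
move=> cf cg.
have h : continuous (fun p : R^o * 'rV[R]_n => row_mx (const_mx p.1 : 'rV[R]_1) p.2).
  apply: lipschitz1_continuous => p q.
  apply: norm_leP => // i j; rewrite opp_row_mx add_row_mx; case: (@split_ordP 1 n j) => k ->.
    by rewrite row_mxEl !mxE [leRHS]/Num.norm /= le_max lexx.
  rewrite row_mxEr; apply: (le_trans (norm_coord _ i k)).
  by rewrite [leRHS]/Num.norm /= le_max lexx orbT.
exact: (@within_comp _ _ _ A setT (fun x => (f x, g x)) _ (fun _ _ => I) (within_pair cf cg) (within_continuous h)).
Qed.

End RowContinuity.

(** * Coordinate expressions on cylinders *)

Section ProductExtensions.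
Context {R : realType}.

Lemma ext_snd n m (D : set 'rV[R]_n) (f : 'rV[R]_n -> 'rV[R]_m) g (D' : set 'rV[R]_(1 + n)) F x :
  D' x -> ext D f (rsubmx x) g -> (forall v, D' v -> D (rsubmx v) /\ F v = f (rsubmx v)) ->
  ext D' F x (fun v => g (rsubmx v)) /\
  forall v, row_mx (0 : 'rV[R]_1) v *m jac (fun v => g (rsubmx v)) x = v *m jac g (rsubmx x).
Proof.
move=> Dx hg H; pose B : 'M[R]_(1 + n, n) := col_mx 0 1%:M.
have BE v : rsubmx v = v *m B.
  by rewrite -[in RHS](hsubmxK v) matrix.mul_row_col mulmx0 add0r mulmx1.
have e1 : ext D' (fun v => rsubmx v) x (fun v => v *m B + 0).
  exists setT; split=> //; [exact: openT| |by move=> v _ _; rewrite addr0 BE].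
  apply: CinftyD; [exact: openT| |by apply: Cinfty_cst; exact: openT].
  by apply: Cinfty_mulmx; [exact: openT|apply: Cinfty_id; exact: openT].
have DD v : D' v -> D (rsubmx v) by move=> /H[].
have gE : (fun v => g (rsubmx v)) = g \o (fun v => v *m B + 0).
  by apply/funext => v; rewrite /= addr0 BE.
rewrite gE; split.
  have [U [oU Ux hU UE]] := ext_comp Dx DD e1 hg.
  by exists U; split=> // v Dv Uv; rewrite UE //; have [_ ->] := H v Dv.
move=> v; rewrite (jac_ext_comp Dx e1 hg) jac_affine mulmxA.
by rewrite matrix.mul_row_col mulmx1 mul0mx add0r.
Qed.

(** The first coordinate is affine with slope s and independent of the rest, so the Jacobian is
    block diagonal. *)
Lemma ext_row n m (D : set 'rV[R]_n) (f : 'rV[R]_n -> 'rV[R]_m) g (s r : R)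
    (D' : set 'rV[R]_(1 + n)) F x :
  D' x -> ext D f (rsubmx x) g ->
  (forall v, D' v -> D (rsubmx v) /\
     F v = row_mx (const_mx (s * lsubmx v 0 0 + r) : 'rV[R]_1) (f (rsubmx v))) ->
  exists G, ext D' F x G /\ (s != 0 -> row_free (jac g (rsubmx x)) -> row_free (jac G x)).
Proof.
move=> Dx hg H.
have [e1 j1] := ext_snd (F := fun v => f (rsubmx v)) Dx hg (fun v Dv => conj (H v Dv).1 erefl).
have [e2 j2] := ext_mulmx (row_mx 0 1%:M : 'M[R]_(m, 1 + m)) e1.
pose A : 'M[R]_(1 + n, 1 + m) := row_mx (col_mx s%:M 0) 0.
pose c : 'rV[R]_(1 + m) := row_mx (const_mx r) 0.
have e3 : ext D' (fun v => v *m A + c) x (fun v => v *m A + c).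
  exists setT; split=> //; first exact: openT.
  apply: CinftyD; [exact: openT| |by apply: Cinfty_cst; exact: openT].
  by apply: Cinfty_mulmx; [exact: openT|apply: Cinfty_id; exact: openT].
have [e4 j4] := extD e3 e2.
exists (fun v => v *m A + c + g (rsubmx v) *m row_mx 0 1%:M); split.
  have [U [oU Ux hU UE]] := e4; exists U; split=> // v Dv Uv; rewrite UE //.
  have [_ ->] := H v Dv; rewrite /A /c mul_mx_row mulmx0 mul_mx_row mulmx0 mulmx1 !add_row_mx !addr0 add0r.
  congr row_mx; rewrite -{1}(hsubmxK v) matrix.mul_row_col mulmx0 addr0 mul_mx_scalar.
  by apply/matrixP => i j; rewrite !ord1 !mxE.
move=> s0 fg; apply: inj_row_free => v.
rewrite j4 j2 jac_affine mulmxDr mulmxA -{2}(hsubmxK v).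
have -> : row_mx (lsubmx v) (rsubmx v) = row_mx (lsubmx v) 0 + row_mx 0 (rsubmx v).
  by rewrite add_row_mx addr0 add0r.
rewrite mulmxDl j1; set w := row_mx (lsubmx v) 0 *m _.
rewrite /A mul_mx_row mulmx0 mul_mx_row mulmx0 mulmx1 add_row_mx addr0 add0r => E.
have : row_mx (0 : 'rV[R]_1) (0 : 'rV[R]_m) = 0 by rewrite row_mx0.
rewrite -E => /eq_row_mx[E1 E2].
have l0 : lsubmx v = 0.
  move: E1; rewrite -{1}(hsubmxK v) matrix.mul_row_col mulmx0 addr0 mul_mx_scalar => /esym/eqP.
  by rewrite scaler_eq0 (negbTE s0) => /eqP.
have r0 : rsubmx v = 0.
  move: E2; rewrite /w l0 row_mx0 mul0mx add0r => /esym h.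
  by apply: (row_free_inj fg); rewrite h mul0mx.
by rewrite -(hsubmxK v) l0 r0 row_mx0.
Qed.

Lemma ivl_coord2 a b : exists s r : R, s != 0 /\
  forall t, ivl_coord b (ivl_coord a t) = s * t + r.
Proof.
case: a; case: b; rewrite /ivl_coord.
- by exists 1, 0; split=> [|t]; [exact: oner_neq0|ring].
- by exists (-1), 1; split=> [|t]; [rewrite oppr_eq0 oner_neq0|ring].
- by exists (-1), 1; split=> [|t]; [rewrite oppr_eq0 oner_neq0|ring].
- by exists 1, 0; split=> [|t]; [exact: oner_neq0|ring].
Qed.

(** Covers transitions of cylinder charts, product coordinate changes and collar maps at once, all
    of them being of the form (t, x) |-> (t, f x). Charts at the two ends read the time as t or 1 -
    t. *)
Lemma ext_cyl_chart {T T' : topologicalType} n m (c : chart R T n) (c' : chart R T' m) a b (w w' : R)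
    (D : set T) (D' : set (R * T)) (f : T -> T') (F : R * T -> R * T') g p :
  (forall q, D' q -> [/\ cdom c q.2, cinv c (cmap c q.2) = q.2, D q.2 & F q = (q.1, f q.2)]) ->
  ext (cmap c @` (cdom c `&` D)) (cmap c' \o f \o cinv c) (cmap c p.2) g -> D' p ->
  exists G, ext (cmap (cyl_chart a w c) @` D')
      (cmap (cyl_chart b w' c') \o F \o cinv (cyl_chart a w c)) (cmap (cyl_chart a w c) p) G /\
    (row_free (jac g (cmap c p.2)) -> row_free (jac G (cmap (cyl_chart a w c) p))).
Proof.
move=> H hg Dp; have [s [r [s0 sr]]] := ivl_coord2 a b.
have E : rsubmx (cmap (cyl_chart a w c) p) = cmap c p.2 by rewrite row_mxKr.
rewrite -E in hg *; pose S := cmap (cyl_chart a w c) @` D'.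
have Sp : S (cmap (cyl_chart a w c) p) by exists p.
have [|G [hG fG]] := @ext_row _ _ _ _ _ s r S
    (cmap (cyl_chart b w' c') \o F \o cinv (cyl_chart a w c)) _ Sp hg; last first.
  by exists G; split=> // /(fG s0).
move=> _ [q Dq <-]; have [cq cK Dq2 Fq] := H q Dq.
split; first by rewrite row_mxKr; exists q.2.
rewrite /= row_mxKr row_mxKl mxE cK -sr ivl_coordK.
by rewrite -surjective_pairing Fq.
Qed.

End ProductExtensions.

(** * Cylinders and slices as manifolds *)

Section ProductManifolds.
Context {R : realType} {T : topologicalType} {M : manifold R T}.
Hypothesis MA : smooth_atlas M.

Lemma unit_ivlE (t : R) : unit_ivl R t <-> 0 <= t <= 1.
Proof. by rewrite /unit_ivl /= in_itv. Qed.

Lemma collar_unit a (w t : R) : w <= 1 -> collar_ivl a w t -> unit_ivl R t.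
Proof.
move=> w1 /collar_ivlE; rewrite unit_ivlE /ivl_coord; case: a => /andP[? ?]; apply/andP; split; lra.
Qed.

Lemma collar_unit_open a (w : R) : w <= 1 -> open_in (unit_ivl R) (collar_ivl a w).
Proof.
move=> w1; exists [set t | ivl_coord a t < w].
  have -> : [set t | ivl_coord a t < w] = ivl_coord a @^-1` [set t | t < w] by [].
  apply: open_comp; last exact: open_lt.
  move=> t _; apply: (@lipschitz1_continuous R R^o R^o) => x y.
  by rewrite (ivl_coord_dist a).
rewrite eqEsubset; split=> t.
  by move=> ht; split; [exact: collar_unit ht|move/collar_ivlE: ht => /andP[]].
move=> [/unit_ivlE/andP[h0 h1] /= h]; apply/collar_ivlE; rewrite h andbT.
by rewrite /ivl_coord; case: (a); lra.
Qed.

Lemma unit_collar (t : R) : unit_ivl R t -> exists a, collar_ivl a 1 t.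
Proof.
move=> /unit_ivlE /andP[h0 h1]; have [t1|t1] := ltP t 1.
  by exists false; apply/collar_ivlE; rewrite /ivl_coord h0.
by exists true; apply/collar_ivlE; rewrite /ivl_coord; apply/andP; split; lra.
Qed.

Lemma open_in_times {T1 T2 : topologicalType} (A A' : set T1) (B B' : set T2) :
  open_in A A' -> open_in B B' -> open_in (A `*` B) (A' `*` B').
Proof.
move=> [P oP ->] [Q oQ ->]; exists (P `*` Q); first exact: open_times.
by rewrite eqEsubset; split=> -[u v] [/= [? ?] [? ?]].
Qed.

Lemma cyl_continuous a (w : R) c : charts M c -> {within cdom (cyl_chart a w c), continuous (cmap (cyl_chart a w c))}.
Proof.
move=> hc; case: MA => _ /(_ c hc)[_ _ cm _ _] _; apply: within_row.
  have h : continuous (fun p : R * T => ivl_coord a p.1 : R).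
    move=> p; apply: continuous_comp; first exact: cvg_fst.
    apply: (@lipschitz1_continuous R R^o R^o) => x y; by rewrite (ivl_coord_dist a).
  exact: (within_continuous h).
apply: (within_comp _ _ cm) => [p []//|]; apply: within_continuous => p; exact: cvg_snd.
Qed.

Lemma cyl_inv_continuous a (w : R) c : charts M c ->
  {within cmap (cyl_chart a w c) @` cdom (cyl_chart a w c), continuous (cinv (cyl_chart a w c))}.
Proof.
move=> hc; case: MA => _ /(_ c hc)[_ _ _ ci _] _; apply: within_pair.
  apply: within_continuous; apply: (@lipschitz1_continuous R _ R^o) => v u.
  by rewrite (ivl_coord_dist a); exact: lsubmx_lipschitz.
apply: (within_comp _ _ ci).
  by move=> _ [p [_ cp] <-]; rewrite row_mxKr; exact: imageP.
by apply: within_continuous; apply: lipschitz1_continuous => v u; exact: rsubmx_lipschitz.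
Qed.

Lemma cyl_chartK a (w : R) c p : charts M c -> cdom (cyl_chart a w c) p ->
  cinv (cyl_chart a w c) (cmap (cyl_chart a w c) p) = p.
Proof.
move=> hc [tp cp]; rewrite /= row_mxKl row_mxKr mxE ivl_coordK (cmapK MA) //.
by case: p {tp cp}.
Qed.

Lemma cyl_fat a c p : charts M c -> cdom (cyl_chart a 1 c) p ->
  fat (cmap (cyl_chart a 1 c) @` cdom (cyl_chart a 1 c)) (cmap (cyl_chart a 1 c) p).
Proof.
case: p => t x hc [/= /collar_ivlE /andP[t0 t1] cx] i; case: (@split_ordP 1 (mdim M) i) => j ->.
  exists (1 - ivl_coord a t); first by rewrite subr_gt0.
  move=> s /andP[s0 s1]; exists (ivl_coord a (ivl_coord a t + s), x).
    by split=> //=; apply/collar_ivlE; rewrite ivl_coordK; apply/andP; split; lra.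
  rewrite /= ivl_coordK delta_mx_lshift scale_row_mx add_row_mx scaler0 addr0; congr row_mx.
  by apply/matrixP => k l; rewrite !ord1 !mxE mulr1.
case: MA => _ /(_ c hc)[_ /(_ x cx j)[r r0 hr] _ _ _] _; exists r => // s /hr[x' cx' Ex'].
exists (t, x'); first by split=> //; apply/collar_ivlE; rewrite /= t0.
by rewrite /= Ex' delta_mx_rshift scale_row_mx add_row_mx scaler0 addr0.
Qed.

Lemma smooth_transition c c' x : charts M c -> charts M c' -> cdom c x -> cdom c' x ->
  exists g, ext (cmap c @` (cdom c `&` cdom c')) (cmap c' \o cinv c) (cmap c x) g.
Proof.
by move=> hc hc' cx cx'; case: MA => _ _ /(_ c c' hc hc')/smooth_in_row; apply; exists x.
Qed.

Lemma cylinder_smooth_atlas : smooth_atlas (cylinder M).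
Proof.
split.
- move=> [t x] [/= /unit_collar[a ht] Mx]; have [hc cx] := chart_atP MA Mx.
  by exists (cyl_chart a 1 (chart_at M x)); [exists a, (chart_at M x)|].
- move=> _ [a [c [hc ->]]]; split.
  + by apply: open_in_times; [exact: collar_unit_open|exact: cdom_open].
  + by move=> p; exact: cyl_fat.
  + exact: cyl_continuous.
  + exact: cyl_inv_continuous.
  + by move=> p; exact: cyl_chartK.
- move=> _ _ [a [c [hc ->]]] [b [c' [hc' ->]]]; apply: row_smooth_in => _ [[t x] [[ht cx] [ht' cx']] <-].
  have [g hg] := smooth_transition hc hc' cx cx'.
  have [||G [hG _]] := ext_cyl_chart (f := id) (F := id) (p := (t, x)) (D' := cdom (cyl_chart a 1 c) `&` cdom (cyl_chart b 1 c'))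
    a b 1 1 _ hg; [|by []|by exists G].
  move=> [t1 x1] [[ht1 cx1] [ht1' cx1']]; split=> //; exact: (cmapK MA hc).
Qed.

Lemma slice_smooth_atlas a : smooth_atlas (slice a M).
Proof.
have sndc (S1 S2 : topologicalType) (A : set (S1 * S2)) : {within A, continuous snd}.
  by apply: within_continuous => p; exact: cvg_snd.
have E c : [set cmap c p.2 | p in [set (endpoint a : R)] `*` cdom c] = cmap c @` cdom c.
  rewrite eqEsubset; split=> _ [p h <-]; first by exists p.2 => //; case: h.
  by exists (endpoint a, p).
split.
- move=> [t x] [/= -> Mx]; have [hc cx] := chart_atP MA Mx.
  by eexists; [exists (chart_at M x)|].
- move=> _ [c hc <-]; case: MA => _ /(_ c hc)[oc fc cm ci cK] _; split.
  + by apply: open_in_times => //; exists setT; [exact: openT|rewrite setIT].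
  + by move=> [t x] [/= _ cx]; rewrite E; exact: fc.
  + by apply: (within_comp _ _ cm) => [p []//|]; exact: sndc.
  + rewrite /= E; apply: within_pair => //; apply: within_continuous; exact: cst_continuous.
  + by move=> [t x] [/= -> cx]; rewrite cK.
- move=> _ _ [c hc <-] [c' hc' <-]; apply: row_smooth_in => _ [[t x] [[ht cx] [ht' cx']] <-].
  have [g hg] := smooth_transition hc hc' cx cx'; exists g; apply: ext_sub hg.
  by move=> _ [[t1 x1] [[_ cx1] [_ cx1']] <-]; exists x1.
Qed.

End ProductManifolds.

(** * Core properties and collars of the product cobordism *)

Section ProductCore.
Context {R : realType} {TX : topologicalType} {K : atlas R TX} {D : int}.
Implicit Types (a : bool) (I J L : {set 'I_(aN K)}).
Hypothesis hA : is_atlas K D.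
Hypothesis ht : tame K.

Local Notation P := (prod_cobordism K).

Let hK : core K.
Proof. by case: hA => h h1; apply: (atlas_core h) => // I /h1[]. Qed.

Lemma prod_footprint (c : kchart R TX) : footprint (prod_chart c) = unit_ivl R `*` footprint c.
Proof.
rewrite eqEsubset; split=> [_ [[t x] [[ut xd] sx] <-]|[t p] [/= ut [x [xd sx] <-]]].
  by split=> //; exists x.
by exists (t, x).
Qed.

Lemma prod_idx I : idx P I <-> idx K I.
Proof.
have u0 : unit_ivl R 0 by apply/unit_ivlE; rewrite lexx ler01.
have E i : footprint (@basic R _ P i) = unit_ivl R `*` footprint (@basic _ _ K i) by exact: prod_footprint.
split=> -[I0 [p hp]]; split=> //.
  by exists p.2 => i /hp; rewrite E => -[].
by exists (0, p) => i iI; rewrite E; split=> //; exact: hp.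
Qed.

Lemma prod_bd_idx a I : idx (bd_atlas a P) I <-> idx P I /\ bdset P a I !=set0.
Proof.
have E i : footprint (@basic R _ (bd_atlas a P) i) = [set endpoint a] `*` footprint (@basic _ _ K i).
  rewrite eqEsubset; split=> [_ [[t x] [[tE xd] sx] <-]|[t p] [/= tE [x [xd sx] <-]]].
    by split=> //; exists x.
  by exists (t, x).
rewrite prod_idx; split=> [[I0 [p hp]]|[[I0 [p hp]] _]].
  have hI : idx K I by split=> //; exists p.2 => i /hp; rewrite E => -[].
  split=> //; case: hA => -[_ _ _ hf _] _; have [EF _] := hf I hI.
  have [_ [q fq]] := hI; rewrite -EF in fq; case: fq => x [xd _] _.
  by exists (endpoint a, x).
by split=> //; exists (endpoint a, p) => i iI; rewrite E; split=> //; exact: hp.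
Qed.

Lemma prod_smooth_ks I : idx K I ->
  smooth_fun (cylinder (kU (ach K I))) (dom (ach P I)) (ks (ach P I)).
Proof.
move=> hI _ [a [c [hc ->]]] _ [[t x] [[tx cx] [ux xd]] <-].
have [g [_ _ hg]] := rep_exists (co_s hK hI) xd hc cx.
rewrite -[cmap c x](row_mxKr (const_mx (ivl_coord a t) : 'rV[R]_1)) in hg.
have [||[U [oU Ux hU UE]] _] := ext_snd (F := fun v => v2r (ks (ach K I) (cinv c (rsubmx v))))
   (D' := cmap (cyl_chart a 1 c) @` (cdom (cyl_chart a 1 c) `&` dom (ach P I))) _ hg.
- by exists (t, x).
- by move=> _ [[s y] [[sy cy] [uy yd]] <-]; split=> //; rewrite row_mxKr; exists y.
- by exists (fun v => g (rsubmx v)), U.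
Qed.

Lemma prod_local I J : idx K I -> idx K J -> I \proper J -> local_core P I J.
Proof.
move=> hI hJ IJ.
have MI := co_man hK hI; have MJ := co_man hK hJ.
have [im cphi sphi] := co_map hK hI hJ IJ; have sIJ := proper_sub IJ.
have Ud (x : kT (ach K I)) : aU K I J x -> dom (ach K I) x by exact: aU_dom.
split.
- by apply: open_in_times; [exists setT; [exact: openT|rewrite setIT]|exact: (co_open hK)].
- split.
  + by move=> _ [[t x] [ut Ux] <-]; split=> //; apply: im; exists x.
  + apply: within_pair; first by apply: within_continuous => p; exact: cvg_fst.
    apply: (within_comp _ _ cphi) => [p []//|]; apply: within_continuous => p; exact: cvg_snd.
  + move=> _ _ [a [c [hc ->]]] [b [c' [hc' ->]]]; apply: row_smooth_in.
    move=> _ [[t x] [[[tx cx] [ut Ux]] [tx' cx']] <-].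
    have [|g hg] := smooth_in_row (sphi c c' hc hc') (x := cmap c x); first by exists x.
    rewrite -setIA in hg.
    have [||G [hG _]] := ext_cyl_chart (p := (t, x)) (F := aphi P J)
        (D' := cdom (cyl_chart a 1 c) `&` aU P I J `&` aphi P J @^-1` cdom (cyl_chart b 1 c')) a b 1 1 _ hg.
    * by move=> [s y] [[[sy cy] [us Uy]] [sy' cy']]; split=> //; exact: (cmapK MI hc).
    * by [].
    * by exists G.
- by move=> [t x] [s y] [ut Ux] [us Uy] [-> /(co_inj hK hI hJ IJ Ux Uy) /= ->].
- move=> [t x] [ut Ux]; have [a ta] := unit_collar ut.
  have [c [c' [g [hc cx hc' cx' [hg fg]]]]] := co_imm hK hI hJ IJ Ux.
  rewrite -setIA in hg.
  have [||G [hG fG]] := ext_cyl_chart (p := (t, x)) (F := aphi P J)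
      (D' := cdom (cyl_chart a 1 c) `&` aU P I J `&` aphi P J @^-1` cdom (cyl_chart a 1 c')) a a 1 1 _ hg.
  + by move=> [s y] [[[sy cy] [us Uy]] [sy' cy']]; split=> //; exact: (cmapK MI hc).
  + by [].
  exists (cyl_chart a 1 c), (cyl_chart a 1 c'), G; split=> //; [by exists a, c|by exists a, c'|].
  by split=> //; exact: fG.
- by move=> [t x] [_ Ux]; exact: (co_ks hK hI hJ IJ Ux).
- move=> [t x] [ut Ux]; have [a ta] := unit_collar ut.
  have [c [g [[hc cx hg] full]]] := co_index hK hI hJ IJ Ux.
  set y := aphi K J x in cx hg full.
  have yd : dom (ach K J) y by apply: im; exists x.
  pose F (v : 'rV[R]_(1 + mdim (kU (ach K J)))) := v2r (ks (ach K J) (cinv c (rsubmx v))).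
  have EE : rsubmx (cmap (cyl_chart a 1 c) (t, y)) = cmap c y by rewrite row_mxKr.
  rewrite -EE in hg.
  have [||hG jG] := ext_snd (F := F) (x := cmap (cyl_chart a 1 c) (t, y))
    (D' := cmap (cyl_chart a 1 c) @` (cdom (cyl_chart a 1 c) `&` dom (ach P J))) _ hg.
  + by exists (t, y).
  + by move=> _ [[s z] [[sz cz] [uz zd]] <-]; split=> //; rewrite row_mxKr; exists z.
  exists (cyl_chart a 1 c), (fun v => g (rsubmx v)); split; first by split=> //; exists a, c.
  move=> w; have [v [e0 Ew]] := full w; exists (row_mx 0 v), e0.
  by rewrite jG EE.
- exact: (co_hat0 hK hI hJ IJ).
Qed.

Lemma prod_tame : tame P.
Proof.
have [add hU hp] := ht; split.
- by move=> I /prod_idx; exact: add.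
- move=> I J L /prod_idx hI /prod_idx hJ /prod_idx hL IJ IL.
  have E := hU I J L hI hJ hL IJ IL; rewrite eqEsubset; split=> -[t x].
    move=> [[ut U1] [_ U2]].
    have : (aU K I J `&` aU K I L) x by []; rewrite E => -[h1 h2].
    by split; [apply/prod_idx|split].
  move=> [/prod_idx h1 [ut h2]].
  have : (aU K I J `&` aU K I L) x by rewrite E.
  by move=> [U1 U2]; split; split.
- move=> I J L /prod_idx hI /prod_idx hJ /prod_idx hL IJ JL.
  have E := hp I J L hI hJ hL IJ JL; rewrite eqEsubset; split=> [_ [[t x] [ut Ux] <-]|[t y]].
    have : (aphi K J @` aU K I L) (aphi K J x) by exists x.
    by rewrite E => -[h1 [h2 h3]]; split; split.
  move=> [[ut Uy] [[_ yd] ky]].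
  have : (aU K J L `&` [set y | dom (ach K J) y /\ ks (ach K J) y \in limg (ahat K I J)]) y by [].
  by rewrite -E => -[x Ux <-]; exists (t, x).
Qed.

Lemma prod_core : core P.
Proof.
apply: core_intro.
- by move=> I /prod_idx hI; apply: cylinder_smooth_atlas; exact: (co_man hK hI).
- by move=> I /prod_idx; exact: prod_smooth_ks.
- move=> I /prod_idx hI; have [E1 E2 E3] := co_id hK hI; split=> //.
    by change (unit_ivl R `*` aU K I I = unit_ivl R `*` dom (ach K I)); rewrite E1.
  by move=> [t x] [_ xd]; change ((t, aphi K I x) = (t, x)); rewrite E2.
- by move=> I J /prod_idx hI /prod_idx hJ IJ; exact: prod_local.
- move=> I J L /prod_idx hI /prod_idx hJ /prod_idx hL IJ JL; split.
  + exact: (co_hat hK hI hJ hL IJ JL).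
  + by move=> [t x] [[ut Ux] [_ Uy]]; split=> //; have [] := co_phi hK hI hJ hL IJ JL Ux Uy.
  + move=> [t x] [ut Ux] [_ Uy]; have [_ E] := co_phi hK hI hJ hL IJ JL Ux Uy.
    by change ((t, aphi K L (aphi K J x)) = (t, aphi K L x)); rewrite E.
- exact: prod_tame.
Qed.

Lemma prod_bd_local a I J : idx K I -> idx K J -> I \proper J -> local_core (bd_atlas a P) I J.
Proof.
move=> hI hJ IJ.
have MI := co_man hK hI; have MJ := co_man hK hJ.
have [im cphi sphi] := co_map hK hI hJ IJ; have sIJ := proper_sub IJ.
have Ud (x : kT (ach K I)) : aU K I J x -> dom (ach K I) x by exact: aU_dom.
split.
- have [Q oQ EQ] := co_open hK hI hJ IJ; exists (setT `*` Q); first exact: (open_times openT oQ).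
  rewrite eqEsubset; split=> -[t x]; first by move=> [[ut]]; rewrite EQ => -[xd Qx] [tE _].
  move=> [[/= tE xd] [_ Qx]]; split; last by [].
  split; last by rewrite EQ.
  by rewrite /= tE; apply/unit_ivlE; rewrite /endpoint; case: (a); rewrite ?lexx ?ler01.
- split.
  + by move=> _ [[t x] [[ut Ux] [tE xd]] <-]; split=> //; apply: im; exists x.
  + apply: within_pair; first by apply: within_continuous => p; exact: cvg_fst.
    apply: (within_comp _ _ cphi) => [p [[]]//|]; apply: within_continuous => p; exact: cvg_snd.
  + move=> _ _ [c hc <-] [c' hc' <-]; apply: row_smooth_in.
    move=> _ [[t x] [[[tx cx] [[ut Ux] _]] [tx' cx']] <-].
    have [|g hg] := smooth_in_row (sphi c c' hc hc') (x := cmap c x); first by exists x.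
    exists g; apply: ext_sub hg.
    by move=> _ [[s y] [[[sy cy] [[us Uy] _]] [sy' cy']] <-]; exists y.
- by move=> [t x] [s y] [[ut Ux] _] [[us Uy] _] [-> /(co_inj hK hI hJ IJ Ux Uy) /= ->].
- move=> [t x] [[ut Ux] [tE xd]].
  have [c [c' [g [hc cx hc' cx' [hg fg]]]]] := co_imm hK hI hJ IJ Ux.
  eexists; eexists; exists g; split; [by exists c|by []|by exists c'|by []|].
  split=> //; apply: ext_sub hg.
  by move=> _ [[s y] [[[sy cy] [[us Uy] _]] [sy' cy']] <-]; exists y.
- by move=> [t x] [[_ Ux] _]; exact: (co_ks hK hI hJ IJ Ux).
- move=> [t x] [[ut Ux] [tE xd]]; have [c [g [[hc cx hg] full]]] := co_index hK hI hJ IJ Ux.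
  pose sc : chart R (R * kT (ach K J))%type _ := Chart ([set (endpoint a : R)] `*` cdom c)
    (fun p => cmap c p.2) (fun v => (endpoint a, cinv c v)).
  exists sc, g; split; last by move=> w; have [v [u Ew]] := full w; exists v, u.
  split; [by exists c|by []|apply: ext_sub hg].
  by move=> _ [[s y] [[sy cy] [_ yd]] <-]; exists y.
- exact: (co_hat0 hK hI hJ IJ).
Qed.

Lemma endpoint_unit a : unit_ivl R (endpoint a).
Proof. by apply/unit_ivlE; rewrite /endpoint; case: a; rewrite ?lexx ?ler01. Qed.

Lemma prod_bd_core a : core (bd_atlas a P).
Proof.
apply: bd_core.
- exact: prod_core.
- exact: prod_bd_idx.
- by move=> I [t x] hI [/= -> xd]; split=> //; exact: endpoint_unit.
- move=> I J [t x] /prod_idx hI /prod_idx hJ IJ [ut Ux]; have [im _ _] := co_map hK hI hJ IJ.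
  split=> -[tE xd]; split=> //; first by apply: im; exists x.
  exact: (aU_dom hK hI hJ (proper_sub IJ) Ux).
- by move=> I /prod_bd_idx[/prod_idx hI _]; apply: slice_smooth_atlas; exact: (co_man hK hI).
- move=> I /prod_bd_idx[/prod_idx hI _] _ [c hc <-] _ [[t x] [[tx cx] [tE xd]] <-].
  have [g [_ _ hg]] := rep_exists (co_s hK hI) xd hc cx; exists g; apply: ext_sub hg.
  by move=> _ [[s y] [[sy cy] [_ yd]] <-]; exists y.
- by move=> I J /prod_bd_idx[/prod_idx hI _] /prod_bd_idx[/prod_idx hJ _]; exact: prod_bd_local.
Qed.

Lemma prod_collarE a (e : R) I : @collar _ _ P a e I = collar_ivl a e `*` dom (ach K I).
Proof.
rewrite eqEsubset; split=> [_ [t [[s x] [ht0 [_ xd] ->]]]|[t x] [tx xd]]; first by [].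
by exists t, (endpoint a, x).
Qed.

(** 1/2 is the largest width for which the half-open collars of the two ends are disjoint. *)
Lemma prod_collars : collars P (1 / 2) (fun _ _ y => y.1) (fun a _ y => (endpoint a, y.2)).
Proof.
have e1 : 1 / 2 <= 1 :> R by lra.
have sf a I : idx K I -> smooth_map (half_cylinder a (1 / 2) (cbdU P a I)) (kU (ach P I))
    (carrier (half_cylinder a (1 / 2) (cbdU P a I))) (fun p => ccolU P a p.1 p.2).
  move=> hI; split.
  - by move=> _ [[t [s x]] [tx [_ xd]] <-]; split=> //; exact: collar_unit tx.
  - apply: within_pair; first by apply: within_continuous => p; exact: cvg_fst.
    apply: within_continuous => p; apply: continuous_comp; exact: cvg_snd.
  - move=> _ _ [_ [c hc <-] <-] [b [c' [hc' ->]]]; apply: row_smooth_in.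
    move=> _ [[t [s x]] [[[tx [/= sE cx]] _] [tx' cx']] <-].
    have [g hg] := smooth_transition (co_man hK hI) hc hc' cx cx'.
    pose sc : chart R (R * kT (ach K I))%type _ := Chart ([set (endpoint a : R)] `*` cdom c)
      (fun p => cmap c p.2) (fun v => (endpoint a, cinv c v)).
    have hg' : ext (cmap sc @` (cdom sc `&` [set q | cdom c' q.2])) (cmap c' \o snd \o cinv sc) (cmap sc (s, x)) g.
      by apply: ext_sub hg => _ [[s1 x1] [[_ cx1] cx1'] <-]; exists x1.
    have [||G [hG _]] := ext_cyl_chart (p := (t, (s, x))) (F := fun p => (p.1, p.2.2))
      (D' := cdom (cyl_chart a (1 / 2) sc) `&` carrier (half_cylinder a (1 / 2) (cbdU P a I)) `&`
         (fun p => ccolU P a p.1 p.2) @^-1` cdom (cyl_chart b 1 c')) a b (1 / 2) 1 _ hg'.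
    + move=> [t1 [s1 x1]] [[[tx1 [/= s1E cx1]] _] [tx1' cx1']]; split=> //.
      by rewrite /= (cmapK (co_man hK hI) hc) // s1E.
    + by split=> //; split=> //; split=> //; split=> //; exact: (cdom_sub (co_man hK hI) hc).
    + by exists G.
have sg a I : idx K I -> smooth_map (kU (ach P I)) (half_cylinder a (1 / 2) (cbdU P a I))
    (@collar _ _ P a (1 / 2) I) (fun y => (y.1, (endpoint a, y.2))).
  move=> hI; rewrite prod_collarE; split.
  - by move=> _ [[t x] [tx xd] <-]; split.
  - apply: within_pair; first by apply: within_continuous => p; exact: cvg_fst.
    apply: within_pair; first by apply: within_continuous => p; exact: cst_continuous.
    by apply: within_continuous => p; exact: cvg_snd.
  - move=> _ _ [b [c [hc ->]]] [_ [c' hc' <-] <-]; apply: row_smooth_in.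
    move=> _ [[t x] [[[tx cx] [tx2 xd]] [tx' [/= _ cx']]] <-].
    have [g hg] := smooth_transition (co_man hK hI) hc hc' cx cx'.
    pose sc : chart R (R * kT (ach K I))%type _ := Chart ([set (endpoint a : R)] `*` cdom c')
      (fun p => cmap c' p.2) (fun v => (endpoint a, cinv c' v)).
    have hg' : ext (cmap c @` (cdom c `&` cdom c')) (cmap sc \o (fun x => (endpoint a, x)) \o cinv c) (cmap c x) g by [].
    have [||G [hG _]] := ext_cyl_chart (p := (t, x)) (F := fun y => (y.1, (endpoint a, y.2)))
      (D' := cdom (cyl_chart b 1 c) `&` (collar_ivl a (1 / 2) `*` dom (ach K I)) `&`
         (fun y => (y.1, (endpoint a, y.2))) @^-1` cdom (cyl_chart a (1 / 2) sc)) b a 1 (1 / 2) _ hg'.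
    + move=> [t1 x1] [[[tx1 cx1] [_ _]] [_ [_ cx1']]]; split=> //.
      by rewrite /= (cmapK (co_man hK hI) hc).
    + by [].
    + by exists G.
have hW a I (y : kT (ach P I)) : @collar _ _ P a (1 / 2) I y <->
    exists t x, [/\ collar_ivl a (1 / 2) t, carrier (cbdU P a I) x & y = ccolU P a t x] by [].
have oW a I : open_in (dom (ach P I)) (@collar _ _ P a (1 / 2) I).
  rewrite prod_collarE; apply: open_in_times; first exact: collar_unit_open.
  by exists setT; [exact: openT|rewrite setIT].
have gK a I t (x : kT (ach P I)) : collar_ivl a (1 / 2) t -> carrier (cbdU P a I) x ->
    ((ccolU P a t x).1, (endpoint a, (ccolU P a t x).2)) = (t, x).
  by case: x => s x tx [/= -> _].
have pM I : idx K I -> smooth_atlas (kU (ach P I)).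
  by move=> hI; apply: cylinder_smooth_atlas; exact: (co_man hK hI).
have sM a I : idx K I -> smooth_atlas (cbdU P a I).
  by move=> hI; apply: slice_smooth_atlas; exact: (co_man hK hI).
split.
- by rewrite divr_gt0.
- exact: prod_bd_idx.
- by move=> a I [t x] _ [/= -> xd]; split=> //; exact: endpoint_unit.
- move=> a I t [s x] _ tx [/= sE xd]; split=> //; last by rewrite sE.
  by split=> //; exact: collar_unit tx.
- by move=> a I [s x] _ [/= -> _].
- by move=> a I _; exact: oW.
- by [].
- move=> a I J t [s x] /prod_idx hI /prod_idx hJ IJ tx [sE xd] [us Ux].
  have [im _ _] := co_map hK hI hJ IJ.
  by split=> //; [split=> //; exact: collar_unit tx|split=> //; apply: im; exists x].
- move=> a I J t [s x] /prod_idx hI /prod_idx hJ IJ tx [/= sE xd] [us Ux]; split=> //.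
  by rewrite /= sE; exact: endpoint_unit.
- move=> a I J [s x] /prod_idx hI /prod_idx hJ IJ [us Ux]; rewrite !prod_collarE => -[ts _]; split=> //.
  exact: (aU_dom hK hI hJ (proper_sub IJ) Ux).
- move=> a I [s x] _ [/= sE _]; rewrite prod_collarE => -[/collar_ivlE + _].
  by rewrite /= sE /ivl_coord /endpoint; case: (a) => /= /andP[_]; rewrite ?subr0; lra.
- by move=> a I /prod_idx hI; exact: (proj_smooth (hW a I) (sg a I hI) (gK a I)).
- by move=> a I /prod_idx hI; exact: (time_smooth (pM I hI) (sM a I hI) (oW a I) (hW a I) (sg a I hI) (gK a I)).
- move=> a I y /prod_idx hI Wy.
  exact: (proj_submersion (pM I hI) (sM a I hI) (oW a I) (hW a I) (sf a I hI) (sg a I hI) (gK a I) Wy).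
- exact: prod_bd_core.
Qed.

End ProductCore.

(** * The product metric and product reductions *)

Section ProductMetric.
Context {R : realType} {TX : topologicalType} {K : atlas R TX} {D : int}.
Implicit Types (a : bool) (I J L : {set 'I_(aN K)}).
Hypothesis hA : is_atlas K D.
Hypothesis ht : tame K.

Local Notation P := (prod_cobordism K).

Let hK : core K.
Proof. by case: hA => h h1; apply: (atlas_core h) => // I /h1[]. Qed.

Definition pcls I (t : R) (x : kT (ach K I)) : set (point P) := @cls R _ P I (t, x).

Definition pfst (q : point P) : R := (projT2 q).1.
Definition psnd (q : point P) : point K := Point (projT2 q).2.

(** The generating steps do not move the time, so a class of the product is a time together with a
    class of |K|. *)
Lemma prod_equiv (p q : point P) : equiv p q -> pfst p = pfst q /\ equiv (psnd p) (psnd q).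
Proof.
elim=> [{}p {}q [I [J [x [[/prod_idx hI /prod_idx hJ IJ [_ Ux]] [-> ->]]]]]|{}p|{}p {}q _ [-> h]|{}p {}q r _ [-> h1] _ [-> h2]].
- by split=> //; apply: Relation_Operators.rst_step; exists I, J, x.2.
- by split=> //; exact: Relation_Operators.rst_refl.
- by split=> //; exact: Relation_Operators.rst_sym.
- by split=> //; exact: Relation_Operators.rst_trans h1 h2.
Qed.

Lemma equiv_prod t (p q : point K) : unit_ivl R t -> equiv p q ->
  equiv (@Point R _ P (projT1 p) (t, projT2 p)) (@Point R _ P (projT1 q) (t, projT2 q)).
Proof.
move=> ut; elim=> [{}p {}q [I [J [x [[hI hJ IJ Ux] [-> ->]]]]]|{}p|{}p {}q _ h|{}p {}q r _ h1 _ h2].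
- apply: Relation_Operators.rst_step; exists I, J, (t, x); split=> //.
  by split=> //; exact/prod_idx.
- exact: Relation_Operators.rst_refl.
- exact: Relation_Operators.rst_sym.
- exact: Relation_Operators.rst_trans h1 h2.
Qed.

Lemma pcls_eq I J s t (x : kT (ach K I)) (y : kT (ach K J)) : unit_ivl R s ->
  pcls s x = pcls t y <-> s = t /\ cls x = cls y.
Proof.
move=> us; rewrite /pcls cls_eqP; split=> [/prod_equiv[/= st h]|[<- /cls_eqP h]].
  by split=> //; exact/cls_eqP.
exact: (equiv_prod us h).
Qed.

Lemma class_timeE I t (x : kT (ach K I)) : class_time (pcls t x) = t.
Proof.
rewrite /class_time; case: xgetP => [s -> [J [y /prod_equiv[]]]|/(_ t)[]] //.
by exists I, x; exact: cls_refl.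
Qed.

Lemma class_spaceE I t (x : kT (ach K I)) : unit_ivl R t -> class_space (pcls t x) = cls x.
Proof.
move=> ut; rewrite eqEsubset; split=> [_ [J [s [y [/prod_equiv[_ h] ->]]]]|[J y] h]; first exact: h.
by exists J, t, y; split=> //; exact: (equiv_prod ut h).
Qed.

Lemma prod_realization b : realization P b <->
  exists t I (x : kT (ach K I)), [/\ unit_ivl R t, idx K I, dom (ach K I) x & b = pcls t x].
Proof.
split=> [[I [[t x] [/prod_idx hI [ut xd] ->]]]|[t [I [x [ut hI xd ->]]]]]; first by exists t, I, x.
by exists I, (t, x); split=> //; exact/prod_idx.
Qed.

Context {d : metric_family K} (hd : admissible_metric d).

Lemma prod_metricE I J s t (x : kT (ach K I)) (y : kT (ach K J)) : unit_ivl R s -> unit_ivl R t ->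
  prod_metric d (pcls s x) (pcls t y) = `|s - t| + d (cls x) (cls y).
Proof. by move=> us ut; rewrite /prod_metric !class_timeE !class_spaceE. Qed.

Lemma open_in_local {T : topologicalType} (S A : set T) : A `<=` S ->
  (forall x, A x -> exists Q, [/\ open Q, Q x & S `&` Q `<=` A]) -> open_in S A.
Proof.
move=> AS H; exists (\bigcup_(Q in [set Q | open Q /\ S `&` Q `<=` A]) Q).
  by apply: bigcup_open => Q [].
rewrite eqEsubset; split=> x; last by move=> [Sx [Q [_ QA] Qx]]; exact: QA.
move=> Ax; split; first exact: AS.
by have [Q [oQ Qx QA]] := H x Ax; exists Q.
Qed.

Lemma prod_metric_on : metric_on (realization P) (prod_metric d).
Proof.
split.
- move=> b c /prod_realization[s [I [x [us hI xd ->]]]] /prod_realization[t [J [y [ut hJ yd ->]]]].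
  by rewrite prod_metricE // addr_ge0 // (d_ge0 hd (real_cls hI xd) (real_cls hJ yd)).
- move=> b c /prod_realization[s [I [x [us hI xd ->]]]] /prod_realization[t [J [y [ut hJ yd ->]]]].
  have dg := d_ge0 hd (real_cls hI xd) (real_cls hJ yd).
  rewrite prod_metricE // pcls_eq //; split=> [/eqP|[-> ->]]; last first.
    by rewrite subrr normr0 add0r (d_refl hd) //; exact: real_cls.
  rewrite paddr_eq0 // normr_eq0 subr_eq0 => /andP[/eqP -> /eqP h]; split=> //.
  exact/(d_eq0 hd (real_cls hI xd) (real_cls hJ yd)).
- move=> b c /prod_realization[s [I [x [us hI xd ->]]]] /prod_realization[t [J [y [ut hJ yd ->]]]].
  by rewrite !prod_metricE // distrC (d_sym hd (real_cls hI xd) (real_cls hJ yd)).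
- move=> b c b' /prod_realization[s [I [x [us hI xd ->]]]] /prod_realization[t [J [y [ut hJ yd ->]]]] /prod_realization[r [L [z [ur hL zd ->]]]].
  rewrite !prod_metricE // addrACA lerD //; first exact: ler_distD.
  exact: (d_tri hd (real_cls hI xd) (real_cls hJ yd) (real_cls hL zd)).
Qed.

(** Times differ by at most 1, whence boundedness. For the topology, a ball of radius r contains the
    box with both radii r/2, and a box contains the ball of its smaller radius. *)
Lemma prod_admissible : admissible_metric (prod_metric d).
Proof.
have [m1 m2 m3 m4] := prod_metric_on.
have rP I (p : kT (ach P I)) : idx K I -> dom (ach P I) p -> realization P (@cls R _ P I p).
  by move=> hI pd; exists I, p; split=> //; exact/prod_idx.
split; first exact: prod_metric_on.
  have [_ [M hM] _] := hd; exists (1 + M).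
  move=> b c /prod_realization[s [I [x [us hI xd ->]]]] /prod_realization[t [J [y [ut hJ yd ->]]]].
  rewrite prod_metricE //; apply: lerD; last by apply: hM; exact: real_cls.
  by move: us ut => /unit_ivlE/andP[? ?] /unit_ivlE/andP[? ?]; rewrite ler_norml; apply/andP; split; lra.
move=> I /prod_idx hI; split.
  split.
  - by move=> p q pd qd; apply: m1; exact: rP.
  - move=> [s x] [t y] [/= us xd] [/= ut yd]; split=> [|->]; last first.
      by apply/m2 => //; apply: rP.
    move=> /(m2 _ _ (rP _ (s, x) hI (conj us xd)) (rP _ (t, y) hI (conj ut yd))).
    by move=> /(pcls_eq t x y us)[-> /(cls_inj hK hI xd) ->].
  - by move=> p q pd qd; apply: m3; exact: rP.
  - by move=> p q r pd qd rd; apply: m4; exact: rP.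
move=> A sA; split=> [[Q oQ EQ] [t x] Ax|H].
  have [ut xd] := sA _ Ax; have : Q (t, x) by move: Ax; rewrite EQ => -[].
  move=> /(open_box oQ)[Q1 [Q2 [oq1 oq2 h1 h2 sub]]].
  have [r1 r10 hr1] := open_real oq1 h1.
  have oq2' : open_in (dom (ach K I)) (dom (ach K I) `&` Q2) by exists Q2.
  have [r2 r20 hr2] := open_ball hd hI oq2' (conj xd h2).
  exists (Num.min r1 r2); first by rewrite lt_min r10.
  move=> [s y] [[/= us yd]].
  rewrite /= [pull_metric _ _ _](prod_metricE x y ut us) => h.
  have dg := d_ge0 hd (real_cls hI xd) (real_cls hI yd).
  have ng := normr_ge0 (t - s).
  rewrite EQ; split=> //; move: h; rewrite lt_min => /andP[l1 l2]; apply: sub.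
    by apply: hr1; rewrite distrC; move: dg l1; lra.
  by have [] : (dom (ach K I) `&` Q2) y; [apply: hr2 => //; move: ng l2; lra|].
apply: open_in_local => // -[t x] Ax; have [/= ut xd] := sA _ Ax.
have [r r0 hr] := H _ Ax.
have r2 : 0 < r / 2 by rewrite divr_gt0.
have rx := real_cls hI xd.
have [Q oQ EQ] := dball_open hd (r / 2) hI rx.
have Qx : Q x.
  have : [set y | dom (ach K I) y /\ d (cls x) (cls y) < r / 2] x by split=> //; rewrite (d_refl hd).
  by rewrite EQ => -[].
exists ([set s | `|t - s| < r / 2] `*` Q); split.
- apply: open_times => //.
  rewrite openE => s /= ts; apply/nbhs_ballP; exists (r / 2 - `|t - s|); first by rewrite /= subr_gt0.
  move=> u /= su; apply: (le_lt_trans (ler_distD s t u)).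
  by move: su; rewrite /ball /=; lra.
- by split=> //=; rewrite subrr normr0.
- move=> [s y] [[/= us yd] [/= st Qy]]; apply: hr; split; first by split.
  rewrite /= [pull_metric _ _ _](prod_metricE x y ut us).
  have [_ dy] : [set y | dom (ach K I) y /\ d (cls x) (cls y) < r / 2] y by rewrite EQ.
  by move: st dy; lra.
Qed.

Lemma prod_dcol a I J t t' (x : kT (ach P I)) (y : kT (ach P J)) : idx P I -> idx P J ->
  bdset P a I x -> bdset P a J y -> collar_ivl a (1 / 2) t -> collar_ivl a (1 / 2) t' ->
  prod_metric d (cls (ccolU P a t x)) (cls (ccolU P a t' y)) = `|t - t'| + prod_metric d (cls x) (cls y).
Proof.
case: x y => sx x [sy y] /= _ _ [/= -> _] [/= -> _] tx ty; have e1 : 1 / 2 <= 1 :> R by lra.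
rewrite [LHS](prod_metricE x y (collar_unit e1 tx) (collar_unit e1 ty)).
by rewrite [prod_metric d _ _](prod_metricE x y (endpoint_unit a) (endpoint_unit a)) subrr normr0 add0r.
Qed.

Lemma prod_dout a I J t (x : kT (ach P I)) (y : kT (ach P J)) : idx P I -> idx P J ->
  bdset P a I x -> dom (ach P J) y -> collar_ivl a (1 / 2) t -> ~ collar a (1 / 2) y ->
  1 / 2 - ivl_coord a t <= prod_metric d (cls y) (cls (ccolU P a t x)).
Proof.
case: x y => sx x [s y] /= /prod_idx hI /prod_idx hJ [/= _ xd] [us yd] tx; rewrite prod_collarE => nW.
have e1 : 1 / 2 <= 1 :> R by lra.
rewrite [leRHS](prod_metricE y x us (collar_unit e1 tx)).
have dg := d_ge0 hd (real_cls hJ yd) (real_cls hI xd).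
have : 1 / 2 <= ivl_coord a s.
  rewrite leNgt; apply/negP => h; apply: nW; split=> //; apply/collar_ivlE; rewrite h andbT.
  by move: us => /unit_ivlE /andP[? ?]; rewrite /ivl_coord; case: (a); lra.
have := ler_norm (ivl_coord a s - ivl_coord a t); rewrite ivl_coord_dist.
by move: dg => /= dg; lra.
Qed.

Lemma prod_closure {T : topologicalType} (A : set T) : closure (unit_ivl R `*` A) `<=` [set p | closure A p.2].
Proof.
move=> [t x] cl B nB; have [|[s y] [[us Ay] By]] := cl (setT `*` B).
  by exists (setT, B) => //; split=> //; exact: filterT.
by exists y; split=> //; case: By.
Qed.

Lemma prod_precompact {T : topologicalType} (A B : set T) : precompact_in A B ->
  precompact_in (unit_ivl R `*` A) (unit_ivl R `*` B).
Proof.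
move=> [AB cA]; split; first by move=> [t x] [ut Ax]; split=> //; exact: AB.
have -> : closure_in (unit_ivl R `*` B) (unit_ivl R `*` A) = unit_ivl R `*` closure_in B A.
  rewrite eqEsubset; split=> -[t x].
    by move=> [[ut Bx] /prod_closure cx]; split.
  move=> [ut [Bx cx]]; split; first by split.
  move=> Q [[Q1 Q2] /= [n1 n2] sub]; have [y [Ay Qy]] := cx Q2 n2.
  exists (t, y); split; first by split.
  by apply: sub; split=> //; exact: nbhs_singleton.
by apply: compact_setX => //; exact: segment_compact.
Qed.

Lemma prod_projK (V : dom_family K) t b I (x : kT (ach K I)) : unit_ivl R t ->
  projK V b -> b = cls x -> projK (K := P) (prod_fam V) (pcls t x).
Proof.
move=> ut [J hJ [y Vy <-]] E; exists J; first exact/prod_idx.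
by exists (t, y) => //; apply/(pcls_eq t y x ut).
Qed.

Lemma prod_reduction (V : dom_family K) : reduction V ->
  cobordism_reduction (K := P) (1 / 2) (prod_fam V).
Proof.
move=> [oV pV zV sV cV]; have e1 : 1 / 2 <= 1 :> R by lra.
split.
  split.
  - move=> I /prod_idx hI; apply: open_in_times; last exact: oV.
    by exists setT; [exact: openT|rewrite setIT].
  - by move=> I /prod_idx hI; apply: prod_precompact; exact: pV.
  - move=> I /prod_idx hI [[t x] [ut Vx]]; have [|y [Vy [yd zy]]] := zV I hI; first by exists x.
    by exists (t, y).
  - move=> I J /prod_idx hI /prod_idx hJ [b [[[t x] [[ut xd] /prod_closure cx] <-] [[s y] [[us yd] /prod_closure cy] E]]].
    apply: (sV I J hI hJ); have [_ Exy] := (pcls_eq t y x us).1 E.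
    exists (cls x); split; first by exists x.
    by exists y.
  - move=> _ [[t p] [/= ut Xp] <-]; have Vp : projK V (iotaX p) by apply: cV; exists p.
    have [J hJ [y Vy Ey]] := Vp.
    (* All zeros over p are equivalent to [y], as iota(p) is the class of [y]; at the fixed time t
       this gives the class of (t, y). *)
    suff -> : @iotaX R _ P (t, p) = pcls t y by apply: (prod_projK ut Vp (esym Ey)).
    rewrite eqEsubset; split=> q.
      move=> [I [[s x] [/prod_idx hI [[us xd] zx] [<- xp] sq]]].
      have Exy : cls x = cls y.
        apply/cls_eqP; have : iotaX p (Point x) by exists I, x; split=> //; exact: cls_refl.
        by rewrite -Ey => yx; exact: Relation_Operators.rst_sym yx.
      by have <- : pcls s x = pcls s y by apply/(pcls_eq s x y us).
    move=> yq; have : iotaX p (Point y) by rewrite -Ey; exact: cls_refl.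
    move=> [I [x [hI [xd zx] xp /cls_eqP xy]]].
    exists I, (t, x); split=> //; first exact/prod_idx; last first.
      by have -> : @cls R _ P I (t, x) = pcls t y by apply/(pcls_eq t x y ut).
    by rewrite -xp.
move=> a I /(prod_bd_idx hA)[/prod_idx hI _]; split.
  move=> t [s x] tx [/= -> xd]; split=> -[ut Vx]; split=> //; first exact: endpoint_unit.
  exact: collar_unit tx.
have hX (x : kT (ach K I)) : zeros (ach K I) x -> aX K (kpsi (ach K I) x).
  move=> zx; have [_ hch] := hA; have [[_ _ _ [Q _ EQ] _] _] := hch I hI.
  have : footprint (ach K I) (kpsi (ach K I) x) by exists x.
  by rewrite EQ => -[].
split=> [[[t x] [[ut Vx] [tE xd]]]|[[t x] [[ut Vx] [_ [_ [tE _]]]]]].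
  have [|y [Vy [yd zy]]] := zV I hI; first by exists x.
  exists (endpoint a, y); have eu := endpoint_unit a.
  split; first by split.
  split; first by split.
  split; last by split=> //; exact: hX.
  by exists (endpoint a, y).
have [_ _] := pV I hI; have xd : dom (ach K I) x by have [h _] := pV I hI; exact: h.
by exists (t, x); split.
Qed.

Lemma product_perturbation_theorem (C V : dom_family K) (n : norm_family K) (delta : R) :
  reduction C -> reduction V -> nested C V -> additive_norms n -> 0 < delta ->
  delta < delta_red (prod_metric d) (prod_fam V) ->
  perturbations_exist (K := P) (prod_metric d) (prod_fam V) (prod_fam C) n delta /\
  relative_perturbations_exist (K := P) (prod_metric d) (prod_fam V) (prod_fam C) n delta.
Proof.
move=> rC rV nCV an d0 ddr.
have hP := prod_core hA ht; have hC := prod_collars hA ht; have hdP := prod_admissible.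
have de : delta < 1 / 2.
  move: ddr; rewrite /delta_red; set S := [set r | _] => dS.
  have S0 : S !=set0.
    apply/set0P/eqP => E; move: dS; rewrite E sup0 => h; have := lt_trans d0 h.
    by rewrite ltxx.
  have [r [/andP[_ r4] _] dr] := sup_gt S0 dS.
  by apply: (lt_trans dr); apply: (le_lt_trans r4); lra.
have [oV pV _ _ _] := rV.
have hV I : idx P I -> prod_fam V (I := I) `<=` dom (ach P I).
  by move=> /prod_idx hI [t x] [ut Vx]; split=> //; have [h _] := pV I hI; exact: h.
have [_ colV'] := prod_reduction rV; have [oPV _ _ _ _] := (prod_reduction rV).1.
have nI I : idx P I -> is_norm (n I).
  by move=> /prod_idx; apply: additive_is_norm => //; case: ht.
have colV a I t x : idx P I -> bdset P a I x -> collar_ivl a (1 / 2) t ->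
    (prod_fam V (ccolU P a t x) <-> prod_fam V x).
  by move=> hI Bx tx; have [h _] := colV' a I (idx_bd hC hI Bx); exact: h.
have nest : exists2 e' : R, 0 < e' & nested_cobordism_reduction (K := P) e' (prod_fam C) (prod_fam V).
  exists (1 / 2); first by rewrite divr_gt0.
  split; [exact: prod_reduction|exact: prod_reduction|].
  by move=> I /prod_idx hI; apply: prod_precompact; exact: nCV.
split.
- exact: (cobordism_perturbations hC hP hdP prod_dcol prod_dout d0 de hV ddr colV nI oPV nest).
- exact: (cobordism_relative hC hP hdP prod_dcol prod_dout d0 de hV ddr colV nI oPV nest).
Qed.

End ProductMetric.

Theorem proposition7p3p10 (R : realType) :
  (forall (TY : topologicalType) (K : cobordism R TY) (D : int)
     (d : metric_family K) (C V : dom_family K) (n : norm_family K)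
     (e delta : R),
     0 < e ->
     metric_tame_cobordism D e d ->
     nested_cobordism_reduction e C V ->
     additive_norms n ->
     0 < delta -> delta < Num.min e (delta_red d V) ->
     [/\ (0 < sigma_rel d V C n delta)%E,
         perturbations_exist d V C n delta &
         relative_perturbations_exist d V C n delta]) /\
  (forall (TX : topologicalType) (K : atlas R TX) (D : int)
     (d : metric_family K) (C V : dom_family K) (n : norm_family K) (delta : R),
     is_atlas K D -> tame K -> admissible_metric d ->
     reduction C -> reduction V -> nested C V ->
     additive_norms n ->
     0 < delta ->
     delta < delta_red (prod_metric d) (prod_fam V) ->
     perturbations_exist (K := prod_cobordism K)
       (prod_metric d) (prod_fam V) (prod_fam C) n delta /\
     relative_perturbations_exist (K := prod_cobordism K)
       (prod_metric d) (prod_fam V) (prod_fam C) n delta).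
Proof.
split=> [TY K D d C V n e delta e0 hK hCV hn d0 de|TX K D d C V n delta hA ht hd rC rV nCV hn d0 ddr].
  exact: (cobordism_perturbation_theorem e0 hK hCV hn d0 de).
exact: (product_perturbation_theorem hA ht hd rC rV nCV hn d0 ddr).
Qed.
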